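(* There is a smooth double covering $\mathcal{P}^\circ\mathbb{C}^2\to\mathcal{O}$ which restricts to a smooth double covering $\mathcal{L}^\circ\mathbb{C}^2\sqcup\mathcal{A}^\circ\mathbb{C}^2\to\mathcal{O}_{fp}$. By transfer of the $L^2$ Kähler structure along these coverings, $\mathcal{O}$ and $\mathcal{O}_{fp}$ are Kähler manifolds.
   Context: Let $S^1=[0,2]/(0\sim2)$, $\mathcal{P}M=C^\infty([0,2],M)$, $\mathcal{L}M=C^\infty(S^1,M)\subset\mathcal{P}M$ (tame Fréchet manifolds). $\mathcal{P}^\circ\mathbb{C}^2=\mathcal{P}(\mathbb{C}^2\setminus\{\vec0\})$, $\mathcal{L}^\circ\mathbb{C}^2=\mathcal{L}(\mathbb{C}^2\setminus\{\vec0\})$, and $\mathcal{A}^\circ\mathbb{C}^2$ is the space of $\Phi\in\mathcal{P}^\circ\mathbb{C}^2$ that are smoothly antiperiodic: $\Phi^{(k)}(2)=-\Phi^{(k)}(0)$ for all $k\ge0$. These spaces carry the flat Kähler structure given by the $L^2$ Hermitian product $\langle\Phi_1,\Phi_2\rangle_{L^2}=\int_0^2\langle\Phi_1(t),\Phi_2(t)\rangle_{\mathbb{C}^2}dt$: (weak) Riemannian metric $\mathrm{Re}\langle\cdot,\cdot\rangle_{L^2}$, (weak) symplectic form $-\mathrm{Im}\langle\cdot,\cdot\rangle_{L^2}$ and complex structure multiplication by $i$. A framed path is a pair $(\gamma,V)$ of smooth maps $[0,2]\to\mathbb{R}^3$ with $\gamma$ an immersion and $V$ a unit vector field along $\gamma$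 with $V\perp\gamma'$. $\mathcal{O}$ is the set of framed paths modulo translation, a Fréchet manifold via the bijection $\mathcal{O}\to\mathcal{P}(\mathrm{SO}(3)\times\mathbb{R}^+)$, $(\gamma,V)\mapsto((T,V,T\times V),\|\gamma'\|)$, $T=\gamma'/\|\gamma'\|$. $\mathcal{O}_{fp}\subset\mathcal{O}$ is the submanifold of frame-periodic framed paths, i.e. those for which $\gamma'$ and $V$ are smooth closed curves; under the bijection it corresponds to $\mathcal{L}(\mathrm{SO}(3)\times\mathbb{R}^+)$. *)

(* Defs.v *)
From HB Require Import structures.
From mathcomp Require Import all_boot all_order all_algebra.
From mathcomp Require Import all_classical all_reals all_analysis.
From mathcomp Require Import complex.

Set Implicit Arguments.
Unset Strict Implicit.
Unset Printing Implicit Defensive.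

Import Order.TTheory GRing.Theory Num.Theory.
Import numFieldNormedType.Exports.

Local Open Scope classical_set_scope.
Local Open Scope ring_scope.
Local Open Scope complex_scope.

(* A graded vector space, presented as a subset [fs_car] of an ambient vector
   space with a sequence of functions [fs_sn]; [is_frechet] says that the subset
   is a linear subspace and that the functions restrict to an increasing
   sequence of seminorms for which it is separated and complete.  Nothing is
   ever asserted about points outside [fs_car]. *)
Record fspace (R : realType) := Fspace {
  fs_amb :> lmodType R;
  fs_car : set fs_amb;
  fs_sn : nat -> fs_amb -> R }.

Record is_frechet (R : realType) (E : fspace R) : Prop := {
  fr_zero : fs_car (0 : E);
  fr_lin : forall (a : R) (x y : E),
    fs_car x -> fs_car y -> fs_car (a *: x + y);
  fr_snZ : forall k (a : R) (x : E),
    fs_car x -> fs_sn k (a *: x) = `|a| * fs_sn k x;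
  fr_snD : forall k (x y : E),
    fs_car x -> fs_car y -> fs_sn k (x + y) <= fs_sn k x + fs_sn k y;
  fr_mono : forall k (x : E), fs_car x -> fs_sn k x <= fs_sn k.+1 x;
  fr_sep : forall x : E, fs_car x -> (forall k, fs_sn k x = 0) -> x = 0;
  fr_complete : forall u : nat -> E, (forall n, fs_car (u n)) ->
    (forall k (e : R), 0 < e -> exists N, forall m n,
      (N <= m)%N -> (N <= n)%N -> fs_sn k (u m - u n) < e) ->
    exists2 x : E, fs_car x & forall k (e : R), 0 < e -> exists N, forall n,
      (N <= n)%N -> fs_sn k (u n - x) < e }.

Definition fs_prod (R : realType) (E F : fspace R) : fspace R :=
  @Fspace R (E * F)%type [set p | fs_car p.1 /\ fs_car p.2]
    (fun k p => fs_sn k p.1 + fs_sn k p.2).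

Definition fs_real (R : realType) : fspace R :=
  @Fspace R R^o setT (fun _ x => `|x|).

Definition fopen (R : realType) (E : fspace R) (U : set E) : Prop :=
  U `<=` @fs_car R E /\
  forall x, U x -> exists k, exists2 e : R, 0 < e &
    forall y : E, fs_car y -> fs_sn k (y - x) < e -> U y.

Definition fcont (R : realType) (E F : fspace R) (U : set E) (f : E -> F)
    : Prop :=
  forall x, U x -> forall k (e : R), 0 < e -> exists m, exists2 d : R, 0 < d &
    forall y, U y -> fs_sn m (y - x) < d -> fs_sn k (f y - f x) < e.

(* [l] is the limit of [(f (x + t h) - f x) / t] as [t] tends to 0 *)
Definition is_dderiv (R : realType) (E F : fspace R) (f : E -> F) (x h : E)
    (l : F) : Prop :=
  fs_car l /\
  forall k (e : R), 0 < e -> exists2 d : R, 0 < d &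
    forall t : R, 0 < `|t| < d ->
      fs_sn k (t^-1 *: (f (x + t *: h) - f x) - l) < e.

(* C^n maps in the sense of Hamilton and Michal-Bastiani: f is C^(n+1) on U when
   its directional derivative exists and is a C^n map on U x E. *)
Fixpoint Cn (R : realType) (n : nat) (E F : fspace R) (U : set E) (f : E -> F)
    : Prop :=
  [/\ forall x, U x -> fs_car (f x), fcont U f &
      if n is m.+1 then
        exists2 df : fs_prod E E -> F,
          forall x h, U x -> fs_car h -> is_dderiv f x h (df (x, h)) &
          Cn m [set p : fs_prod E E | U p.1 /\ fs_car p.2] df
      else True].

Definition Csmooth (R : realType) (E F : fspace R) (U : set E) (f : E -> F)
    : Prop :=
  forall n, Cn n U f.

(* A set of points with a family of charts.  The charts are total functions
   that only matter on their domains, and the topology is the one for which a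
   set is open when all its images in the charts are. *)
Record premfd (R : realType) := Premfd {
  mf_pt : Type;
  mf_pts : set mf_pt;
  mf_idx : Type;
  mf_dom : mf_idx -> set mf_pt;
  mf_mod : mf_idx -> fspace R;
  mf_map : forall i, mf_pt -> mf_mod i }.

Arguments mf_pts {R} p.

Definition mopen (R : realType) (M : premfd R) (W : set (mf_pt M)) : Prop :=
  W `<=` mf_pts M /\
  forall i : mf_idx M, fopen (mf_map i @` (W `&` mf_dom i)).

Record is_mfd (R : realType) (M : premfd R) : Prop := {
  mfd_mod : forall i : mf_idx M, is_frechet (mf_mod i);
  mfd_sub : forall i : mf_idx M, mf_dom i `<=` mf_pts M;
  mfd_cover : forall p, mf_pts M p -> exists i : mf_idx M, mf_dom i p;
  mfd_inj : forall (i : mf_idx M) p q,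
    mf_dom i p -> mf_dom i q -> mf_map i p = mf_map i q -> p = q;
  mfd_open : forall i j : mf_idx M,
    fopen (mf_map i @` (mf_dom i `&` mf_dom j));
  mfd_trans : forall i j : mf_idx M, exists2 tau : mf_mod i -> mf_mod j,
    Csmooth (mf_map i @` (mf_dom i `&` mf_dom j)) tau &
    forall p, mf_dom i p -> mf_dom j p -> tau (mf_map i p) = mf_map j p;
  mfd_hausdorff : forall p q, mf_pts M p -> mf_pts M q -> p <> q ->
    exists W, exists W', [/\ mopen W, mopen W', W p, W' q & W `&` W' = set0] }.

Definition msmooth (R : realType) (M N : premfd R) (f : mf_pt M -> mf_pt N)
    : Prop :=
  (forall p, mf_pts M p -> mf_pts N (f p)) /\
  forall (i : mf_idx M) (j : mf_idx N) p, mf_dom i p -> mf_dom j (f p) ->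
    exists2 W : set (mf_pt M),
      [/\ mopen W, W p, W `<=` mf_dom i & f @` W `<=` mf_dom j] &
      exists2 F : mf_mod i -> mf_mod j, Csmooth (mf_map i @` W) F &
        forall x, W x -> F (mf_map i x) = mf_map j (f x).

Definition mrestr (R : realType) (M : premfd R) (W : set (mf_pt M))
    : premfd R :=
  @Premfd R (mf_pt M) (mf_pts M `&` W) (mf_idx M)
    (fun i => mf_dom i `&` W) (@mf_mod R M) (@mf_map R M).

Definition diffeo (R : realType) (M N : premfd R) (W : set (mf_pt M))
    (V : set (mf_pt N)) (f : mf_pt M -> mf_pt N) : Prop :=
  msmooth (M := mrestr W) (N := mrestr V) f /\
  exists2 h : mf_pt N -> mf_pt M, msmooth (M := mrestr V) (N := mrestr W) h &
    (forall x, W x -> h (f x) = x) /\ (forall y, V y -> f (h y) = y).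

Definition smooth_double_covering (R : realType) (M N : premfd R)
    (f : mf_pt M -> mf_pt N) : Prop :=
  [/\ is_mfd M, is_mfd N, msmooth f &
    forall q, mf_pts N q -> exists2 V, mopen V /\ V q &
      exists W1, exists W2,
        [/\ mopen W1, mopen W2, W1 `&` W2 = set0,
            mf_pts M `&` f @^-1` V = W1 `|` W2 &
            diffeo W1 V f /\ diffeo W2 V f]].

Definition fs_mfd (R : realType) (E : fspace R) (U : set E) : premfd R :=
  @Premfd R E U unit (fun=> U) (fun=> E) (fun=> id).

Definition sum_mfd (R : realType) (M N : premfd R) : premfd R :=
  @Premfd R (mf_pt M + mf_pt N)%type
    (fun s => match s with inl p => mf_pts M p | inr q => mf_pts N q end)
    (mf_idx M + mf_idx N)%type
    (fun k s => match k, s with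
                | inl i, inl p => mf_dom i p
                | inr j, inr q => mf_dom j q
                | _, _ => False
                end)
    (fun k => match k with inl i => mf_mod i | inr j => mf_mod j end)
    (fun k => match k with
              | inl i => fun s => if s is inl p then mf_map i p else 0
              | inr j => fun s => if s is inr q then mf_map j q else 0
              end).

(* the manifold structure carried over to [pts] by [b : pts -> M] *)
Definition transport_mfd (R : realType) (T : Type) (pts : set T)
    (M : premfd R) (b : T -> mf_pt M) : premfd R :=
  @Premfd R T pts (mf_idx M) (fun i => pts `&` b @^-1` mf_dom i)
    (@mf_mod R M) (fun i p => mf_map i (b p)).

(* [v] is the image of the tangent vector [u] under the differential of [f] at
   [p], both being read in the charts [i] and [j]. *)
Definition mderiv (R : realType) (M N : premfd R) (f : mf_pt M -> mf_pt N)
    (p : mf_pt M) (i : mf_idx M) (j : mf_idx N) (u : mf_mod i) (v : mf_mod j)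
    : Prop :=
  exists2 W : set (mf_pt M),
    [/\ mopen W, W p, W `<=` mf_dom i & f @` W `<=` mf_dom j] &
    exists2 F : mf_mod i -> mf_mod j,
      forall x, W x -> F (mf_map i x) = mf_map j (f x) &
      fs_car u /\ is_dderiv F (mf_map i p) u v.

(* In each chart: a metric [kg x u v], a two-form [kw x u v] and an almost
   complex structure [kJ x u], for x in the image of the chart. *)
Record kahler_data (R : realType) (M : premfd R) := KahlerData {
  kg : forall i : mf_idx M, mf_mod i -> mf_mod i -> mf_mod i -> R;
  kw : forall i : mf_idx M, mf_mod i -> mf_mod i -> mf_mod i -> R;
  kJ : forall i : mf_idx M, mf_mod i -> mf_mod i -> mf_mod i }.

(* [f] pulls the structure [K'] back to [K] *)
Definition kahler_map (R : realType) (M N : premfd R)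
    (K : kahler_data M) (K' : kahler_data N) (f : mf_pt M -> mf_pt N) : Prop :=
  forall p (i : mf_idx M) (j : mf_idx N), mf_dom i p -> mf_dom j (f p) ->
  forall (u v : mf_mod i) (u' v' : mf_mod j),
    mderiv f p u u' -> mderiv f p v v' ->
    [/\ kg K (mf_map i p) u v = kg K' (mf_map j (f p)) u' v',
        kw K (mf_map i p) u v = kw K' (mf_map j (f p)) u' v' &
        mderiv f p (kJ K (mf_map i p) u) (kJ K' (mf_map j (f p)) u')].

Definition is_complex_structure (R : realType) (E : fspace R) (I : E -> E)
    : Prop :=
  [/\ forall x, fs_car x -> fs_car (I x),
      fcont (@fs_car R E) I,
      forall (a : R) (x y : E), fs_car x -> fs_car y ->
        I (a *: x + y) = a *: I x + I y &
      forall x, fs_car x -> I (I x) = - x].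

(* Integrability is required in the strong sense: around every point there is
   a chart in a complex Fréchet space which is holomorphic, i.e. in which the
   almost complex structure is constant.  (Outside of finite dimension, the
   vanishing of the Nijenhuis tensor does not suffice.) *)
Definition integrable (R : realType) (M : premfd R) (K : kahler_data M)
    : Prop :=
  forall p, mf_pts M p ->
  exists (C : fspace R) (I : C -> C) (W : set (mf_pt M)) (V : set C)
    (h : mf_pt M -> C),
  [/\ is_frechet C /\ is_complex_structure I,
      mopen W /\ W p,
      fopen V,
      diffeo (N := fs_mfd V) W V h &
      forall q (i : mf_idx M), W q -> mf_dom i q ->
      forall (u : mf_mod i) (u' : C),
        mderiv (N := fs_mfd V) h q (j := tt) u u' ->
        mderiv (N := fs_mfd V) h q (j := tt) (kJ K (mf_map i q) u) (I u')].

(* Weak Kähler structures: g and w are nondegenerate in the sense that the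
   induced maps from a tangent space to its dual are injective. *)
Record is_kahler (R : realType) (M : premfd R) (K : kahler_data M) : Prop := {
  kl_mfd : is_mfd M;
  kl_compat : kahler_map K K id;
  kl_g_smooth : forall i : mf_idx M,
    Csmooth (E := fs_prod (mf_mod i) (fs_prod (mf_mod i) (mf_mod i)))
      (F := fs_real R)
      [set z | (mf_map i @` mf_dom i) z.1 /\ fs_car z.2]
      (fun z => kg K z.1 z.2.1 z.2.2);
  kl_w_smooth : forall i : mf_idx M,
    Csmooth (E := fs_prod (mf_mod i) (fs_prod (mf_mod i) (mf_mod i)))
      (F := fs_real R)
      [set z | (mf_map i @` mf_dom i) z.1 /\ fs_car z.2]
      (fun z => kw K z.1 z.2.1 z.2.2);
  kl_J_smooth : forall i : mf_idx M,
    Csmooth (E := fs_prod (mf_mod i) (mf_mod i)) (F := mf_mod i)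
      [set z | (mf_map i @` mf_dom i) z.1 /\ fs_car z.2]
      (fun z => kJ K z.1 z.2);
  kl_J : forall (i : mf_idx M) p, mf_dom i p ->
    is_complex_structure (kJ K (mf_map i p));
  kl_g_lin : forall (i : mf_idx M) p, mf_dom i p ->
    forall (a : R) (u v w : mf_mod i), fs_car u -> fs_car v -> fs_car w ->
    kg K (mf_map i p) (a *: u + v) w
      = a * kg K (mf_map i p) u w + kg K (mf_map i p) v w;
  kl_g_sym : forall (i : mf_idx M) p, mf_dom i p ->
    forall u v : mf_mod i, fs_car u -> fs_car v ->
    kg K (mf_map i p) u v = kg K (mf_map i p) v u;
  kl_g_pos : forall (i : mf_idx M) p, mf_dom i p ->
    forall u : mf_mod i, fs_car u -> u <> 0 -> 0 < kg K (mf_map i p) u u;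
  kl_w_lin : forall (i : mf_idx M) p, mf_dom i p ->
    forall (a : R) (u v w : mf_mod i), fs_car u -> fs_car v -> fs_car w ->
    kw K (mf_map i p) (a *: u + v) w
      = a * kw K (mf_map i p) u w + kw K (mf_map i p) v w;
  kl_w_alt : forall (i : mf_idx M) p, mf_dom i p ->
    forall u v : mf_mod i, fs_car u -> fs_car v ->
    kw K (mf_map i p) u v = - kw K (mf_map i p) v u;
  kl_w_nondeg : forall (i : mf_idx M) p, mf_dom i p ->
    forall u : mf_mod i, fs_car u ->
    (forall v, fs_car v -> kw K (mf_map i p) u v = 0) -> u = 0;
  kl_gwJ : forall (i : mf_idx M) p, mf_dom i p ->
    forall u v : mf_mod i, fs_car u -> fs_car v ->
    kg K (mf_map i p) u v = kw K (mf_map i p) u (kJ K (mf_map i p) v);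
  kl_w_closed : forall (i : mf_idx M) p, mf_dom i p ->
    forall u v w : mf_mod i, fs_car u -> fs_car v -> fs_car w ->
    forall a b c : R,
    is_dderiv (F := fs_real R) (fun x => kw K x v w) (mf_map i p) u a ->
    is_dderiv (F := fs_real R) (fun x => kw K x w u) (mf_map i p) v b ->
    is_dderiv (F := fs_real R) (fun x => kw K x u v) (mf_map i p) w c ->
    a + b + c = 0;
  kl_integrable : integrable K }.

Definition sum_kahler (R : realType) (M N : premfd R) (K : kahler_data M)
    (K' : kahler_data N) : kahler_data (sum_mfd M N) :=
  @KahlerData R (sum_mfd M N)
    (fun k => match k with inl i => kg K (i := i) | inr j => kg K' (i := j) end)
    (fun k => match k with inl i => kw K (i := i) | inr j => kw K' (i := j) end)
    (fun k => match k with inl i => kJ K (i := i) | inr j => kJ K' (i := j) end).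

Definition in02 (R : realType) (t : R) : bool := (0 <= t) && (t <= 2).

(* Maps on [0,2] are represented by maps on R that vanish outside [0,2]. *)
Definition on02 (R : realType) (V : zmodType) (f : R -> V) : R -> V :=
  fun t => if in02 t then f t else 0.

Definition diff_quot (R : realType) (V : normedModType R) (f : R -> V) (t s : R)
    : V :=
  (s - t)^-1 *: (f s - f t).

(* one-sided at the endpoints *)
Definition deriv02 (R : realType) (V : normedModType R) (f : R -> V) : R -> V :=
  on02 (fun t => lim (diff_quot f t s @[s --> within [set s | in02 s] t^'])).

Definition smooth_curve (R : realType) (V : normedModType R) : set (R -> V) :=
  [set f | on02 f = f /\ forall k t, in02 t ->
     cvg (diff_quot (iter k (@deriv02 R V) f) t s
       @[s --> within [set s | in02 s] t^'])].

Definition smooth_loop (R : realType) (V : normedModType R) : set (R -> V) :=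
  [set f | smooth_curve f /\
    forall k, iter k (@deriv02 R V) f 2 = iter k (@deriv02 R V) f 0].

Definition smooth_antiloop (R : realType) (V : normedModType R) : set (R -> V) :=
  [set f | smooth_curve f /\
    forall k, iter k (@deriv02 R V) f 2 = - iter k (@deriv02 R V) f 0].

Definition curve_fs (R : realType)
    (X : forall V : normedModType R, set (R -> V)) (V : normedModType R)
    : fspace R :=
  @Fspace R (R -> V) (X V)
    (fun k f => \sum_(j < k.+1)
       sup [set `|iter j (@deriv02 R V) f t| | t in [set t | in02 t]]).

(* The pair (x, y) stands for x + i y. *)
Definition C2 (R : realType) : normedModType R := ('rV[R]_2 * 'rV[R]_2)%type.

Definition C2_coord (R : realType) (z : C2 R) (j : 'I_2) : R[i] :=
  z.1 0 j +i* z.2 0 j.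

Definition C2_i (R : realType) (z : C2 R) : C2 R := (- z.2, z.1).

(* Linear in the first argument, so that -Im <u, i v> = Re <u, v>. *)
Definition C2_herm (R : realType) (z w : C2 R) : R[i] :=
  \sum_(j < 2) C2_coord z j * (C2_coord w j)^*.

Definition herm_L2 (R : realType) (f g : R -> C2 R) : R[i] :=
  (\int[lebesgue_measure]_(t in `[0, 2]) complex.Re (C2_herm (f t) (g t)))
  +i* (\int[lebesgue_measure]_(t in `[0, 2]) complex.Im (C2_herm (f t) (g t))).

Definition C2o_mfd (R : realType)
    (X : forall V : normedModType R, set (R -> V)) : premfd R :=
  @fs_mfd R (curve_fs X (C2 R))
    [set f | X (C2 R) f /\ forall t, in02 t -> f t <> 0].

Definition L2_kahler (R : realType)
    (X : forall V : normedModType R, set (R -> V)) : kahler_data (C2o_mfd X) :=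
  @KahlerData R (C2o_mfd X)
    (fun _ _ u v => complex.Re (herm_L2 u v))
    (fun _ _ u v => - complex.Im (herm_L2 u v))
    (fun _ _ u t => C2_i (u t)).

Definition PoC2 (R : realType) : premfd R := C2o_mfd (@smooth_curve R).
Definition LoC2 (R : realType) : premfd R := C2o_mfd (@smooth_loop R).
Definition AoC2 (R : realType) : premfd R := C2o_mfd (@smooth_antiloop R).

Definition SO3Rp (R : realType) : set ('M[R]_3 * R^o) :=
  [set x | [/\ x.1 *m x.1^T = 1%:M, \det x.1 = 1 & 0 < x.2]].

(* On SO(3) this is the Cayley transform (A - 1)(A + 1)^-1, where the skew
   matrix of x |-> xi x x is identified with xi; it is a diffeomorphism from
   the rotations of angle less than pi (i.e. of trace different from -1) onto
   R^3.  The indices are added modulo 3. *)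
Definition cayley (R : realType) (A : 'M[R]_3) : 'rV[R]_3 :=
  (1 + \tr A)^-1 *: \row_i (A (i + 2%:R) (i + 1) - A (i + 1) (i + 2%:R)).

(* The mapping manifold structure: the chart centred at the curve (g, r) sends
   (q, s) to the pointwise Cayley coordinates of g^-1 q, paired with s. *)
Definition SO3Rp_mfd (R : realType)
    (X : forall V : normedModType R, set (R -> V)) : premfd R :=
  let pts := [set q | X ('M[R]_3 * R^o)%type q /\
                      forall t, in02 t -> SO3Rp (q t)] in
  @Premfd R (R -> 'M[R]_3 * R^o)%type pts (R -> 'M[R]_3 * R^o)%type
    (fun g => [set q | [/\ pts g, pts q &
       forall t, in02 t -> \tr ((g t).1^T *m (q t).1) <> -1]])
    (fun=> curve_fs X ('rV[R]_3 * R^o)%type)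
    (fun g q => on02 (fun t => (cayley ((g t).1^T *m (q t).1), (q t).2))).

Definition dot3 (R : realType) (u v : 'rV[R]_3) : R := \sum_i u 0 i * v 0 i.

Definition norm3 (R : realType) (u : 'rV[R]_3) : R := Num.sqrt (dot3 u u).

(* The indices are added modulo 3. *)
Definition cross3 (R : realType) (u v : 'rV[R]_3) : 'rV[R]_3 :=
  \row_i (u 0 (i + 1) * v 0 (i + 2%:R) - u 0 (i + 2%:R) * v 0 (i + 1)).

Definition is_framed (R : realType) : set ((R -> 'rV[R]_3) * (R -> 'rV[R]_3)) :=
  [set x | [/\ smooth_curve x.1, smooth_curve x.2 & forall t, in02 t ->
     [/\ deriv02 x.1 t <> 0, norm3 (x.2 t) = 1 &
         dot3 (x.2 t) (deriv02 x.1 t) = 0]]].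

Definition is_frame_periodic (R : realType)
    : set ((R -> 'rV[R]_3) * (R -> 'rV[R]_3)) :=
  [set x | [/\ is_framed x, smooth_loop (deriv02 x.1) & smooth_loop x.2]].

Definition framed_class (R : realType) (x : (R -> 'rV[R]_3) * (R -> 'rV[R]_3))
    : set ((R -> 'rV[R]_3) * (R -> 'rV[R]_3)) :=
  [set y | is_framed y /\
     exists a : 'rV[R]_3, y = (on02 (fun t => x.1 t + a), x.2)].

(* the curve ((T, V, T x V), |gamma'|), the frame vectors being columns *)
Definition frame_curve (R : realType) (x : (R -> 'rV[R]_3) * (R -> 'rV[R]_3))
    : R -> 'M[R]_3 * R^o :=
  on02 (fun t =>
    let s := norm3 (deriv02 x.1 t) in
    let T := s^-1 *: deriv02 x.1 t in
    let V := x.2 t in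
    (\matrix_(i, j) (nth 0 [:: T; V; cross3 T V] j) 0 i, s)).

Definition class_curve (R : realType)
    (o : set ((R -> 'rV[R]_3) * (R -> 'rV[R]_3))) : R -> 'M[R]_3 * R^o :=
  frame_curve (xget (0, 0) o).

Definition O_mfd (R : realType) : premfd R :=
  transport_mfd (M := SO3Rp_mfd (@smooth_curve R))
    (@framed_class R @` @is_framed R) (@class_curve R).

Definition Ofp_mfd (R : realType) : premfd R :=
  transport_mfd (M := SO3Rp_mfd (@smooth_loop R))
    (@framed_class R @` @is_frame_periodic R) (@class_curve R).

(* Main.v *)
(* Read C^2 as the quaternions.  A nowhere zero path Phi gives the rotations
   x |-> Phi x Phi^-1 and the speed |Phi|^2, hence a framed path up to
   translation, and it is determined by them up to sign.  In the Cayley chart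
   centred at the image of a path f, the image of Phi has coordinates
   (Im q / Re q, |Phi|^2) with q = conj(f) Phi, and f l (1 + xi), for the l > 0
   that gives the right speed, is a smooth section over the whole chart.

   A path is lifted by lifting t |-> g (k t / N) for k = 0, ..., N, each of these
   paths being in the chart of the preceding one.  The products Phi_a Phi_b are
   linear functions of (s A, s), where (A, s) is the image of Phi, and
   Phi_a' = s^-1 (sum_b (Phi_a Phi_b)' Phi_b - s' Phi_a / 2); hence, by induction
   on the order of the derivatives, a lift of a loop is a loop or antiloop,
   according to whether Phi(2) = Phi(0) or Phi(2) = - Phi(0).

   The L^2 structure is constant and invariant under Phi |-> - Phi, so it descends
   along local sections.  The sections serve as holomorphic charts, and the two-form is
   closed because second derivatives of the sections are symmetric. *)

(* Differentiability is only directional here, so neither the chain rule nor the linearity of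
   derivatives is formal: both rest on a mean value inequality, which makes difference quotients
   converge uniformly in base point and direction.

   The covering, its sections and the frames are built from linear maps, products and one nonlinear
   operation on scalar curves, [1 / sqrt f] for positive [f]; reciprocals and norms reduce to it.
   Its smoothness on the space of paths is therefore the only delicate estimate. Loops and antiloops
   are complete subspaces of the paths with the same seminorms. Being complete they are closed, so
   the derivatives of a map that preserves them take values in them, and smoothness is inherited by
   restriction.

   Lifting through the curves [g (k t / N)], rather than piece by piece along a subdivision of
   [0,2], avoids any gluing: every intermediate lift is a smooth curve on all of [0,2], produced by
   a section that is already known to be smooth.

   Charts are indexed by arbitrary curves. Those off the manifold have an empty domain, and default
   lifts are carried along for them. *)
Require Import Defs.
From HB Require Import structures.
From mathcomp Require Import all_boot all_order all_algebra.
From mathcomp Require Import all_classical all_reals all_analysis.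
From mathcomp Require Import ring lra complex.
(* Again, because the measure library has an [mrestr] too. *)
Require Import Defs.

Set Implicit Arguments.
Unset Strict Implicit.
Unset Printing Implicit Defensive.

Import Order.TTheory GRing.Theory Num.Theory.
Import numFieldNormedType.Exports.

Local Open Scope classical_set_scope.
Local Open Scope ring_scope.

(** * Frechet spaces *)

Module LinearCombination.
Section LinearCombination.
Context {R : pzRingType} {V : lmodType R}.

Inductive expr :=
  Var of nat | Zero | Add of expr & expr | Opp of expr | Scale of R & expr.

Fixpoint eval (s : seq V) (e : expr) : V :=
  match e with
  | Var n => s`_n
  | Zero => 0
  | Add e1 e2 => eval s e1 + eval s e2
  | Opp e1 => - eval s e1
  | Scale a e1 => a *: eval s e1
  end.

Fixpoint coef (e : expr) (n : nat) : R :=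
  match e with
  | Var m => if m == n then 1 else 0
  | Zero => 0
  | Add e1 e2 => coef e1 n + coef e2 n
  | Opp e1 => - coef e1 n
  | Scale a e1 => a * coef e1 n
  end.

Lemma evalE (s : seq V) (e : expr) :
  eval s e = \sum_(i < size s) coef e i *: s`_i.
Proof.
elim: e => [n||e1 IH1 e2 IH2|e IH|a e IH] /=; rewrite ?IH1 ?IH2 ?IH.
- have [ns|sn] := ltnP n (size s).
    rewrite (bigD1 (Ordinal ns)) //= eqxx scale1r big1 ?addr0 // => i.
    by rewrite -val_eqE /= eq_sym => /negPf ->; rewrite scale0r.
  rewrite nth_default // big1 // => i _; case: eqP => [ni|]; last by rewrite scale0r.
  by have := ltn_ord i; rewrite -ni ltnNge sn.
- by rewrite big1 // => i _; rewrite scale0r.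
- by rewrite -big_split; apply: eq_bigr => i _; rewrite scalerDl.
- by rewrite -sumrN; apply: eq_bigr => i _; rewrite scaleNr.
- by rewrite scaler_sumr; apply: eq_bigr => i _; rewrite scalerA.
Qed.

(** A conjunction rather than a quantifier over ordinals, so that simplification leaves one scalar
    goal per vector. *)
Fixpoint all_below (n : nat) (P : nat -> Prop) : Prop :=
  if n is m.+1 then P m /\ all_below m P else True.

Lemma eval_eq (s : seq V) (e1 e2 : expr) :
  all_below (size s) (fun i => coef e1 i = coef e2 i) -> eval s e1 = eval s e2.
Proof.
move=> H; rewrite !evalE; apply: eq_bigr => -[i /= + _].
by elim: (size s) H => //= n IH [e12 /IH{}IH]; rewrite ltnS leq_eqVlt => /predU1P[->|/IH //]; rewrite e12.
Qed.

End LinearCombination.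

Ltac index x s :=
  match s with
  (* Atoms are compared by unification, hence found up to conversion. *)
  | ?y :: _ => let _ := match goal with _ => unify x y end in constr:(O)
  | _ :: ?s' => let n := index x s' in constr:(S n)
  end.

Ltac reify R s t :=
  match t with
  | (?a + ?b)%R =>
      let a' := reify R s a in let b' := reify R s b in constr:(@Add R a' b')
  | (- ?a)%R => let a' := reify R s a in constr:(@Opp R a')
  | (?c *: ?a)%R => let a' := reify R s a in constr:(@Scale R c a')
  | (0)%R => constr:(@Zero R)
  | _ => let n := index t s in constr:(@Var R n)
  end.
End LinearCombination.

(* Proves an identity between linear combinations of the vectors of the list
   [s], leaving the equality of the coefficients to [ring] or [field]. *)
Ltac lincomb s :=
  match goal with |- context [@GRing.scale ?R ?V _ _] =>
  match goal with |- ?a = ?b =>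
    let a' := LinearCombination.reify R s a in
    let b' := LinearCombination.reify R s b in
    apply: (@LinearCombination.eval_eq R V s a' b') => /=; (repeat split);
    try by [ring | field]
  end end.

Existing Class is_frechet.
#[export] Hint Extern 0 (is_frechet _) => typeclasses eauto : core.
#[global] Arguments fr_zero {R E _}.
#[global] Arguments fr_lin {R E _} a [x y].
#[global] Arguments fr_snZ {R E _} k a [x].
#[global] Arguments fr_snD {R E _} k [x y].
#[global] Arguments fr_mono {R E _} k [x].
#[global] Arguments fr_sep {R E _} [x].
#[global] Arguments fr_complete {R E _} [u].

Section Seminorms.
Context {R : realType} (E : fspace R) {hE : is_frechet E}.
Implicit Types x y z : E.

Lemma fs_car0 : fs_car (0 : E).
Proof. exact: fr_zero. Qed.

Lemma fs_carZ a x : fs_car x -> fs_car (a *: x).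
Proof. by move=> hx; rewrite -[_ *: _]addr0; apply: fr_lin => //; exact: fs_car0. Qed.

Lemma fs_carD x y : fs_car x -> fs_car y -> fs_car (x + y).
Proof. by move=> hx hy; rewrite -[x]scale1r; exact: fr_lin. Qed.

Lemma fs_carN x : fs_car x -> fs_car (- x).
Proof. by rewrite -scaleN1r; exact: fs_carZ. Qed.

Lemma fs_carB x y : fs_car x -> fs_car y -> fs_car (x - y).
Proof. by move=> hx hy; apply: fs_carD => //; exact: fs_carN. Qed.

Lemma fs_sn0 k : fs_sn k (0 : E) = 0.
Proof. by rewrite -(scale0r (0 : E)) fr_snZ ?normr0 ?mul0r //; exact: fs_car0. Qed.

Lemma fs_snN k x : fs_car x -> fs_sn k (- x) = fs_sn k x.
Proof. by move=> hx; rewrite -scaleN1r fr_snZ // normrN1 mul1r. Qed.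

Lemma fs_sn_ge0 k x : fs_car x -> 0 <= fs_sn k x.
Proof.
move=> hx; have /(_ hE) := fr_snD k hx (fs_carN hx).
by rewrite subrr fs_sn0 fs_snN // -mulr2n pmulrn_lge0.
Qed.

Lemma fs_sn_distC k x y : fs_car x -> fs_car y -> fs_sn k (x - y) = fs_sn k (y - x).
Proof. by move=> hx hy; rewrite -fs_snN ?opprB //; exact: fs_carB. Qed.

Lemma fs_sn_dist k y x z : fs_car x -> fs_car y -> fs_car z ->
  fs_sn k (x - z) <= fs_sn k (x - y) + fs_sn k (y - z).
Proof.
move=> hx hy hz; have /(_ hE) := fr_snD k (fs_carB hx hy) (fs_carB hy hz).
by rewrite addrA subrK.
Qed.

Lemma fs_sn_leD k y x : fs_car x -> fs_car y -> fs_sn k x <= fs_sn k (x - y) + fs_sn k y.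
Proof.
by move=> hx hy; rewrite -{1}(subrK y x); apply: fr_snD => //; exact: fs_carB.
Qed.

Lemma fs_sn_le k m x : (k <= m)%N -> fs_car x -> fs_sn k x <= fs_sn m x.
Proof.
move=> /subnKC <- hx; elim: (m - k)%N => [|n IH]; first by rewrite addn0.
by rewrite addnS; apply: le_trans IH _; exact: fr_mono.
Qed.

End Seminorms.

#[export] Hint Resolve fs_car0 : core.

Lemma frechet_prod (R : realType) (E F : fspace R) :
  is_frechet E -> is_frechet F -> is_frechet (fs_prod E F).
Proof.
move=> hE hF; split => /=.
- by split; exact: fs_car0.
- by move=> a x y [? ?] [? ?]; split; exact: fr_lin.
- by move=> k a x [? ?]; rewrite !fr_snZ // mulrDr.
- move=> k x y [? ?] [? ?]; rewrite addrACA lerD //; exact: fr_snD.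
- by move=> k x [? ?]; rewrite lerD // fr_mono.
- move=> [x y] [/= hx hy] h; have hk k : fs_sn k x = 0 /\ fs_sn k y = 0.
    have /eqP := h k; rewrite paddr_eq0 ?fs_sn_ge0 // => /andP[/eqP ? /eqP ?]; by [].
  by congr (_, _); apply: fr_sep => // k; have [] := hk k.
- move=> u hu cu.
  have [|x hx ux] := @fr_complete _ _ hE (fst \o u) (fun n => (hu n).1).
    move=> k e e0; have [N HN] := cu k e e0; exists N => m n mN nN.
    apply: le_lt_trans (HN m n mN nN); rewrite lerDl fs_sn_ge0 //.
    by apply: fs_carB; [exact: (hu m).2 | exact: (hu n).2].
  have [|y hy uy] := @fr_complete _ _ hF (snd \o u) (fun n => (hu n).2).
    move=> k e e0; have [N HN] := cu k e e0; exists N => m n mN nN.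
    apply: le_lt_trans (HN m n mN nN); rewrite lerDr fs_sn_ge0 //.
    by apply: fs_carB; [exact: (hu m).1 | exact: (hu n).1].
  exists (x, y) => // k e e0.
  have e20 : 0 < e / 2 by rewrite divr_gt0.
  have [N HN] := ux k _ e20; have [M HM] := uy k _ e20.
  exists (maxn N M) => n; rewrite geq_max => /andP[nN nM].
  by rewrite [e]splitr ltrD //; [exact: HN | exact: HM].
Qed.
#[export] Existing Instance frechet_prod.

Lemma frechet_real (R : realType) : is_frechet (fs_real R).
Proof.
split => //=.
- by move=> k a x _; rewrite normrM.
- by move=> k x y _ _; exact: ler_normD.
- by move=> x _ /(_ 0%N) /normr0_eq0.
- move=> u _ cu.
  have cvu : cvgn (u : nat -> R).
    apply/cauchy_cvgP; apply: cauchy_exP => e e0; have [N HN] := cu 0%N e e0.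
    by exists (u N); exists N => // n /= Nn; rewrite /ball /= HN.
  exists (limn (u : nat -> R)) => // _ e e0.
  have /cvgrPdist_lt /(_ e e0) [N _ HN] : u @ \oo --> limn (u : nat -> R) by [].
  by exists N => n /HN; rewrite distrC.
Qed.
#[export] Existing Instance frechet_real.

(** * Convergence along filters, continuous bilinear maps *)

Section Tends.
Context {R : realType}.
Implicit Types E F G : fspace R.

(** An [fspace] carries no library topology. A general filter is allowed because limits are taken
    both as a real parameter tends to 0 and along neighbourhoods relative to an open set. *)
Definition tends {I : Type} (B : set_system I) E (f : I -> E) (l : E) : Prop :=
  forall k e, 0 < e -> B [set i | fs_sn k (f i - l) < e].

Section Filter.
Context {I : Type} (B : set_system I) {fB : Filter B}.

Lemma tends_cst E {hE : is_frechet E} (l : E) : tends B (fun=> l) l.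
Proof. by move=> k e e0; apply: filterE => i /=; rewrite subrr fs_sn0. Qed.

Lemma tends_near E (f g : I -> E) l : B [set i | f i = g i] -> tends B g l -> tends B f l.
Proof. by move=> fg + k e e0 => /(_ k e e0); apply: filterS2 fg => i /= ->. Qed.

Lemma tends_le E F {hE : is_frechet E} {hF : is_frechet F}
  (f : I -> E) l (g : I -> F) l' :
  (forall k, exists m, exists2 C : R, 0 < C &
     B [set i | fs_sn k (f i - l) <= C * fs_sn m (g i - l')]) ->
  tends B g l' -> tends B f l.
Proof.
move=> H gl k e e0; have [m [C C0 {}H]] := H k.
have := gl m (e / C) (divr_gt0 e0 C0).
by apply: filterS2 H => i /= + h2; move/le_lt_trans; apply; rewrite mulrC -ltr_pdivlMr.
Qed.

Lemma tendsD E {hE : is_frechet E} (f g : I -> E) l l' :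
  B [set i | fs_car (f i)] -> B [set i | fs_car (g i)] -> fs_car l -> fs_car l' ->
  tends B f l -> tends B g l' -> tends B (fun i => f i + g i) (l + l').
Proof.
move=> cf cg hl hl' fl gl k e e0.
have e20 : 0 < e / 2 by rewrite divr_gt0.
near=> i.
have h1 : fs_car (f i) by near: i.
have h2 : fs_car (g i) by near: i.
have h3 : fs_sn k (f i - l) < e / 2 by near: i; exact: fl.
have h4 : fs_sn k (g i - l') < e / 2 by near: i; exact: gl.
rewrite /= opprD addrACA [e]splitr.
apply: le_lt_trans (ltrD h3 h4); apply: fr_snD; exact: fs_carB.
Unshelve. all: by end_near. Qed.

Lemma tends_pair E F (f : I -> E) (g : I -> F) l l' :
  tends B f l -> tends B g l' ->
  tends B (fun i => (f i, g i) : fs_prod E F) ((l, l') : fs_prod E F).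
Proof.
move=> fl gl k e e0; have e20 : 0 < e / 2 by rewrite divr_gt0.
by apply: filterS2 (fl k _ e20) (gl k _ e20) => i /= h1 h2; rewrite [ltRHS]splitr; exact: ltrD.
Qed.

Lemma tends_fcont E F (U : set E) (g : E -> F) (f : I -> E) l :
  fcont U g -> U l -> B [set i | U (f i)] -> tends B f l -> tends B (g \o f) (g l).
Proof.
move=> cg Ul Uf fl k e e0; have [m [d d0 H]] := cg _ Ul k e e0.
by apply: filterS2 Uf (fl m d d0) => i /= Ui; exact: H.
Qed.

End Filter.

Lemma tends_unique I (B : set_system I) {pB : ProperFilter B} E {hE : is_frechet E}
  (f : I -> E) l l' :
  B [set i | fs_car (f i)] -> fs_car l -> fs_car l' ->
  tends B f l -> tends B f l' -> l = l'.
Proof.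
move=> cf hl hl' fl fl'; apply/eqP; rewrite -subr_eq0; apply/eqP.
apply: fr_sep => [|k]; first exact: fs_carB.
apply/eqP; rewrite eq_le fs_sn_ge0 ?andbT; last exact: fs_carB.
apply/ler_addgt0Pl => e e0; rewrite addr0.
have e20 : 0 < e / 2 by rewrite divr_gt0.
have : B ([set i | fs_sn k (f i - l) < e / 2] `&`
    [set i | fs_sn k (f i - l') < e / 2] `&` [set i | fs_car (f i)]).
  by apply: filterI cf; apply: filterI; [exact: fl | exact: fl'].
move=> /filter_ex [i [/= [h1 h2] h3]].
rewrite (le_trans (fs_sn_dist k hl h3 hl')) // [e]splitr ltW //.
by rewrite ltrD // fs_sn_distC.
Qed.

Section Bilinear.
Context (E F G : fspace R) {hE : is_frechet E} {hF : is_frechet F} {hG : is_frechet G}.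

(** A single index [m] for both arguments is no restriction, the seminorms being increasing. *)
Record bilin (b : E -> F -> G) : Prop := {
  bilin_car : forall x y, fs_car x -> fs_car y -> fs_car (b x y);
  bilin_l : forall a x x' y, fs_car x -> fs_car x' -> fs_car y ->
    b (a *: x + x') y = a *: b x y + b x' y;
  bilin_r : forall a x y y', fs_car x -> fs_car y -> fs_car y' ->
    b x (a *: y + y') = a *: b x y + b x y';
  bilin_bound : forall k, exists m, exists2 C, 0 < C &
    forall x y, fs_car x -> fs_car y ->
      fs_sn k (b x y) <= C * fs_sn m x * fs_sn m y }.

Context (b : E -> F -> G) (hb : bilin b).

Lemma bilinBl x x' y : fs_car x -> fs_car x' -> fs_car y ->
  b (x - x') y = b x y - b x' y.
Proof. by move=> ? ? ?; rewrite addrC -scaleN1r bilin_l // scaleN1r addrC. Qed.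

Lemma bilinBr x y y' : fs_car x -> fs_car y -> fs_car y' ->
  b x (y - y') = b x y - b x y'.
Proof. by move=> ? ? ?; rewrite addrC -scaleN1r bilin_r // scaleN1r addrC. Qed.

Lemma bilinZl a x y : fs_car x -> fs_car y -> b (a *: x) y = a *: b x y.
Proof.
move=> hx hy; have b0 : b 0 y = 0.
  by rewrite -(subrr (0 : E)) bilinBl ?subrr //; exact: fs_car0.
by rewrite -[a *: x]addr0 bilin_l ?b0 ?addr0 //; exact: fs_car0.
Qed.

Lemma bilinZr a x y : fs_car x -> fs_car y -> b x (a *: y) = a *: b x y.
Proof.
move=> hx hy; have b0 : b x 0 = 0.
  by rewrite -(subrr (0 : F)) bilinBr ?subrr //; exact: fs_car0.
by rewrite -[a *: y]addr0 bilin_r ?b0 ?addr0 //; exact: fs_car0.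
Qed.

Lemma tends_bilin I (B : set_system I) {fB : Filter B} (f : I -> E) (g : I -> F) l l' :
  B [set i | fs_car (f i)] -> B [set i | fs_car (g i)] -> fs_car l -> fs_car l' ->
  tends B f l -> tends B g l' -> tends B (fun i => b (f i) (g i)) (b l l').
Proof.
move=> cf cg hl hl' fl gl k e e0.
have [m [C C0 bC]] := bilin_bound hb k.
(* The bound 1 keeps the seminorm of [f i] below that of [l] plus 1; the other one makes
   [C * d * (fs_sn m l + fs_sn m l' + 1)] at most [e / 2]. *)
pose d := Num.min 1 (e / (2 * C * (fs_sn m l + fs_sn m l' + 1))).
have l0 : 0 <= fs_sn m l by exact: fs_sn_ge0.
have l0' : 0 <= fs_sn m l' by exact: fs_sn_ge0.
have K0 : 0 < 2 * C * (fs_sn m l + fs_sn m l' + 1) by rewrite !mulr_gt0 // ltr_wpDl // addr_ge0.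
have d0 : 0 < d by rewrite lt_min ltr01 divr_gt0.
have dK : d * (2 * C * (fs_sn m l + fs_sn m l' + 1)) <= e.
  by rewrite -ler_pdivlMr // ge_min lexx orbT.
have d1 : d <= 1 by rewrite ge_min lexx.
near=> i.
have h1 : fs_car (f i) by near: i.
have h2 : fs_car (g i) by near: i.
have h3 : fs_sn m (f i - l) < d by near: i; exact: fl.
have h4 : fs_sn m (g i - l') < d by near: i; exact: gl.
have h10 : 0 <= fs_sn m (f i - l) by apply: fs_sn_ge0; exact: fs_carB.
have h20 : 0 <= fs_sn m (g i - l') by apply: fs_sn_ge0; exact: fs_carB.
have h5 : fs_sn m (f i) <= fs_sn m l + 1.
  apply: le_trans (fs_sn_leD m h1 hl) _.
  by rewrite addrC lerD2l (le_trans (ltW h3)).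
rewrite /= (_ : _ - _ = b (f i) (g i - l') + b (f i - l) l'); last first.
  by rewrite bilinBr // bilinBl // addrA subrK.
have h11 : fs_car (g i - l') by exact: fs_carB.
have h12 : fs_car (f i - l) by exact: fs_carB.
have h6 := bC _ _ h1 h11; have h7 := bC _ _ h12 hl'.
apply: le_lt_trans (fr_snD _ (bilin_car hb h1 h11) (bilin_car hb h12 hl')) _.
apply: le_lt_trans (lerD h6 h7) _.
have h8 : fs_sn m (f i) * fs_sn m (g i - l') <= (fs_sn m l + 1) * d.
  by rewrite ler_pM ?fs_sn_ge0 // ltW.
have h9 : fs_sn m (f i - l) * fs_sn m l' <= d * fs_sn m l' by rewrite ler_wpM2r // ltW.
have : C * (fs_sn m (f i) * fs_sn m (g i - l') + fs_sn m (f i - l) * fs_sn m l') <=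
   C * ((fs_sn m l + 1) * d + d * fs_sn m l') by rewrite ler_pM2l // lerD.
have : 0 < C * d * (fs_sn m l + fs_sn m l' + 1) by rewrite !mulr_gt0 // ltr_wpDl // addr_ge0.
by nra.
Unshelve. all: by end_near. Qed.

End Bilinear.
End Tends.

(** * Differential calculus *)

(** The supremum of the points up to which the estimate holds with slope [M + e] satisfies it too,
    and cannot lie before [b]. As [N] is not assumed symmetric, both orders of the difference appear
    in the local hypothesis; this lets the lemma serve for seminorms on a carrier and for norms
    alike. *)
Lemma mean_value (R : realType) (V : lmodType R) (car : set V) (N : V -> R)
    (phi : R -> V) (a b M : R) :
  N 0 = 0 ->
  (forall x y z, car x -> car y -> car z -> N (x - z) <= N (x - y) + N (y - z)) ->
  a <= b -> (forall s, a <= s <= b -> car (phi s)) ->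
  (forall s e, a <= s <= b -> 0 < e -> exists2 d, 0 < d & forall r, a <= r <= b ->
     `|r - s| < d -> N (phi r - phi s) <= (M + e) * `|r - s| /\
                     N (phi s - phi r) <= (M + e) * `|r - s|) ->
  N (phi b - phi a) <= M * (b - a).
Proof.
move=> N0 tri ab cphi loc.
have phi_le e : 0 < e -> N (phi b - phi a) <= (M + e) * (b - a).
  move=> e0; set K := M + e.
  pose S := [set s | a <= s <= b /\ N (phi s - phi a) <= K * (s - a)].
  have aa : a <= a <= b by rewrite lexx ab.
  have Sa : S a by split => //; rewrite !subrr N0 mulr0.
  have Sb : has_sup S by split; [exists a | exists b => s [/andP[_ ?]]].
  pose c := sup S.
  have ac : a <= c by exact: (ub_le_sup Sb.2).
  have cb : c <= b by apply: ge_sup => [|s [/andP[_ ?]] //]; exists a.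
  have acb : a <= c <= b by rewrite ac cb.
  have [d d0 H] := loc c e acb e0.
  (* An element of [S] within [d] of the supremum [c] carries the estimate over to [c]. *)
  have [s Ss cs] := sup_adherent d0 Sb.
  have sc : s <= c by exact: (ub_le_sup Sb.2).
  have [asb Ns] := Ss.
  have [_ H1] : N (phi s - phi c) <= K * `|s - c| /\ N (phi c - phi s) <= K * `|s - c|.
    by apply: H => //; rewrite ltr_norml; rewrite -/c in cs; lra.
  have Nc : N (phi c - phi a) <= K * (c - a).
    apply: le_trans (tri _ (phi s) _ _ _ _) _; [exact: cphi..|].
    rewrite distrC ger0_norm ?subr_ge0 // in H1.
    have -> : K * (c - a) = K * (c - s) + K * (s - a) by ring.
    exact: lerD.
  have /predU1P[cb'|cltb] : (c == b) || (c < b) by rewrite -le_eqVlt.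
    by move: Nc; rewrite cb'.
  (* If [c < b], the local estimate at [c] puts a point beyond [c] into [S]. *)
  pose r := Num.min (c + d / 2) b.
  have cr : c < r by rewrite lt_min cltb andbT ltrDl divr_gt0.
  have rd : r - c < d.
    have : r <= c + d / 2 by rewrite ge_min lexx.
    by move=> ?; lra.
  have arb : a <= r <= b by rewrite (le_trans ac (ltW cr)) ge_min lexx orbT.
  have [H2 _] : N (phi r - phi c) <= K * `|r - c| /\ N (phi c - phi r) <= K * `|r - c|.
    by apply: H => //; rewrite gtr0_norm // subr_gt0.
  suff Sr : S r by have := ub_le_sup Sb.2 Sr; rewrite leNgt -/c cr.
  split => //; apply: le_trans (tri _ (phi c) _ _ _ _) _; [exact: cphi..|].
  rewrite gtr0_norm ?subr_gt0 // in H2.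
  have -> : K * (r - a) = K * (r - c) + K * (c - a) by ring.
  exact: lerD.
apply/ler_addgt0Pl => e e0.
have /predU1P[->|ba] : (a == b) || (a < b) by rewrite -le_eqVlt.
  by rewrite subrr N0 subrr mulr0 addr0 ltW.
have ba0 : 0 < b - a by rewrite subr_gt0.
have := phi_le _ (divr_gt0 e0 ba0); rewrite mulrDl divfK ?gt_eqF // addrC.
by rewrite [_ + M * _]addrC.
Qed.

Section Calculus.
Context {R : realType}.
Implicit Types E F G : fspace R.

Lemma fopen_car E (U : set E) x : fopen U -> U x -> fs_car x.
Proof. by case=> + _ => /[apply]. Qed.

Lemma fopen_line E {hE : is_frechet E} (U : set E) x h : fopen U -> U x -> fs_car h ->
  exists2 d : R, 0 < d & forall t, `|t| < d -> U (x + t *: h).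
Proof.
move=> [UE oU] Ux hh; have [k [e e0 H]] := oU x Ux.
have hx := UE _ Ux; have k0 : 0 <= fs_sn k h by exact: fs_sn_ge0.
have K0 : 0 < fs_sn k h + 1 by rewrite ltr_wpDl.
exists (e / (fs_sn k h + 1)); first exact: divr_gt0.
move=> t; rewrite ltr_pdivlMr // => td; apply: H.
  by apply: fs_carD => //; exact: fs_carZ.
rewrite addrAC subrr add0r fr_snZ //; apply: le_lt_trans td.
by rewrite ler_wpM2l // lerDl.
Qed.

Lemma fopenI E {hE : is_frechet E} (U V : set E) : fopen U -> fopen V -> fopen (U `&` V).
Proof.
move=> oU oV; split=> [x [/(fopen_car oU)]//|x [Ux Vx]].
have hx := fopen_car oU Ux.
have [k [e e0 H]] := oU.2 x Ux; have [k' [e' e0' H']] := oV.2 x Vx.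
exists (maxn k k'), (Num.min e e'); first by rewrite lt_min e0.
move=> y hy; rewrite lt_min => /andP[h1 h2].
have hyx : fs_car (y - x) by exact: fs_carB.
split; [apply: H => //; apply: le_lt_trans h1 | apply: H' => //; apply: le_lt_trans h2];
  by apply: fs_sn_le => //; rewrite ?leq_maxl ?leq_maxr.
Qed.

Lemma fopenU E (U V : set E) : fopen U -> fopen V -> fopen (U `|` V).
Proof.
move=> oU oV; split=> [x [/(fopen_car oU)|/(fopen_car oV)]//|x [/oU.2|/oV.2]].
  by move=> [k [e e0 H]]; exists k, e => // y hy /(H _ hy); left.
by move=> [k [e e0 H]]; exists k, e => // y hy /(H _ hy); right.
Qed.

Lemma fopen_preim E F (U : set E) (V : set F) (f : E -> F) {hE : is_frechet E} :
  fopen U -> (forall x, U x -> fs_car (f x)) -> fcont U f -> fopen V -> fopen (U `&` f @^-1` V).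
Proof.
move=> oU fF cf oV; split=> [x [/(fopen_car oU)]//|x [Ux Vfx]].
have hx := fopen_car oU Ux.
have [k [e e0 H]] := oU.2 x Ux; have [k' [e' e0' H']] := oV.2 _ Vfx.
have [m [d d0 H2]] := cf x Ux k' e' e0'.
exists (maxn k m), (Num.min e d); first by rewrite lt_min e0.
move=> y hy; rewrite lt_min => /andP[h1 h2].
have hyx : fs_car (y - x) by exact: fs_carB.
have Uy : U y.
  by apply: H => //; apply: le_lt_trans h1; apply: fs_sn_le => //; exact: leq_maxl.
split => //; apply: H'; first exact: fF.
by apply: H2 => //; apply: le_lt_trans h2; apply: fs_sn_le => //; exact: leq_maxr.
Qed.

Lemma fopen_setX E F {hE : is_frechet E} {hF : is_frechet F} (U : set E) (V : set F) :
  fopen U -> fopen V -> fopen (E := fs_prod E F) [set p : fs_prod E F | U p.1 /\ V p.2].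
Proof.
move=> oU oV; split=> [x [/= /(fopen_car oU) ? /(fopen_car oV) ?]//|[x x'] [/= Ux Vx]].
have hx := fopen_car oU Ux; have hx' := fopen_car oV Vx.
have [k [e e0 H]] := oU.2 x Ux; have [k' [e' e0' H']] := oV.2 x' Vx.
exists (maxn k k'), (Num.min e e'); first by rewrite lt_min e0.
move=> [y y'] [/= hy hy']; rewrite lt_min => /andP[h1 h2].
have hyx : fs_car (y - x) by exact: fs_carB.
have hyx' : fs_car (y' - x') by exact: fs_carB.
split.
  apply: H => //; apply: le_lt_trans h1.
  by rewrite (le_trans (fs_sn_le (leq_maxl k k') _)) // lerDl fs_sn_ge0.
apply: H' => //; apply: le_lt_trans h2.
by rewrite (le_trans (fs_sn_le (leq_maxr k k') _)) // lerDr fs_sn_ge0.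
Qed.

Lemma fopen_fs_car E : fopen (@fs_car R E).
Proof. by split => // x hx; exists 0%N, 1. Qed.

Lemma is_dderivP E F (f : E -> F) x h l :
  is_dderiv f x h l <->
  fs_car l /\ tends (0 : R)^' (fun t => t^-1 *: (f (x + t *: h) - f x)) l.
Proof.
split=> -[hl H]; split=> // k e e0; have := H k e e0.
  move=> [d d0 Hd]; exists d => //= t; rewrite /= sub0r normrN => td t0.
  by apply: Hd; rewrite normr_gt0 t0.
move=> [d /= d0 Hd]; exists d => // t /andP[t0 td]; apply: Hd; rewrite /= ?sub0r ?normrN //.
by rewrite -normr_gt0.
Qed.

Lemma near0_line E {hE : is_frechet E} (U : set E) x h : fopen U -> U x -> fs_car h ->
  (0 : R)^' [set t | U (x + t *: h)].
Proof.
move=> oU Ux hh; have [d d0 Hd] := fopen_line oU Ux hh.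
by exists d => //= t; rewrite /= sub0r normrN => td _; exact: Hd.
Qed.

Lemma tends_line E {hE : is_frechet E} (x h : E) : fs_car x -> fs_car h ->
  tends (0 : R)^' (fun t => x + t *: h) x.
Proof.
move=> hx hh k e e0.
have ob : fopen [set y : E | fs_car y /\ fs_sn k (y - x) < e].
  split=> [y []//|y [hy yxe]]; exists k, (e - fs_sn k (y - x)); first by rewrite subr_gt0.
  move=> z hz; rewrite ltrBrDr => H; split=> //.
  exact: le_lt_trans (fs_sn_dist k hz hy hx) H.
have : [set y : E | fs_car y /\ fs_sn k (y - x) < e] x by split; rewrite // subrr fs_sn0.
by move=> /(near0_line ob) /(_ hh); apply: filterS => t [].
Qed.

Lemma near0_quot E F {hE : is_frechet E} {hF : is_frechet F} (f : E -> F) (U : set E) x h :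
  fopen U -> U x -> fs_car h -> (forall x, U x -> fs_car (f x)) ->
  (0 : R)^' [set t | fs_car (t^-1 *: (f (x + t *: h) - f x))].
Proof.
move=> oU Ux hh fF; apply: filterS (near0_line oU Ux hh) => t Ut /=.
apply: fs_carZ; apply: fs_carB; exact: fF.
Qed.

Lemma is_dderiv_unique E F {hE : is_frechet E} {hF : is_frechet F} (f : E -> F)
  (U : set E) x h l l' :
  fopen U -> U x -> fs_car h -> (forall x, U x -> fs_car (f x)) ->
  is_dderiv f x h l -> is_dderiv f x h l' -> l = l'.
Proof.
move=> oU Ux hh fF /is_dderivP[hl fl] /is_dderivP[hl' fl'].
by apply: (tends_unique _ hl hl' fl fl'); exact: near0_quot fF.
Qed.

Lemma is_dderiv_eq E F {hE : is_frechet E} (f g : E -> F) (U : set E) x h l :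
  fopen U -> U x -> fs_car h -> (forall y, U y -> f y = g y) ->
  is_dderiv f x h l -> is_dderiv g x h l.
Proof.
move=> oU Ux hh fg /is_dderivP[hl fl]; apply/is_dderivP; split=> //.
apply: tends_near fl; apply: filterS (near0_line oU Ux hh) => t Ut /=.
by rewrite !fg.
Qed.

Definition derives E F (U : set E) (f : E -> F) (df : fs_prod E E -> F) : Prop :=
  forall x h, U x -> fs_car h -> is_dderiv f x h (df (x, h)).

Definition tangent E (U : set E) : set (fs_prod E E) :=
  [set p : fs_prod E E | U p.1 /\ fs_car p.2].

Lemma fopen_tangent E {hE : is_frechet E} (U : set E) : fopen U -> fopen (tangent U).
Proof. by move=> oU; apply: fopen_setX => //; exact: fopen_fs_car. Qed.

(* The difference quotients converge uniformly with respect to the base point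
   and the direction, by the mean value inequality. *)
Lemma strict_dderiv E F {hE : is_frechet E} {hF : is_frechet F} (U : set E)
    (f : E -> F) (df : fs_prod E E -> F) :
  fopen U -> (forall x, U x -> fs_car (f x)) -> derives U f df -> fcont (tangent U) df ->
  forall y k, U y -> fs_car k -> forall j e, 0 < e ->
  exists m, exists2 d, 0 < d & forall y' k' t, fs_car y' -> fs_car k' ->
    fs_sn m (y' - y) < d -> fs_sn m (k' - k) < d -> 0 < `|t| < d ->
    fs_sn j (t^-1 *: (f (y' + t *: k') - f y') - df (y, k)) < e.
Proof.
move=> oU fF fdf cdf y k Uy hk j e e0.
have hy := fopen_car oU Uy.
have [k0 [e1 e10 He1]] := oU.2 y Uy.
have [m1 [d1 d10 Hd1]] := cdf (y, k) (conj Uy hk) j (e / 2) (divr_gt0 e0 (ltr0Sn _ _)).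
pose m := maxn m1 k0.
have km0 : 0 <= fs_sn m k by exact: fs_sn_ge0.
pose c := Num.min e1 d1; pose K := 2 * (fs_sn m k + 2).
have c0 : 0 < c by rewrite lt_min e10 d10.
have ce1 : c <= e1 by rewrite ge_min lexx.
have cd1 : c <= d1 by rewrite ge_min lexx orbT.
have K0 : 0 < K by rewrite mulr_gt0 // ltr_wpDl.
pose d := Num.min 1 (c / K).
have d0 : 0 < d by rewrite lt_min ltr01 divr_gt0.
have d_1 : d <= 1 by rewrite ge_min lexx.
have dc : d * K <= c by rewrite -ler_pdivlMr // ge_min lexx orbT.
exists m, d => // y' k' t hy' hk' y'd k'd /andP[t0 td].
have hy'y : fs_car (y' - y) by exact: fs_carB.
have hk'k : fs_car (k' - k) by exact: fs_carB.
have k'm : fs_sn m k' <= fs_sn m k + 1.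
  by have := fs_sn_leD m hk' hk => /(_ hE); lra.
have zc s : 0 <= s <= 1 -> fs_sn m (y' + (s * t) *: k' - y) < c / 2.
  move=> /andP[s0 s1]; rewrite addrAC.
  apply: le_lt_trans (fr_snD _ hy'y (fs_carZ _ hk')) _.
  rewrite fr_snZ // normrM ger0_norm //.
  have : s * `|t| * fs_sn m k' <= 1 * d * (fs_sn m k + 1).
    by rewrite ler_pM ?mulr_ge0 ?fs_sn_ge0 // ler_pM // ltW.
  rewrite /K in dc; nra.
have hz s : fs_car (y' + (s * t) *: k') by apply: fs_carD => //; exact: fs_carZ.
have Uz s : 0 <= s <= 1 -> U (y' + (s * t) *: k').
  move=> s01; apply: He1 => //; apply: le_lt_trans (_ : _ <= c / 2) _; last by lra.
  apply: le_trans (ltW (zc s s01)); apply: fs_sn_le; first exact: leq_maxr.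
  exact: fs_carB.
have tn0 : t != 0 by rewrite -normr_gt0.
have hdf : fs_car (df (y, k)) by exact: (fdf _ _ Uy hk).1.
(* The quantity to be bounded is the increment of [phi] over [0,1]; the derivative of [phi] is
   [df (y' + (s t) k', k') - df (y, k)], of seminorm at most [e / 2]. *)
pose phi s := t^-1 *: f (y' + (s * t) *: k') - s *: df (y, k).
have hphi s : 0 <= s <= 1 -> fs_car (phi s).
  by move=> s01; apply: fs_carB; apply: fs_carZ => //; apply: fF; exact: Uz.
have -> : t^-1 *: (f (y' + t *: k') - f y') - df (y, k) = phi 1 - phi 0.
  rewrite /phi mul1r mul0r !scale0r addr0 subr0 scale1r.
  by lincomb [:: f (y' + t *: k'); f y'; df (y, k)].
apply: le_lt_trans (_ : _ <= e / 2 * (1 - 0)) _; last by lra.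
apply: (mean_value (car := @fs_car R F)) => //; first exact: fs_sn0.
  by move=> *; exact: fs_sn_dist.
move=> s e' s01 e'0.
have [_ /(_ j e' e'0) [dl dl0 Hdl]] := fdf _ _ (Uz s s01) hk'.
exists (dl / `|t|); first exact: divr_gt0.
move=> r r01 rs; rewrite [X in _ /\ X <= _]fs_sn_distC; [|exact: hphi..].
suff H : fs_sn j (phi r - phi s) <= (e / 2 + e') * `|r - s| by [].
have [->|rns] := eqVneq r s; first by rewrite subrr fs_sn0 subrr normr0 mulr0.
have rs0 : r - s != 0 by rewrite subr_eq0.
pose tau := (r - s) * t.
have tau0 : tau != 0 by rewrite mulf_neq0.
have zr : y' + (s * t) *: k' + tau *: k' = y' + (r * t) *: k'.
  by rewrite /tau; lincomb [:: y'; k'].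
pose q := tau^-1 *: (f (y' + (s * t) *: k' + tau *: k') - f (y' + (s * t) *: k')).
have hq : fs_car q.
  apply: fs_carZ; apply: fs_carB; apply: fF; last exact: Uz.
  by rewrite zr; exact: Uz.
pose l := df (y' + (s * t) *: k', k').
have hl : fs_car l by exact: (fdf _ _ (Uz s s01) hk').1.
have -> : phi r - phi s = (r - s) *: (q - df (y, k)).
  rewrite /phi /q zr /tau.
  by lincomb [:: f (y' + (r * t) *: k'); f (y' + (s * t) *: k'); df (y, k)];
    field; rewrite ?tn0 ?rs0.
rewrite fr_snZ; last exact: fs_carB.
rewrite mulrC ler_wpM2r //.
apply: le_trans (fs_sn_dist j hq hl hdf) _.
rewrite addrC lerD //.
  apply: ltW; apply: Hd1; first by split => //=; exact: Uz.
  rewrite /= -[X in _ < X]/d1.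
  apply: lt_le_trans (_ : c / 2 + d <= _).
    rewrite ler_ltD //.
      apply: le_trans (ltW (zc s s01)); apply: fs_sn_le; [exact: leq_maxl | exact: fs_carB].
    by apply: le_lt_trans k'd; apply: fs_sn_le => //; exact: leq_maxl.
  by rewrite /K in dc; nra.
apply: ltW; apply: Hdl; rewrite normr_gt0 tau0 /= normrM.
by rewrite -ltr_pdivlMr // normr_gt0.
Qed.

End Calculus.

(** * Linearity of the derivative, chain rule, symmetry of second derivatives *)

Section Differential.
Context {R : realType}.
Implicit Types E F G : fspace R.

Section OneMap.
Context {E F : fspace R} {hE : is_frechet E} {hF : is_frechet F}.
Context (U : set E) (f : E -> F) (df : fs_prod E E -> F).
Context (oU : fopen U) (fF : forall x, U x -> fs_car (f x)).
Context (fdf : derives U f df) (cdf : fcont (tangent U) df).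

(** The form in which uniform convergence is used below: base point, direction and step may all
    vary. *)
Lemma tends_strict I (B : set_system I) {fB : Filter B} (y : I -> E) (k : I -> E)
    (t : I -> R) l m :
  U l -> fs_car m -> B [set i | fs_car (y i)] -> B [set i | fs_car (k i)] ->
  tends B y l -> tends B k m -> (forall d, 0 < d -> B [set i | 0 < `|t i| < d]) ->
  tends B (fun i => (t i)^-1 *: (f (y i + t i *: k i) - f (y i))) (df (l, m)).
Proof.
move=> Ul hm cy ck yl km t0 j e e0.
have [n [d d0 H]] := strict_dderiv oU fF fdf cdf Ul hm j e0.
near=> i; apply: H; first [by near: i | near: i; first [exact: yl | exact: km | exact: t0]].
Unshelve. all: by end_near. Qed.

Lemma near0_small d : 0 < d -> (0 : R)^' [set t | 0 < `|t| < d].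
Proof.
by move=> d0; exists d => //= t; rewrite /= sub0r normrN => td t0; rewrite normr_gt0 t0.
Qed.

Lemma derives_car x h : U x -> fs_car h -> fs_car (df (x, h)).
Proof. by move=> Ux hh; have [] := fdf Ux hh. Qed.

(** The difference quotient in the direction [u + v] splits into one at [x] and one at the moving
    point [x + t u]; the latter converges only because of strict differentiability. *)
Lemma derivesD x u v : U x -> fs_car u -> fs_car v -> df (x, u + v) = df (x, u) + df (x, v).
Proof.
move=> Ux hu hv; have huv : fs_car (u + v) by exact: fs_carD.
have hx := fopen_car oU Ux.
apply: (is_dderiv_unique oU Ux huv fF); first exact: fdf.
apply/is_dderivP; split; first by apply: fs_carD; exact: derives_car.
apply: (tends_near (g := fun t =>
  t^-1 *: (f (x + t *: u + t *: v) - f (x + t *: u)) + t^-1 *: (f (x + t *: u) - f x))).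
  apply: nearW => t _ /=; rewrite (_ : x + t *: (u + v) = x + t *: u + t *: v); last by rewrite scalerDr addrA.
  by lincomb [:: f (x + t *: u + t *: v); f (x + t *: u); f x].
have c1 : (0 : R)^' [set t | U (x + t *: u)] by exact: near0_line.
have c2 : (0 : R)^' [set t | U (x + t *: u + t *: v)].
  by apply: filterS (near0_line oU Ux huv) => t /=; rewrite scalerDr addrA.
rewrite addrC; apply: tendsD; try exact: derives_car.
- by apply: filterS2 c1 c2 => t ? ? /=; apply: fs_carZ; apply: fs_carB; exact: fF.
- exact: near0_quot fF.
- apply: tends_strict => //; last exact: near0_small.
  + by apply: filterS c1 => t /=; exact: fopen_car.
  + exact: nearW.
  + exact: tends_line.
  + exact: tends_cst.
- by have /is_dderivP[] := fdf Ux hu.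
Qed.

Lemma derives0 x : U x -> df (x, 0) = 0.
Proof.
move=> Ux; have h0 : fs_car (0 : E) by exact: fs_car0.
apply: (is_dderiv_unique oU Ux h0 fF); first exact: fdf.
apply/is_dderivP; split; first exact: fs_car0.
apply: (tends_near (g := fun=> 0)); last exact: tends_cst.
by apply: nearW => t _ /=; rewrite scaler0 addr0 subrr scaler0.
Qed.

Lemma derivesZ a x u : U x -> fs_car u -> df (x, a *: u) = a *: df (x, u).
Proof.
move=> Ux hu; have [->|a0] := eqVneq a 0; first by rewrite !scale0r derives0.
have a00 : 0 < `|a| by rewrite normr_gt0.
have hau : fs_car (a *: u) by exact: fs_carZ.
have hx := fopen_car oU Ux.
apply: (is_dderiv_unique oU Ux hau fF); first exact: fdf.
apply/is_dderivP; split; first by apply: fs_carZ; exact: derives_car.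
have H : tends (0 : R)^' (fun t => (t * a)^-1 *: (f (x + (t * a) *: u) - f x)) (df (x, u)).
  apply: tends_strict => //; [exact: nearW|exact: nearW|exact: tends_cst..|].
  move=> d d0; have dd : 0 < d / `|a| by rewrite divr_gt0 ?normr_gt0.
  apply: filterS (near0_small dd) => t /= /andP[t0 td].
  by rewrite normrM; apply/andP; split; [exact: mulr_gt0 | rewrite -ltr_pdivlMr].
move=> k e e0.
have cq : (0 : R)^' [set t | fs_car (t^-1 *: (f (x + t *: (a *: u)) - f x))].
  exact: near0_quot fF.
apply: filterS3 (H k _ (divr_gt0 e0 a00)) cq (near0_small ltr01) => t /= h1 h2 /andP[t0 _].
have tn0 : t != 0 by rewrite -normr_gt0.
have -> : t^-1 *: (f (x + t *: (a *: u)) - f x) - a *: df (x, u) =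
   a *: ((t * a)^-1 *: (f (x + (t * a) *: u) - f x) - df (x, u)).
  rewrite scalerA; lincomb [:: f (x + (t * a) *: u); f x; df (x, u)]; field; by rewrite ?tn0 ?a0.
rewrite fr_snZ; first by rewrite mulrC -ltr_pdivlMr.
apply: fs_carB; last exact: derives_car.
have -> : (t * a)^-1 *: (f (x + (t * a) *: u) - f x) =
  a^-1 *: (t^-1 *: (f (x + t *: (a *: u)) - f x)) by rewrite !scalerA invfM mulrC.
exact: fs_carZ.
Qed.

Lemma derives_lin a x u v : U x -> fs_car u -> fs_car v ->
  df (x, a *: u + v) = a *: df (x, u) + df (x, v).
Proof. by move=> Ux hu hv; rewrite derivesD ?derivesZ //; exact: fs_carZ. Qed.

End OneMap.

(** With [q] the difference quotient of [f], one has [f (x + t h) = f x + t q(t)], so that the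
    quotient of [g o f] is one of [g] at the fixed point [f x] in the moving direction [q(t)]. *)
Lemma derives_comp E F G {hE : is_frechet E} {hF : is_frechet F} {hG : is_frechet G}
    (U : set E) (V : set F) (f : E -> F) (g : F -> G) df dg :
  fopen U -> fopen V -> (forall x, U x -> V (f x)) -> (forall y, V y -> fs_car (g y)) ->
  derives U f df -> derives V g dg -> fcont (tangent V) dg ->
  derives U (g \o f) (fun p => dg (f p.1, df p)).
Proof.
move=> oU oV fV gG fdf gdg cdg x h Ux hh /=.
have fF y : U y -> fs_car (f y) by move=> /fV /(fopen_car oV).
have [hl _] := fdf _ _ Ux hh.
apply/is_dderivP; split; first by have [] := gdg _ _ (fV _ Ux) hl.
pose q t := t^-1 *: (f (x + t *: h) - f x).
apply: (tends_near (g := fun t => t^-1 *: (g (f x + t *: q t) - g (f x)))).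
  apply: filterS (near0_small ltr01) => t /= /andP[t0 _].
  by rewrite /q scalerA divff -?normr_gt0 // scale1r [f x + _]addrC subrK.
apply: (tends_strict oV gG gdg cdg) => //; last exact: near0_small.
- exact: fV.
- by apply: nearW => t _; exact: fF.
- exact: near0_quot fF.
- exact: tends_cst.
- by have /is_dderivP[] := fdf _ _ Ux hh.
Qed.

(* Schwarz: both sides are the limit of the second difference quotient. *)
Lemma second_deriv_sym E F {hE : is_frechet E} {hF : is_frechet F} (U : set E) (f : E -> F)
    (df : fs_prod E E -> F) (ddf : fs_prod (fs_prod E E) (fs_prod E E) -> F) :
  fopen U -> (forall x, U x -> fs_car (f x)) -> derives U f df ->
  derives (tangent U) df ddf -> fcont (tangent (tangent U)) ddf ->
  forall x u v, U x -> fs_car u -> fs_car v ->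
  ddf ((x, u), (v, 0)) = ddf ((x, v), (u, 0)).
Proof.
move=> oU fF fdf dfddf cddf x.
pose D2 t u v := t^-1 *: (t^-1 *: (f (x + t *: u + t *: v) - f (x + t *: u) -
  (f (x + t *: v) - f x))).
have oTU : fopen (tangent U) by exact: fopen_tangent.
have dfF p : tangent U p -> fs_car (df p).
  by case: p => y h [/= Uy hh]; have [] := fdf _ _ Uy hh.
have D2lim u v : U x -> fs_car u -> fs_car v ->
    tends (0 : R)^' (fun t => D2 t u v) (ddf ((x, u), (v, 0))).
  move=> Ux hu hv j e e0.
  have hx := fopen_car oU Ux.
  have Txu : tangent U (x, u) by [].
  have hv0 : fs_car ((v, 0) : fs_prod E E) by split => //; exact: fs_car0.
  set B := ddf _; have hB : fs_car B by have [] := dfddf _ _ Txu hv0.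
  have e20 : 0 < e / 2 by rewrite divr_gt0.
  have [m [d d0 Hd]] := strict_dderiv oTU dfF dfddf cddf Txu hv0 j e20.
  have [k [e1 e10 He1]] := oU.2 x Ux.
  have u0 : 0 <= fs_sn m u by exact: fs_sn_ge0.
  have ku0 : 0 <= fs_sn k u by exact: fs_sn_ge0.
  have kv0 : 0 <= fs_sn k v by exact: fs_sn_ge0.
  have A0 : 0 < fs_sn m u + 1 by rewrite ltr_wpDl.
  have A1 : 0 < fs_sn k u + fs_sn k v + 1 by rewrite ltr_wpDl // addr_ge0.
  (* The third bound keeps [x + (s t) u] in the range where the difference quotients of [df] are
     controlled, the fourth keeps the whole parallelogram inside [U]. *)
  pose d' := Num.min (Num.min 1 d) (Num.min (d / (fs_sn m u + 1)) (e1 / (fs_sn k u + fs_sn k v + 1))).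
  have d'0 : 0 < d' by rewrite !lt_min ltr01 d0 !divr_gt0.
  apply: filterS (near0_small d'0) => t /= /andP[t0].
  rewrite !lt_min => /andP[/andP[t1 td] /andP[]].
  rewrite !ltr_pdivlMr // => tdu te1.
  have tn0 : t != 0 by rewrite -normr_gt0.
  have Uz s r : 0 <= s <= 1 -> 0 <= r <= 1 -> U (x + (s * t) *: u + (r * t) *: v).
    move=> /andP[s0 s1] /andP[r0 r1]; apply: He1.
      by apply: fs_carD; [apply: fs_carD|]; rewrite //; exact: fs_carZ.
    have -> : x + (s * t) *: u + (r * t) *: v - x = (s * t) *: u + (r * t) *: v.
      by lincomb [:: x; u; v].
    apply: le_lt_trans (fr_snD _ (fs_carZ _ hu) (fs_carZ _ hv)) _.
    rewrite !fr_snZ // !normrM (ger0_norm s0) (ger0_norm r0).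
    have h1 : s * `|t| <= 1 * `|t| by rewrite ler_wpM2r.
    have h2 : r * `|t| <= 1 * `|t| by rewrite ler_wpM2r.
    have h3 : s * `|t| * fs_sn k u <= 1 * `|t| * fs_sn k u by rewrite ler_wpM2r.
    have h4 : r * `|t| * fs_sn k v <= 1 * `|t| * fs_sn k v by rewrite ler_wpM2r.
    by nra.
  have i01 : 0 <= (1 : R) <= 1 by rewrite ler01 lexx.
  have i00 : 0 <= (0 : R) <= 1 by rewrite ler01 lexx.
  have Uz0 s : 0 <= s <= 1 -> U (x + (s * t) *: u).
    by move=> s01; have := Uz s 0 s01 i00; rewrite mul0r scale0r addr0.
  have Uz1 s : 0 <= s <= 1 -> U (x + (s * t) *: u + t *: v).
    by move=> s01; have := Uz s 1 s01 i01; rewrite mul1r.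
  (* Its derivative [t^-1 (df (z1, u) - df (z0, u)) - B], with [z0 = x + (s t) u] and
     [z1 = z0 + t v], compares a difference quotient of [df] in the direction [(v, 0)] with its
     limit [B]. *)
  pose phi s := t^-1 *: (t^-1 *: (f (x + (s * t) *: u + t *: v) - f (x + (s * t) *: u))) - s *: B.
  have cphi s : 0 <= s <= 1 -> fs_car (phi s).
    move=> s01; apply: fs_carB; last exact: fs_carZ.
    by do 2 apply: fs_carZ; apply: fs_carB; apply: fF; [exact: Uz1 | exact: Uz0].
  have -> : D2 t u v - B = phi 1 - phi 0.
    rewrite /phi /D2 !mul1r !mul0r !scale0r !addr0 scale1r.
    by lincomb [:: f (x + t *: u + t *: v); f (x + t *: u); f (x + t *: v); f x; B].
  apply: le_lt_trans (_ : _ <= e / 2 * (1 - 0)) _; last by lra.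
  apply: (mean_value (car := @fs_car R F)) => //; first exact: fs_sn0.
    by move=> *; exact: fs_sn_dist.
  move=> s e' s01 e'0.
  (* The factor [|t|] makes up for the division by [t] in [phi], and each of the two increments of
     [f] gets one half. *)
  have e'' : 0 < e' * `|t| / 2 by rewrite !mulr_gt0 ?invr_gt0.
  have [_ /(_ j _ e'') [d1 d10 H1]] := fdf _ _ (Uz1 s s01) hu.
  have [_ /(_ j _ e'') [d2 d20 H2]] := fdf _ _ (Uz0 s s01) hu.
  exists (Num.min d1 d2 / `|t|); first by rewrite divr_gt0 // lt_min d10.
  move=> r r01 rs; rewrite [X in _ /\ X <= _]fs_sn_distC; [|exact: cphi..].
  suff H : fs_sn j (phi r - phi s) <= (e / 2 + e') * `|r - s| by [].
  have [->|rns] := eqVneq r s; first by rewrite subrr fs_sn0 subrr normr0 mulr0.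
  have rs0 : r - s != 0 by rewrite subr_eq0.
  pose tau := (r - s) * t.
  have tau0 : tau != 0 by rewrite mulf_neq0.
  have taud : `|tau| < d1 /\ `|tau| < d2.
    by move: rs; rewrite ltr_pdivlMr // -normrM lt_min => /andP[].
  pose z1 := x + (s * t) *: u + t *: v; pose z0 := x + (s * t) *: u.
  have zr1 : z1 + tau *: u = x + (r * t) *: u + t *: v.
    by rewrite /z1 /tau; lincomb [:: x; u; v].
  have zr0 : z0 + tau *: u = x + (r * t) *: u.
    by rewrite /z0 /tau; lincomb [:: x; u].
  pose q1 := tau^-1 *: (f (z1 + tau *: u) - f z1).
  pose q0 := tau^-1 *: (f (z0 + tau *: u) - f z0).
  have cq1 : fs_car q1.
    by apply: fs_carZ; apply: fs_carB; apply: fF; [rewrite zr1; exact: Uz1 | exact: Uz1].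
  have cq0 : fs_car q0.
    by apply: fs_carZ; apply: fs_carB; apply: fF; [rewrite zr0; exact: Uz0 | exact: Uz0].
  have cl1 : fs_car (df (z1, u)) by apply: dfF; split => //; exact: Uz1.
  have cl0 : fs_car (df (z0, u)) by apply: dfF; split => //; exact: Uz0.
  have h1 : fs_sn j (q1 - df (z1, u)) < e' * `|t| / 2.
    by apply: H1; rewrite normr_gt0 tau0 /=; case: taud.
  have h0 : fs_sn j (q0 - df (z0, u)) < e' * `|t| / 2.
    by apply: H2; rewrite normr_gt0 tau0 /=; case: taud.
  have hs : fs_sn j (t^-1 *: (df (z1, u) - df (z0, u)) - B) < e / 2.
    have := Hd (z0, u) (v, 0) t.
    have -> : ((z0, u) : fs_prod E E) + t *: ((v, 0) : fs_prod E E) = (z1, u).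
      by apply: injective_projections; rewrite /= ?scaler0 ?addr0.
    rewrite subrr fs_sn0; apply => //; last by rewrite t0.
      by split => //; apply: (fopen_car oU); exact: Uz0.
    rewrite /= subrr fs_sn0 addr0.
    have -> : z0 - x = (s * t) *: u by rewrite /z0; lincomb [:: x; u].
    rewrite fr_snZ // normrM; case/andP: s01 => s0 s1; rewrite ger0_norm //.
    have : s * (`|t| * fs_sn m u) <= 1 * (`|t| * fs_sn m u) by rewrite ler_wpM2r // mulr_ge0.
    by nra.
  have -> : phi r - phi s = (r - s) *: (t^-1 *: (q1 - df (z1, u)) +
      (- t^-1) *: (q0 - df (z0, u)) + (t^-1 *: (df (z1, u) - df (z0, u)) - B)).
    rewrite /phi /q1 /q0 zr1 zr0 -/z1 -/z0 /tau.
    lincomb [:: f (x + (r * t) *: u + t *: v); f (x + (r * t) *: u); f z1; f z0; B;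
       df (z1, u); df (z0, u)]; field; by rewrite ?tn0 ?rs0.
  have c1 : fs_car (q1 - df (z1, u)) by exact: fs_carB.
  have c0 : fs_car (q0 - df (z0, u)) by exact: fs_carB.
  have c2 : fs_car (t^-1 *: (df (z1, u) - df (z0, u)) - B).
    by apply: fs_carB => //; apply: fs_carZ; exact: fs_carB.
  have c3 : fs_car (t^-1 *: (q1 - df (z1, u))) by exact: fs_carZ.
  have c4 : fs_car (- t^-1 *: (q0 - df (z0, u))) by exact: fs_carZ.
  rewrite fr_snZ; last by apply: fs_carD => //; apply: fs_carD.
  rewrite mulrC ler_wpM2r //.
  apply: le_trans (fr_snD _ (fs_carD c3 c4) c2) _.
  apply: le_trans (lerD (fr_snD _ c3 c4) (ltW hs)) _.
  rewrite !fr_snZ // normrN normfV.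
  have k1 : `|t|^-1 * fs_sn j (q1 - df (z1, u)) <= e' / 2.
    by rewrite mulrC ler_pdivrMr //; move: (ltW h1); rewrite mulrAC.
  have k2 : `|t|^-1 * fs_sn j (q0 - df (z0, u)) <= e' / 2.
    by rewrite mulrC ler_pdivrMr //; move: (ltW h0); rewrite mulrAC.
  by lra.
move=> u v Ux hu hv.
have hv0 : fs_car ((v, 0) : fs_prod E E) by split => //; exact: fs_car0.
have hu0 : fs_car ((u, 0) : fs_prod E E) by split => //; exact: fs_car0.
have c1 : fs_car (ddf ((x, u), (v, 0))) by have [] := dfddf (x, u) _ (conj Ux hu) hv0.
have c2 : fs_car (ddf ((x, v), (u, 0))) by have [] := dfddf (x, v) _ (conj Ux hv) hu0.
apply: (tends_unique _ c1 c2 (D2lim u v Ux hu hv)).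
  apply: filterS3 (near0_line oU Ux hu) (near0_line oU Ux hv)
     (near0_line oU Ux (fs_carD hu hv)) => t /= Uu Uv; rewrite scalerDr addrA => Uuv.
  by do 2 apply: fs_carZ; apply: fs_carB; apply: fs_carB; exact: fF.
have -> : (fun t => D2 t u v) = (fun t => D2 t v u); last exact: D2lim.
apply/funext => t; rewrite /D2.
have -> : x + t *: v + t *: u = x + t *: u + t *: v by rewrite addrAC.
by lincomb [:: f (x + t *: u + t *: v); f (x + t *: u); f (x + t *: v); f x].
Qed.

End Differential.

(** * Maps of class C^n *)

Section Smooth.
Context {R : realType}.
Implicit Types E F G : fspace R.

(** Neighbourhoods relative to [U]: they turn [fcont] into [tends], so that the limit rules give
    continuity. *)
Definition fnbhs E (U : set E) (x : E) : set_system E :=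
  [set P | exists m, exists2 d, 0 < d & forall y, U y -> fs_sn m (y - x) < d -> P y].

Lemma fnbhs_filter E {hE : is_frechet E} (U : set E) (x : E) :
  U `<=` @fs_car R E -> fs_car x -> Filter (fnbhs U x).
Proof.
move=> UE hx; split.
- by exists 0%N, 1.
- move=> P Q [m [d d0 H]] [m' [d' d0' H']].
  exists (maxn m m'), (Num.min d d'); first by rewrite lt_min d0.
  move=> y Uy; rewrite lt_min => /andP[h1 h2].
  have hyx : fs_car (y - x) by apply: fs_carB => //; exact: UE.
  split; [apply: H => //; apply: le_lt_trans h1 | apply: H' => //; apply: le_lt_trans h2];
    by apply: fs_sn_le => //; rewrite ?leq_maxl ?leq_maxr.
- by move=> P Q PQ [m [d d0 H]]; exists m, d => // y Uy /(H y Uy) /PQ.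
Qed.

Lemma fcontI E F {hE : is_frechet E} (U : set E) (f : E -> F) : fopen U ->
  (forall x, U x -> Filter (fnbhs U x) -> tends (fnbhs U x) f (f x)) -> fcont U f.
Proof.
move=> oU H x Ux; apply: H => //.
by apply: fnbhs_filter; [exact: oU.1 | exact: fopen_car Ux].
Qed.

Lemma fnbhs_in E (U : set E) (x : E) (P : set E) : U `<=` P -> fnbhs U x P.
Proof. by move=> UP; exists 0%N, 1 => // y Uy _; exact: UP. Qed.

Lemma tends_fnbhs E {hE : is_frechet E} (U : set E) (x : E) : tends (fnbhs U x) id x.
Proof. by move=> k e e0; exists k, e. Qed.

Lemma fcont_sub E F (U U' : set E) (f : E -> F) : U' `<=` U -> fcont U f -> fcont U' f.
Proof.
move=> sU cf x /sU Ux k e e0; have [m [d d0 H]] := cf x Ux k e e0.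
by exists m, d => // y /sU; exact: H.
Qed.

Lemma fcont_eq E F (U : set E) (f g : E -> F) :
  (forall x, U x -> f x = g x) -> fcont U f -> fcont U g.
Proof.
move=> fg cf x Ux k e e0; have [m [d d0 H]] := cf x Ux k e e0.
by exists m, d => // y Uy; rewrite -!fg //; exact: H.
Qed.

Lemma fcont_comp E F G (U : set E) (V : set F) (f : E -> F) (g : F -> G) :
  (forall x, U x -> V (f x)) -> fcont U f -> fcont V g -> fcont U (g \o f).
Proof.
move=> fV cf cg x Ux k e e0; have [m [d d0 H]] := cg _ (fV x Ux) k e e0.
have [m' [d' d0' H']] := cf x Ux m d d0.
by exists m', d' => // y Uy /(H' y Uy); apply: H; exact: fV.
Qed.

Lemma Cn_car n E F (U : set E) (f : E -> F) : Cn n U f -> forall x, U x -> fs_car (f x).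
Proof. by case: n => [|n] []. Qed.

Lemma Cn_cont n E F (U : set E) (f : E -> F) : Cn n U f -> fcont U f.
Proof. by case: n => [|n] []. Qed.

Lemma CnS n E F (U : set E) (f : E -> F) (df : fs_prod E E -> F) :
  (forall x, U x -> fs_car (f x)) -> fcont U f -> derives U f df ->
  Cn n (tangent U) df -> Cn n.+1 U f.
Proof. by move=> fF cf fdf Cdf; split=> //; exists df. Qed.

Lemma CnS_inv n E F (U : set E) (f : E -> F) : Cn n.+1 U f ->
  exists2 df, derives U f df & Cn n (tangent U) df.
Proof. by case=> _ _ [df fdf Cdf]; exists df. Qed.

Lemma Cn_le n E F (U : set E) (f : E -> F) : Cn n.+1 U f -> Cn n U f.
Proof.
elim: n E F U f => [|n IH] E F U f [fF cf [df fdf Cdf]]; first by split.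
by split=> //; exists df => //; exact: IH.
Qed.

Lemma Cn_sub n E F (U U' : set E) (f : E -> F) : U' `<=` U -> Cn n U f -> Cn n U' f.
Proof.
elim: n E F U U' f => [|n IH] E F U U' f sU.
  by case=> fF cf _; split=> // [x /sU|]; [exact: fF | exact: fcont_sub cf].
case=> fF cf [df fdf Cdf]; split=> [x /sU||]; [exact: fF | exact: fcont_sub cf|].
by exists df => [x h /sU|]; [exact: fdf | apply: IH Cdf => p [/sU]].
Qed.

Lemma Cn_eq n E F {hE : is_frechet E} (U : set E) (f g : E -> F) :
  fopen U -> (forall x, U x -> f x = g x) -> Cn n U f -> Cn n U g.
Proof.
move=> oU fg; have E' x : U x -> fs_car (f x) -> fs_car (g x) by move=> /fg ->.
case: n => [|n].
  by case=> fF cf _; split=> // [x Ux|]; [apply: E' => //; exact: fF | exact: fcont_eq cf].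
case=> fF cf [df fdf Cdf]; split=> [x Ux||]; [by apply: E' => //; exact: fF | exact: fcont_eq cf|].
by exists df => // x h Ux hh; apply: (is_dderiv_eq oU Ux hh fg); exact: fdf.
Qed.

Lemma Csmooth_eq E F {hE : is_frechet E} (U : set E) (f g : E -> F) :
  fopen U -> (forall x, U x -> f x = g x) -> Csmooth U f -> Csmooth U g.
Proof. by move=> oU fg Cf n; exact: Cn_eq fg (Cf n). Qed.

Lemma derives_eq E F {hE : is_frechet E} {hF : is_frechet F} (U : set E) (f : E -> F) df df' :
  fopen U -> (forall x, U x -> fs_car (f x)) -> derives U f df -> derives U f df' ->
  forall p, tangent U p -> df p = df' p.
Proof.
move=> oU fF fdf fdf' [x h] [/= Ux hh].
by apply: (is_dderiv_unique oU Ux hh fF); [exact: fdf | exact: fdf'].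
Qed.

(** Each order provides its own derivative map; by uniqueness of directional derivatives, the one
    chosen at order 1 serves for all orders. *)
Lemma Csmooth_derives E F {hE : is_frechet E} {hF : is_frechet F} (U : set E) (f : E -> F) :
  fopen U -> Csmooth U f -> exists2 df, derives U f df & Csmooth (tangent U) df.
Proof.
move=> oU Cf; have [df fdf _] := CnS_inv (Cf 1%N); exists df => // n.
have [df' fdf' Cdf'] := CnS_inv (Cf n.+1).
apply: Cn_eq Cdf'; first exact: fopen_tangent.
exact: derives_eq (Cn_car (Cf 0%N)) fdf' fdf.
Qed.

Record flin E F (T : E -> F) : Prop := {
  flin_car : forall x, fs_car x -> fs_car (T x);
  flin_lin : forall a x y, fs_car x -> fs_car y -> T (a *: x + y) = a *: T x + T y;
  flin_bound : forall k, exists m, exists2 C, 0 < C &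
    forall x, fs_car x -> fs_sn k (T x) <= C * fs_sn m x }.

Lemma flinB E F {hE : is_frechet E} {hF : is_frechet F} (T : E -> F) x y :
  flin T -> fs_car x -> fs_car y -> T (x - y) = T x - T y.
Proof. by move=> hT hx hy; rewrite addrC -scaleN1r (flin_lin hT) // scaleN1r addrC. Qed.

Lemma flin0 E F {hE : is_frechet E} {hF : is_frechet F} (T : E -> F) : flin T -> T 0 = 0.
Proof. by move=> hT; rewrite -(subrr (0 : E)) flinB ?subrr //; exact: fs_car0. Qed.

Lemma flinZ E F {hE : is_frechet E} {hF : is_frechet F} (T : E -> F) a x :
  flin T -> fs_car x -> T (a *: x) = a *: T x.
Proof.
move=> hT hx; rewrite -[a *: x]addr0 (flin_lin hT) ?(flin0 hT) ?addr0 //; exact: fs_car0.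
Qed.

Lemma flin_comp E F G {hE : is_frechet E} {hF : is_frechet F} {hG : is_frechet G}
  (T : E -> F) (S : F -> G) : flin T -> flin S -> flin (S \o T).
Proof.
move=> hT hS; split => /=.
- by move=> x hx; apply: (flin_car hS); exact: (flin_car hT).
- by move=> a x y hx hy; rewrite (flin_lin hT) // (flin_lin hS) //; exact: (flin_car hT).
- move=> k; have [m [C C0 HS]] := flin_bound hS k; have [m' [C' C0' HT]] := flin_bound hT m.
  exists m', (C * C'); first exact: mulr_gt0.
  move=> x hx; apply: le_trans (HS _ (flin_car hT hx)) _.
  by rewrite -mulrA ler_pM2l // HT.
Qed.

Lemma flin_id E : flin (id : E -> E).
Proof. by split=> // k; exists k, 1 => // x _; rewrite mul1r. Qed.

Lemma flin_fst E F {hE : is_frechet E} {hF : is_frechet F} : flin (fun p : fs_prod E F => p.1 : E).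
Proof.
split=> [x []//||k] //; exists k, 1 => // x [h1 h2].
by rewrite mul1r lerDl fs_sn_ge0.
Qed.

Lemma flin_snd E F {hE : is_frechet E} {hF : is_frechet F} : flin (fun p : fs_prod E F => p.2 : F).
Proof.
split=> [x []//||k] //; exists k, 1 => // x [h1 h2].
by rewrite mul1r lerDr fs_sn_ge0.
Qed.

Lemma flin_add E {hE : is_frechet E} : flin (fun p : fs_prod E E => p.1 + p.2 : E).
Proof.
split=> [x [h1 h2]|a x y _ _|k]; first exact: fs_carD.
  by rewrite /= scalerDr addrACA.
by exists k, 1 => // x [h1 h2]; rewrite mul1r; exact: fr_snD.
Qed.

Lemma flin_pair E F G {hE : is_frechet E} {hF : is_frechet F} {hG : is_frechet G}
  (T : E -> F) (S : E -> G) : flin T -> flin S -> flin (fun x => (T x, S x) : fs_prod F G).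
Proof.
move=> hT hS; split.
- by move=> x hx; split; [exact: (flin_car hT) | exact: (flin_car hS)].
- by move=> a x y hx hy; rewrite (flin_lin hT) // (flin_lin hS).
- move=> k; have [m [C C0 HS]] := flin_bound hS k; have [m' [C' C0' HT]] := flin_bound hT k.
  exists (maxn m m'), (C + C'); first exact: addr_gt0.
  move=> x hx /=; rewrite mulrDl addrC; apply: lerD.
    by apply: le_trans (HS x hx) _; rewrite ler_pM2l // fs_sn_le // leq_maxl.
  by apply: le_trans (HT x hx) _; rewrite ler_pM2l // fs_sn_le // leq_maxr.
Qed.

Lemma tends_flin I (B : set_system I) {fB : Filter B} E F {hE : is_frechet E}
  {hF : is_frechet F} (T : E -> F) (f : I -> E) l :
  flin T -> B [set i | fs_car (f i)] -> fs_car l -> tends B f l -> tends B (T \o f) (T l).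
Proof.
move=> hT cf hl; apply: tends_le => k; have [m [C C0 H]] := flin_bound hT k.
exists m, C => //; apply: filterS cf => i /= hi.
by rewrite -flinB // H //; exact: fs_carB.
Qed.

Lemma Cn_flin n E F {hE : is_frechet E} {hF : is_frechet F} (U : set E) (T : E -> F) :
  flin T -> fopen U -> Cn n U T.
Proof.
elim: n E F hE hF U T => [|n IH] E F hE hF U T hT oU.
  split=> // [x /(fopen_car oU)|]; first exact: (flin_car hT).
  apply: fcontI => // x Ux fU.
  apply: (@tends_flin _ (fnbhs U x) fU _ _ hE hF T id x hT) => //; last exact: tends_fnbhs.
    exact: fnbhs_in oU.1.
  exact: fopen_car Ux.
apply: (@CnS n _ _ _ _ (fun p => T p.2)).
- by move=> x /(fopen_car oU); exact: (flin_car hT).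
- exact: (Cn_cont (IH _ _ hE hF _ _ hT oU)).
- move=> x h Ux hh; apply/is_dderivP; split; first exact: (flin_car hT).
  apply: (tends_near (g := fun=> T h)); last exact: tends_cst.
  apply: filterS (near0_small ltr01) => t /= /andP[t0 _].
  have hx := fopen_car oU Ux.
  rewrite [x + _]addrC (flin_lin hT) // addrK scalerA mulVf ?scale1r //.
  by rewrite -normr_gt0.
- apply: IH; last exact: fopen_tangent.
  exact: flin_comp (@flin_snd _ _ _ _) hT.
Qed.

Lemma Cn_pair n E F G {hE : is_frechet E} {hF : is_frechet F} {hG : is_frechet G}
    (U : set E) (f : E -> F) (g : E -> G) :
  fopen U -> Cn n U f -> Cn n U g -> Cn n U (fun x => (f x, g x) : fs_prod F G).
Proof.
elim: n E F G hE hF hG U f g => [|n IH] E F G hE hF hG U f g oU Cf Cg.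
  split=> // [x Ux|]; first by split; [exact: (Cn_car Cf) | exact: (Cn_car Cg)].
  apply: fcontI => // x Ux fU.
  by apply: tends_pair; [exact: (Cn_cont Cf) | exact: (Cn_cont Cg)].
have [df fdf Cdf] := CnS_inv Cf; have [dg gdg Cdg] := CnS_inv Cg.
apply: (@CnS n _ _ _ _ (fun p => (df p, dg p) : fs_prod F G)).
- by move=> x Ux; split; [exact: (Cn_car Cf) | exact: (Cn_car Cg)].
- apply: fcontI => // x Ux fU.
  by apply: tends_pair; [exact: (Cn_cont Cf) | exact: (Cn_cont Cg)].
- move=> x h Ux hh; have /is_dderivP[hl fl] := fdf _ _ Ux hh.
  have /is_dderivP[hl' gl] := gdg _ _ Ux hh.
  by apply/is_dderivP; split => //; exact: tends_pair.
- by apply: IH => //; exact: fopen_tangent.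
Qed.

(** The derivative [dg (f x, df (x, h))] is itself a composite, of [dg] with a map into a product,
    whence an induction over all spaces at once. *)
Lemma Cn_comp n E F G {hE : is_frechet E} {hF : is_frechet F} {hG : is_frechet G}
    (U : set E) (V : set F) (f : E -> F) (g : F -> G) :
  fopen U -> fopen V -> (forall x, U x -> V (f x)) -> Cn n U f -> Cn n V g -> Cn n U (g \o f).
Proof.
elim: n E F G hE hF hG U V f g => [|n IH] E F G hE hF hG U V f g oU oV fV Cf Cg.
  split=> // [x Ux|]; first by apply: (Cn_car Cg); exact: fV.
  exact: fcont_comp (Cn_cont Cf) (Cn_cont Cg).
have [df fdf Cdf] := CnS_inv Cf; have [dg gdg Cdg] := CnS_inv Cg.
apply: (@CnS n _ _ _ _ (fun p => dg (f p.1, df p))).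
- by move=> x Ux; apply: (Cn_car Cg); exact: fV.
- exact: fcont_comp (Cn_cont Cf) (Cn_cont Cg).
- exact: (derives_comp oU oV fV (Cn_car Cg) fdf gdg (Cn_cont Cdg)).
- apply: (IH (fs_prod E E) (fs_prod F F) G _ _ _ (tangent U) (tangent V) (fun p => (f p.1, df p) : fs_prod F F) dg) => //.
  + exact: fopen_tangent.
  + exact: fopen_tangent.
  + by move=> [x h] [/= Ux hh]; split; [exact: fV | have [] := fdf _ _ Ux hh].
  + apply: Cn_pair => //; first exact: fopen_tangent.
    apply: (IH (fs_prod E E) E F _ _ _ (tangent U) U (fun p : fs_prod E E => p.1 : E) f) => //.
    * exact: fopen_tangent.
    * by move=> p [].
    * by apply: Cn_flin; [exact: flin_fst | exact: fopen_tangent].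
    * exact: Cn_le.
Qed.

Lemma Csmooth_comp E F G {hE : is_frechet E} {hF : is_frechet F} {hG : is_frechet G}
    (U : set E) (V : set F) (f : E -> F) (g : F -> G) :
  fopen U -> fopen V -> (forall x, U x -> V (f x)) -> Csmooth U f -> Csmooth V g ->
  Csmooth U (g \o f).
Proof. by move=> oU oV fV Cf Cg n; exact: (Cn_comp oU oV fV (Cf n) (Cg n)). Qed.

Lemma Csmooth_flin E F {hE : is_frechet E} {hF : is_frechet F} (U : set E) (T : E -> F) :
  flin T -> fopen U -> Csmooth U T.
Proof. by move=> hT oU n; exact: Cn_flin. Qed.

Lemma Csmooth_pair E F G {hE : is_frechet E} {hF : is_frechet F} {hG : is_frechet G}
    (U : set E) (f : E -> F) (g : E -> G) :
  fopen U -> Csmooth U f -> Csmooth U g -> Csmooth U (fun x => (f x, g x) : fs_prod F G).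
Proof. by move=> oU Cf Cg n; exact: Cn_pair. Qed.

Lemma CnD n E F {hE : is_frechet E} {hF : is_frechet F} (U : set E) (f g : E -> F) :
  fopen U -> Cn n U f -> Cn n U g -> Cn n U (fun x => f x + g x).
Proof.
move=> oU Cf Cg; have oF : fopen (@fs_car R (fs_prod F F)) by exact: fopen_fs_car.
apply: (@Cn_comp n E (fs_prod F F) F _ _ _ U _ (fun x => (f x, g x)) (fun p => p.1 + p.2) oU oF).
- by move=> x Ux; split; [exact: (Cn_car Cf) | exact: (Cn_car Cg)].
- exact: Cn_pair.
- by apply: Cn_flin => //; exact: flin_add.
Qed.

Lemma Cn_cst n E F {hE : is_frechet E} {hF : is_frechet F} (U : set E) (c : F) :
  fopen U -> fs_car c -> Cn n U (fun=> c).
Proof.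
move=> + hc; elim: n E hE U => [|n IH] E hE U oU.
  split=> //; apply: fcontI => // x Ux fU.
  exact: tends_cst.
apply: (@CnS n _ _ _ _ (fun=> 0)) => //.
- exact: (Cn_cont (IH _ _ _ oU)).
- move=> x h Ux hh; apply/is_dderivP; split; first exact: fs_car0.
  apply: (tends_near (g := fun=> 0)); last exact: tends_cst.
  by apply: nearW => t _ /=; rewrite subrr scaler0.
- apply: Cn_flin; last exact: fopen_tangent.
  split=> [*|*|k]; [exact: fs_car0 | by rewrite scaler0 addr0|].
  by exists k, 1 => // x hx; rewrite fs_sn0 mul1r fs_sn_ge0.
Qed.

Lemma Cn_bilin n E F G H {hE : is_frechet E} {hF : is_frechet F} {hG : is_frechet G}
    {hH : is_frechet H} (U : set E) (b : F -> G -> H) (f : E -> F) (g : E -> G) :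
  bilin b -> fopen U -> Cn n U f -> Cn n U g -> Cn n U (fun x => b (f x) (g x)).
Proof.
move=> hb; elim: n E hE U f g => [|n IH] E hE U f g oU Cf Cg.
  split=> // [x Ux|].
    by apply: (bilin_car hb); [exact: (Cn_car Cf) | exact: (Cn_car Cg)].
  apply: fcontI => // x Ux fU.
  apply: tends_bilin => //.
  + by apply: fnbhs_in => y; exact: (Cn_car Cf).
  + by apply: fnbhs_in => y; exact: (Cn_car Cg).
  + exact: (Cn_car Cf).
  + exact: (Cn_car Cg).
  + exact: (Cn_cont Cf).
  + exact: (Cn_cont Cg).
have [df fdf Cdf] := CnS_inv Cf; have [dg gdg Cdg] := CnS_inv Cg.
have fF := Cn_car Cf; have gG := Cn_car Cg.
have oTU : fopen (tangent U) by exact: fopen_tangent.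
apply: (@CnS n _ _ _ _ (fun p => b (df p) (g p.1) + b (f p.1) (dg p))).
- by move=> x Ux; apply: (bilin_car hb); [exact: fF | exact: gG].
- exact: (Cn_cont (IH _ _ _ _ _ oU (Cn_le Cf) (Cn_le Cg))).
- move=> x h Ux hh; have /is_dderivP[hl fl] := fdf _ _ Ux hh.
  have /is_dderivP[hl' gl] := gdg _ _ Ux hh.
  have c1 : (0 : R)^' [set t | U (x + t *: h)] by exact: near0_line.
  have hx := fopen_car oU Ux.
  apply/is_dderivP; split.
    by apply: fs_carD; apply: (bilin_car hb) => //; [exact: gG | exact: fF].
  apply: (tends_near (g := fun t => b (t^-1 *: (f (x + t *: h) - f x)) (g (x + t *: h)) +
      b (f x) (t^-1 *: (g (x + t *: h) - g x)))).
    apply: filterS c1 => t /= Ut.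
    have [[[h1 h2] h3] h4] := (fF _ Ut, fF _ Ux, gG _ Ut, gG _ Ux).
    rewrite (bilinZl hb) ?(bilinZr hb) ?(bilinBl hb) ?(bilinBr hb) //; try exact: fs_carB.
    by lincomb [:: b (f (x + t *: h)) (g (x + t *: h)); b (f x) (g x); b (f x) (g (x + t *: h))].
  have q1 : (0 : R)^' [set t | fs_car (t^-1 *: (f (x + t *: h) - f x))] by exact: near0_quot fF.
  have q2 : (0 : R)^' [set t | fs_car (t^-1 *: (g (x + t *: h) - g x))] by exact: near0_quot gG.
  have q3 : (0 : R)^' [set t | fs_car (g (x + t *: h))] by apply: filterS c1 => t; exact: gG.
  have hfx := fF _ Ux; have hgx := gG _ Ux.
  apply: tendsD.
  + by apply: filterS2 q1 q3 => t; exact: (bilin_car hb).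
  + by apply: filterS q2 => t /=; exact: (bilin_car hb).
  + exact: (bilin_car hb).
  + exact: (bilin_car hb).
  + apply: tends_bilin => //.
    apply: (@tends_fcont _ _ _ _ _ _ U g (fun t => x + t *: h)) => //.
      exact: (Cn_cont Cg).
    exact: tends_line.
  + by apply: tends_bilin => //; [exact: nearW | exact: tends_cst].
- have C1 : Cn n (tangent U) (fun p => f p.1).
    apply: (@Cn_comp n _ _ _ _ _ _ (tangent U) U (fun p : fs_prod E E => p.1 : E) f) => //.
    * by move=> p [].
    * by apply: Cn_flin => //; exact: flin_fst.
    * exact: Cn_le.
  have C2 : Cn n (tangent U) (fun p => g p.1).
    apply: (@Cn_comp n _ _ _ _ _ _ (tangent U) U (fun p : fs_prod E E => p.1 : E) g) => //.
    * by move=> p [].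
    * by apply: Cn_flin => //; exact: flin_fst.
    * exact: Cn_le.
  by apply: CnD => //; exact: IH.
Qed.

Lemma Csmooth_bilin E F G H {hE : is_frechet E} {hF : is_frechet F} {hG : is_frechet G}
    {hH : is_frechet H} (U : set E) (b : F -> G -> H) (f : E -> F) (g : E -> G) :
  bilin b -> fopen U -> Csmooth U f -> Csmooth U g -> Csmooth U (fun x => b (f x) (g x)).
Proof. by move=> hb oU Cf Cg n; exact: Cn_bilin. Qed.

Lemma Csmooth_cst E F {hE : is_frechet E} {hF : is_frechet F} (U : set E) (c : F) :
  fopen U -> fs_car c -> Csmooth U (fun=> c).
Proof. by move=> oU hc n; exact: Cn_cst. Qed.

Lemma Csmooth_sub E F (U U' : set E) (f : E -> F) : U' `<=` U -> Csmooth U f -> Csmooth U' f.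
Proof. by move=> sU Cf n; exact: Cn_sub (Cf n). Qed.

(** A complete subspace is closed. A sequence is extracted whose [n]-th term is [1 / (n + 1)]-close
    to [l] in the [n]-th seminorm; since the seminorms increase it is Cauchy for each of them, and
    its limit in [c'] must be [l]. *)
Lemma frechet_closed (A : lmodType R) (c c' : set A) (sn : nat -> A -> R) I (B : set_system I)
    {pB : ProperFilter B} (f : I -> A) (l : A) :
  is_frechet (Fspace c sn) -> is_frechet (Fspace c' sn) -> c' `<=` c ->
  B [set i | c' (f i)] -> c l -> tends (E := Fspace c sn) B f l -> c' l.
Proof.
move=> hE hE' c'c cf cl fl.
have ex n : exists y, c' y /\ sn n (y - l) < n.+1%:R^-1.
  have [|i [/= h1 h2]] := @filter_ex _ _ pB ([set i | c' (f i)] `&` [set i | sn n (f i - l) < n.+1%:R^-1]).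
    by apply: filterI => //; apply: (fl n); rewrite invr_gt0.
  by exists (f i).
have [u hu] := choice ex.
have uC n : c (u n) by apply: c'c; have [] := hu n.
have ul k e : 0 < e -> exists N, forall n, (N <= n)%N -> sn k (u n - l) < e.
  move=> e0; have [N _ HN] := near_infty_natSinv_lt (PosNum e0).
  exists (maxn k N) => n; rewrite geq_max => /andP[kn nn].
  apply: le_lt_trans (_ : _ <= sn n (u n - l)) _.
    by apply: (@fs_sn_le _ (Fspace c sn)) => //; apply: (@fs_carB _ (Fspace c sn)).
  exact: lt_trans (hu n).2 (HN n nn).
have [|x hx ux] := @fr_complete _ _ hE' u (fun n => (hu n).1).
  move=> k e e0; have [N HN] := ul k (e / 2) (divr_gt0 e0 (ltr0Sn _ _)).
  exists N => m n mN nN; apply: le_lt_trans (@fs_sn_dist _ (Fspace c sn) _ k l _ _ _ _ _) _ => //.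
  rewrite [e]splitr ltrD //; first exact: HN.
  by rewrite (@fs_sn_distC _ (Fspace c sn)) //; exact: HN.
suff -> : l = x by [].
have cx := c'c _ hx.
apply/eqP; rewrite -subr_eq0; apply/eqP; apply: (@fr_sep _ (Fspace c sn)) => [|k].
  exact: (@fs_carB _ (Fspace c sn)).
apply/eqP; rewrite eq_le (@fs_sn_ge0 _ (Fspace c sn)) ?andbT; last exact: (@fs_carB _ (Fspace c sn)).
apply/ler_addgt0Pl => e e0; rewrite addr0.
have [N HN] := ul k (e / 2) (divr_gt0 e0 (ltr0Sn _ _)).
have [M HM] := ux k (e / 2) (divr_gt0 e0 (ltr0Sn _ _)).
apply: le_trans (@fs_sn_dist _ (Fspace c sn) _ k (u (maxn N M)) _ _ _ _ _) _ => //.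
rewrite ltW // [e]splitr ltrD //; last by apply: HM; rewrite leq_maxr.
by rewrite (@fs_sn_distC _ (Fspace c sn)) //; apply: HN; rewrite leq_maxl.
Qed.

(** The derivatives along the smaller space are limits of difference quotients with values in [cB'],
    which is closed. This reduces smoothness for loops and antiloops to smoothness for paths. *)
Lemma Cn_restrict n (A B : lmodType R) (cA cA' : set A) (sA : nat -> A -> R)
    (cB cB' : set B) (sB : nat -> B -> R) (U U' : set A) (f : A -> B) :
  is_frechet (Fspace cA sA) -> is_frechet (Fspace cA' sA) -> cA' `<=` cA ->
  is_frechet (Fspace cB sB) -> is_frechet (Fspace cB' sB) -> cB' `<=` cB ->
  U' `<=` U -> fopen (E := Fspace cA' sA) U' -> (forall x, U' x -> cB' (f x)) ->
  Cn (E := Fspace cA sA) (F := Fspace cB sB) n U f ->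
  Cn (E := Fspace cA' sA) (F := Fspace cB' sB) n U' f.
Proof.
move=> + + + hB hB' sBB'.
elim: n A cA cA' sA U U' f => [|n IH] A cA cA' sA U U' f hA hA' sAA' sU oU' fB'.
  case=> fF cf _; split=> // x Ux k e e0.
  have [m [d d0 H]] := cf x (sU _ Ux) k e e0.
  by exists m, d => // y Uy; apply: H; exact: sU.
case=> fF cf [df fdf Cdf].
have dfB' x h : U' x -> cA' h -> cB' (df (x, h)).
  move=> Ux hh; have /is_dderivP[hl fl] := fdf _ _ (sU _ Ux) (sAA' _ hh).
  apply: (frechet_closed hB hB' sBB' _ hl fl).
  apply: filterS (near0_line oU' Ux hh) => t /= Ut.
  apply: (@fs_carZ _ (Fspace cB' sB)); apply: (@fs_carB _ (Fspace cB' sB)); exact: fB'.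
split=> // [x Ux k e e0|].
  have [m [d d0 H]] := cf x (sU _ Ux) k e e0.
  by exists m, d => // y Uy; apply: H; exact: sU.
exists df => [x h Ux hh|].
  by split; [exact: dfB' | have [] := fdf _ _ (sU _ Ux) (sAA' _ hh)].
apply: (IH (A * A)%type _ [set p | cA' p.1 /\ cA' p.2] (fun k p => sA k p.1 + sA k p.2) _ _ _ _ _ _ _ _ _ Cdf).
- exact: (@frechet_prod _ (Fspace cA sA) (Fspace cA sA)).
- exact: (@frechet_prod _ (Fspace cA' sA) (Fspace cA' sA)).
- by move=> p [/= /sAA' ? /sAA' ?].
- by move=> p [/= /sU ? /sAA' ?].
- exact: (@fopen_tangent _ (Fspace cA' sA)).
- by move=> [x h] [/= Ux hh]; exact: dfB'.
Qed.

End Smooth.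

(** * Disjoint sums of manifolds *)

Section Manifolds.
Context {R : realType}.
Implicit Types (E F : fspace R) (M N : premfd R).

Lemma fopen_local E (U : set E) :
  (forall x, U x -> exists2 V, fopen V /\ V x & V `<=` U) -> fopen U.
Proof.
move=> H; split=> [x /H [V [oV Vx] _]|x /H [V [oV Vx] VU]]; first exact: fopen_car Vx.
have [k [e e0 He]] := oV.2 x Vx.
by exists k, e => // y hy /(He y hy) /VU.
Qed.

Lemma fopen0 E : fopen (set0 : set E).
Proof. by split. Qed.

Lemma Csmooth0 E F {hE : is_frechet E} {hF : is_frechet F} (U : set E) (f : E -> F) :
  U = set0 -> Csmooth U f.
Proof.
move=> ->; apply: (Csmooth_eq (f := fun=> 0)) => //; first exact: fopen0.
by apply: Csmooth_cst; [exact: fopen0 | exact: fs_car0].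
Qed.

Lemma map_imageI M (i : mf_idx M) (W W' : set (mf_pt M)) : is_mfd M ->
  mf_map i @` (W `&` W' `&` mf_dom i) =
  (mf_map i @` (W `&` mf_dom i)) `&` (mf_map i @` (W' `&` mf_dom i)).
Proof.
move=> hM; apply/seteqP; split.
  by move=> _ [p [[Wp W'p] ip] <-]; split; exists p.
move=> _ [[p [Wp ip] <-] [q [Wq iq] qp]]; exists p => //; split=> //; split=> //.
by rewrite -(mfd_inj hM iq ip qp).
Qed.

Lemma mopenI M (W W' : set (mf_pt M)) : is_mfd M -> mopen W -> mopen W' -> mopen (W `&` W').
Proof.
move=> hM [sW oW] [sW' oW']; split=> [p [/sW]//|i].
by rewrite map_imageI //; have := mfd_mod hM i => ?; exact: fopenI.
Qed.

Lemma mopen_image M (i : mf_idx M) (W : set (mf_pt M)) :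
  mopen W -> W `<=` mf_dom i -> fopen (mf_map i @` W).
Proof. by move=> [_ oW] sW; rewrite -(setIidl sW). Qed.

Lemma mfd_image M (i : mf_idx M) p : is_mfd M -> mf_dom i p -> fs_car (mf_map i p).
Proof.
move=> hM ip; apply: (fopen_car (mfd_open hM i i)); by exists p.
Qed.

Lemma mopen_restr M (W W' : set (mf_pt M)) : mopen W' -> W' `<=` W ->
  mopen (M := mrestr W) W'.
Proof.
move=> [sW' oW'] sWW'; split=> [p Wp|i /=]; first by split; [exact: sW' | exact: sWW'].
have := oW' i; rewrite (_ : W' `&` _ = W' `&` (@mf_dom R M i `&` W)) //.
by apply/seteqP; split=> p [W'p]; [move=> ip; split=> //; split=> //; exact: sWW' | case].
Qed.

Lemma msmooth_restr M N (f : mf_pt M -> mf_pt N) (W : set (mf_pt M)) (V : set (mf_pt N)) :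
  is_mfd M -> msmooth f -> mopen W -> (forall x, W x -> V (f x)) ->
  msmooth (M := mrestr W) (N := mrestr V) f.
Proof.
move=> hM [fN sf] oW fV; split=> [p [Mp Wp]|i j p [ip Wp] [jp Vp]].
  by split; [exact: fN | exact: fV].
have [W' [oW' W'p sW' fW'] [F CF Ff]] := sf i j p ip jp.
exists (W' `&` W); last first.
  exists F; last by move=> x [/Ff].
  by apply: Csmooth_sub CF => _ [x [W'x _] <-]; exists x.
split=> //.
- by apply: mopen_restr; [exact: mopenI | move=> ? []].
- by move=> x [/sW'].
- by move=> _ [x [W'x Wx] <-]; split; [apply: fW'; exists x | exact: fV].
Qed.

(** [mderiv] leaves the neighbourhood and the local representative free. Two representatives agree
    on a common neighbourhood, so the differential may be computed from a preferred one. *)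
Lemma mderiv_unique M N (f : mf_pt M -> mf_pt N) (i : mf_idx M) (j : mf_idx N) p W
    (F : mf_mod i -> mf_mod j) (u : mf_mod i) (v l : mf_mod j) :
  is_mfd M -> is_mfd N -> mopen W -> W p -> W `<=` mf_dom i -> f @` W `<=` mf_dom j ->
  (forall x, W x -> F (mf_map i x) = mf_map j (f x)) ->
  is_dderiv F (mf_map i p) u l -> mderiv f p u v -> v = l.
Proof.
move=> hM hN oW Wp sW fW Ff dF [W' [oW' W'p sW' fW'] [F' F'f [hu dF']]].
have hi := mfd_mod hM i; have hj := mfd_mod hN j.
have oWW : fopen (mf_map i @` (W `&` W')).
  by apply: mopen_image; [exact: mopenI | move=> ? [/sW]].
have pWW : (mf_map i @` (W `&` W')) (mf_map i p) by exists p.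
have dF2 : is_dderiv F (mf_map i p) u v.
  apply: (is_dderiv_eq oWW pWW hu _ dF') => _ [x [Wx W'x] <-].
  by rewrite F'f // Ff.
apply: (is_dderiv_unique oWW pWW hu _ dF2 dF) => _ [x [Wx W'x] <-].
by rewrite Ff //; apply: mfd_image => //; apply: fW; exists x.
Qed.

Section OpenSubset.
Context (E : fspace R) (U : set E) {hE : is_frechet E} (oU : fopen U).

Lemma fs_mopenP (W : set E) : mopen (M := fs_mfd U) W <-> W `<=` U /\ fopen W.
Proof.
by split=> -[sW oW]; split=> //; [have := oW tt | move=> []];
  rewrite /= image_id (setIidl sW).
Qed.

Lemma fs_is_mfd : is_mfd (fs_mfd U).
Proof.
split.
- by move=> [].
- by move=> [].
- by move=> p Up; exists tt.
- by move=> [].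
- by move=> [] [] /=; rewrite image_id setIid.
- move=> [] []; exists id => //=; rewrite image_id setIid.
  by apply: Csmooth_flin => //; exact: flin_id.
- move=> p q Up Uq pq; have hp := fopen_car oU Up; have hq := fopen_car oU Uq.
  have hpq : fs_car (p - q) by exact: fs_carB.
  have [k kpq] : exists k, fs_sn k (p - q) <> 0.
    apply: contrapT => /forallNP H; apply: pq; apply/eqP; rewrite -subr_eq0; apply/eqP.
    by apply: fr_sep => // k; apply: contrapT.
  pose e := fs_sn k (p - q) / 2.
  have e0 : 0 < e by rewrite divr_gt0 // lt_neqAle fs_sn_ge0 // andbT eq_sym; apply/eqP.
  have oB (c : E) : fs_car c -> fopen [set y | fs_car y /\ fs_sn k (y - c) < e].
    move=> hc; split=> [y []//|y [hy yxe]]; exists k, (e - fs_sn k (y - c)).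
      by rewrite subr_gt0.
    move=> z hz; rewrite ltrBrDr => H; split=> //.
    exact: le_lt_trans (fs_sn_dist k hz hy hc) H.
  exists (U `&` [set y | fs_car y /\ fs_sn k (y - p) < e]).
  exists (U `&` [set y | fs_car y /\ fs_sn k (y - q) < e]).
  split.
  + by apply/fs_mopenP; split=> [? []//|]; apply: fopenI => //; exact: oB.
  + by apply/fs_mopenP; split=> [? []//|]; apply: fopenI => //; exact: oB.
  + by split=> //; split=> //; rewrite subrr fs_sn0.
  + by split=> //; split=> //; rewrite subrr fs_sn0.
  + apply/seteqP; split=> // z [[_ [hz h1]] [_ [_ h2]]].
    have := fs_sn_dist k hp hz hq => /(_ hE); rewrite (fs_sn_distC k hp hz) => h3.
    have : fs_sn k (p - q) = e + e by rewrite /e -splitr.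
    by move: h1 h2 h3; rewrite /=; lra.
Qed.

End OpenSubset.

Section Sum.
Context (M N : premfd R).

Lemma mopen_inl (W : set (mf_pt M)) : mopen W -> mopen (M := sum_mfd M N) (inl @` W).
Proof.
move=> [sW oW]; split=> [_ [p Wp <-]|[i|j]] /=; first exact: sW.
  rewrite (_ : _ @` _ = mf_map i @` (W `&` mf_dom i)) //.
  apply/seteqP; split=> [_ [_ [[p Wp <-] ip] <-]|_ [p [Wp ip] <-]]; first by exists p.
  by exists (inl p) => //; split=> //; exists p.
rewrite (_ : _ @` _ = set0); first exact: fopen0.
by apply/seteqP; split=> // y [_ [[p Wp <-] ip] _]; case: ip.
Qed.

Lemma mopen_inr (W : set (mf_pt N)) : mopen W -> mopen (M := sum_mfd M N) (inr @` W).
Proof.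
move=> [sW oW]; split=> [_ [p Wp <-]|[i|j]] /=; first exact: sW.
  rewrite (_ : _ @` _ = set0); first exact: fopen0.
  by apply/seteqP; split=> // y [_ [[p Wp <-] ip] _]; case: ip.
rewrite (_ : _ @` _ = mf_map j @` (W `&` mf_dom j)) //.
apply/seteqP; split=> [_ [_ [[p Wp <-] ip] <-]|_ [p [Wp ip] <-]]; first by exists p.
by exists (inr p) => //; split=> //; exists p.
Qed.

Lemma mopen_inlV (W : set (mf_pt M + mf_pt N)) :
  mopen (M := sum_mfd M N) W -> mopen (inl @^-1` W).
Proof.
move=> [sW oW]; split=> [p /sW //|i]; have := oW (inl i) => /=.
rewrite (_ : _ @` _ = mf_map i @` (inl @^-1` W `&` mf_dom i)) //.
apply/seteqP; split=> [_ [[p|q] [Wp //= ip] <-]|_ [p [Wp ip] <-]]; first by exists p.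
by exists (inl p).
Qed.

Lemma mopen_inrV (W : set (mf_pt M + mf_pt N)) :
  mopen (M := sum_mfd M N) W -> mopen (inr @^-1` W).
Proof.
move=> [sW oW]; split=> [p /sW //|i]; have := oW (inr i) => /=.
rewrite (_ : _ @` _ = mf_map i @` (inr @^-1` W `&` mf_dom i)) //.
apply/seteqP; split=> [_ [[p|q] [Wp //= ip] <-]|_ [p [Wp ip] <-]]; first by exists q.
by exists (inr p).
Qed.

Lemma sum_is_mfd : is_mfd M -> is_mfd N -> is_mfd (sum_mfd M N).
Proof.
move=> hM hN; have oM : mopen (M := sum_mfd M N) (inl @` mf_pts M).
  apply: mopen_inl; split=> // i; rewrite setIidr; last exact: mfd_sub.
  by rewrite -[mf_dom i]setIid; exact: mfd_open.
have oN : mopen (M := sum_mfd M N) (inr @` mf_pts N).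
  apply: mopen_inr; split=> // i; rewrite setIidr; last exact: mfd_sub.
  by rewrite -[mf_dom i]setIid; exact: mfd_open.
split.
- by move=> [i|j]; [exact: (mfd_mod hM) | exact: (mfd_mod hN)].
- by move=> [i|j] [p|q] //=; [exact: (mfd_sub hM) | exact: (mfd_sub hN)].
- move=> [p|q] /= pq; first by have [i ip] := mfd_cover hM pq; exists (inl i).
  by have [j jq] := mfd_cover hN pq; exists (inr j).
- move=> [i|j] [p|p] [q|q] //= ip iq pq.
    by congr inl; exact: (mfd_inj hM ip iq pq).
  by congr inr; exact: (mfd_inj hN ip iq pq).
- have e1 (i i' : mf_idx M) : (mf_map (inl i : mf_idx (sum_mfd M N)) @`
      (mf_dom (inl i : mf_idx (sum_mfd M N)) `&` mf_dom (inl i' : mf_idx (sum_mfd M N)))) =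
      mf_map i @` (mf_dom i `&` mf_dom i').
    apply/seteqP; split=> [_ [[p|q] [//= ip ip'] <-]|_ [p [ip ip'] <-]]; first by exists p.
    by exists (inl p).
  have e2 (i i' : mf_idx N) : (mf_map (inr i : mf_idx (sum_mfd M N)) @`
      (mf_dom (inr i : mf_idx (sum_mfd M N)) `&` mf_dom (inr i' : mf_idx (sum_mfd M N)))) =
      mf_map i @` (mf_dom i `&` mf_dom i').
    apply/seteqP; split=> [_ [[p|q] [//= ip ip'] <-]|_ [p [ip ip'] <-]]; first by exists q.
    by exists (inr p).
  move=> [i|i] [j|j].
  + by rewrite e1; exact: (mfd_open hM i j).
  + rewrite (_ : _ @` _ = set0); first exact: fopen0.
    by apply/seteqP; split=> // y [[p|p] [/= ip /= jp] _].
  + rewrite (_ : _ @` _ = set0); first exact: fopen0.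
    by apply/seteqP; split=> // y [[p|p] [/= ip /= jp] _].
  + by rewrite e2; exact: (mfd_open hN i j).
- move=> [i|i] [j|j].
  + have [tau Ctau Htau] := mfd_trans hM i j; exists tau; last by move=> [p|q] //=; exact: Htau.
    by apply: Csmooth_sub Ctau => _ [[p|q] [//= ip jp] <-]; exists p.
  (* Charts of different summands do not meet: any map will do. *)
  + exists (fun=> 0); last by move=> [p|p].
    have := mfd_mod hM i; have := mfd_mod hN j => ? ?.
    by apply: Csmooth0; apply/seteqP; split=> // y [[p|p] [/= ip /= jp] _].
  + exists (fun=> 0); last by move=> [p|p].
    have := mfd_mod hN i; have := mfd_mod hM j => ? ?.
    by apply: Csmooth0; apply/seteqP; split=> // y [[p|p] [/= ip /= jp] _].
  + have [tau Ctau Htau] := mfd_trans hN i j; exists tau; last by move=> [p|q] //=; exact: Htau.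
    by apply: Csmooth_sub Ctau => _ [[p|q] [//= ip jp] <-]; exists q.
- move=> [p|p] [q|q] /= hp hq pq.
  + have [|W [W' [oW oW' Wp W'q WW']]] := mfd_hausdorff hM hp hq; first by move=> e; apply: pq; rewrite e.
    exists (inl @` W), (inl @` W'); split; try exact: mopen_inl; try by [exists p | exists q].
    apply/seteqP; split=> // _ [[x Wx <-] [y Wy [yx]]].
    by have : (W `&` W') x; [split; rewrite // -yx | rewrite WW'].
  + exists (inl @` mf_pts M), (inr @` mf_pts N); split=> //; try by [exists p | exists q].
    by apply/seteqP; split=> // _ [[x _ <-] [y _]].
  + exists (inr @` mf_pts N), (inl @` mf_pts M); split=> //; try by [exists p | exists q].
    by apply/seteqP; split=> // _ [[x _ <-] [y _]].
  + have [|W [W' [oW oW' Wp W'q WW']]] := mfd_hausdorff hN hp hq; first by move=> e; apply: pq; rewrite e.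
    exists (inr @` W), (inr @` W'); split; try exact: mopen_inr; try by [exists p | exists q].
    apply/seteqP; split=> // _ [[x Wx <-] [y Wy [yx]]].
    by have : (W `&` W') x; [split; rewrite // -yx | rewrite WW'].
Qed.

Context (Q : premfd R) (f : mf_pt M -> mf_pt Q) (g : mf_pt N -> mf_pt Q).

Definition sum_fun (s : mf_pt M + mf_pt N) : mf_pt Q :=
  match s with inl x => f x | inr x => g x end.

Lemma msmooth_sum : msmooth f -> msmooth g -> msmooth (M := sum_mfd M N) sum_fun.
Proof.
move=> [fQ sf] [gQ sg]; split=> [[p|p] /=|[i|i] j [p|p] //= ip jp]; [exact: fQ | exact: gQ|..].
  have [W [oW Wp sW fW] [F CF Ff]] := sf i j p ip jp.
  exists (inl @` W).
    split; [exact: mopen_inl | by exists p | by move=> _ [x /sW ? <-]|].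
    by move=> _ [_ [x Wx <-] <-] /=; apply: fW; exists x.
  exists F => [|_ [x Wx <-]]; last exact: Ff.
  by apply: Csmooth_sub CF => _ [_ [x Wx <-] <-]; exists x.
have [W [oW Wp sW fW] [F CF Ff]] := sg i j p ip jp.
exists (inr @` W).
  split; [exact: mopen_inr | by exists p | by move=> _ [x /sW ? <-]|].
  by move=> _ [_ [x Wx <-] <-] /=; apply: fW; exists x.
exists F => [|_ [x Wx <-]]; last exact: Ff.
by apply: Csmooth_sub CF => _ [_ [x Wx <-] <-]; exists x.
Qed.

Lemma diffeo_inl (W : set (mf_pt M)) (V : set (mf_pt Q)) :
  diffeo W V f -> diffeo (M := sum_mfd M N) (inl @` W) V sum_fun.
Proof.
move=> [[fV sf] [h [hW sh] [hf fh]]]; split.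
  split=> [s [Ms [p Wp ps]]|i j s [ip [p Wp ps]] jp].
    by move: Ms; rewrite -ps => Mp; exact: fV (conj Mp Wp).
  move: ip jp; rewrite -ps => {s ps} ip jp.
  case: i ip => [i|//] ip.
  have [W' [oW' W'p sW' fW'] [F CF Ff]] := sf i j p (conj ip Wp) jp.
  exists (inl @` W').
    split; [|by exists p|by move=> _ [x /sW' [? ?] <-]; split => //; exists x|].
      split=> [_ [x W'x <-]|].
        by have [? ?] := oW'.1 _ W'x; split=> //; exists x.
      move=> [k|k] /=.
        have := oW'.2 k; rewrite (_ : [set _ | _ in _] = mf_map k @` (W' `&` (mf_dom k `&` W))) //.
        apply/seteqP; split.
          by move=> _ [_ [[x W'x <-] [kx [y Wy [yx]]]] <-]; rewrite yx in Wy; exists x.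
        by move=> _ [x [W'x [kx Wx]] <-]; exists (inl x) => //; split; [exists x|split=> //; exists x].
      rewrite (_ : [set _ | _ in _] = set0); first exact: fopen0.
      by apply/seteqP; split=> // y [_ [[x W'x <-] [kx _]] _]; case: kx.
    by move=> _ [_ [x W'x <-] <-] /=; apply: fW'; exists x.
  exists F => [|_ [x W'x <-]]; last exact: Ff.
  by apply: Csmooth_sub CF => _ [_ [x W'x <-] <-]; exists x.
exists (inl \o h); last first.
  by split=> [_ [x Wx <-]|y Vy] /=; [rewrite hf | exact: fh].
split=> [q Vq|i j q iq] /=.
  by have [? ?] := hW _ Vq; split=> //; exists (h q).
case: j => [j|j] [//= jq [x Wx [xhq]]].
have Whq : W (h q) by rewrite -xhq.
have [W' [oW' W'p sW' fW'] [F CF Ff]] := sh i j q iq (conj jq Whq).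
exists W'.
  split=> // _ [y W'y <-]; have [] : (mf_dom (j : mf_idx (mrestr W))) (h y) by apply: fW'; exists y.
  by move=> ? ?; split=> //; exists (h y).
by exists F.
Qed.

Lemma diffeo_inr (W : set (mf_pt N)) (V : set (mf_pt Q)) :
  diffeo W V g -> diffeo (M := sum_mfd M N) (inr @` W) V sum_fun.
Proof.
move=> [[fV sf] [h [hW sh] [hf fh]]]; split.
  split=> [s [Ms [p Wp ps]]|i j s [ip [p Wp ps]] jp].
    by move: Ms; rewrite -ps => Mp; exact: fV (conj Mp Wp).
  move: ip jp; rewrite -ps => {s ps} ip jp.
  case: i ip => [//|i] ip.
  have [W' [oW' W'p sW' fW'] [F CF Ff]] := sf i j p (conj ip Wp) jp.
  exists (inr @` W').
    split; [|by exists p|by move=> _ [x /sW' [? ?] <-]; split => //; exists x|].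
      split=> [_ [x W'x <-]|].
        by have [? ?] := oW'.1 _ W'x; split=> //; exists x.
      move=> [k|k] /=.
        rewrite (_ : [set _ | _ in _] = set0); first exact: fopen0.
        by apply/seteqP; split=> // y [_ [[x W'x <-] [kx _]] _]; case: kx.
      have := oW'.2 k; rewrite (_ : [set _ | _ in _] = mf_map k @` (W' `&` (mf_dom k `&` W))) //.
      apply/seteqP; split.
        by move=> _ [_ [[x W'x <-] [kx [y Wy [yx]]]] <-]; rewrite yx in Wy; exists x.
      by move=> _ [x [W'x [kx Wx]] <-]; exists (inr x) => //; split; [exists x|split=> //; exists x].
    by move=> _ [_ [x W'x <-] <-] /=; apply: fW'; exists x.
  exists F => [|_ [x W'x <-]]; last exact: Ff.
  by apply: Csmooth_sub CF => _ [_ [x W'x <-] <-]; exists x.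
exists (inr \o h); last first.
  by split=> [_ [x Wx <-]|y Vy] /=; [rewrite hf | exact: fh].
split=> [q Vq|i j q iq] /=.
  by have [? ?] := hW _ Vq; split=> //; exists (h q).
case: j => [j|j] [//= jq [x Wx [xhq]]].
have Whq : W (h q) by rewrite -xhq.
have [W' [oW' W'p sW' fW'] [F CF Ff]] := sh i j q iq (conj jq Whq).
exists W'.
  split=> // _ [y W'y <-]; have [] : (mf_dom (j : mf_idx (mrestr W))) (h y) by apply: fW'; exists y.
  by move=> ? ?; split=> //; exists (h y).
by exists F.
Qed.

Lemma mderiv_inl p (i : mf_idx M) (j : mf_idx Q) (u : mf_mod i) (v : mf_mod j) :
  mderiv f p u v <->
  mderiv (M := sum_mfd M N) sum_fun (inl p) (i := inl i) (j := j) u v.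
Proof.
split=> -[W [oW Wp sW fW] [F Ff dF]].
  exists (inl @` W).
    split; [exact: mopen_inl | by exists p | by move=> _ [x /sW ? <-]|].
    by move=> _ [_ [x Wx <-] <-] /=; apply: fW; exists x.
  by exists F => // _ [x Wx <-]; exact: Ff.
exists (inl @^-1` W).
  split=> //; [exact: mopen_inlV | by move=> x /sW|].
  by move=> _ [x Wx <-]; apply: fW; exists (inl x).
by exists F => // x; exact: Ff.
Qed.

Lemma mderiv_inr p (i : mf_idx N) (j : mf_idx Q) (u : mf_mod i) (v : mf_mod j) :
  mderiv g p u v <->
  mderiv (M := sum_mfd M N) sum_fun (inr p) (i := inr i) (j := j) u v.
Proof.
split=> -[W [oW Wp sW fW] [F Ff dF]].
  exists (inr @` W).
    split; [exact: mopen_inr | by exists p | by move=> _ [x /sW ? <-]|].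
    by move=> _ [_ [x Wx <-] <-] /=; apply: fW; exists x.
  by exists F => // _ [x Wx <-]; exact: Ff.
exists (inr @^-1` W).
  split=> //; [exact: mopen_inrV | by move=> x /sW|].
  by move=> _ [x Wx <-]; apply: fW; exists (inr x).
by exists F => // x; exact: Ff.
Qed.

Lemma kahler_map_sum (K : kahler_data M) (K' : kahler_data N) (KQ : kahler_data Q) :
  kahler_map K KQ f -> kahler_map K' KQ g -> kahler_map (sum_kahler K K') KQ sum_fun.
Proof.
move=> kf kg [p|p] [i|i] j //= ip jp u v u' v' /= du dv.
  have [-> -> ?] := kf p i j ip jp u v u' v' (iffRL (mderiv_inl _ _ _) du) (iffRL (mderiv_inl _ _ _) dv).
  by split=> //; apply/mderiv_inl.
have [-> -> ?] := kg p i j ip jp u v u' v' (iffRL (mderiv_inr _ _ _) du) (iffRL (mderiv_inr _ _ _) dv).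
by split=> //; apply/mderiv_inr.
Qed.

End Sum.
End Manifolds.

(** * Two-to-one coverings by flat manifolds *)

Lemma fopen_ball (R : realType) (E : fspace R) {hE : is_frechet E} k (c : E) (e : R) :
  fs_car c -> fopen [set y : E | fs_car y /\ fs_sn k (y - c) < e].
Proof.
move=> hc; split=> [y []//|y [hy yce]]; exists k, (e - fs_sn k (y - c)).
  by rewrite subr_gt0.
move=> z hz; rewrite ltrBrDr => H; split=> //.
exact: le_lt_trans (fs_sn_dist k hz hy hc) H.
Qed.

Lemma fopen_opp (R : realType) (E : fspace R) {hE : is_frechet E} (U : set E) :
  fopen U -> fopen [set y : E | U (- y)].
Proof.
move=> oU; split=> [y /(fopen_car oU) hy|y Uy]; first by rewrite -[y]opprK; exact: fs_carN.
have hy : fs_car y by rewrite -[y]opprK; apply: fs_carN; exact: (fopen_car oU Uy).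
have [k [e e0 He]] := oU.2 _ Uy; exists k, e => // z hz zy; apply: He; first exact: fs_carN.
by rewrite opprK addrC fs_sn_distC.
Qed.

Lemma exists_sn_gt0 (R : realType) (E : fspace R) {hE : is_frechet E} (x : E) :
  fs_car x -> x <> 0 -> exists k, 0 < fs_sn k x.
Proof.
move=> hx x0; apply: contrapT => /forallNP H; apply: x0; apply: fr_sep => // k.
apply/eqP; rewrite eq_le fs_sn_ge0 // andbT leNgt; exact/negP.
Qed.

(* A manifold [N] whose charts lift through the map [pr], which is two-to-one up
   to sign: [P i] is [pr] read in the chart [i], and [L i] is a section of it
   over the chart [i].  All lifts live in one vector space [A], in one of the
   closed subspaces [car k]. *)
Record flat_cover (R : realType) (A : lmodType R) (sn : nat -> A -> R) (K : Type)
    (car : K -> set A) (N : premfd R) (cl : mf_idx N -> K) (T : set A) (pr : A -> mf_pt N)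
    (L : forall i : mf_idx N, mf_mod i -> A) (P : forall i : mf_idx N, A -> mf_mod i) : Prop := {
  fc_frechet : forall k, is_frechet (Fspace (car k) sn);
  fc_mod : forall i : mf_idx N, is_frechet (mf_mod i);
  fc_sub : forall i : mf_idx N, mf_dom i `<=` mf_pts N;
  fc_cover : forall p, mf_pts N p -> exists i : mf_idx N, mf_dom i p;
  fc_total : forall k, fopen (E := Fspace (car k) sn) (T `&` car k);
  fc_class : forall y, T y -> exists k, car k y;
  fc_class_eq : forall y k k', T y -> car k y -> car k' y -> car k = car k';
  fc_pr : forall y, T y -> mf_pts N (pr y);
  fc_P : forall (i : mf_idx N) y, T y -> mf_dom i (pr y) ->
    car (cl i) y /\ mf_map i (pr y) = P i y;
  fc_open : forall i : mf_idx N,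
    fopen (E := Fspace (car (cl i)) sn) [set y | T y /\ mf_dom i (pr y)];
  fc_P_smooth : forall i : mf_idx N, Csmooth (E := Fspace (car (cl i)) sn)
    (F := mf_mod i) [set y | T y /\ mf_dom i (pr y)] (P i);
  fc_image : forall i : mf_idx N, fopen (mf_map i @` mf_dom i);
  fc_L : forall (i : mf_idx N) p, mf_dom i p ->
    T (L i (mf_map i p)) /\ pr (L i (mf_map i p)) = p;
  fc_L_smooth : forall i : mf_idx N, Csmooth (E := mf_mod i)
    (F := Fspace (car (cl i)) sn) (mf_map i @` mf_dom i) (L i);
  fc_pm : forall y y', T y -> T y' -> pr y = pr y' -> y' = y \/ y' = - y;
  fc_neg : forall y, T y -> T (- y) /\ pr (- y) = pr y;
  fc_neq0 : forall y, T y -> y <> 0 }.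

Record flat_kahler (R : realType) (E : fspace R) (g w : E -> E -> R) (J : E -> E) : Prop := {
  fk_g : @bilin R E E (fs_real R) g;
  fk_w : @bilin R E E (fs_real R) w;
  fk_J : flin J;
  fk_JJ : forall x, fs_car x -> J (J x) = - x;
  fk_sym : forall x y, fs_car x -> fs_car y -> g x y = g y x;
  fk_pos : forall x, fs_car x -> x <> 0 -> 0 < g x x;
  fk_alt : forall x y, fs_car x -> fs_car y -> w x y = - w y x;
  fk_gw : forall x y, fs_car x -> fs_car y -> g x y = w x (J y) }.

Section FlatCover.
Context {R : realType} {A : lmodType R} {sn : nat -> A -> R} {K : Type} {car : K -> set A}
  {N : premfd R} {cl : mf_idx N -> K} {T : set A} {pr : A -> mf_pt N}
  {L : forall i : mf_idx N, mf_mod i -> A} {P : forall i : mf_idx N, A -> mf_mod i}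
  (H : flat_cover sn car cl T pr L P).

Local Notation C k := (Fspace (car k) sn).
Local Notation D i := (mf_map i @` mf_dom i).
Local Notation V i := [set y | T y /\ mf_dom i (pr y)].
Implicit Types (i j : mf_idx N) (k : K) (y : A).

#[local] Instance fc_frechet_inst k : is_frechet (C k) := fc_frechet H k.
#[local] Instance fc_mod_inst i : is_frechet (mf_mod i) := fc_mod H i.

Lemma fc_L_in i x : D i x -> V i (@L i x).
Proof. by move=> [p ip <-]; have [? e] := fc_L H ip; split; rewrite //= e. Qed.

Lemma fc_PL i x : D i x -> P i (@L i x) = x.
Proof.
move=> Dx; have [TLx ix] := fc_L_in Dx.
have [_ <-] := fc_P H TLx ix; case: Dx => p ip <-; by have [_ ->] := fc_L H ip.
Qed.

Lemma fc_L_car i x : D i x -> car (cl i) (@L i x).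
Proof. by move=> /fc_L_in [? ?]; have [] := @fc_P _ _ _ _ _ _ _ _ _ _ _ H i (@L i x). Qed.

Lemma fc_P_in i y : V i y -> D i (P i y).
Proof. by move=> [Ty iy]; have [_ <-] := fc_P H Ty iy; exists (pr y). Qed.

Lemma fc_LP i y : V i y -> @L i (P i y) = y \/ @L i (P i y) = - y.
Proof.
move=> [Ty iy]; have [_ <-] := fc_P H Ty iy; have [TL e] := fc_L H iy.
by apply: (fc_pm H Ty TL).
Qed.

Lemma fc_Vneg i y : V i y -> V i (- y).
Proof. by move=> [Ty iy]; have [TN e] := fc_neg H Ty; split; rewrite //= e. Qed.

Lemma fc_Pneg i y : V i y -> P i (- y) = P i y.
Proof.
move=> Vy; have [TN iN] := fc_Vneg Vy; case: Vy => Ty iy.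
have [_ <-] := fc_P H TN iN; have [_ <-] := fc_P H Ty iy.
by have [_ ->] := fc_neg H Ty.
Qed.

(** Classes are compared as sets and not through their indices, because for paths both signs denote
    the same space. *)
Lemma fopen_class (c c' : set A) (U : set A) : c = c' ->
  fopen (E := Fspace c sn) U -> fopen (E := Fspace c' sn) U.
Proof. by move=> ->. Qed.

Lemma fc_openV i k : car k = car (cl i) -> fopen (E := C k) (V i).
Proof. by move=> e; apply: fopen_class (fc_open H i). Qed.

(** A point of the chart [i] belongs to the image of [B] exactly when its lift by [L i] is in [B] or
    in [- B]. *)
Lemma fc_pr_open (B : set A) : B `<=` T -> (forall k, fopen (E := C k) (B `&` car k)) ->
  mopen (pr @` B).
Proof.
move=> sB oB; split=> [_ [y /sB Ty <-]|i]; first exact: (fc_pr H).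
pose W := (B `&` car (cl i)) `|` [set y | (B `&` car (cl i)) (- y)].
have -> : mf_map i @` (pr @` B `&` mf_dom i) = D i `&` @L i @^-1` W.
  apply/seteqP; split=> [_ [_ [[y By <-] iy] <-]|_ [[p ip <-]]].
    have Ty := sB _ By; have [ky _] := fc_P H Ty iy.
    split; first by exists (pr y).
    have [TL e] := fc_L H iy.
    case: (fc_pm H Ty TL (esym e)) => /= ->; first by left.
    by right; rewrite /= opprK.
  have [TL e] := fc_L H ip => -[[BL _]|[BL _]]; exists p => //; split=> //; first by exists (@L i (mf_map i p)).
  exists (- @L i (mf_map i p)) => //; by have [_ ->] := fc_neg H TL.
apply: (@fopen_preim _ _ (C (cl i))).
- exact: (fc_image H).
- by move=> x; exact: fc_L_car.
- exact: (Cn_cont (fc_L_smooth H i 0%N)).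
- by apply: fopenU; [exact: oB | exact: (@fopen_opp _ (C (cl i)))].
Qed.

Lemma fc_dom_pr i : mf_dom i = pr @` V i.
Proof.
apply/seteqP; split=> [p ip|_ [y [_ ?] <-]//].
by have [TL e] := fc_L H ip; exists (@L i (mf_map i p)) => //; split; rewrite //= e.
Qed.

Lemma fc_mopen_dom i : mopen (mf_dom i).
Proof.
rewrite fc_dom_pr; apply: fc_pr_open => [y []//|k].
apply: fopen_local => y [Vy ky]; exists (V i); last first.
  move=> z Vz; split=> //; case: Vy => Ty iy; case: (Vz) => Tz iz.
  have [cy _] := fc_P H Ty iy; have [cz _] := fc_P H Tz iz.
  by rewrite (fc_class_eq H Ty ky cy).
split=> //; apply: fc_openV; case: Vy => Ty iy.
by have [cy _] := fc_P H Ty iy; exact: (fc_class_eq H Ty).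
Qed.

Lemma fc_lift p : mf_pts N p -> exists y k, [/\ T y, car k y & pr y = p].
Proof.
move=> /(fc_cover H)[i ip]; have [TL e] := fc_L H ip.
by have [k ky] := fc_class H TL; exists (@L i (mf_map i p)), k.
Qed.

Lemma fc_class_overlap i j p : mf_dom i p -> mf_dom j p -> car (cl i) = car (cl j).
Proof.
move=> ip jp; have [TL e] := fc_L H ip.
have [c1 _] : car (cl i) (@L i (mf_map i p)) /\ mf_map i (pr (@L i (mf_map i p))) = P i (@L i (mf_map i p)).
  by apply: (fc_P H); rewrite ?e.
have [c2 _] : car (cl j) (@L i (mf_map i p)) /\ mf_map j (pr (@L i (mf_map i p))) = P j (@L i (mf_map i p)).
  by apply: (fc_P H); rewrite ?e.
exact: (fc_class_eq H TL).
Qed.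

Definition fc_overlap i j := mf_map i @` (mf_dom i `&` mf_dom j).
Arguments fc_overlap : clear implicits.

(** Transition maps are factored through the total space, so their smoothness needs no formula of
    their own. *)
Definition fc_trans i j : mf_mod i -> mf_mod j := fun x => P j (@L i x).
Arguments fc_trans : clear implicits.

Lemma fc_overlap_open i j : fopen (fc_overlap i j).
Proof. by have [_ o] := fc_mopen_dom j; have := o i; rewrite setIC. Qed.

Lemma fc_overlap_sub i j : fc_overlap i j `<=` D i.
Proof. by move=> _ [p [ip _] <-]; exists p. Qed.

Lemma fc_overlap_V i j x : fc_overlap i j x -> V j (@L i x).
Proof. by move=> [p [ip jp] <-]; have [TL e] := fc_L H ip; split; rewrite //= e. Qed.

Lemma fc_transE i j p : mf_dom i p -> mf_dom j p -> fc_trans i j (mf_map i p) = mf_map j p.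
Proof.
move=> ip jp; have [TL e] := fc_L H ip; rewrite /fc_trans.
have [_ <-] : car (cl j) (@L i (mf_map i p)) /\ mf_map j (pr (@L i (mf_map i p))) = P j (@L i (mf_map i p)).
  by apply: (fc_P H); rewrite ?e.
by rewrite e.
Qed.

Lemma Csmooth_class (E : fspace R) (c c' : set A) (U : set E) (f : E -> A) : c = c' ->
  Csmooth (F := Fspace c sn) U f -> Csmooth (F := Fspace c' sn) U f.
Proof. by move=> ->. Qed.

Lemma Csmooth_class_dom (F : fspace R) (c c' : set A) (U : set A) (f : A -> F) : c = c' ->
  Csmooth (E := Fspace c sn) U f -> Csmooth (E := Fspace c' sn) U f.
Proof. by move=> ->. Qed.

Lemma fc_L_overlap_smooth i j :
  Csmooth (F := C (cl j)) (fc_overlap i j) (@L i).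
Proof.
(* The classes of two charts need to agree only when the charts meet. *)
have [e0|/set0P[_ [p [ip jp] _]]] := eqVneq (fc_overlap i j) set0; first exact: Csmooth0.
apply: (Csmooth_class (fc_class_overlap ip jp)).
exact: Csmooth_sub (@fc_overlap_sub i j) (fc_L_smooth H i).
Qed.

Lemma fc_trans_smooth i j : Csmooth (fc_overlap i j) (fc_trans i j).
Proof.
apply: (@Csmooth_comp _ _ (C (cl j)) _ _ _ _ (fc_overlap i j) (V j) (@L i) (P j)).
- exact: fc_overlap_open.
- exact: (fc_open H).
- by move=> x; exact: fc_overlap_V.
- exact: fc_L_overlap_smooth.
- exact: (fc_P_smooth H).
Qed.

Lemma fc_ball_open m k y (e : R) : T y -> car k y ->
  mopen (pr @` (T `&` [set z | car k z /\ sn m (z - y) < e])).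
Proof.
move=> Ty ky; apply: fc_pr_open => [z []//|k'].
have oB : fopen (E := C k) ((T `&` car k) `&` [set z | car k z /\ sn m (z - y) < e]).
  by apply: fopenI; [exact: (fc_total H) | exact: (@fopen_ball _ (C k))].
apply: fopen_local => z [[Tz [kz ze]] k'z].
have ee : car k = car k' by exact: (fc_class_eq H Tz).
exists ((T `&` car k) `&` [set z | car k z /\ sn m (z - y) < e]).
  by split=> //; exact: fopen_class oB.
by move=> z' [[Tz' kz'] [_ ze']]; split; [split | rewrite -ee].
Qed.

Lemma fc_is_mfd : is_mfd N.
Proof.
split.
- exact: (fc_mod H).
- exact: (fc_sub H).
- exact: (fc_cover H).
- move=> i p q ip iq pq; have [_ <-] := fc_L H ip; have [_ <-] := fc_L H iq.
  by rewrite pq.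
- exact: fc_overlap_open.
- move=> i j; exists (fc_trans i j); first exact: fc_trans_smooth.
  exact: fc_transE.
- move=> p q Np Nq pq.
  have [y [k [Ty ky yp]]] := fc_lift Np; have [y' [k' [Ty' ky' yq]]] := fc_lift Nq.
  (* The lifts have to be separated up to sign: [y] from [y'] and from [- y']. If [y'] is in another
     class, the sets meet for no radius. *)
  have [m [e e0 He]] : exists m, exists2 e : R, 0 < e &
      (car k y' -> e <= sn m (y - y') /\ e <= sn m (y + y')).
    have [cy'|] := pselect (car k y'); last by exists 0%N, 1.
    have h1 : fs_car (y - y' : C k) by exact: (@fs_carB _ (C k)).
    have h2 : fs_car (y + y' : C k) by exact: (@fs_carD _ (C k)).
    have [||m1 d1] := @exists_sn_gt0 _ (C k) _ (y - y') => //.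
      by move=> /eqP; rewrite subr_eq0 => /eqP yy'; apply: pq; rewrite -yp -yq yy'.
    have [||m2 d2] := @exists_sn_gt0 _ (C k) _ (y + y') => //.
      move=> /eqP; rewrite addr_eq0 => /eqP yy'; apply: pq; rewrite -yp -yq yy'.
      by have [_ ->] := fc_neg H Ty'.
    exists (maxn m1 m2), (Num.min (sn m1 (y - y')) (sn m2 (y + y'))).
      by rewrite lt_min d1.
    move=> _; rewrite !ge_min; split; apply/orP; [left|right].
      by apply: (@fs_sn_le _ (C k)) => //; exact: leq_maxl.
    by apply: (@fs_sn_le _ (C k)) => //; exact: leq_maxr.
  exists (pr @` (T `&` [set z | car k z /\ sn m (z - y) < e / 2])).
  exists (pr @` (T `&` [set z | car k' z /\ sn m (z - y') < e / 2])).
  have e20 : 0 < e / 2 by rewrite divr_gt0.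
  split; try exact: fc_ball_open.
  + by exists y => //; split=> //; split=> //; rewrite subrr [X in X < _](@fs_sn0 _ (C k) _ m).
  + by exists y' => //; split=> //; split=> //; rewrite subrr [X in X < _](@fs_sn0 _ (C k') _ m).
  + apply/seteqP; split=> // x [[z [Tz [kz ze]] <-] [z' [Tz' [k'z' ze']] zz']].
    have kz' : car k z'.
      by case: (fc_pm H Tz Tz' (esym zz')) => ->; [|exact: (@fs_carN _ (C k))].
    have kk' : car k = car k' by exact: (fc_class_eq H Tz').
    have cy' : car k y' by rewrite kk'.
    have [h1 h2] := He cy'.
    have ky'N : car k (- y') by exact: (@fs_carN _ (C k)).
    have ky'z : car k (- z) by exact: (@fs_carN _ (C k)).
    have k1 := @fs_sn_dist _ (C k) (fc_frechet H k) m z y y' ky kz cy'.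
    have k2 := @fs_sn_dist _ (C k) (fc_frechet H k) m z y (- y') ky kz ky'N.
    rewrite /= opprK in k2.
    have k3 := @fs_sn_distC _ (C k) (fc_frechet H k) m y z ky kz; rewrite /= in k1 k3.
    case: (fc_pm H Tz Tz' (esym zz')) => ez; rewrite ez in ze'.
      by rewrite k3 in k1; clear - k1 h1 ze ze'; lra.
    have k4 := @fs_snN _ (C k) (fc_frechet H k) m (- z - y'); rewrite /= opprB opprK [y' + z]addrC in k4.
    have k5 : car k (- z - y') by exact: (@fs_carB _ (C k)).
    by rewrite k3 (k4 k5) in k2; clear - k2 h2 ze ze'; lra.
Qed.

(** For [z] near [y], both [z] and its lift [L (P z)] are near [y]. The only other value [- z] of
    that lift is near [- y], and half the size of [y + y] separates the two. *)
Lemma fc_sheet_open i : fopen (E := C (cl i)) (V i `&` [set y | @L i (P i y) = y]).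
Proof.
apply: fopen_local => y [Vy Ly].
have cy : car (cl i) y by case: Vy => Ty iy; have [] := fc_P H Ty iy.
have yy : fs_car (y + y : C (cl i)) by exact: (@fs_carD _ (C (cl i))).
have [||m y0] := @exists_sn_gt0 _ (C (cl i)) _ (y + y) => //.
  move=> /eqP; rewrite -mulr2n -scaler_nat scaler_eq0 pnatr_eq0 /= => /eqP y0.
  by case: Vy => Ty _; apply: (fc_neq0 H Ty).
pose B := [set z | car (cl i) z /\ sn m (z - y) < sn m (y + y) / 2].
have oB : fopen (E := C (cl i)) B by exact: (@fopen_ball _ (C (cl i))).
have By : B y by split=> //; rewrite subrr [X in X < _](@fs_sn0 _ (C (cl i)) _ m) divr_gt0.
exists ((V i `&` (@L i \o P i) @^-1` B) `&` B).
  split; last by split=> //; split=> //=; rewrite Ly.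
  apply: fopenI => //; apply: (@fopen_preim _ (C (cl i)) (C (cl i))) => //; first exact: (fc_open H).
    by move=> x Vx; apply: fc_L_car; exact: fc_P_in.
  apply: (@fcont_comp _ (C (cl i)) (mf_mod i) (C (cl i)) (V i) (D i)).
  - by move=> x; exact: fc_P_in.
  - exact: (Cn_cont (fc_P_smooth H i 0%N)).
  - exact: (Cn_cont (fc_L_smooth H i 0%N)).
move=> z [[Vz /= [_ Bz]] [cz Bz']]; split=> //=.
case: (fc_LP Vz) => // e; exfalso; rewrite e in Bz.
have cNz : car (cl i) (- z) by exact: (@fs_carN _ (C (cl i))).
have cNy : car (cl i) (- y) by exact: (@fs_carN _ (C (cl i))).
have cB : car (cl i) (- z - y) by exact: (@fs_carB _ (C (cl i))).
have h1 := @fs_sn_dist _ (C (cl i)) (fc_frechet H (cl i)) m z y (- y) cy cz cNy.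
have h2 := @fs_sn_distC _ (C (cl i)) (fc_frechet H (cl i)) m y z cy cz.
have h3 := @fs_snN _ (C (cl i)) (fc_frechet H (cl i)) m (- z - y) cB.
rewrite /= !opprK in h1; rewrite /= in h2; rewrite /= opprB opprK [y + z]addrC in h3.
rewrite h2 h3 in h1.
by have := ltrD Bz' Bz; rewrite -splitr ltNge => /negP; apply; exact: h1.
Qed.

End FlatCover.

Definition sg (V : zmodType) (b : bool) (x : V) : V := if b then - x else x.

Lemma sgK (V : zmodType) b : involutive (@sg V b).
Proof. by case: b => x //=; rewrite opprK. Qed.

(** * Sheets and local inverses of the projection *)

Section FlatCoverMaps.
Context {R : realType} {A : lmodType R} {sn : nat -> A -> R} {K : Type} {car : K -> set A}
  {N : premfd R} {cl : mf_idx N -> K} {T : set A} {pr : A -> mf_pt N}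
  {L : forall i : mf_idx N, mf_mod i -> A} {P : forall i : mf_idx N, A -> mf_mod i}
  (H : flat_cover sn car cl T pr L P).

Local Notation C k := (Fspace (car k) sn).
Local Notation D i := (mf_map i @` mf_dom i).
Local Notation V i := [set y | T y /\ mf_dom i (pr y)].
Implicit Types (i j : mf_idx N) (k : K) (y : A).

#[local] Instance fc_frechet_inst' k : is_frechet (C k) := fc_frechet H k.
#[local] Instance fc_mod_inst' i : is_frechet (mf_mod i) := fc_mod H i.

Definition fc_total_mfd k := @fs_mfd R (C k) (T `&` car k).

Lemma fc_total_is_mfd k : is_mfd (fc_total_mfd k).
Proof. exact: (@fs_is_mfd _ (C k) _ _ (fc_total H k)). Qed.

Lemma fc_V_class k i y : car k y -> V i y -> car k = car (cl i).
Proof. by move=> ky [Ty iy]; have [cy _] := fc_P H Ty iy; exact: (fc_class_eq H Ty). Qed.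

Lemma fc_V_sub k i : car k = car (cl i) -> V i `<=` T `&` car k.
Proof. by move=> e y [Ty iy]; have [cy _] := fc_P H Ty iy; rewrite e. Qed.

Lemma fc_mopenV k i : car k = car (cl i) -> mopen (M := fc_total_mfd k) (V i).
Proof.
move=> e; apply/(@fs_mopenP _ (C k)); split; first exact: fc_V_sub.
exact: (fc_openV H).
Qed.

Lemma fc_msmooth k : msmooth (M := fc_total_mfd k) pr.
Proof.
split=> [y [Ty _]|[] j y /= [Ty ky] jy]; first exact: (fc_pr H).
have Vy : V j y by [].
have e := fc_V_class ky Vy.
exists (V j).
  by split=> //; [exact: fc_mopenV | exact: fc_V_sub | move=> _ [z [_ ?] <-]].
exists (P j); last by move=> z [Tz jz]; have [_ ->] := fc_P H Tz jz.
by rewrite /= image_id; apply: Csmooth_class_dom (fc_P_smooth H j).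
Qed.

Definition fc_sheet i (b : bool) : set A := V i `&` [set y | L (P i y) = sg b y].

Lemma fc_sheet_neg i b y : fc_sheet i b y -> fc_sheet i (~~ b) (- y).
Proof.
move=> [Vy e]; split; first exact: (fc_Vneg H).
by rewrite /= (fc_Pneg H) // e; case: (b) => //=; rewrite opprK.
Qed.

Lemma fc_sheetb_open k i b : car k = car (cl i) -> fopen (E := C k) (fc_sheet i b).
Proof.
move=> e; apply: (fopen_class (esym e)); case: b; last exact: (fc_sheet_open H).
have -> : fc_sheet i true = [set y | fc_sheet i false (- y)].
  apply/seteqP; split=> y Sy; first exact: (fc_sheet_neg Sy).
  by rewrite -[y]opprK; exact: (fc_sheet_neg Sy).
exact: (@fopen_opp _ (C (cl i)) _ _ (fc_sheet_open H i)).
Qed.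

Lemma fc_sheetU i : V i = fc_sheet i false `|` fc_sheet i true.
Proof.
apply/seteqP; split=> [y Vy|y [[]|[]] //].
by case: (fc_LP H Vy) => e; [left|right].
Qed.

Lemma fc_sheetI i : fc_sheet i false `&` fc_sheet i true = set0.
Proof.
apply/seteqP; split=> // y [[[Ty _] /= e1] [_ /= /eqP]].
rewrite e1 -addr_eq0 -mulr2n -scaler_nat scaler_eq0 pnatr_eq0 /= => /eqP.
exact: (fc_neq0 H Ty).
Qed.

Lemma flin_sg b k : @flin _ (C k) (C k) (sg b).
Proof.
case: b; last exact: flin_id.
split=> [x|a x y _ _|m] /=; first exact: (@fs_carN _ (C k)).
  by rewrite opprD scalerN.
by exists m, 1 => // x hx; rewrite mul1r [leLHS](@fs_snN _ (C k) (fc_frechet H k)).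
Qed.

Lemma fc_sheet_mopen k i b : car k = car (cl i) -> mopen (M := fc_total_mfd k) (fc_sheet i b).
Proof.
move=> e; apply/(@fs_mopenP _ (C k)); split; last exact: fc_sheetb_open.
by move=> y [Vy _]; exact: fc_V_sub Vy.
Qed.

Lemma fc_section i b p : mf_dom i p ->
  fc_sheet i b (sg b (L (mf_map i p))) /\ pr (sg b (L (mf_map i p))) = p.
Proof.
move=> ip; have Dx : D i (mf_map i p) by exists p.
have Vy := fc_L_in H Dx; have [TL e] := fc_L H ip.
split; last by case: b => //=; have [_ ->] := fc_neg H TL.
split; first by case: b => //=; exact: (fc_Vneg H).
by case: b => /=; rewrite ?(fc_Pneg H) // (fc_PL H) // opprK.
Qed.

Lemma fc_diffeo k i b : car k = car (cl i) ->
  diffeo (M := fc_total_mfd k) (fc_sheet i b) (mf_dom i) pr.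
Proof.
move=> e; split.
  apply: msmooth_restr; [exact: fc_total_is_mfd | exact: fc_msmooth | exact: fc_sheet_mopen|].
  by move=> y [[]].
exists (fun p => sg b (L (mf_map i p))); last first.
  split=> [y [Vy /= e2]|p ip]; last by have [] := fc_section b ip.
  by case: (Vy) => Ty iy; have [_ ->] := fc_P H Ty iy; rewrite e2 sgK.
split=> [p [Np ip]|j [] p [jp ip] _].
  have [S _] := fc_section b ip; split=> //.
  by case: S => Vy _; exact: fc_V_sub Vy.
exists (@mf_dom R N j `&` mf_dom i).
  split=> //.
  - apply: mopen_restr => [|? []//].
    apply: mopenI; [exact: (fc_is_mfd H) | exact: (fc_mopen_dom H)..].
  - move=> _ [q [jq iq] <-]; have [S _] := fc_section b iq; split=> //.
    by case: S => Vy _; exact: fc_V_sub Vy.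
exists (fun x => sg b (L (@fc_trans R A N L P j i x))).
  apply: (@Csmooth_comp _ _ (mf_mod i) (C k) _ _ _ _ (D i) (@fc_trans R A N L P j i)
    (fun x => sg b (@L i x))).
  - exact: (fc_overlap_open H).
  - exact: (fc_image H).
  - by move=> x /(fc_overlap_V H) Vx; exact: (fc_P_in H).
  - exact: (fc_trans_smooth H).
  - apply: (@Csmooth_comp _ _ (C k) (C k) _ _ _ (D i) (car k) (@L i) (sg b)).
    + exact: (fc_image H).
    + exact: fopen_fs_car.
    + by move=> x Dx; rewrite e; exact: (fc_L_car H).
    + by apply: Csmooth_class (fc_L_smooth H i).
    + by apply: Csmooth_flin; [exact: flin_sg | exact: fopen_fs_car].
by move=> q [jq iq]; rewrite (fc_transE H).
Qed.

(** The case of paths: there is a single class, and both sheets over a chart lie in one total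
    space. *)
Lemma fc_covering k : (forall k', car k' = car k) ->
  smooth_double_covering (M := fc_total_mfd k) (N := N) pr.
Proof.
move=> ek; split; [exact: fc_total_is_mfd | exact: (fc_is_mfd H) | exact: fc_msmooth|].
move=> q /(fc_cover H)[i iq]; exists (mf_dom i); first by split=> //; exact: (fc_mopen_dom H).
have e : car k = car (cl i) by rewrite (ek (cl i)).
exists (fc_sheet i false), (fc_sheet i true); split.
- exact: fc_sheet_mopen.
- exact: fc_sheet_mopen.
- exact: fc_sheetI.
- rewrite -fc_sheetU; apply/seteqP; split=> [y [[Ty _] iy] //|y Vy].
  by split; [exact: fc_V_sub Vy | case: Vy].
- by split; exact: fc_diffeo.
Qed.

End FlatCoverMaps.

(** The case of loops: a lift and its opposite have the same class, so both sheets over the chart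
    [i] lie in the summand selected by [cl i], and nothing of the other summand lies above the
    chart. *)
Lemma fc_covering_sum (R : realType) (A : lmodType R) (sn : nat -> A -> R) (car : bool -> set A)
    (N : premfd R) (cl : mf_idx N -> bool) (T : set A) (pr : A -> mf_pt N)
    (L : forall i : mf_idx N, mf_mod i -> A) (P : forall i : mf_idx N, A -> mf_mod i) :
  flat_cover sn car cl T pr L P -> (forall y b b', T y -> car b y -> car b' y -> b = b') ->
  smooth_double_covering
    (M := sum_mfd (@fc_total_mfd R A sn bool car T false) (@fc_total_mfd R A sn bool car T true))
    (N := N) (@sum_fun R (@fc_total_mfd R A sn bool car T false) (@fc_total_mfd R A sn bool car T true) N pr pr).
Proof.
move=> H eb; split.
- by apply: sum_is_mfd; exact: (fc_total_is_mfd H).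
- exact: (fc_is_mfd H).
- by apply: msmooth_sum; exact: (fc_msmooth H).
move=> q /(fc_cover H)[i iq]; exists (mf_dom i); first by split=> //; exact: (fc_mopen_dom H).
have Vcl b y : T y -> mf_dom i (pr y) -> car b y -> b = cl i.
  by move=> Ty iy by_; have [cy _] := fc_P H Ty iy; exact: (eb y).
have sV b y : @fc_sheet R A N T pr L P i b y -> T y /\ car (cl i) y.
  by move=> [Vy _]; exact: (fc_V_sub H erefl Vy).
case e : (cl i).
- exists (inr @` @fc_sheet R A N T pr L P i false), (inr @` @fc_sheet R A N T pr L P i true); split.
  + by apply: mopen_inr; apply: (fc_sheet_mopen H); rewrite e.
  + by apply: mopen_inr; apply: (fc_sheet_mopen H); rewrite e.
  + apply/seteqP; split=> // _ [[y Sy <-] [z Sz [zy]]]; rewrite zy in Sz.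
    by have := conj Sy Sz; rewrite -[_ /\ _]/((_ `&` _) y) (fc_sheetI H).
  + rewrite -image_setU -(fc_sheetU H); apply/seteqP; split.
      move=> [y|y] [/= [Ty cy] iy]; last by exists y.
      by have := Vcl _ _ Ty iy cy; rewrite e.
    move=> _ [y Vy <-]; split; last by case: Vy.
    by have [? ?] := fc_V_sub H erefl Vy; split; rewrite // -e.
  + by split; apply: diffeo_inr; apply: (fc_diffeo H); rewrite e.
- exists (inl @` @fc_sheet R A N T pr L P i false), (inl @` @fc_sheet R A N T pr L P i true); split.
  + by apply: mopen_inl; apply: (fc_sheet_mopen H); rewrite e.
  + by apply: mopen_inl; apply: (fc_sheet_mopen H); rewrite e.
  + apply/seteqP; split=> // _ [[y Sy <-] [z Sz [zy]]]; rewrite zy in Sz.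
    by have := conj Sy Sz; rewrite -[_ /\ _]/((_ `&` _) y) (fc_sheetI H).
  + rewrite -image_setU -(fc_sheetU H); apply/seteqP; split.
      move=> [y|y] [/= [Ty cy] iy]; first by exists y.
      by have := Vcl _ _ Ty iy cy; rewrite e.
    move=> _ [y Vy <-]; split; last by case: Vy.
    by have [? ?] := fc_V_sub H erefl Vy; split; rewrite // -e.
  + by split; apply: diffeo_inl; apply: (fc_diffeo H); rewrite e.
Qed.

(** * The descended Kahler structure *)

Section FlatCoverKahler.
Context {R : realType} {A : lmodType R} {sn : nat -> A -> R} {K : Type} {car : K -> set A}
  {N : premfd R} {cl : mf_idx N -> K} {T : set A} {pr : A -> mf_pt N}
  {L : forall i : mf_idx N, mf_mod i -> A} {P : forall i : mf_idx N, A -> mf_mod i}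
  (H : flat_cover sn car cl T pr L P).
Context {g0 w0 : A -> A -> R} {J0 : A -> A}
  (hk : forall k, @flat_kahler R (Fspace (car k) sn) g0 w0 J0).

Local Notation C k := (Fspace (car k) sn).
Local Notation D i := (mf_map i @` mf_dom i).
Local Notation V i := [set y | T y /\ mf_dom i (pr y)].
Implicit Types (i j : mf_idx N) (k : K) (y : A).

#[local] Instance fc_frechet_inst'' k : is_frechet (C k) := fc_frechet H k.
#[local] Instance fc_mod_inst'' i : is_frechet (mf_mod i) := fc_mod H i.

Lemma fc_dP_ex i : exists2 dP, derives (E := C (cl i)) (V i) (P i) dP &
  Csmooth (tangent (E := C (cl i)) (V i)) dP.
Proof. exact: (Csmooth_derives (fc_open H i) (fc_P_smooth H i)). Qed.

Lemma fc_dL_ex i : exists2 dL, derives (F := C (cl i)) (D i) (@L i) dL &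
  Csmooth (F := C (cl i)) (tangent (D i)) dL.
Proof. exact: (Csmooth_derives (fc_image H i) (fc_L_smooth H i)). Qed.

Definition fc_dP i : A * A -> mf_mod i := s2val (cid2 (fc_dP_ex i)).
Definition fc_dL i : mf_mod i * mf_mod i -> A := s2val (cid2 (fc_dL_ex i)).

Lemma fc_dPP i : derives (E := C (cl i)) (V i) (P i) (fc_dP i).
Proof. exact: (s2valP (cid2 (fc_dP_ex i))). Qed.

Lemma fc_dP_smooth i : Csmooth (E := fs_prod (C (cl i)) (C (cl i)))
  (tangent (E := C (cl i)) (V i)) (fc_dP i).
Proof. exact: (s2valP' (cid2 (fc_dP_ex i))). Qed.

Lemma fc_dLP i : derives (F := C (cl i)) (D i) (@L i) (@fc_dL i).
Proof. exact: (s2valP (cid2 (fc_dL_ex i))). Qed.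

Lemma fc_dL_smooth i : Csmooth (E := fs_prod (mf_mod i) (mf_mod i)) (F := C (cl i))
  (tangent (D i)) (@fc_dL i).
Proof. exact: (s2valP' (cid2 (fc_dL_ex i))). Qed.

Lemma fc_P_car i y : V i y -> fs_car (P i y).
Proof. exact: (Cn_car (fc_P_smooth H i 0%N)). Qed.

Lemma fc_dP_car i y h : V i y -> car (cl i) h -> fs_car (fc_dP i (y, h)).
Proof. by move=> Vy hh; have [] := fc_dPP Vy hh. Qed.

Lemma fc_dL_car i (x u : mf_mod i) : D i x -> fs_car u -> car (cl i) (fc_dL (x, u)).
Proof. by move=> Dx hu; have [] := fc_dLP Dx hu. Qed.

Lemma fc_dP_lin i a y h h' : V i y -> car (cl i) h -> car (cl i) h' ->
  fc_dP i (y, a *: h + h') = a *: fc_dP i (y, h) + fc_dP i (y, h').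
Proof.
move=> Vy hh hh'.
exact: (@derives_lin _ (C (cl i)) (mf_mod i) _ _ (V i) (P i) (fc_dP i) (fc_open H i)
  (@fc_P_car i) (@fc_dPP i) (Cn_cont (@fc_dP_smooth i 0%N)) a y h h' Vy hh hh').
Qed.

Lemma fc_dL_lin i a x u v : D i x -> fs_car u -> fs_car v ->
  @fc_dL i (x, a *: u + v) = a *: @fc_dL i (x, u) + @fc_dL i (x, v).
Proof.
move=> Dx hu hv.
exact: (@derives_lin _ (mf_mod i) (C (cl i)) _ _ (D i) (@L i) (@fc_dL i) (fc_image H i)
  (@fc_L_car _ _ _ _ _ _ _ _ _ _ _ H i) (@fc_dLP i) (Cn_cont (@fc_dL_smooth i 0%N)) a x u v Dx hu hv).
Qed.

Lemma fc_dP_sg i b y h : V i y -> car (cl i) h -> fc_dP i (y, sg b h) = sg b (fc_dP i (y, h)).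
Proof.
case: b => //= Vy hh; have h0 : car (cl i) 0 by exact: (@fs_car0 _ (C (cl i))).
have e0 : fc_dP i (y, 0) = 0.
  exact: (@derives0 _ (C (cl i)) (mf_mod i) _ _ (V i) (P i) (fc_dP i) (fc_open H i)
    (@fc_P_car i) (@fc_dPP i)).
by rewrite -[- h]addr0 -scaleN1r fc_dP_lin // scaleN1r e0 addr0.
Qed.

Lemma fc_dPdL i x u : D i x -> fs_car u -> fc_dP i (L x, fc_dL (x, u)) = u.
Proof.
move=> Dx hu.
have dc := @derives_comp _ (mf_mod i) (C (cl i)) (mf_mod i) _ _ _ (D i) (V i) (@L i) (P i)
  (@fc_dL i) (fc_dP i) (fc_image H i) (fc_open H i) (@fc_L_in _ _ _ _ _ _ _ _ _ _ _ H i)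
  (@fc_P_car i) (@fc_dLP i) (@fc_dPP i) (Cn_cont (@fc_dP_smooth _ 0%N)).
have idF z : D i z -> fs_car z by exact: (fopen_car (fc_image H i)).
apply: (is_dderiv_unique (fc_image H i) Dx hu idF).
  have dc1 : is_dderiv (P i \o @L i) x u (fc_dP i (L x, fc_dL (x, u))) by exact: dc.
  by apply: (is_dderiv_eq (fc_image H i) Dx hu _ dc1) => z Dz /=; rewrite (fc_PL H).
split=> // k e e0; exists 1 => // t /andP[t0 _].
by rewrite [x + _]addrC addrK scalerA mulVf -?normr_gt0 // scale1r subrr fs_sn0.
Qed.

Lemma fc_dP_opp i y h : V i y -> car (cl i) h -> fc_dP i (- y, - h) = fc_dP i (y, h).
Proof.
move=> Vy hh.
have Vy' := fc_Vneg H Vy.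
have hh' : car (cl i) (- h) by exact: (@fs_carN _ (C (cl i))).
apply: (@is_dderiv_unique _ (C (cl i)) (mf_mod i) _ _ (P i) (V i) (- y) (- h) _ _
  (fc_open H i) Vy' hh' (@fc_P_car i)); first exact: (fc_dPP Vy' hh').
have /is_dderivP[hl Pl] := fc_dPP Vy hh.
apply/is_dderivP; split=> //; apply: tends_near Pl.
apply: filterS (near0_line (fc_open H i) Vy hh) => t Vt /=.
by rewrite scalerN -opprD !(fc_Pneg H).
Qed.

(** The chain rule for [L o P] is applied on the sheet of [L x], an open set where this composite is
    the identity. *)
Lemma fc_dLdP i x h : D i x -> car (cl i) h -> @fc_dL i (x, fc_dP i (L x, h)) = h.
Proof.
move=> Dx hh; pose S := V i `&` [set y | L (P i y) = y].
have oS : fopen (E := C (cl i)) S by exact: (fc_sheet_open H).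
have Sx : S (L x) by split; [exact: (fc_L_in H) | rewrite /= (fc_PL H)].
have SF z : S z -> car (cl i) z by move=> /(fopen_car oS).
have dc := @derives_comp _ (C (cl i)) (mf_mod i) (C (cl i)) _ _ _ S (D i) (P i) (@L i)
  (fc_dP i) (@fc_dL i) oS (fc_image H i).
have {}dc : derives (E := C (cl i)) (F := C (cl i)) S (@L i \o P i)
    (fun p => fc_dL (P i p.1, fc_dP i p)).
  apply: dc.
  - by move=> z [Vz _]; exact: (fc_P_in H).
  - exact: (@fc_L_car _ _ _ _ _ _ _ _ _ _ _ H i).
  - by move=> z k [Vz _] hk'; exact: fc_dPP.
  - exact: fc_dLP.
  - exact: (Cn_cont (@fc_dL_smooth _ 0%N)).
have := dc _ _ Sx hh; rewrite /= (fc_PL H) // => dc1.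
apply: (@is_dderiv_unique _ (C (cl i)) (C (cl i)) _ _ id S (L x) h _ _ oS Sx hh SF).
  by apply: (@is_dderiv_eq _ (C (cl i)) (C (cl i)) _ _ _ S (L x) h _ oS Sx hh _ dc1) => z [].
split=> // k e e0; exists 1 => // t /andP[t0 _].
rewrite [L x + _]addrC addrK scalerA mulVf -?normr_gt0 // scale1r subrr.
by rewrite [X in X < _](@fs_sn0 _ (C (cl i)) _ k).
Qed.

(** One sign for the point and for all tangent vectors at it. Every invariance statement below is
    reduced to this one. *)
Lemma fc_dLP_pm i y : V i y -> exists b, L (P i y) = sg b y /\
  forall h, car (cl i) h -> fc_dL (P i y, fc_dP i (y, h)) = sg b h.
Proof.
move=> Vy; have DP := fc_P_in H Vy.
case: (fc_LP H Vy) => e; [exists false | exists true]; split=> // h hh /=.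
  by rewrite -{2}e fc_dLdP.
rewrite -fc_dP_opp // -e fc_dLdP //.
exact: (@fs_carN _ (C (cl i))).
Qed.

(** The constant structure pulled back by the section [L i]; at [L x] the map [fc_dP] is inverse to
    the differential of [L i] at [x]. *)
Definition fc_kahler : kahler_data N :=
  @KahlerData R N (fun i x u v => g0 (@fc_dL i (x, u)) (fc_dL (x, v)))
    (fun i x u v => w0 (@fc_dL i (x, u)) (fc_dL (x, v)))
    (fun i x u => fc_dP i (L x, J0 (fc_dL (x, u)))).

Lemma fc_sgg k b x y : car k x -> car k y -> g0 (sg b x) (sg b y) = g0 x y.
Proof.
case: b => //= hx hy; have hg := fk_g (hk k).
rewrite -(scaleN1r x) -(scaleN1r y) (bilinZl hg) // ?(bilinZr hg) //; last exact: (@fs_carZ _ (C k)).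
by rewrite !scaleN1r /GRing.scale /= ?mulN1r opprK.
Qed.

Lemma fc_sgw k b x y : car k x -> car k y -> w0 (sg b x) (sg b y) = w0 x y.
Proof.
case: b => //= hx hy; have hg := fk_w (hk k).
rewrite -(scaleN1r x) -(scaleN1r y) (bilinZl hg) // ?(bilinZr hg) //; last exact: (@fs_carZ _ (C k)).
by rewrite !scaleN1r /GRing.scale /= ?mulN1r opprK.
Qed.

Lemma fc_J_car k x : car k x -> car k (J0 x).
Proof. exact: (flin_car (fk_J (hk k))). Qed.

Lemma fc_J_sg k b x : car k x -> J0 (sg b x) = sg b (J0 x).
Proof.
by case: b => //= hx; rewrite -scaleN1r (flinZ (-1) (fk_J (hk k))) // scaleN1r.
Qed.

Lemma fc_J_Vsg i b y h : V i y -> car (cl i) h ->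
  fc_dP i (sg b y, J0 (sg b h)) = fc_dP i (y, J0 h).
Proof.
move=> Vy hh; rewrite (fc_J_sg b hh); case: b => //=; apply: fc_dP_opp => //.
exact: fc_J_car.
Qed.

(** Lifting the projection of a tangent vector back along [L j] returns the vector up to a sign,
    which [g0], [w0] and [J0] do not see. *)
Lemma fc_kahler_map k :
  kahler_map (M := @fc_total_mfd R A sn K car T k)
    (@KahlerData R (@fc_total_mfd R A sn K car T k) (fun _ _ => g0) (fun _ _ => w0) (fun _ _ => J0))
    fc_kahler pr.
Proof.
move=> y [] j /= [Ty ky] jy u v u' v' du dv.
have Vy : V j y by [].
have e := fc_V_class H ky Vy.
have [_ ey] := fc_P H Ty jy.
have oV : mopen (M := @fc_total_mfd R A sn K car T k) (V j) by exact: (fc_mopenV H).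
have PE z : V j z -> P j z = mf_map j (pr z) by move=> [Tz jz]; have [_ ->] := fc_P H Tz jz.
have ck h : car k h -> car (cl j) h by rewrite e.
have dE (h : A) h' : mderiv (M := @fc_total_mfd R A sn K car T k) pr y (i := tt) h h' ->
    car k h /\ h' = fc_dP j (y, h).
  move=> dh; have hh : car k h by case: dh => [? _ [? _ []]].
  split=> //; apply: (@mderiv_unique _ (@fc_total_mfd R A sn K car T k) N pr tt j y (V j) (P j) h h'
     (fc_dP j (y, h)) (fc_total_is_mfd H k) (fc_is_mfd H) oV Vy) => //.
  - exact: (fc_V_sub H e).
  - by move=> _ [z [] _ ? <-].
  - exact: fc_dPP Vy (ck _ hh).
have [hu eu] := dE u u' du; have [hv ev] := dE v v' dv.
have [b [Lb db]] := fc_dLP_pm Vy.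
rewrite eu ev ey !db; try exact: ck.
split.
- by rewrite (fc_sgg b hu hv).
- by rewrite (fc_sgw b hu hv).
- exists (V j).
    by split=> //; [exact: (fc_V_sub H e) | move=> _ [z [_ ?] <-]].
  exists (P j) => //; split; first exact: fc_J_car.
  rewrite Lb fc_J_Vsg //; last exact: ck.
  by apply: fc_dPP => //; apply: ck; exact: fc_J_car.
Qed.

Lemma fc_dtrans i j p u : mf_dom i p -> mf_dom j p -> fs_car u ->
  is_dderiv (fc_trans (L := @L) (P := P) (i := i) j) (mf_map i p) u
    (fc_dP j (L (mf_map i p), fc_dL (mf_map i p, u))).
Proof.
move=> ip jp hu; have e := fc_class_overlap H ip jp.
have Op : fc_overlap (i := i) j (mf_map i p) by exists p.
have dc := @derives_comp _ (mf_mod i) (C (cl j)) (mf_mod j) _ _ _ (fc_overlap (i := i) j) (V j)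
  (@L i) (P j) (@fc_dL i) (fc_dP j) (fc_overlap_open H i j) (fc_open H j).
apply: dc Op hu.
- by move=> x; exact: (fc_overlap_V H).
- exact: fc_P_car.
- move=> x h Ox hh; rewrite -e; apply: fc_dLP => //; exact: (fc_overlap_sub Ox).
- exact: fc_dPP.
- exact: (Cn_cont (@fc_dP_smooth _ 0%N)).
Qed.

(** At each point of an overlap, the sections of the two charts and their differentials agree up to
    a common sign. *)
Lemma fc_kahler_compat : kahler_map fc_kahler fc_kahler id.
Proof.
move=> p i j ip jp u v u' v' du dv.
have e := fc_class_overlap H ip jp.
have oW : mopen (mf_dom i `&` mf_dom j).
  by apply: mopenI; [exact: (fc_is_mfd H) | exact: (fc_mopen_dom H)..].
have Wp : (mf_dom i `&` mf_dom j) p by [].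
have sW : mf_dom i `&` mf_dom j `<=` mf_dom i by move=> ? [].
have iW : id @` (mf_dom i `&` mf_dom j) `<=` mf_dom j by rewrite image_id => ? [].
have TE q : (mf_dom i `&` mf_dom j) q -> fc_trans (L := @L) (P := P) j (mf_map i q) = mf_map j q.
  by move=> [iq jq]; exact: (fc_transE H).
have dE h h' : mderiv id p h h' -> fs_car h /\ h' = fc_dP j (L (mf_map i p), @fc_dL i (mf_map i p, h)).
  move=> dh; have hh : fs_car h by case: dh => [? _ [? _ []]].
  split=> //; apply: (mderiv_unique (fc_is_mfd H) (fc_is_mfd H) oW Wp sW iW TE _ dh).
  exact: fc_dtrans.
have [hu eu] := dE u u' du; have [hv ev] := dE v v' dv.
have Di : D i (mf_map i p) by exists p.
have Vj : V j (L (mf_map i p)) by apply: (fc_overlap_V H); exists p.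
have e2 : P j (L (mf_map i p)) = mf_map j p by rewrite -TE.
have [b [Lb db]] := fc_dLP_pm Vj.
have cu : car (cl i) (fc_dL (mf_map i p, u)) by exact: fc_dL_car.
have cv : car (cl i) (fc_dL (mf_map i p, v)) by exact: fc_dL_car.
rewrite e2 in Lb db; rewrite /= eu ev !db -?e //; split.
- by rewrite (fc_sgg b cu cv).
- by rewrite (fc_sgw b cu cv).
- exists (mf_dom i `&` mf_dom j) => //.
  exists (fc_trans (L := @L) (P := P) (i := i) j) => //; split.
    by apply: fc_dP_car; [exact: (fc_L_in H) | exact: fc_J_car].
  rewrite Lb fc_J_Vsg -?e //.
  have cJ : fs_car (fc_dP i (L (mf_map i p), J0 (fc_dL (mf_map i p, u)))).
    by apply: fc_dP_car; [exact: (fc_L_in H) | exact: fc_J_car].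
  by have := fc_dtrans ip jp cJ; rewrite fc_dLdP //; exact: fc_J_car.
Qed.

(** Symmetry of the second derivative of the section, in the form needed for closedness of the
    two-form. *)
Lemma fc_second i x u v : D i x -> fs_car u -> fs_car v -> exists l, car (cl i) l /\
  is_dderiv (F := C (cl i)) (fun x => @fc_dL i (x, u)) x v l /\
  is_dderiv (F := C (cl i)) (fun x => @fc_dL i (x, v)) x u l.
Proof.
move=> Dx hu hv; have oD := fc_image H i.
have oT : fopen (tangent (D i)) by exact: fopen_tangent.
have [ddL dd Cdd] := Csmooth_derives oT (@fc_dL_smooth i).
have sym := @second_deriv_sym _ (mf_mod i) (C (cl i)) _ _ (D i) (@L i) (@fc_dL i) ddL oD
  (@fc_L_car _ _ _ _ _ _ _ _ _ _ _ H i) (@fc_dLP i) dd (Cn_cont (Cdd 0%N)).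
have part a b : fs_car a -> fs_car b ->
    is_dderiv (F := C (cl i)) (fun x => @fc_dL i (x, a)) x b (ddL ((x, a), (b, 0))).
  move=> ha hb.
  have hb0 : fs_car ((b, 0) : fs_prod (mf_mod i) (mf_mod i)) by split=> //; exact: fs_car0.
  have /is_dderivP[hl Hl] := dd (x, a) (b, 0) (conj Dx ha) hb0.
  apply/is_dderivP; split=> //; apply: tends_near Hl.
  apply: nearW => t _ /=; congr (_ *: (fc_dL _ - _)).
  by apply: injective_projections; rewrite /= ?scaler0 ?addr0.
exists (ddL ((x, u), (v, 0))); split; first by have [] := part u v hu hv.
by split; [exact: part | rewrite sym //; exact: part].
Qed.

Lemma fc_dderiv_bilin i (b : A -> A -> R) x v w u lv lw :
  @bilin R (C (cl i)) (C (cl i)) (fs_real R) b -> D i x -> fs_car v -> fs_car w -> fs_car u ->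
  is_dderiv (F := C (cl i)) (fun x => @fc_dL i (x, v)) x u lv ->
  is_dderiv (F := C (cl i)) (fun x => @fc_dL i (x, w)) x u lw ->
  is_dderiv (F := fs_real R) (fun x => b (fc_dL (x, v)) (fc_dL (x, w))) x u
    (b lv (@fc_dL i (x, w)) + b (@fc_dL i (x, v)) lw).
Proof.
move=> hb Dx hv hw hu /is_dderivP[cv Hv] /is_dderivP[cw Hw].
have oD := fc_image H i.
have near_D : (0 : R)^' [set t | D i (x + t *: u)] by exact: near0_line.
have cL a z : fs_car a -> D i z -> fs_car (@fc_dL i (z, a) : C (cl i)).
  by move=> ha Dz; exact: fc_dL_car.
have cLx a : fs_car a -> fs_car (@fc_dL i (x, a) : C (cl i)) by move=> ha; exact: cL.
apply/is_dderivP; split => //.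
pose qv t := t^-1 *: (@fc_dL i (x + t *: u, v) - fc_dL (x, v)) : C (cl i).
pose qw t := t^-1 *: (@fc_dL i (x + t *: u, w) - fc_dL (x, w)) : C (cl i).
have cqv : (0 : R)^' [set t | fs_car (qv t)].
  apply: filterS near_D => t Dt; apply: (@fs_carZ _ (C (cl i))).
  by apply: (@fs_carB _ (C (cl i))); apply: cL.
have cqw : (0 : R)^' [set t | fs_car (qw t)].
  apply: filterS near_D => t Dt; apply: (@fs_carZ _ (C (cl i))).
  by apply: (@fs_carB _ (C (cl i))); apply: cL.
have cw' : (0 : R)^' [set t | fs_car (@fc_dL i (x + t *: u, w) : C (cl i))].
  by apply: filterS near_D => t Dt; exact: cL.
apply: (@tends_near _ _ _ _ (fs_real R) _
  (fun t => b (qv t) (fc_dL (x + t *: u, w)) + b (fc_dL (x, v)) (qw t) : fs_real R)).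
  apply: filterS near_D => t Dt /=.
  have h1 := cL _ _ hv Dt; have h2 := cLx _ hv; have h3 := cL _ _ hw Dt; have h4 := cLx _ hw.
  have h5 : fs_car (fc_dL (x + t *: u, v) - fc_dL (x, v) : C (cl i)) by exact: (@fs_carB _ (C (cl i))).
  have h6 : fs_car (fc_dL (x + t *: u, w) - fc_dL (x, w) : C (cl i)) by exact: (@fs_carB _ (C (cl i))).
  rewrite /qv /qw (bilinZl hb) ?(bilinZr hb) ?(bilinBl hb) ?(bilinBr hb) //.
  by rewrite -scalerDr; congr (_ *: _); ring.
apply: (@tendsD _ _ _ _ (fs_real R)) => //; try exact: nearW.
- apply: (tends_bilin hb) => //; first exact: cLx.
  have Csec : fcont (D i) (fun z => @fc_dL i (z, w) : C (cl i)).
    apply: (@fcont_comp _ _ (fs_prod (mf_mod i) (mf_mod i)) (C (cl i)) (D i) (tangent (D i))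
      (fun z => (z, w)) (@fc_dL i)); last exact: (Cn_cont (@fc_dL_smooth _ 0%N)).
      by move=> z Dz; split.
    apply: (Cn_cont (n := 0)); apply: Cn_pair => //; last exact: Cn_cst.
    by apply: Cn_flin => //; exact: flin_id.
  apply: (@tends_fcont _ _ _ _ _ _ (D i) (fun z => @fc_dL i (z, w) : C (cl i)) (fun t => x + t *: u)) => //.
  by apply: tends_line => //; exact: (fopen_car oD Dx).
- apply: (tends_bilin hb) => //.
  + by apply: nearW => t _; exact: cLx.
  + exact: cLx.
  + exact: tends_cst.
Qed.

Lemma fc_bilin_smooth i (b : A -> A -> R) : @bilin R (C (cl i)) (C (cl i)) (fs_real R) b ->
  Csmooth (E := fs_prod (mf_mod i) (fs_prod (mf_mod i) (mf_mod i))) (F := fs_real R)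
    [set z | D i z.1 /\ fs_car z.2] (fun z => b (fc_dL (z.1, z.2.1)) (fc_dL (z.1, z.2.2))).
Proof.
move=> hb; set E := fs_prod _ _.
have oW : fopen (E := E) [set z : E | D i z.1 /\ fs_car z.2].
  by apply: fopen_setX; [exact: (fc_image H) | exact: fopen_fs_car].
have oT : fopen (tangent (D i)) by apply: fopen_tangent; exact: (fc_image H).
have part (T' : E -> mf_mod i) : flin T' -> (forall z : E, fs_car z.2 -> fs_car (T' z)) ->
    Csmooth (E := E) (F := C (cl i)) [set z : E | D i z.1 /\ fs_car z.2] (fun z => fc_dL (z.1, T' z)).
  move=> hT' cT'.
  apply: (@Csmooth_comp _ E (fs_prod (mf_mod i) (mf_mod i)) (C (cl i)) _ _ _ _ (tangent (D i))
    (fun z => (z.1, T' z)) (@fc_dL i)) => //.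
  - by move=> z [Dz cz]; split => //=; exact: cT'.
  - apply: Csmooth_flin => //; apply: flin_pair => //; exact: flin_fst.
  - exact: fc_dL_smooth.
apply: (Csmooth_bilin hb oW).
  apply: (part (fun z => z.2.1)); last by move=> z [].
  exact: (flin_comp (@flin_snd _ _ _ _ _) (@flin_fst _ _ _ _ _)).
apply: (part (fun z => z.2.2)); last by move=> z [].
exact: (flin_comp (@flin_snd _ _ _ _ _) (@flin_snd _ _ _ _ _)).
Qed.

Lemma fc_J_smooth i : Csmooth (E := fs_prod (mf_mod i) (mf_mod i)) (F := mf_mod i)
  (tangent (D i)) (fun z => fc_dP i (L z.1, J0 (fc_dL (z.1, z.2)))).
Proof.
have oD := fc_image H i.
have oT : fopen (tangent (D i)) by exact: fopen_tangent.
have oV : fopen (tangent (E := C (cl i)) (V i)) by apply: fopen_tangent; exact: (fc_open H).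
apply: (@Csmooth_comp _ _ (fs_prod (C (cl i)) (C (cl i))) _ _ _ _ (tangent (D i)) _
  (fun z => (L z.1, J0 (fc_dL (z.1, z.2)))) (fc_dP i) oT oV).
- move=> [x u] [Dx hu]; split; first exact: (fc_L_in H).
  by apply: fc_J_car; exact: fc_dL_car.
- apply: Csmooth_pair => //.
    apply: (@Csmooth_comp _ _ (mf_mod i) (C (cl i)) _ _ _ (tangent (D i)) (D i)
      (fun z => z.1) (@L i)) => //.
    + by move=> z [].
    + by apply: Csmooth_flin => //; exact: flin_fst.
    + exact: (fc_L_smooth H).
  apply: (@Csmooth_comp _ _ (C (cl i)) (C (cl i)) _ _ _ (tangent (D i)) (car (cl i))
      (fun z => fc_dL (z.1, z.2)) J0) => //.
  + exact: fopen_fs_car.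
  + by move=> [x u] [Dx hu]; exact: fc_dL_car.
  + by apply: Csmooth_eq (@fc_dL_smooth i) => // -[].
  + by apply: Csmooth_flin; [exact: (fk_J (hk _)) | exact: fopen_fs_car].
- exact: fc_dP_smooth.
Qed.

Lemma fc_dL_eq0 i x u : D i x -> fs_car u -> @fc_dL i (x, u) = 0 -> u = 0.
Proof.
move=> Dx hu e; rewrite -(fc_dPdL Dx hu) e.
exact: (@derives0 _ (C (cl i)) (mf_mod i) _ _ (V i) (P i) (fc_dP i) (fc_open H i)
    (@fc_P_car i) (@fc_dPP i) _ (fc_L_in H Dx)).
Qed.

Lemma fc_integrable : integrable fc_kahler.
Proof.
move=> p /(fc_cover H)[j jp].
pose S := V j `&` [set y | L (P j y) = y].
have oS : fopen (E := C (cl j)) S by exact: (fc_sheet_open H).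
have SV : S `<=` T `&` car (cl j) by move=> y [Vy _]; exact: (fc_V_sub H erefl Vy).
have mapS q : mf_dom j q -> S (L (mf_map j q)).
  move=> jq; have Dq : D j (mf_map j q) by exists q.
  by split; [exact: (fc_L_in H) | rewrite /= (fc_PL H)].
have smS i q : mf_dom i q -> mf_dom j q -> Csmooth (E := mf_mod i) (F := C (cl j))
    (fc_overlap (i := i) j) (fun x => L (fc_trans (L := @L) (P := P) j x)).
  move=> iq jq; apply: (@Csmooth_comp _ _ (mf_mod j) (C (cl j)) _ _ _ _ (D j)
     (fc_trans (L := @L) (P := P) (i := i) j) (@L j)).
  - exact: (fc_overlap_open H i j).
  - exact: (fc_image H).
  - by move=> x /(fc_overlap_V H) Vx; exact: (fc_P_in H).
  - exact: (fc_trans_smooth H).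
  - exact: (fc_L_smooth H).
exists (C (cl j)), J0, (mf_dom j), S, (fun q => L (mf_map j q)); split.
- split; first exact: (fc_frechet H).
  have hJ := fk_J (hk (cl j)); split.
  + exact: (flin_car hJ).
  + apply: (Cn_cont (n := 0)); apply: Cn_flin => //; exact: fopen_fs_car.
  + exact: (flin_lin hJ).
  + exact: (fk_JJ (hk (cl j))).
- by split=> //; exact: (fc_mopen_dom H).
- exact: oS.
- split.
    split=> [q [_ jq]|i [] q [iq jq] Sq].
      by split; [exact: mapS | exact: mapS].
    exists (@mf_dom R N i `&` mf_dom j).
      split=> //.
      * apply: mopen_restr => [|? []//].
        apply: mopenI; [exact: (fc_is_mfd H) | exact: (fc_mopen_dom H)..].
      * by move=> _ [z [iz jz] <-]; split; exact: mapS.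
    exists (fun x => L (fc_trans (L := @L) (P := P) (i := i) j x)); first exact: smS iq jq.
    by move=> z [iz jz]; rewrite (fc_transE H).
  exists pr.
    split=> [y [Sy _]|[] i]; last change (mf_idx N) in (type of i).
      case: Sy => [[Ty jy] _]; split => //; exact: (fc_pr H).
    move=> y [Sy _] [iy jy]; have Vi : V i y by split=> //; case: Sy => [[]].
    have cy : car (cl j) y by have [] := SV _ Sy.
    have e : car (cl j) = car (cl i) by exact: (fc_V_class H cy Vi).
    have oSV : fopen (E := C (cl j)) (S `&` V i) by apply: fopenI => //; exact: (fc_openV H).
    exists (S `&` V i).
      split=> //.
      * split=> [z [Sz _]|[]] //=.
        rewrite (_ : _ @` _ = S `&` V i) // image_id.
        by rewrite /= setIid; apply/seteqP; split=> [z [] //|z Sz]; split=> //; case: Sz.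
      * by move=> z [].
      * by move=> _ [z [Sz [_ iz]] <-]; split=> //; case: Sz => [[]].
    exists (P i); last by move=> z [_ [Tz iz]]; have [_ ->] := fc_P H Tz iz.
    have CP : Csmooth (E := C (cl j)) (V i) (P i) by exact: Csmooth_class_dom (esym e) (fc_P_smooth H i).
    by rewrite /= image_id => n; apply: Cn_sub (CP n) => z [].
  split=> [q jq|y [[Ty jy] e]]; first by have [_ ->] := fc_L H jq.
  by have [_ ->] := fc_P H Ty jy.
- move=> q i jq iq u u' du.
  have e := fc_class_overlap H iq jq.
  have hu : fs_car u by case: du => [? _ [? _ []]].
  have oW : mopen (mf_dom i `&` mf_dom j).
    by apply: mopenI; [exact: (fc_is_mfd H) | exact: (fc_mopen_dom H)..].
  have Wq : (mf_dom i `&` mf_dom j) q by [].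
  have sW : mf_dom i `&` mf_dom j `<=` mf_dom i by move=> ? [].
  have iW : (fun q => L (mf_map j q)) @` (mf_dom i `&` mf_dom j) `<=` S.
    by move=> _ [z [iz jz] <-]; exact: mapS.
  have FE z : (mf_dom i `&` mf_dom j) z ->
      L (fc_trans (L := @L) (P := P) j (mf_map i z)) = L (mf_map j z).
    by move=> [iz jz]; rewrite (fc_transE H).
  have Di : D i (mf_map i q) by exists q.
  have Dj : D j (mf_map j q) by exists q.
  have Vj : V j (L (mf_map i q)) by apply: (fc_overlap_V H); exists q.
  have e2 : P j (L (mf_map i q)) = mf_map j q by rewrite -(fc_transE H iq jq).
  have [b [Lb db]] := fc_dLP_pm Vj; rewrite e2 in Lb db.
  (* Read in the chart [i], the holomorphic chart is the section of [j] after a transition; its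
     differential is that of the section of [i] up to the sign [b]. *)
  have dF h : fs_car h -> is_dderiv (F := C (cl j))
      (fun x => L (fc_trans (L := @L) (P := P) (i := i) j x)) (mf_map i q) h
      (sg b (fc_dL (mf_map i q, h))).
    move=> hh; have cL : car (cl j) (fc_dL (mf_map i q, h)) by rewrite -e; exact: fc_dL_car.
    have [ddt dt_ _] : exists2 dt, derives (fc_overlap (i := i) j) (fc_trans (L := @L) (P := P) (i := i) j) dt &
        Csmooth (tangent (fc_overlap (i := i) j)) dt.
      by apply: Csmooth_derives; [exact: (fc_overlap_open H i j) | exact: (fc_trans_smooth H)].
    have Oq : fc_overlap (i := i) j (mf_map i q) by exists q.
    have dc := @derives_comp _ (mf_mod i) (mf_mod j) (C (cl j)) _ _ _ (fc_overlap (i := i) j) (D j)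
      (fc_trans (L := @L) (P := P) (i := i) j) (@L j) _ (@fc_dL j) (fc_overlap_open H i j) (fc_image H j)
      (fun x Ox => fc_P_in H (fc_overlap_V H Ox)) (@fc_L_car _ _ _ _ _ _ _ _ _ _ _ H j) dt_ (@fc_dLP j) (Cn_cont (@fc_dL_smooth _ 0%N)).
    have {}dc : is_dderiv (F := C (cl j)) (fun x => L (fc_trans (L := @L) (P := P) (i := i) j x))
        (mf_map i q) h (fc_dL (fc_trans (L := @L) (P := P) j (mf_map i q), ddt (mf_map i q, h))).
      exact: dc Oq hh.
    rewrite (fc_transE H) // in dc.
    have trF x : fc_overlap (i := i) j x -> fs_car (fc_trans (L := @L) (P := P) j x).
      by move=> /(fc_overlap_V H) Vx; exact: fc_P_car.
    rewrite (is_dderiv_unique (fc_overlap_open H i j) Oq hh trF (dt_ _ _ Oq hh) (fc_dtrans iq jq hh)) in dc.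
    by rewrite db in dc.
  have oSm : is_mfd (@fs_mfd R (C (cl j)) S) by exact: (@fs_is_mfd _ (C (cl j))).
  have eu' : u' = sg b (fc_dL (mf_map i q, u)).
    by apply: (mderiv_unique (fc_is_mfd H) oSm oW Wq sW iW FE (dF _ hu) du).
  have cu : car (cl i) (fc_dL (mf_map i q, u)) by exact: fc_dL_car.
  have cJ : fs_car (fc_dP i (L (mf_map i q), J0 (fc_dL (mf_map i q, u)))).
    by apply: fc_dP_car; [exact: (fc_L_in H) | exact: fc_J_car].
  exists (mf_dom i `&` mf_dom j) => //.
  exists (fun x => L (fc_trans (L := @L) (P := P) (i := i) j x)) => //; split=> //.
  have := dF _ cJ; rewrite fc_dLdP //; last exact: fc_J_car.
  by rewrite eu' (fc_J_sg b cu).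
Qed.

Lemma fc_is_kahler : is_kahler fc_kahler.
Proof.
have Dm i p : mf_dom i p -> D i (mf_map i p) by exists p.
split.
- exact: (fc_is_mfd H).
- exact: fc_kahler_compat.
- by move=> i; apply: fc_bilin_smooth; exact: (fk_g (hk _)).
- by move=> i; apply: fc_bilin_smooth; exact: (fk_w (hk _)).
- exact: fc_J_smooth.
- move=> i p ip; have Dx := Dm _ _ ip; have Vx := fc_L_in H Dx; split.
  + by move=> u hu; apply: fc_dP_car => //; apply: fc_J_car; exact: fc_dL_car.
  + apply: (@fcont_comp _ _ (fs_prod (mf_mod i) (mf_mod i)) _ _ (tangent (D i))
      (fun u => (mf_map i p, u)) (fun z => fc_dP i (L z.1, J0 (fc_dL (z.1, z.2))))).
    * by move=> u hu; split.
    * apply: (Cn_cont (n := 0)); apply: Cn_pair; first exact: fopen_fs_car.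
        by apply: Cn_cst; [exact: fopen_fs_car | exact: (fopen_car (fc_image H i) Dx)].
      by apply: Cn_flin; [exact: flin_id | exact: fopen_fs_car].
    * exact: (Cn_cont (@fc_J_smooth i 0%N)).
  + move=> a u v hu hv /=; have cu := fc_dL_car Dx hu; have cv := fc_dL_car Dx hv.
    rewrite fc_dL_lin // (flin_lin (fk_J (hk (cl i)))) // fc_dP_lin //; exact: fc_J_car.
  + move=> u hu /=; have cu := fc_dL_car Dx hu.
    rewrite fc_dLdP //; last exact: fc_J_car.
    rewrite (fk_JJ (hk (cl i))) //.
    by have := fc_dP_sg true Vx cu; rewrite /= => ->; rewrite fc_dPdL.
- move=> i p ip a u v w hu hv hw /=; have Dx := Dm _ _ ip.
  rewrite fc_dL_lin // (bilin_l (fk_g (hk (cl i)))) //; exact: fc_dL_car.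
- move=> i p ip u v hu hv /=; have Dx := Dm _ _ ip.
  by apply: (fk_sym (hk (cl i))); exact: fc_dL_car.
- move=> i p ip u hu u0 /=; have Dx := Dm _ _ ip.
  apply: (fk_pos (hk (cl i))); first exact: fc_dL_car.
  by move=> /(fc_dL_eq0 Dx hu).
- move=> i p ip a u v w hu hv hw /=; have Dx := Dm _ _ ip.
  rewrite fc_dL_lin // (bilin_l (fk_w (hk (cl i)))) //; exact: fc_dL_car.
- move=> i p ip u v hu hv /=; have Dx := Dm _ _ ip.
  by apply: (fk_alt (hk (cl i))); exact: fc_dL_car.
(* The two-form is tested on [u] and [J u], where it equals the metric on [u, u]. *)
- move=> i p ip u hu Hu; have Dx := Dm _ _ ip; have Vx := fc_L_in H Dx.
  have cu := fc_dL_car Dx hu.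
  apply: (fc_dL_eq0 Dx hu); apply: contrapT => /(fk_pos (hk (cl i)) cu).
  rewrite (fk_gw (hk (cl i)) cu cu).
  have cJ : fs_car (fc_dP i (L (mf_map i p), J0 (fc_dL (mf_map i p, u)))).
    by apply: fc_dP_car => //; exact: fc_J_car.
  have := Hu _ cJ; rewrite /= fc_dLdP // => [->|]; last exact: fc_J_car.
  by rewrite ltxx.
- move=> i p ip u v hu hv /=; have Dx := Dm _ _ ip.
  rewrite (fk_gw (hk (cl i))) ?fc_dLdP //; try exact: fc_dL_car.
  by apply: fc_J_car; exact: fc_dL_car.
(* Leibniz' rule gives six terms. Each of the symmetric second derivatives [luv], [lvw], [lwu]
   occurs in two of them, once in either argument of the alternating form, and they cancel. *)
- move=> i p ip u v w hu hv hw a b c /= da db dc; have Dx := Dm _ _ ip.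
  have [luv [cuv [uv vu]]] := fc_second Dx hu hv.
  have [lvw [cvw [vw wv]]] := fc_second Dx hv hw.
  have [lwu [cwu [wu uw]]] := fc_second Dx hw hu.
  have cu := fc_dL_car Dx hu; have cv := fc_dL_car Dx hv; have cw := fc_dL_car Dx hw.
  have hw0 := fk_w (hk (cl i)).
  have oD := fc_image H i.
  have cR (f : mf_mod i -> fs_real R) z : D i z -> fs_car (f z) by [].
  rewrite (is_dderiv_unique oD Dx hu (cR _) da (fc_dderiv_bilin hw0 Dx hv hw hu vu wu)).
  rewrite (is_dderiv_unique oD Dx hv (cR _) db (fc_dderiv_bilin hw0 Dx hw hu hv wv uv)).
  rewrite (is_dderiv_unique oD Dx hw (cR _) dc (fc_dderiv_bilin hw0 Dx hu hv hw uw vw)).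
  have alt := fk_alt (hk (cl i)).
  rewrite (alt _ _ cv cwu) (alt _ _ cw cuv) (alt _ _ cu cvw).
  by ring.
- exact: fc_integrable.
Qed.

End FlatCoverKahler.

(** * Curves on [0,2] *)

Section Curves.
Context {R : realType}.
Implicit Types (V W : normedModType R) (t s : R).

Definition near02 t : set_system R := within [set s | in02 s] t^'.

Lemma near02P t (P : set R) :
  near02 t P <-> exists2 d, 0 < d & forall s, in02 s -> s != t -> `|s - t| < d -> P s.
Proof.
split=> [[d /= d0 H]|[d d0 H]]; exists d => //.
  by move=> s s02 st sd; apply: H; rewrite //= distrC.
by move=> s /= sd st s02; apply: H => //; rewrite distrC.
Qed.

Lemma near02_filter t : Filter (near02 t).
Proof. exact: within_filter. Qed.
#[export] Existing Instance near02_filter.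

Lemma near02_proper t : in02 t -> ProperFilter (near02 t).
Proof.
move=> /andP[t0 t2]; apply: Build_ProperFilter_ex => P /near02P[d d0 H].
pose e := Num.min (d / 2) 1; have e0 : 0 < e by rewrite lt_min divr_gt0 /=.
have ed : e < d by rewrite (@le_lt_trans _ _ (d / 2)) ?ge_min ?lexx // ltr_pdivrMr // ltr_pMr // ltr1n.
have e1 : e <= 1 by rewrite ge_min lexx orbT.
(* Step inwards, so as to stay in [0,2] at the endpoints too. *)
have [t1|t1] := leP t 1.
  exists (t + e); apply: H; rewrite ?/in02.
  - by apply/andP; split; lra.
  - by rewrite gt_eqF // ltrDl.
  - by rewrite addrAC subrr add0r gtr0_norm.
exists (t - e); apply: H; rewrite ?/in02.
- by apply/andP; split; lra.
- by rewrite lt_eqF // ltrBlDr ltrDl.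
- by rewrite addrAC subrr add0r normrN gtr0_norm.
Qed.

(** A relation, in contrast to [deriv02], which has a default value where the limit fails to
    exist. *)
Definition isd V (f g : R -> V) : Prop :=
  forall t, in02 t -> diff_quot f t s @[s --> near02 t] --> g t.

Lemma on02E V (f : R -> V) t : in02 t -> on02 f t = f t.
Proof. by rewrite /on02 => ->. Qed.

Lemma on02_eq V (f g : R -> V) : (forall t, in02 t -> f t = g t) -> on02 f = on02 g.
Proof. by move=> fg; apply/funext => t; rewrite /on02; case: ifPn => // /fg. Qed.

Lemma on02_on02 V (f : R -> V) : on02 (on02 f) = on02 f.
Proof. by apply: on02_eq => t t02; rewrite on02E. Qed.

Lemma eq_on02 V (f g : R -> V) : on02 f = f -> on02 g = g ->
  (forall t, in02 t -> f t = g t) -> f = g.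
Proof. by move=> f02 g02 fg; rewrite -f02 -g02; exact: on02_eq. Qed.

Lemma on02_deriv V (f : R -> V) : on02 (deriv02 f) = deriv02 f.
Proof. exact: on02_on02. Qed.

Lemma isd_eq V (f g f' g' : R -> V) : (forall t, in02 t -> f t = f' t) ->
  (forall t, in02 t -> g t = g' t) -> isd f g -> isd f' g'.
Proof.
move=> ff' gg' fg t t02; rewrite -gg' //; apply: cvg_trans (fg t t02).
apply: near_eq_cvg; apply/near02P; exists 1 => // s s02 _ _.
by rewrite /diff_quot !ff'.
Qed.

Lemma deriv02E V (f g : R -> V) t : isd f g -> in02 t -> deriv02 f t = g t.
Proof.
move=> fg t02; rewrite /deriv02 on02E //.
have := near02_proper t02 => ?.
exact: (@cvg_lim _ (@norm_hausdorff _ _) _ _ _ _ _ (fg t t02)).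
Qed.

Lemma deriv02_isd V (f g : R -> V) : isd f g -> on02 g = g -> deriv02 f = g.
Proof.
move=> fg g02; apply: eq_on02 => //; first exact: on02_deriv.
by move=> t t02; exact: deriv02E.
Qed.

Definition diff02 V (f : R -> V) : Prop :=
  forall t, in02 t -> cvg (diff_quot f t s @[s --> near02 t]).

Lemma diff02_isd V (f : R -> V) : diff02 f -> isd f (deriv02 f).
Proof. by move=> df t t02; rewrite /deriv02 on02E //; exact: df. Qed.

Lemma isd_diff02 V (f g : R -> V) : isd f g -> diff02 f.
Proof. by move=> fg t t02; apply/cvg_ex; exists (g t); exact: fg. Qed.

Lemma isd_cont V (f g : R -> V) : isd f g -> forall t, in02 t -> f s @[s --> near02 t] --> f t.
Proof.
move=> fg t t02.
have fE : f t = (t - t) *: g t + f t by rewrite subrr scale0r add0r.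
have : (s - t) *: diff_quot f t s + f t @[s --> near02 t] --> (t - t) *: g t + f t.
  apply: cvgD; last exact: cvg_cst.
  apply: cvgZ; last exact: fg.
  apply: cvgB; last exact: cvg_cst.
  by apply: cvg_within_filter; apply: cvg_within_filter.
rewrite -fE; apply: cvg_trans; apply: near_eq_cvg; apply/near02P; exists 1 => // s _ st _.
by rewrite /diff_quot scalerA divff ?subr_eq0 // scale1r subrK.
Qed.

Lemma isd_cst V (c : V) : isd (fun=> c) (fun=> 0).
Proof.
move=> t t02; apply: cvg_trans (@cvg_cst _ (0 : V) _ (near02 t) _).
by apply: near_eq_cvg; apply: nearW => s; rewrite /diff_quot subrr scaler0.
Qed.

Lemma isdD V (f g f' g' : R -> V) : isd f f' -> isd g g' ->
  isd (fun t => f t + g t) (fun t => f' t + g' t).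
Proof.
move=> ff' gg' t t02; have : diff_quot f t s + diff_quot g t s @[s --> near02 t] --> f' t + g' t.
  by apply: cvgD; [exact: ff' | exact: gg'].
apply: cvg_trans; apply: near_eq_cvg; apply: nearW => s /=.
by rewrite /diff_quot -scalerDr opprD addrACA.
Qed.

Record blin V W (l : V -> W) : Prop := {
  blin_lin : forall a x y, l (a *: x + y) = a *: l x + l y;
  blin_bound : exists2 C, 0 < C & forall x, `|l x| <= C * `|x| }.

Lemma blinB V W (l : V -> W) x y : blin l -> l (x - y) = l x - l y.
Proof. by move=> hl; rewrite addrC -scaleN1r (blin_lin hl) scaleN1r addrC. Qed.

Lemma blin0 V W (l : V -> W) : blin l -> l 0 = 0.
Proof. by move=> hl; rewrite -(subrr (0 : V)) (blinB _ _ hl) subrr. Qed.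

Lemma blinZ V W (l : V -> W) a x : blin l -> l (a *: x) = a *: l x.
Proof. by move=> hl; rewrite -[a *: x]addr0 (blin_lin hl) (blin0 hl) addr0. Qed.

Lemma blin_cvg V W (l : V -> W) I (F : set_system I) {fF : Filter F} (f : I -> V) x :
  blin l -> f i @[i --> F] --> x -> l (f i) @[i --> F] --> l x.
Proof.
move=> hl fx; have [C C0 lC] := blin_bound hl.
apply/cvgrPdist_lt => e e0.
have /cvgrPdist_lt /(_ (e / C) (divr_gt0 e0 C0)) := fx.
apply: filterS => i; rewrite ltr_pdivlMr // mulrC -(blinB _ _ hl) => H.
exact: le_lt_trans (lC _) H.
Qed.

Lemma isd_blin V W (l : V -> W) (f f' : R -> V) : blin l -> isd f f' ->
  isd (fun t => l (f t)) (fun t => l (f' t)).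
Proof.
move=> hl ff' t t02.
have : l (diff_quot f t s) @[s --> near02 t] --> l (f' t).
  by apply: blin_cvg => //; exact: ff'.
apply: cvg_trans; apply: near_eq_cvg; apply: nearW => s.
by rewrite /diff_quot (blinZ _ _ hl) (blinB _ _ hl).
Qed.

Definition cmul (f g : R -> R^o) : R -> R^o := fun t => (f t : R) * (g t : R).

Lemma isd_mul (f g f' g' : R -> R^o) : isd f f' -> isd g g' ->
  isd (cmul f g) (cmul f' g + cmul f g').
Proof.
move=> ff' gg' t t02; have cg := isd_cont gg' t02.
have : (diff_quot f t s : R) * (g s : R) + (f t : R) * (diff_quot g t s : R)
    @[s --> near02 t] --> ((f' t : R) * (g t : R) + (f t : R) * (g' t : R)).
  apply: cvgD; apply: cvgM => //; [exact: ff' | exact: cvg_cst | exact: gg'].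
apply: cvg_trans; apply: near_eq_cvg; apply: nearW => s.
rewrite /diff_quot /cmul /GRing.scale /=; ring.
Qed.

(** Chosen as the basic nonlinear operation: its derivative [- f' r^3 / 2] is polynomial in itself
    and [f'], and with products it yields reciprocals and norms. *)
Definition crsqrt (f : R -> R^o) : R -> R^o := on02 (fun t => (Num.sqrt (f t : R))^-1 : R^o).

(** With [y - x] factored out, the other factors have limits; the same formula gives the derivative
    in [t] and, for whole curves, the derivative with respect to the curve. *)
Lemma rsqrtB (x y : R) : 0 < x -> 0 < y ->
  (Num.sqrt y)^-1 - (Num.sqrt x)^-1 =
  - (y - x) * ((Num.sqrt x)^-1 ^+ 2 * (Num.sqrt y)^-1 ^+ 2 / ((Num.sqrt x)^-1 + (Num.sqrt y)^-1)).
Proof.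
move=> x0 y0; have sx : 0 < Num.sqrt x by rewrite sqrtr_gt0.
have sy : 0 < Num.sqrt y by rewrite sqrtr_gt0.
have ex : x = Num.sqrt x ^+ 2 by rewrite sqr_sqrtr // ltW.
have ey : y = Num.sqrt y ^+ 2 by rewrite sqr_sqrtr // ltW.
rewrite {2}ey {2}ex; field.
by rewrite !gt_eqF // addr_gt0.
Qed.

Lemma isd_rsqrt (f f' : R -> R^o) : isd f f' -> (forall t, in02 t -> 0 < (f t : R)) ->
  isd (crsqrt f) (fun t => - 2^-1 * ((crsqrt f t : R) ^+ 3 * (f' t : R)) : R^o).
Proof.
move=> ff' f0 t t02; have cf := isd_cont ff' t02.
pose r s := (Num.sqrt (f s : R))^-1.
have r0 s : in02 s -> 0 < r s by move=> /f0 fs; rewrite invr_gt0 sqrtr_gt0.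
have cr : r s @[s --> near02 t] --> r t.
  apply: cvgV; first by rewrite gt_eqF // sqrtr_gt0 f0.
  exact: (@cvg_comp _ _ _ f (@Num.sqrt R) (near02 t) _ _ cf (@sqrt_continuous R (f t))).
have e2 : crsqrt f t = r t by rewrite /crsqrt on02E.
have -> : - 2^-1 * ((crsqrt f t : R) ^+ 3 * (f' t : R)) =
    - f' t * (r t ^+ 2 * r t ^+ 2 / (r t + r t)) :> R.
  by rewrite e2; field; rewrite gt_eqF //= ?r0 // addr_gt0 ?r0.
have : - (diff_quot f t s : R) * (r t ^+ 2 * r s ^+ 2 / (r t + r s))
    @[s --> near02 t] --> - (f' t : R) * (r t ^+ 2 * r t ^+ 2 / (r t + r t)).
  apply: cvgM; first by apply: cvgN; exact: ff'.
  apply: cvgM.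
    apply: cvgM; first exact: cvg_cst.
    by rewrite expr2; under eq_fun do rewrite expr2; exact: cvgM.
  apply: cvgV; first by rewrite gt_eqF // addr_gt0 // r0.
  by apply: cvgD => //; exact: cvg_cst.
apply: cvg_trans; apply: near_eq_cvg; apply/near02P; exists 1 => // s s02 st _.
rewrite /diff_quot /crsqrt !on02E // /GRing.scale /= rsqrtB; try exact: f0.
by rewrite /r; ring.
Qed.

Definition endc (o : option bool) V (f : R -> V) : Prop :=
  match o with None => True | Some b => f 2 = sg b (f 0) end.

(** Smoothness of finite order with the end condition on each derivative. Closure properties are
    proved by induction on [n] and passed to all orders by [clsP]. *)
Fixpoint Dn (o : option bool) (n : nat) V (f : R -> V) : Prop :=
  [/\ on02 f = f, endc o f, diff02 f & if n is m.+1 then Dn o m (deriv02 f) else True].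

(** One index for paths, loops and antiloops, so that each closure property is proved once. *)
Definition cls (o : option bool) (V : normedModType R) : set (R -> V) :=
  match o with
  | None => @smooth_curve R V
  | Some false => @smooth_loop R V
  | Some true => @smooth_antiloop R V
  end.

Lemma smooth_curve_deriv V (f : R -> V) : smooth_curve f -> smooth_curve (deriv02 f).
Proof.
move=> [f02 df]; split=> [|k t t02]; first exact: on02_deriv.
by rewrite -iterSr; exact: df.
Qed.

Lemma clsE o V (f : R -> V) :
  cls o f <-> smooth_curve f /\ forall k, endc o (iter k (@deriv02 R V) f).
Proof.
by case: o => [[]|] /=; split=> // -[].
Qed.

Lemma clsP o V (f : R -> V) : cls o f <-> forall n, Dn o n f.
Proof.
rewrite clsE; split=> [[sf ef] n|H].
  elim: n f sf ef => [|n IH] f sf ef; (split; [by case: sf | exact: ef 0%N | by case: sf => _ /(_ 0%N)|]) => //.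
  by apply: IH => [|k]; [exact: smooth_curve_deriv | rewrite -iterSr; exact: ef].
have Hk k n : Dn o n (iter k (@deriv02 R V) f).
  elim: k n => [|k IH] n; first exact: H.
  by have [] := IH n.+1.
split=> [|k]; last by have [] := Hk k 0%N.
by split=> [|k t]; [have [] := H 0%N | have [_ _ + _] := Hk k 0%N; exact].
Qed.

Lemma Dn_le o n V (f : R -> V) : Dn o n.+1 f -> Dn o n f.
Proof. by elim: n f => [|n IH] f [? ? ? H]; split=> //; exact: IH. Qed.

Lemma Dn_on o n V (f : R -> V) : Dn o n f -> on02 f = f.
Proof. by case: n => [|n] []. Qed.

Lemma Dn_isd o n V (f : R -> V) : Dn o n f -> isd f (deriv02 f).
Proof. by case: n => [|n] [? ? df _]; exact: diff02_isd. Qed.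

Lemma DnS o n V (f g : R -> V) : on02 f = f -> endc o f -> isd f g -> Dn o n g -> Dn o n.+1 f.
Proof.
move=> f02 ef fg Dg; split=> //; first exact: isd_diff02 fg.
by rewrite (deriv02_isd fg (Dn_on Dg)).
Qed.

Lemma endc_blin o V W (l : V -> W) (f : R -> V) : blin l -> endc o f -> endc o (fun t => l (f t)).
Proof.
move=> hl; case: o => [[]|] //= ->; last by [].
by rewrite -scaleN1r (blinZ _ _ hl) scaleN1r.
Qed.

Lemma on02_blin V W (l : V -> W) (f : R -> V) : blin l -> on02 f = f ->
  on02 (fun t => l (f t)) = (fun t => l (f t)).
Proof.
move=> hl f02; apply/funext => t; rewrite /on02; case: ifPn => // t02.
by rewrite -f02 /on02 (negPf t02) (blin0 hl).
Qed.

Lemma Dn_blin o n V W (l : V -> W) (f : R -> V) : blin l -> Dn o n f -> Dn o n (fun t => l (f t)).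
Proof.
move=> hl; elim: n f => [|n IH] f Df.
  case: Df => f02 ef df _; split=> //; [exact: on02_blin | exact: endc_blin|].
  exact: isd_diff02 (isd_blin hl (diff02_isd df)).
case: Df => f02 ef df Df; apply: DnS (IH _ Df); [exact: on02_blin | exact: endc_blin|].
exact: isd_blin (diff02_isd df).
Qed.

Lemma cls_blin o V W (l : V -> W) (f : R -> V) : blin l -> cls o f -> cls o (fun t => l (f t)).
Proof. by move=> hl /clsP Df; apply/clsP => n; exact: Dn_blin. Qed.

Lemma deriv02_blin V W (l : V -> W) (f : R -> V) : blin l -> diff02 f ->
  deriv02 (fun t => l (f t)) = (fun t => l (deriv02 f t)).
Proof.
move=> hl df; apply: deriv02_isd; first exact: isd_blin (diff02_isd df).
by apply: on02_blin => //; exact: on02_deriv.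
Qed.

Lemma endcD o V (f g : R -> V) : endc o f -> endc o g -> endc o (f + g).
Proof.
case: o => [[]|] //=; rewrite !fctE => -> -> //; by rewrite opprD.
Qed.

Lemma on02D V (f g : R -> V) : on02 f = f -> on02 g = g -> on02 (f + g) = f + g.
Proof.
move=> f02 g02; apply/funext => t; rewrite /on02 !fctE; case: ifPn => // t02.
by rewrite -f02 -g02 /on02 (negPf t02) addr0.
Qed.

Lemma DnD o n V (f g : R -> V) : Dn o n f -> Dn o n g -> Dn o n (f + g).
Proof.
elim: n f g => [|n IH] f g [f02 ef df Df] [g02 eg dg Dg].
  split=> //; [exact: on02D | exact: endcD|].
  exact: isd_diff02 (isdD (diff02_isd df) (diff02_isd dg)).
apply: DnS (IH _ _ Df Dg); [exact: on02D | exact: endcD|].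
exact: isdD (diff02_isd df) (diff02_isd dg).
Qed.

Lemma Dn0 o n V : Dn o n (0 : R -> V).
Proof.
have e0 : on02 (0 : R -> V) = 0 by apply/funext => t; rewrite /on02; case: ifP.
have ee : endc o (0 : R -> V) by case: o => [[]|] //=; rewrite oppr0.
elim: n => [|n IH]; first by split=> //; exact: isd_diff02 (isd_cst 0).
by apply: DnS IH => //; exact: isd_cst.
Qed.

(** End signs multiply: the product of two antiloops is a loop. *)
Definition omul (o o' : option bool) : option bool :=
  if o is Some b then if o' is Some b' then Some (b (+) b') else None else None.

Lemma endcM o o' (f g : R -> R^o) : endc o f -> endc o' g -> endc (omul o o') (cmul f g).
Proof.
case: o => [b|] //; case: o' => [b'|] //=; rewrite /cmul => -> ->.
by case: b; case: b' => /=; ring.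
Qed.

Lemma on02M (f g : R -> R^o) : on02 f = f -> on02 (cmul f g) = cmul f g.
Proof.
move=> f02; apply/funext => t; rewrite /on02 /cmul; case: ifPn => // t02.
by rewrite -f02 /on02 (negPf t02) mul0r.
Qed.

Lemma DnM o o' n (f g : R -> R^o) : Dn o n f -> Dn o' n g -> Dn (omul o o') n (cmul f g).
Proof.
elim: n f g => [|n IH] f g Df Dg.
  case: Df Dg => [f02 ef df _] [g02 eg dg _]; split=> //; [exact: on02M | exact: endcM|].
  exact: isd_diff02 (isd_mul (diff02_isd df) (diff02_isd dg)).
have Df' := Dn_le Df; have Dg' := Dn_le Dg.
case: Df Dg => [f02 ef df Df] [g02 eg dg Dg].
apply: (DnS (g := cmul (deriv02 f) g + cmul f (deriv02 g))); [exact: on02M | exact: endcM| |].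
  exact: isd_mul (diff02_isd df) (diff02_isd dg).
by apply: DnD; exact: IH.
Qed.

Lemma cls_mul o o' (f g : R -> R^o) : cls o f -> cls o' g -> cls (omul o o') (cmul f g).
Proof. by move=> /clsP Df /clsP Dg; apply/clsP => n; exact: DnM. Qed.

Lemma clsD o V (f g : R -> V) : cls o f -> cls o g -> cls o (f + g).
Proof. by move=> /clsP Df /clsP Dg; apply/clsP => n; exact: DnD. Qed.

Lemma cls0 o V : cls o (0 : R -> V).
Proof. by apply/clsP => n; exact: Dn0. Qed.

Lemma blin_scale V (a : R) : @blin V V ( *:%R a).
Proof.
split=> [b x y|]; first by rewrite scalerDr !scalerA mulrC.
exists (`|a| + 1); first by rewrite ltr_wpDl.
by move=> x; rewrite normrZ ler_wpM2r // lerDl.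
Qed.

Lemma clsZ o V a (f : R -> V) : cls o f -> cls o (a *: f).
Proof. exact: (cls_blin (blin_scale V a)). Qed.

Lemma clsN o V (f : R -> V) : cls o f -> cls o (- f).
Proof. by rewrite -scaleN1r; exact: clsZ. Qed.

Lemma clsB o V (f g : R -> V) : cls o f -> cls o g -> cls o (f - g).
Proof. by move=> cf cg; apply: clsD => //; exact: clsN. Qed.

Lemma cls_smooth o V (f : R -> V) : cls o f -> smooth_curve f.
Proof. by case: o => [[]|] // []. Qed.

Lemma cls_on o V (f : R -> V) : cls o f -> on02 f = f.
Proof. by move=> /cls_smooth[]. Qed.

Lemma cls_out o V (f : R -> V) t : cls o f -> ~~ in02 t -> f t = 0.
Proof. by move=> /cls_on <- t02; rewrite /on02 (negPf t02). Qed.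

Lemma cls_isd o V (f : R -> V) : cls o f -> isd f (deriv02 f).
Proof. by move=> /clsP /(_ 0%N) /Dn_isd. Qed.

Lemma cls_deriv o V (f : R -> V) : cls o f -> cls o (deriv02 f).
Proof. by move=> /clsP Df; apply/clsP => n; have [] := Df n.+1. Qed.

Lemma cls_isdP o V (f g : R -> V) : on02 f = f -> endc o f -> isd f g -> cls o g -> cls o f.
Proof.
move=> f02 ef fg /clsP Dg; apply/clsP => -[|n]; last exact: DnS (Dg n).
by split=> //; exact: isd_diff02 fg.
Qed.

(** The classes stable under products, namely paths and loops. Stated as an equation it can be used
    for rewriting before [cls_mul]. *)
Definition per_even (o : option bool) := o = omul o o.

Lemma per_evenP o : per_even o -> o = None \/ o = Some false.
Proof. by case: o => [[]|] //; [right|left]. Qed.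

Lemma endc_rsqrt o (f : R -> R^o) : per_even o -> endc o f -> endc o (crsqrt f).
Proof.
by move=> /per_evenP[]-> //=; rewrite /crsqrt !on02E /in02 ?lexx ?ler0n // => ->.
Qed.

(** The derivative of [r = 1 / sqrt f] is [- r^3 f' / 2], of order [n] as soon as [r] and [f']
    are. *)
Lemma Dn_rsqrt o n (f : R -> R^o) : per_even o -> (forall t, in02 t -> 0 < (f t : R)) ->
  Dn o n f -> Dn o n (crsqrt f).
Proof.
move=> ho f0; elim: n => [|n IH] Df; have [f02 ef df Df'] := Df.
  split=> //; [exact: on02_on02 | exact: endc_rsqrt|].
  exact: isd_diff02 (isd_rsqrt (diff02_isd df) f0).
pose r := crsqrt f; have Dr : Dn o n r by apply: IH; exact: Dn_le.
apply: (DnS (g := (- 2^-1) *: cmul (cmul r (cmul r r)) (deriv02 f))).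
- exact: on02_on02.
- exact: endc_rsqrt.
- by apply: isd_eq (isd_rsqrt (diff02_isd df) f0).
- apply: (Dn_blin (blin_scale _ _)).
  by rewrite ho; apply: DnM => //; rewrite ho; apply: DnM => //; rewrite ho; exact: DnM.
Qed.

Lemma cls_rsqrt o (f : R -> R^o) : per_even o -> (forall t, in02 t -> 0 < (f t : R)) ->
  cls o f -> cls o (crsqrt f).
Proof. by move=> ho f0 /clsP Df; apply/clsP => n; exact: Dn_rsqrt. Qed.

Lemma cls_cst o (c : R) : per_even o -> cls o (on02 (fun=> c : R^o)).
Proof.
move=> ho; apply: (cls_isdP (g := 0)); [exact: on02_on02| | |exact: cls0].
  by case: (per_evenP ho) => -> //=; rewrite !on02E // /in02 ?lexx ?ler0n.
by apply: isd_eq (isd_cst c) => // t t02; rewrite on02E.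
Qed.

End Curves.

(** * Spaces of curves *)

Section CurveSpaces.
Context {R : realType}.
Implicit Types (V W : normedModType R) (t s : R) (o : option bool).

Definition supnorm V (f : R -> V) : R := sup [set `|f t| | t in [set t | in02 t]].

Definition csn V (k : nat) (f : R -> V) : R :=
  \sum_(j < k.+1) supnorm (iter j (@deriv02 R V) f).

Definition curves o V : fspace R := curve_fs (@cls R o) V.

Lemma csnE o V k f : fs_sn (f := curves o V) k f = csn k f.
Proof. by []. Qed.

Lemma csn0 V (f : R -> V) : csn 0 f = supnorm f.
Proof. by rewrite /csn big_ord_recl big_ord0 addr0. Qed.

Lemma csnS V k (f : R -> V) : csn k.+1 f = supnorm f + csn k (deriv02 f).
Proof.
rewrite /csn big_ord_recl; congr (_ + _).
by apply: eq_bigr => i _; rewrite -iterSr.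
Qed.

Lemma in02_0 : @in02 R 0. Proof. by rewrite /in02 lexx ler0n. Qed.

Lemma isd_continuous V (f g : R -> V) : isd f g -> {within `[0, 2], continuous f}.
Proof.
move=> fg; apply/subspace_continuousP => t; rewrite /= in_itv /= => t02.
apply/cvgrPdist_lt => e e0.
have /cvgrPdist_lt /(_ e e0) /near02P[d d0 H] := isd_cont fg t02.
exists d => //= s /= sd s02.
have [->|st] := eqVneq s t; first by rewrite subrr normr0.
by apply: H; rewrite // 1?distrC //; move: s02; rewrite in_itv.
Qed.

Lemma isd_bounded V (f g : R -> V) : isd f g -> exists2 M : R, 0 < M & forall t, in02 t -> `|f t| <= M.
Proof.
move=> fg; have cf := isd_continuous fg.
have cn : {within `[0, 2], continuous (fun t => `|f t|)}.
  by move=> t; apply: continuous_comp; [exact: cf | exact: norm_continuous].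
have [c c02 H] := EVT_max (ler0n R 2) cn.
exists (`|f c| + 1); first by rewrite ltr_wpDl.
by move=> t t02; rewrite (le_trans (H t _)) ?lerDl // in_itv.
Qed.

Lemma supnorm_set V (f : R -> V) : [set `|f t| | t in [set t | in02 t]] !=set0.
Proof. by exists `|f 0|, 0 => //=; exact: in02_0. Qed.

Lemma supnorm_ge V (f g : R -> V) t : isd f g -> in02 t -> `|f t| <= supnorm f.
Proof.
move=> fg t02; apply: ub_le_sup; last by exists t.
have [M _ HM] := isd_bounded fg; by exists M => _ [s /= s02 <-]; exact: HM.
Qed.

Lemma supnorm_le V (f : R -> V) c : (forall t, in02 t -> `|f t| <= c) -> supnorm f <= c.
Proof. by move=> H; apply: ge_sup; [exact: supnorm_set | move=> _ [t /= t02 <-]; exact: H]. Qed.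

Lemma supnorm_ge0 V (f : R -> V) : diff02 f -> 0 <= supnorm f.
Proof. by move=> /diff02_isd fg; apply: le_trans (supnorm_ge fg in02_0). Qed.

Lemma cls_diff o V (f : R -> V) : cls o f -> diff02 f.
Proof. by move=> /cls_isd /isd_diff02. Qed.

Lemma cls_sup o V (f : R -> V) t : cls o f -> in02 t -> `|f t| <= supnorm f.
Proof. by move=> /cls_isd fg; exact: (supnorm_ge fg). Qed.

Lemma supnormZ V a (f : R -> V) : diff02 f -> supnorm (a *: f) = `|a| * supnorm f.
Proof.
move=> df; have fg := diff02_isd df; apply/eqP; rewrite eq_le; apply/andP; split.
  by apply: supnorm_le => t t02; rewrite fctE normrZ ler_wpM2l //; exact: (supnorm_ge fg).
have [->|a0] := eqVneq a 0.
  rewrite normr0 mul0r; apply: supnorm_ge0.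
  have -> : 0 *: f = (fun=> 0) by apply/funext => t; rewrite fctE scale0r.
  exact: isd_diff02 (isd_cst 0).
rewrite mulrC -ler_pdivlMr ?normr_gt0 //; apply: supnorm_le => t t02.
rewrite ler_pdivlMr ?normr_gt0 // mulrC -normrZ.
by apply: (supnorm_ge (f := a *: f) (isd_blin (blin_scale V a) fg)).
Qed.

Lemma supnormD V (f g : R -> V) : diff02 f -> diff02 g -> supnorm (f + g) <= supnorm f + supnorm g.
Proof.
move=> /diff02_isd ff /diff02_isd gg; apply: supnorm_le => t t02.
by rewrite fctE (le_trans (ler_normD _ _)) // lerD //; [exact: (supnorm_ge ff) | exact: (supnorm_ge gg)].
Qed.

Lemma deriv02D V (f g : R -> V) : diff02 f -> diff02 g ->
  deriv02 (f + g) = deriv02 f + deriv02 g.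
Proof.
move=> df dg; apply: deriv02_isd; first exact: isdD (diff02_isd df) (diff02_isd dg).
by apply: on02D; exact: on02_deriv.
Qed.

Lemma deriv02Z V a (f : R -> V) : diff02 f -> deriv02 (a *: f) = a *: deriv02 f.
Proof. exact: (deriv02_blin (blin_scale V a)). Qed.

Lemma csnZ o V k a (f : R -> V) : cls o f -> csn k (a *: f) = `|a| * csn k f.
Proof.
elim: k f => [|k IH] f cf; first by rewrite !csn0 supnormZ //; exact: cls_diff cf.
have df := cls_diff cf.
by rewrite !csnS mulrDr supnormZ // deriv02Z // IH //; exact: cls_deriv.
Qed.

Lemma csnD o V k (f g : R -> V) : cls o f -> cls o g -> csn k (f + g) <= csn k f + csn k g.
Proof.
elim: k f g => [|k IH] f g cf cg; have df := cls_diff cf; have dg := cls_diff cg.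
  by rewrite !csn0; exact: supnormD.
rewrite !csnS addrACA lerD ?supnormD // deriv02D // IH //; exact: cls_deriv.
Qed.

Lemma csn_ge0 o V k (f : R -> V) : cls o f -> 0 <= csn k f.
Proof.
elim: k f => [|k IH] f cf; have df := cls_diff cf; first by rewrite csn0 supnorm_ge0.
by rewrite csnS addr_ge0 ?supnorm_ge0 // IH //; exact: cls_deriv.
Qed.

Lemma csn_le o V k (f : R -> V) : cls o f -> csn k f <= csn k.+1 f.
Proof.
elim: k f => [|k IH] f cf; have df := cls_diff cf.
  by rewrite csnS [leLHS]csn0 lerDl (csn_ge0 _ (cls_deriv cf)).
by rewrite csnS [leRHS]csnS lerD2l IH //; exact: cls_deriv.
Qed.

Lemma csn_deriv o V k (f : R -> V) : cls o f -> csn k (deriv02 f) <= csn k.+1 f.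
Proof. by move=> cf; rewrite csnS lerDr supnorm_ge0 //; exact: cls_diff cf. Qed.

Lemma supnorm_csn o V k (f : R -> V) : cls o f -> supnorm f <= csn k f.
Proof.
case: k => [|k] cf; first by rewrite csn0.
by rewrite csnS lerDl (csn_ge0 _ (cls_deriv cf)).
Qed.

Lemma cls_csn o V k (f : R -> V) t : cls o f -> in02 t -> `|f t| <= csn k f.
Proof. by move=> cf t02; apply: le_trans (supnorm_csn k cf); exact: cls_sup cf t02. Qed.

Lemma isd_mean V (f g : R -> V) a b M : isd f g -> in02 a -> in02 b -> a <= b ->
  (forall s, a <= s <= b -> `|g s| <= M) -> `|f b - f a| <= M * (b - a).
Proof.
move=> fg a02 b02 ab gM.
have s02 s : a <= s <= b -> in02 s.
  by move=> /andP[as_ sb]; move: a02 b02; rewrite /in02 => /andP[? ?] /andP[? ?]; lra.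
apply: (@mean_value _ V setT (fun v => `|v|)) => //.
- exact: normr0.
- by move=> x y z _ _ _; have := ler_normD (x - y) (y - z); rewrite addrA subrK.
move=> s e sab e0.
have /cvgrPdist_lt /(_ e e0) /near02P[d d0 H] := fg s (s02 s sab).
exists d => // r rab rs; rewrite [`|f s - _|]distrC; suff : `|f r - f s| <= (M + e) * `|r - s| by [].
have [->|rns] := eqVneq r s; first by rewrite !subrr !normr0 mulr0.
have := H r (s02 r rab) rns rs; rewrite /diff_quot => /ltW H1.
have -> : f r - f s = (r - s) *: ((r - s)^-1 *: (f r - f s)).
  by rewrite scalerA divff ?subr_eq0 // scale1r.
rewrite normrZ mulrC ler_wpM2r //.
have -> : (r - s)^-1 *: (f r - f s) = g s - (g s - (r - s)^-1 *: (f r - f s)) by rewrite subKr.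
by rewrite (le_trans (ler_normB _ _)) // lerD // gM.
Qed.

Definition seq_complete V := forall u : nat -> V,
  (forall e, 0 < e -> exists N, forall m n, (N <= m)%N -> (N <= n)%N -> `|u m - u n| < e) ->
  exists l, forall e, 0 < e -> exists N, forall n, (N <= n)%N -> `|u n - l| < e.

Lemma iter_deriv_cls o V j (f : R -> V) : cls o f -> cls o (iter j (@deriv02 R V) f).
Proof. by elim: j => //= j IH /IH; exact: cls_deriv. Qed.

Lemma iter_derivB o V j (f g : R -> V) : cls o f -> cls o g ->
  iter j (@deriv02 R V) (f - g) = iter j (@deriv02 R V) f - iter j (@deriv02 R V) g.
Proof.
move=> cf cg; elim: j => //= j ->.
have c1 := iter_deriv_cls j cf; have c2 := iter_deriv_cls j cg.
rewrite deriv02D; [|exact: cls_diff c1|exact: cls_diff (clsN c2)].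
rewrite -[in LHS](scaleN1r (iter j _ g)) deriv02Z ?scaleN1r //; exact: cls_diff c2.
Qed.

Lemma supnorm_iter o V j k (f : R -> V) : (j <= k)%N -> cls o f ->
  supnorm (iter j (@deriv02 R V) f) <= csn k f.
Proof.
elim: j k f => [|j IH] k f jk cf; first exact: supnorm_csn cf.
case: k jk => // k jk; rewrite iterSr (le_trans (IH k _ jk (cls_deriv cf))) //.
exact: csn_deriv cf.
Qed.

(** The derivatives of each order converge uniformly; the mean value inequality shows that the
    limits are successive derivatives of the first one. *)
Lemma curves_complete o V (u : nat -> R -> V) : seq_complete V -> (forall n, cls o (u n)) ->
  (forall k (e : R), 0 < e -> exists N, forall m n, (N <= m)%N -> (N <= n)%N ->
     csn k (u m - u n) < e) ->
  exists2 x, cls o x & forall k (e : R), 0 < e -> exists N, forall n, (N <= n)%N ->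
     csn k (u n - x) < e.
Proof.
move=> hV cu Cu; pose w j n := iter j (@deriv02 R V) (u n).
have cw j n : cls o (w j n) by exact: iter_deriv_cls.
have Cw j e : 0 < e -> exists N, forall m n t, (N <= m)%N -> (N <= n)%N -> in02 t ->
    `|w j m t - w j n t| < e.
  move=> e0; have [N HN] := Cu j e e0; exists N => m n t mN nN t02.
  apply: le_lt_trans (HN m n mN nN).
  apply: le_trans (cls_sup (clsB (cw j m) (cw j n)) t02) _.
  rewrite /w -(iter_derivB j (cu m) (cu n)); exact: supnorm_iter (clsB (cu m) (cu n)).
have ex j t : exists l, if in02 t then
    forall e, 0 < e -> exists N, forall n, (N <= n)%N -> `|w j n t - l| < e else l = 0.
  (* The value 0 outside [0,2] keeps the limit in normal form. *)
  case t02 : (in02 t); last by exists 0.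
  apply: hV => e e0; have [N HN] := Cw j e e0; exists N => m n mN nN.
  exact: HN.
pose v j t := projT1 (cid (ex j t)).
have vlim j t e : in02 t -> 0 < e -> exists N, forall n, (N <= n)%N -> `|w j n t - v j t| < e.
  by move=> t02; rewrite /v; case: cid => l /=; rewrite t02; exact.
have v02 j : on02 (v j) = v j.
  apply/funext => t; rewrite /on02; case: ifPn => // t02.
  by rewrite /v; case: cid => l /=; rewrite (negPf t02).
have vunif j e : 0 < e -> exists N, forall n t, (N <= n)%N -> in02 t -> `|w j n t - v j t| <= e.
  move=> e0; have [N HN] := Cw j e e0; exists N => n t nN t02.
  apply/ler_addgt0Pl => d d0; have [M HM] := vlim j t d t02 d0.
  have h1 := HN n (maxn N M) t nN (leq_maxl _ _) t02.
  have h2 := HM (maxn N M) (leq_maxr _ _).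
  have -> : w j n t - v j t = (w j (maxn N M) t - v j t) + (w j n t - w j (maxn N M) t).
    by rewrite [RHS]addrC addrA subrK.
  by rewrite (le_trans (ler_normD _ _)) // lerD // ltW.
have vend j : endc o (v j).
  case: (o) (cw j) => [b|] // cwj; apply/eqP; rewrite -subr_eq0 -normr_le0.
  apply/ler_addgt0Pl => e e0; rewrite addr0.
  have i2 : @in02 R 2 by rewrite /in02 lexx ler0n.
  have e20 : 0 < e / 2 by rewrite divr_gt0.
  have [N HN] := vunif j _ e20.
  have h1 := HN N 2 (leqnn N) i2; have h2 := HN N 0 (leqnn N) in02_0.
  have := (clsE _ _).1 (cwj N) => -[_ /(_ 0%N)] /= ewj.
  have -> : v j 2 - sg b (v j 0) = sg b (w j N 0 - v j 0) - (w j N 2 - v j 2).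
    by rewrite ewj; case: (b); rewrite /= -[LHS]scale1r; lincomb [:: v j 2; v j 0; w j N 0].
  rewrite (le_trans (ler_normB _ _)) // [leRHS]splitr lerD //.
  by case: (b); rewrite //= normrN.
have vd j : isd (v j) (v j.+1).
  move=> t t02; apply/cvgrPdist_lt => e e0.
  have e40 : 0 < e / 4 by rewrite divr_gt0.
  have [N HN] := vunif j.+1 _ e40.
  have [M HM] := Cw j.+1 _ e40.
  (* From [n] on, the derivatives are within [e / 4] of each other and of their limit. The
     increments of [w j n] and of [v j] then differ by at most [e / 4 * |s - t|]; the third [e / 4]
     comes from the differentiability of [w j n] at [t]. *)
  pose n := maxn N M.
  have wd m : isd (w j m) (w j.+1 m) by exact: cls_isd (cw j m).
  have /cvgrPdist_lt /(_ _ e40) /near02P[d d0 Hd] := wd n t t02.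
  apply/near02P; exists d => // s s02 st sd.
  have h1 := HN n t (leq_maxl _ _) t02.
  have h2 := Hd s s02 st sd.
  have mean m x y : (n <= m)%N -> in02 x -> in02 y -> x <= y ->
      `|(w j m y - w j n y) - (w j m x - w j n x)| <= e / 4 * (y - x).
    move=> nm x02 y02 xy.
    rewrite -[w j m y - w j n y]/((w j m - w j n) y) -[w j m x - w j n x]/((w j m - w j n) x).
    apply: (@isd_mean _ (w j m - w j n) (w j.+1 m - w j.+1 n)) => //.
      apply: isd_eq (isdD (wd m) (isd_blin (blin_scale V (-1)) (wd n))) => r r02;
        by rewrite !fctE scaleN1r.
    move=> r /andP[xr ry]; apply: ltW; apply: HM; rewrite ?(leq_trans _ nm) ?leq_maxr //.
    by move: x02 y02; rewrite /in02 => /andP[? ?] /andP[? ?]; apply/andP; split; lra.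
  have mean' m : (n <= m)%N -> `|(w j m s - w j n s) - (w j m t - w j n t)| <= e / 4 * `|s - t|.
    move=> nm; case: (leP t s) => [ts|/ltW ts].
      by rewrite ger0_norm ?subr_ge0 //; exact: mean.
    rewrite distrC [`|s - t|]distrC ger0_norm ?subr_ge0 //; exact: mean.
  have st0 : 0 < `|s - t| by rewrite normr_gt0 subr_eq0.
  have mean_v : `|(v j s - w j n s) - (v j t - w j n t)| <= e / 4 * `|s - t|.
    apply/ler_addgt0Pl => r r0; have r20 : 0 < r / 2 by rewrite divr_gt0.
    have [N1 H1] := vlim j s _ s02 r20; have [N2 H2] := vlim j t _ t02 r20.
    pose m := maxn n (maxn N1 N2).
    have k1 : `|w j m s - v j s| < r / 2 by apply: H1; rewrite /m !leq_max leqnn !orbT.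
    have k2 : `|w j m t - v j t| < r / 2 by apply: H2; rewrite /m !leq_max leqnn !orbT.
    have k3 := mean' m (leq_maxl _ _).
    have -> : (v j s - w j n s) - (v j t - w j n t) =
        (w j m t - v j t) - (w j m s - v j s) + ((w j m s - w j n s) - (w j m t - w j n t)).
      rewrite -[LHS](scale1r (_ : V)).
      by lincomb [:: v j s; w j n s; v j t; w j n t; w j m t; w j m s].
    rewrite (le_trans (ler_normD _ _)) // lerD //.
    by rewrite (le_trans (ler_normB _ _)) // [r]splitr lerD // ltW.
  have -> : v j.+1 t - diff_quot (v j) t s = - (w j.+1 n t - v j.+1 t) +
      ((w j.+1 n t - diff_quot (w j n) t s) -
       (s - t)^-1 *: ((v j s - w j n s) - (v j t - w j n t))).
    rewrite /diff_quot.
    by lincomb [:: v j.+1 t; w j.+1 n t; v j s; w j n s; v j t; w j n t].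
  rewrite (le_lt_trans (ler_normD _ _)) // normrN.
  have h3 : `|(s - t)^-1 *: ((v j s - w j n s) - (v j t - w j n t))| <= e / 4.
    by rewrite normrZ normfV mulrC ler_pdivrMr.
  have := ler_normB (w j.+1 n t - diff_quot (w j n) t s)
      ((s - t)^-1 *: ((v j s - w j n s) - (v j t - w j n t))).
  by move: h1 h2 h3 e0; lra.
have vcls : cls o (v 0%N).
  suff Dv n j : Dn o n (v j) by apply/clsP => n.
  elim: n j => [|n IH] j; last exact: DnS (IH _).
  by split=> //; exact: isd_diff02 (vd j).
have viter j : iter j (@deriv02 R V) (v 0%N) = v j.
  by elim: j => //= j ->; apply: deriv02_isd.
exists (v 0%N) => // k e e0.
have e0' : 0 < e / 2 / k.+1%:R by rewrite !divr_gt0.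
have G K : exists N, forall j n, (j < K)%N -> (N <= n)%N ->
    supnorm (w j n - v j) <= e / 2 / k.+1%:R.
  elim: K => [|i [N IH]]; first by exists 0%N.
  have [M HM] := vunif i _ e0'; exists (maxn N M) => j n.
  rewrite ltnS leq_eqVlt geq_max => /predU1P[->|ji] /andP[nN nM]; last exact: IH.
  by apply: supnorm_le => t t02; exact: HM.
have [N HN] := G k.+1.
exists N => n nN.
apply: le_lt_trans (_ : \sum_(j < k.+1) (e / 2 / k.+1%:R) < e); last first.
  rewrite sumr_const card_ord -(mulr_natr (e / 2 / _)) divfK ?pnatr_eq0 //.
  by rewrite ltr_pdivrMr // ltr_pMr // ltr1n.
apply: ler_sum => j _; rewrite (iter_derivB j (cu n) vcls) viter.
exact: HN.
Qed.

Lemma curves_frechet o V : seq_complete V -> is_frechet (curves o V).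
Proof.
move=> hV; split => /=.
- exact: cls0.
- by move=> a x y cx cy; apply: clsD => //; exact: clsZ.
- by move=> k a x; exact: csnZ.
- by move=> k x y; exact: csnD.
- by move=> k x; exact: csn_le.
- move=> f cf /(_ 0%N); rewrite -/(csn 0 f) csn0 => f0; apply/funext => t.
  have [t02|t02] := boolP (in02 t); last exact: cls_out cf t02.
  by apply/eqP; rewrite -normr_le0 -f0; exact: cls_sup cf t02.
- move=> u cu Cu; exact: (curves_complete hV cu Cu).
Qed.

Lemma cls_none o V (f : R -> V) : cls o f -> cls None f.
Proof. exact: cls_smooth. Qed.

End CurveSpaces.

(** * Products and inverse square roots of scalar curves *)

Section ScalarCurves.
Context {R : realType}.
Implicit Types (V W : normedModType R) (t s : R) (o : option bool) (f g a b : R -> R^o).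

Lemma seq_complete_real : seq_complete (R^o : normedModType R).
Proof.
move=> u Cu; have [|l _ Hl] := @fr_complete _ (fs_real R) _ u (fun _ => I).
  by move=> k e e0; exact: Cu.
by exists l => e e0; exact: (Hl 0%N).
Qed.

#[export] Instance frechet_scalar o : is_frechet (curves o (R^o : normedModType R)).
Proof. exact: curves_frechet seq_complete_real. Qed.

Notation SC := (curves None (R^o : normedModType R)).

Lemma smooth_mul f g : cls None f -> cls None g -> cls None (cmul f g).
Proof. exact: (@cls_mul R None None). Qed.

Lemma cmulZl (c : R) f g : cmul (c *: f) g = c *: cmul f g.
Proof. by apply/funext => t; rewrite /cmul; exact: esym (mulrA _ _ _). Qed.

Lemma deriv_cmul o o' f g : cls o f -> cls o' g ->
  deriv02 (cmul f g) = cmul (deriv02 f) g + cmul f (deriv02 g).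
Proof.
move=> cf cg; apply: deriv02_isd; first exact: isd_mul (cls_isd cf) (cls_isd cg).
apply: on02D; apply: on02M; [exact: on02_deriv | exact: cls_on cf].
Qed.

Lemma csn_mul k : exists2 C : R, 0 < C & forall f g, cls None f -> cls None g ->
  csn k (cmul f g) <= C * csn k f * csn k g.
Proof.
have sup_mul f g : cls None f -> cls None g -> supnorm (cmul f g) <= supnorm f * supnorm g.
  move=> cf cg; apply: supnorm_le => t t02; rewrite /cmul normrM.
  by apply: ler_pM => //; [exact: cls_sup cf t02 | exact: cls_sup cg t02].
elim: k => [|k [C C0 IH]].
  by exists 1 => // f g cf cg; rewrite !csn0 mul1r sup_mul.
(* One for the supremum norm of the product, [C] for either term of Leibniz' rule. *)
exists (1 + C + C); first by rewrite !addr_gt0.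
move=> f g cf cg; rewrite [leLHS]csnS (deriv_cmul cf cg).
have df := cls_deriv cf; have dg := cls_deriv cg.
have c1 : cls None (cmul (deriv02 f) g) by exact: cls_mul df cg.
have c2 : cls None (cmul f (deriv02 g)) by exact: cls_mul cf dg.
have := csnD k c1 c2; have := sup_mul f g cf cg.
have := IH _ _ df cg; have := IH _ _ cf dg.
have h1 := csn_deriv k cf; have h2 := csn_deriv k cg.
have h3 := csn_le k cf; have h4 := csn_le k cg.
have h5 := supnorm_csn k.+1 cf; have h6 := supnorm_csn k.+1 cg.
have p1 := csn_ge0 k cf; have p2 := csn_ge0 k cg.
have p3 := csn_ge0 k df; have p4 := csn_ge0 k dg.
have p5 := supnorm_ge0 (cls_diff cf); have p6 := supnorm_ge0 (cls_diff cg).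
have q1 : csn k f * csn k (deriv02 g) <= csn k.+1 f * csn k.+1 g by exact: ler_pM.
have q2 : csn k (deriv02 f) * csn k g <= csn k.+1 f * csn k.+1 g by exact: ler_pM.
have q3 : supnorm f * supnorm g <= csn k.+1 f * csn k.+1 g by exact: ler_pM.
have q4 : C * (csn k f * csn k (deriv02 g)) <= C * (csn k.+1 f * csn k.+1 g) by rewrite ler_pM2l.
have q5 : C * (csn k (deriv02 f) * csn k g) <= C * (csn k.+1 f * csn k.+1 g) by rewrite ler_pM2l.
move=> r1 r2 r3 r4.
by lra.
Qed.

Lemma bilin_mul : @bilin R SC SC SC cmul.
Proof.
split.
- by move=> f g; exact: smooth_mul.
- by move=> c f f' g _ _ _; apply/funext => t; rewrite /cmul !fctE /GRing.scale /=; ring.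
- by move=> c f g g' _ _ _; apply/funext => t; rewrite /cmul !fctE /GRing.scale /=; ring.
- by move=> k; have [C C0 H] := csn_mul k; exists k, C.
Qed.

Lemma csn_blin V W (l : V -> W) k : blin l -> exists2 C : R, 0 < C &
  forall h : R -> V, cls None h -> csn k (fun t => l (h t)) <= C * csn k h.
Proof.
move=> hl; have [C C0 lC] := blin_bound hl; exists C => // h ch.
have sup_l h' : cls None h' -> supnorm (fun t => l (h' t)) <= C * supnorm h'.
  move=> ch'; apply: supnorm_le => t t02; apply: le_trans (lC _) _.
  by rewrite ler_pM2l //; exact: cls_sup ch' t02.
elim: k h ch => [|k IH] h ch; first by rewrite !csn0; exact: sup_l.
rewrite !csnS mulrDr (deriv02_blin hl (cls_diff ch)) lerD ?sup_l // IH //.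
exact: cls_deriv.
Qed.

Lemma flin_blin o V W (l : V -> W) : blin l ->
  @flin R (curves o V) (curves o W) (fun h t => l (h t)).
Proof.
move=> hl; split.
- by move=> h; exact: cls_blin.
- by move=> c h h' _ _; apply/funext => t; rewrite !fctE (blin_lin hl).
- move=> k; have [C C0 H] := csn_blin k hl; exists k, C => // h ch.
  exact: H (cls_none ch).
Qed.

Definition positive_curves : set (R -> R^o) :=
  [set f | cls None f /\ forall t, in02 t -> 0 < (f t : R)].

Lemma crsqrtE f t : in02 t -> crsqrt f t = (Num.sqrt (f t : R))^-1 :> R.
Proof. by move=> t02; rewrite /crsqrt on02E. Qed.

Lemma crsqrt_gt0 f t : (forall t, in02 t -> 0 < (f t : R)) -> in02 t -> 0 < (crsqrt f t : R).
Proof. by move=> f0 t02; rewrite crsqrtE // invr_gt0 sqrtr_gt0 f0. Qed.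

Lemma crsqrt_sqr f t : (forall t, in02 t -> 0 < (f t : R)) -> in02 t ->
  (crsqrt f t : R) ^+ 2 * (f t : R) = 1.
Proof.
move=> f0 t02; have ft := f0 t t02.
by rewrite crsqrtE // exprVn sqr_sqrtr ?ltW // mulVf // gt_eqF.
Qed.

Lemma crsqrt_smooth f : positive_curves f -> cls None (crsqrt f).
Proof. by move=> [cf f0]; exact: cls_rsqrt. Qed.

(** The bound is uniform in [f]; the upper bound [m] on [1 / sqrt f] expresses that [f] stays away
    from 0. By induction, since the derivative [- r^3 f' / 2] involves [r] to one order less. *)
Lemma rsqrt_bound k (M m : R) : exists2 B : R, 0 < B & forall f, positive_curves f ->
  csn k f <= M -> (forall t, in02 t -> (crsqrt f t : R) <= m) -> csn k (crsqrt f) <= B.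
Proof.
elim: k => [|k [B B0 IH]].
  exists (`|m| + 1); first by rewrite ltr_wpDl.
  move=> f [cf f0] _ fm; rewrite csn0; apply: supnorm_le => t t02.
  rewrite gtr0_norm; last exact: crsqrt_gt0.
  by have := fm t t02; have := ler_norm m; lra.
have [C C0 HC] := csn_mul k.
(* The first two terms bound the supremum norm, the rest bounds [r^3 f' / 2], by three uses of
   [csn_mul]. *)
pose B' := `|m| + 1 + 2^-1 * (C * (C * B * (C * B * B)) * (`|M| + 1)).
exists B'; first by rewrite /B' addr_gt0 ?mulr_gt0 // ?ltr_wpDl ?mulr_gt0.
move=> f [cf f0] fM fm; rewrite csnS.
have cr : cls None (crsqrt f) by exact: crsqrt_smooth.
have h0 : supnorm (crsqrt f) <= `|m| + 1.
  apply: supnorm_le => t t02; rewrite gtr0_norm; last exact: crsqrt_gt0.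
  by have := fm t t02; have := ler_norm m; lra.
have fM' : csn k f <= M by apply: le_trans fM; exact: csn_le cf.
have rB : csn k (crsqrt f) <= B by apply: IH.
pose r := crsqrt f; pose r2 := cmul r r; pose r3 := cmul r r2.
have c2 : cls None r2 by exact: (smooth_mul cr cr).
have c3 : cls None r3 by exact: (smooth_mul cr c2).
have cd := cls_deriv cf.
have c4 : cls None (cmul r3 (deriv02 f)) by exact: (smooth_mul c3 cd).
have -> : deriv02 (crsqrt f) = (- 2^-1 : R) *: cmul r3 (deriv02 f).
  apply: deriv02_isd; last exact: cls_on (clsZ _ c4).
  apply: (isd_eq (fun _ _ => erefl) _ (isd_rsqrt (cls_isd cf) f0)) => t t02.
  by rewrite exprS expr2.
rewrite (csnZ k _ c4) normrN ger0_norm; last by rewrite invr_ge0 ler0n.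
apply: lerD => //; rewrite ler_pM2l ?invr_gt0 //.
have p0 := csn_ge0 k cr.
have p1 : csn k r2 <= C * B * B.
  apply: le_trans (HC _ _ cr cr) _; rewrite -!mulrA ler_pM2l //; exact: ler_pM.
have p2 : csn k r3 <= C * B * (C * B * B).
  apply: le_trans (HC _ _ cr c2) _; rewrite -!mulrA ler_pM2l //.
  by apply: ler_pM => //; [exact: csn_ge0 c2 | rewrite !mulrA].
apply: le_trans (HC _ _ c3 cd) _.
rewrite -!mulrA ler_pM2l //.
have p3 : csn k (deriv02 f) <= `|M| + 1.
  by have := csn_deriv k cf; have := ler_norm M; lra.
have := ler_pM (csn_ge0 k c3) (csn_ge0 k cd) p2 p3.
by rewrite !mulrA.
Qed.

(** The smooth curve [1 / sqrt f] is bounded, and its supremum to the power -2 is a lower bound of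
    [f]. *)
Lemma positive_min f : positive_curves f -> exists2 m : R, 0 < m & forall t, in02 t -> m <= (f t : R).
Proof.
move=> hf; have [cf f0] := hf; have cr := crsqrt_smooth hf.
pose M := supnorm (crsqrt f).
have M0 : 0 < M.
  apply: lt_le_trans (cls_sup cr (@in02_0 R)); rewrite gtr0_norm; apply: crsqrt_gt0 => //; exact: in02_0.
exists (M ^- 2); first by rewrite invr_gt0 exprn_gt0.
move=> t t02; have h1 := crsqrt_gt0 f0 t02.
have h2 : (crsqrt f t : R) <= M by rewrite -(gtr0_norm h1); exact: cls_sup cr t02.
have h3 := crsqrt_sqr f0 t02.
rewrite -[(f t : R)]invrK lef_pV2 ?posrE ?exprn_gt0 ?invr_gt0 ?f0 //.
have -> : (f t : R)^-1 = (crsqrt f t : R) ^+ 2.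
  by rewrite -[LHS]mul1r -h3 mulfK // gt_eqF // f0.
by rewrite ler_pXn2r // ?nnegrE ltW.
Qed.

Lemma fopen_positive : @fopen R SC positive_curves.
Proof.
split=> [f []//|f hf]; have [m m0 Hm] := positive_min hf.
exists 0%N, m => // g cg gf; split=> // t t02.
have [cf f0] := hf; have cgf := clsB cg cf.
have := cls_csn 0 cgf t02; rewrite -[(g - f) t]/(g t - f t) ler_norml => /andP[+ _].
have := Hm t t02; move: gf; rewrite csnE => gf h1 h2.
have : - m < (g t : R) - (f t : R) by apply: lt_le_trans h2; rewrite ltrN2.
by lra.
Qed.

(** The identity [rsqrtB] for curves, where the reciprocal of [r + q] is written as the inverse
    square root of its square, so that only products and [crsqrt] occur. *)
Lemma crsqrtB f g : positive_curves f -> positive_curves g ->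
  let r := crsqrt f in let q := crsqrt g in
  q - r = (-1 : R) *: cmul (g - f) (cmul (cmul r r) (cmul (cmul q q)
     (crsqrt (cmul (r + q) (r + q))))).
Proof.
move=> [cf f0] [cg g0] r q; apply/funext => t.
have [t02|t02] := boolP (in02 t); last first.
  have cr : cls None r by exact: (crsqrt_smooth (conj cf f0)).
  have cq : cls None q by exact: (crsqrt_smooth (conj cg g0)).
  rewrite -[(q - r) t]/(q t - r t) /cmul !fctE /GRing.scale /=.
  by rewrite (cls_out cr t02) (cls_out cq t02) !mul0r mulr0 subrr mulr0.
rewrite /cmul !fctE /GRing.scale /= [in RHS]/crsqrt !on02E // /cmul.
have r0 := crsqrt_gt0 f0 t02; have q0 := crsqrt_gt0 g0 t02.
have -> : Num.sqrt ((r t + q t) * (r t + q t) : R) = (r t : R) + (q t : R).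
  by rewrite -expr2 sqrtr_sqr gtr0_norm //; exact: addr_gt0.
have -> : (q t : R) - (r t : R) = (Num.sqrt (g t : R))^-1 - (Num.sqrt (f t : R))^-1.
  by rewrite /q /r !crsqrtE.
rewrite rsqrtB; [|exact: f0|exact: g0].
by rewrite /r /q !crsqrtE //; ring.
Qed.

Lemma positive_rsqrt_sum f g : positive_curves f -> positive_curves g ->
  positive_curves (cmul (crsqrt f + crsqrt g) (crsqrt f + crsqrt g)).
Proof.
move=> hf hg; have cs := clsD (crsqrt_smooth hf) (crsqrt_smooth hg).
split=> [|t t02]; first exact: (smooth_mul cs cs).
rewrite /cmul -expr2 exprn_gt0 // -[(_ + _) t]/((crsqrt f t : R) + (crsqrt g t : R)).
by rewrite addr_gt0 //; apply: crsqrt_gt0 => //; [case: hf | case: hg].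
Qed.

Lemma fcont_rsqrt : @fcont R SC SC positive_curves (@crsqrt R).
Proof.
move=> f hf k e e0; have [cf f0] := hf; have cr := crsqrt_smooth hf.
have [m m0 Hm] := positive_min hf.
pose M := supnorm (crsqrt f).
have rM t : in02 t -> (crsqrt f t : R) <= M.
  by move=> t02; apply: le_trans (ler_norm _) _; exact: cls_sup cr t02.
(* These hypotheses will hold for [f] and for every [g] close enough to it. *)
have [B B0 HB] := rsqrt_bound k (csn k f + 1) (2 * M).
have [C C0 HC] := csn_mul k.
pose c1 := C * (B + B) * (B + B).
have [fM fM0 HfM] : exists2 K : R, 0 < K & forall t, in02 t -> (f t : R) <= K.
  by have [K K0 HK] := isd_bounded (cls_isd cf); exists K => // t t02; apply: le_trans (ler_norm _) (HK t t02).
(* For the factor [1 / (r + q)]: the square of [r + q] has seminorm at most [c1], and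
   [1 / (r + q) <= 1 / r = sqrt f]. *)
have [B' B'0 HB'] := rsqrt_bound k c1 (Num.sqrt fM).
pose K := C * (C * B * B) * (C * (C * B * B) * B').
have K0 : 0 < K by rewrite !mulr_gt0.
(* The three bounds serve to control the seminorm of [g], to have [g >= f / 2] and hence [q <= 2 M],
   and to bring the final product below [e]. *)
pose d := Num.min 1 (Num.min (m / 2) (e / (C * K))).
have d0 : 0 < d by rewrite !lt_min ltr01 !divr_gt0 // mulr_gt0.
exists k, d => // g hg gf; have [cg g0] := hg; have cq := crsqrt_smooth hg.
move: gf; rewrite csnE !lt_min => /andP[gf1 /andP[gfm gfe]].
have cgf := clsB cg cf.
have gk : csn k g <= csn k f + 1.
  have := csnD k cgf cf; rewrite subrK => /le_trans; apply.
  by rewrite addrC lerD2l ltW.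
have gm t : in02 t -> (f t : R) / 2 <= (g t : R).
  move=> t02; have := cls_csn k cgf t02; rewrite -[(g - f) t]/(g t - f t) ler_norml => /andP[h1 _].
  have h2 := Hm t t02; move: (gfm) => h3.
  have : - (m / 2) <= (g t : R) - (f t : R) by apply: le_trans h1; rewrite lerN2 ltW.
  by lra.
have q2 t : in02 t -> (crsqrt g t : R) <= 2 * M.
  move=> t02; apply: le_trans (_ : _ <= 2 * (crsqrt f t : R)) _; last by rewrite ler_pM2l // rM.
  have r0 := crsqrt_gt0 f0 t02; have q0 := crsqrt_gt0 g0 t02.
  have e1 := crsqrt_sqr f0 t02; have e2 := crsqrt_sqr g0 t02.
  have gt := gm t t02; have ft := f0 t t02.
  rewrite leNgt; apply/negP => h.
  have h1 : (2 * (crsqrt f t : R)) ^+ 2 < (crsqrt g t : R) ^+ 2.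
    by rewrite ltrXn2r // ?mulr_ge0 // ltW.
  have h2 : (2 * (crsqrt f t : R)) ^+ 2 * ((f t : R) / 2) < (crsqrt g t : R) ^+ 2 * ((f t : R) / 2).
    by rewrite ltr_pM2r // divr_gt0.
  have h3 : (crsqrt g t : R) ^+ 2 * ((f t : R) / 2) <= (crsqrt g t : R) ^+ 2 * (g t : R).
    by rewrite ler_wpM2l // sqr_ge0.
  by move: h2 h3; rewrite e2 exprMn; move: e1; lra.
have qB : csn k (crsqrt g) <= B by apply: HB.
have rB : csn k (crsqrt f) <= B.
  apply: HB => //; first by rewrite lerDl.
  by move=> t t02; have := rM t t02; have := crsqrt_gt0 f0 t02; lra.
set r := crsqrt f in cr rB *; set q := crsqrt g in cq qB *.
have crq := clsD cr cq.
pose w := cmul (r + q) (r + q).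
have cw : cls None w by exact: (smooth_mul crq crq).
have pw : positive_curves w by exact: positive_rsqrt_sum.
have wB : csn k (crsqrt w) <= B'.
  apply: HB' => //.
    apply: le_trans (HC _ _ crq crq) _; rewrite /c1 -!mulrA ler_pM2l //.
    have h : csn k (r + q) <= B + B by apply: le_trans (csnD k cr cq) _; exact: lerD.
    by apply: ler_pM => //; exact: csn_ge0 crq.
  move=> t t02; rewrite crsqrtE // /w /cmul -expr2 sqrtr_sqr.
  have r0 := crsqrt_gt0 f0 t02; have q0 := crsqrt_gt0 g0 t02.
  rewrite -[(r + q) t]/((r t : R) + (q t : R)) gtr0_norm ?addr_gt0 //.
  apply: le_trans (_ : (r t : R)^-1 <= _).
    by rewrite lef_pV2 ?posrE ?addr_gt0 // lerDl ltW.
  by rewrite /r crsqrtE // invrK ler_wsqrtr // HfM.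
have cr2 : cls None (cmul r r) by exact: (smooth_mul cr cr).
have cq2 : cls None (cmul q q) by exact: (smooth_mul cq cq).
have crw := crsqrt_smooth pw.
have cqw : cls None (cmul (cmul q q) (crsqrt w)) by exact: (smooth_mul cq2 crw).
have cY : cls None (cmul (cmul r r) (cmul (cmul q q) (crsqrt w))) by exact: (smooth_mul cr2 cqw).
have cX := smooth_mul cgf cY.
rewrite csnE crsqrtB // (csnZ k _ cX) normrN1 mul1r.
apply: le_lt_trans (HC _ _ cgf cY) _.
have b1 : csn k (cmul r r) <= C * B * B.
  apply: le_trans (HC _ _ cr cr) _; rewrite -!mulrA ler_pM2l //; apply: ler_pM => //; exact: csn_ge0 cr.
have b2 : csn k (cmul q q) <= C * B * B.
  apply: le_trans (HC _ _ cq cq) _; rewrite -!mulrA ler_pM2l //; apply: ler_pM => //; exact: csn_ge0 cq.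
have b3 : csn k (cmul (cmul q q) (crsqrt w)) <= C * (C * B * B) * B'.
  apply: le_trans (HC _ _ cq2 crw) _; rewrite -[leLHS]mulrA -[leRHS]mulrA ler_pM2l //.
  by apply: ler_pM => //; [exact: csn_ge0 cq2 | exact: csn_ge0 crw].
have b4 : csn k (cmul (cmul r r) (cmul (cmul q q) (crsqrt w))) <= K.
  apply: le_trans (HC _ _ cr2 cqw) _; rewrite -[leLHS]mulrA /K -[leRHS]mulrA ler_pM2l //.
  by apply: ler_pM => //; [exact: csn_ge0 cr2 | exact: csn_ge0 cqw].
apply: le_lt_trans (_ : _ <= C * csn k (g - f) * K) _.
  by apply: ler_wpM2l b4; rewrite mulr_ge0 // ?(csn_ge0 k cgf) // ltW.
move: gfe; rewrite ltr_pdivlMr ?mulr_gt0 //.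
by rewrite mulrA [_ * C]mulrC.
Qed.

Section Maps.
Context {E : fspace R} {hE : is_frechet E} (U : set E) (oU : fopen U).
Implicit Types F G : E -> SC.

Lemma Cn_mul n F G : Cn n U F -> Cn n U G -> Cn n U (fun x => cmul (F x) (G x) : SC).
Proof. exact: Cn_bilin bilin_mul oU. Qed.

End Maps.

(** By [crsqrtB] the difference quotient is a product of the one of [F] with factors that converge
    by continuity of [crsqrt]. The limit [- r^3 dF / 2] is of class C^n by induction. *)
Lemma Cn_rsqrt n (E : fspace R) {hE : is_frechet E} (U : set E) (F : E -> SC) :
  fopen U -> (forall x, U x -> positive_curves (F x)) -> Cn n U F ->
  Cn n U (fun x => crsqrt (F x) : SC).
Proof.
elim: n E hE U F => [|n IH] E hE U F oU FP CF.
  split=> // [x Ux|]; first by apply: crsqrt_smooth; exact: FP.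
  exact: (fcont_comp FP (Cn_cont CF) fcont_rsqrt).
have [dF FdF CdF] := CnS_inv CF.
have FC := Cn_car CF; have CF' := Cn_le CF.
pose r x := crsqrt (F x) : SC.
have Cr : Cn n U r by exact: IH.
have oT : fopen (tangent U) by exact: fopen_tangent.
have rC x : U x -> cls None (r x) by exact: (Cn_car Cr).
pose r3 x := cmul (r x) (cmul (r x) (r x)) : SC.
have Cr3 : Cn n U r3 by do 2 apply: Cn_mul => //.
apply: (@CnS R n E SC U r (fun p : fs_prod E E => (- 2^-1 : R) *: cmul (r3 p.1) (dF p) : SC)).
- exact: rC.
- exact: (fcont_comp FP (Cn_cont CF) fcont_rsqrt).
- move=> x h Ux hh; have /is_dderivP[hl Fl] := FdF x h Ux hh.
  have near_U := near0_line oU Ux hh.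
  have hx := fopen_car oU Ux.
  have nearU : (0 : R)^' [set t | U (x + t *: h)] by exact: near0_line.
  have c1 : cls None (r3 x) by exact: (Cn_car Cr3).
  have c2 : cls None (cmul (r3 x) (dF (x, h))) by exact: (smooth_mul c1 hl).
  apply/is_dderivP; split; first exact: clsZ.
  pose rt t := r (x + t *: h).
  pose w t := cmul (r x + rt t) (r x + rt t).
  have crt : (0 : R)^' [set t | cls None (rt t)] by apply: filterS nearU => t; exact: rC.
  have rtl : tends (E := SC) (0 : R)^' rt (r x).
    apply: (@tends_fcont _ _ _ _ _ _ U r (fun t => x + t *: h)) => //; first exact: (Cn_cont Cr).
    exact: tends_line.
  have pos t : U (x + t *: h) -> positive_curves (w t).
    by move=> Ut; exact: (positive_rsqrt_sum (FP _ Ux) (FP _ Ut)).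
  pose w0 := cmul (r x + r x) (r x + r x).
  have pos0 : positive_curves w0 := positive_rsqrt_sum (FP _ Ux) (FP _ Ux).
  have crx := rC _ Ux.
  have cs0 := clsD crx crx.
  have cst : (0 : R)^' [set t | cls None (r x + rt t)].
    by apply: filterS crt => t ht; exact: (clsD crx ht).
  have n_r : (0 : R)^' [set t | cls None (r x)] by apply: nearW => t _; exact: crx.
  have t_r : tends (E := SC) (0 : R)^' (fun t : R => r x) (r x) by exact: tends_cst.
  have stl : tends (E := SC) (0 : R)^' (fun t => r x + rt t) (r x + r x).
    exact: (@tendsD R _ (0 : R)^' _ SC _ (fun=> r x) rt (r x) (r x) n_r crt crx crx t_r rtl).
  have wtl : tends (E := SC) (0 : R)^' w w0 by exact: (tends_bilin bilin_mul cst cst cs0 cs0 stl stl).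
  have vtl : tends (E := SC) (0 : R)^' (fun t => crsqrt (w t)) (crsqrt w0).
    apply: (@tends_fcont _ _ _ _ SC SC positive_curves (@crsqrt R) w) => //; first exact: fcont_rsqrt.
    by apply: filterS nearU => t; exact: pos.
  have cvt : (0 : R)^' [set t | cls None (crsqrt (w t))].
    by apply: filterS nearU => t /pos; exact: crsqrt_smooth.
  have cv0 := crsqrt_smooth pos0.
  pose q t := t^-1 *: (F (x + t *: h) - F x).
  have cq : (0 : R)^' [set t | cls None (q t)].
    by apply: filterS nearU => t Ut; apply: clsZ; apply: clsB; exact: FC.
  have mulc f g : cls None f -> cls None g -> cls None (cmul f g) := @smooth_mul f g.
  have c_rr : cls None (cmul (r x) (r x)) by exact: (mulc _ _ crx crx).
  have c_rtrt : (0 : R)^' [set t | cls None (cmul (rt t) (rt t))].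
    by apply: filterS crt => t ht; exact: (mulc _ _ ht ht).
  have l1 : tends (E := SC) (0 : R)^' (fun t => cmul (rt t) (rt t)) (cmul (r x) (r x)).
    exact: (tends_bilin bilin_mul crt crt crx crx rtl rtl).
  have l2 : tends (E := SC) (0 : R)^' (fun t => cmul (cmul (rt t) (rt t)) (crsqrt (w t)))
      (cmul (cmul (r x) (r x)) (crsqrt w0)).
    exact: (tends_bilin bilin_mul c_rtrt cvt c_rr cv0 l1 vtl).
  have c_2 : (0 : R)^' [set t | cls None (cmul (cmul (rt t) (rt t)) (crsqrt (w t)))].
    by apply: filterS2 c_rtrt cvt => t h1 h2; exact: (mulc _ _ h1 h2).
  have c_20 : cls None (cmul (cmul (r x) (r x)) (crsqrt w0)) by exact: (mulc _ _ c_rr cv0).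
  have l3 : tends (E := SC) (0 : R)^'
      (fun t => cmul (cmul (r x) (r x)) (cmul (cmul (rt t) (rt t)) (crsqrt (w t))))
      (cmul (cmul (r x) (r x)) (cmul (cmul (r x) (r x)) (crsqrt w0))).
    have n_rr : (0 : R)^' [set t | cls None (cmul (r x) (r x))] by apply: nearW => t _; exact: c_rr.
    have t_rr : tends (E := SC) (0 : R)^' (fun t : R => cmul (r x) (r x)) (cmul (r x) (r x)).
      exact: tends_cst.
    exact: (tends_bilin bilin_mul n_rr c_2 c_rr c_20 t_rr l2).
  have c_3 : (0 : R)^' [set t | cls None (cmul (cmul (r x) (r x)) (cmul (cmul (rt t) (rt t)) (crsqrt (w t))))].
    by apply: filterS c_2 => t h1; exact: (mulc _ _ c_rr h1).
  have c_30 : cls None (cmul (cmul (r x) (r x)) (cmul (cmul (r x) (r x)) (crsqrt w0))) by exact: (mulc _ _ c_rr c_20).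
  have l4 : tends (E := SC) (0 : R)^'
      (fun t => cmul (q t) (cmul (cmul (r x) (r x)) (cmul (cmul (rt t) (rt t)) (crsqrt (w t)))))
      (cmul (dF (x, h)) (cmul (cmul (r x) (r x)) (cmul (cmul (r x) (r x)) (crsqrt w0)))).
    have t_q : tends (E := SC) (0 : R)^' q (dF (x, h)) by [].
    exact: (tends_bilin bilin_mul cq c_3 hl c_30 t_q l3).
  have c_4 : (0 : R)^' [set t | cls None (cmul (q t) (cmul (cmul (r x) (r x)) (cmul (cmul (rt t) (rt t)) (crsqrt (w t)))))].
    by apply: filterS2 cq c_3 => t h1 h2; exact: (mulc _ _ h1 h2).
  have c_40 : cls None (cmul (dF (x, h)) (cmul (cmul (r x) (r x)) (cmul (cmul (r x) (r x)) (crsqrt w0)))).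
    exact: (mulc _ _ hl c_30).
  (* At the limit [crsqrt w0 = 1 / (2 r)], and [r^4 / (2 r) = r^3 / 2]. *)
  have -> : (- 2^-1 : R) *: cmul (r3 (x, h).1) (dF (x, h)) =
      (-1 : R) *: cmul (dF (x, h)) (cmul (cmul (r x) (r x)) (cmul (cmul (r x) (r x)) (crsqrt w0))).
    apply/funext => s; have [s02|s02] := boolP (in02 s); last first.
      rewrite -[LHS]/((- 2^-1 : R) * ((r3 x s : R) * (dF (x, h) s : R))).
      rewrite -[RHS]/(-1 * ((dF (x, h) s : R) * _)).
      by rewrite (cls_out hl s02) mulr0 mul0r !mulr0.
    have rs : 0 < (r x s : R) by apply: crsqrt_gt0 => //; have [] := FP _ Ux.
    rewrite !fctE /cmul /GRing.scale /= [crsqrt w0 s]/crsqrt on02E // /w0 /cmul -expr2 sqrtr_sqr.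
    rewrite -[(r x + r x) s]/((r x s : R) + (r x s : R)) gtr0_norm ?addr_gt0 // /r3 /cmul.
    by field; rewrite gt_eqF // ?gt_eqF // addr_gt0.
  apply: (tends_near (E := SC) (g := fun t => (-1 : R) *: cmul (q t) (cmul (cmul (r x) (r x))
      (cmul (cmul (rt t) (rt t)) (crsqrt (w t)))))).
    apply: filterS2 nearU (near0_small ltr01) => t Ut /andP[t0 _] /=.
    by rewrite (crsqrtB (FP _ Ux) (FP _ Ut)) /q cmulZl [LHS]scalerA [RHS]scalerA mulrC.
  have fl : @flin R SC SC (fun a => (-1 : R) *: a) := flin_blin None (blin_scale _ _).
  exact: (@tends_flin R _ _ _ SC SC _ _ _ _ _ fl c_4 c_40 l4).
- pose G := fun p : fs_prod E E => cmul (r3 p.1) (dF p) : SC.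
  pose S := fun a : SC => (- 2^-1 : R) *: a : SC.
  suff : Cn n (tangent U) (S \o G) by [].
  apply: (@Cn_comp R n (fs_prod E E) SC SC _ _ _ (tangent U) (@fs_car R SC) G S).
  + exact: oT.
  + exact: fopen_fs_car.
  + move=> [x h] [Ux hh] /=; have [h1 _] := FdF x h Ux hh.
    exact: (smooth_mul (Cn_car Cr3 Ux) h1).
  + apply: (Cn_mul oT); last exact: CdF.
    apply: (@Cn_comp R n (fs_prod E E) E SC _ _ _ (tangent U) U (fun p => p.1) r3 oT oU).
    * by move=> p [].
    * by apply: Cn_flin => //; exact: flin_fst.
    * exact: Cr3.
  + apply: Cn_flin; last exact: fopen_fs_car.
    exact: (flin_blin None (blin_scale _ _)).
Qed.

End ScalarCurves.

Section LinearMaps.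
Context {R : realType}.
Implicit Types V W : normedModType R.

Lemma blin_fst V W : @blin R (V * W)%type V fst.
Proof.
split=> //; exists 1 => // x.
by rewrite mul1r prod_normE le_max lexx.
Qed.

Lemma blin_snd V W : @blin R (V * W)%type W snd.
Proof.
split=> //; exists 1 => // x.
by rewrite mul1r prod_normE le_max lexx orbT.
Qed.

Lemma blin_comp V W (X : normedModType R) (l : V -> W) (l' : W -> X) :
  blin l -> blin l' -> blin (l' \o l).
Proof.
move=> hl hl'; split=> [a x y|] /=; first by rewrite (blin_lin hl) (blin_lin hl').
have [C C0 H] := blin_bound hl; have [C' C'0 H'] := blin_bound hl'.
exists (C' * C); first exact: mulr_gt0.
by move=> x; rewrite (le_trans (H' _)) // -mulrA ler_pM2l.
Qed.

Lemma blin_line V (v : V) : @blin R (R^o : normedModType R) V (fun x => x *: v).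
Proof.
split=> [a x y|]; first by rewrite scalerDl scalerA.
exists (`|v| + 1); first by rewrite ltr_wpDl.
by move=> x; rewrite normrZ mulrC ler_wpM2r // lerDl.
Qed.

Lemma blin_entry m n (i : 'I_m.+1) (j : 'I_n.+1) :
  @blin R ('M[R]_(m.+1, n.+1) : normedModType R) (R^o : normedModType R) (fun A => A i j).
Proof.
split=> [a A B|]; first by rewrite !mxE.
exists 1 => // A; rewrite mul1r [leRHS]mx_normrE.
by rewrite (le_trans _ (le_bigmax _ _ (i, j))).
Qed.

Lemma seq_complete_prod V W : seq_complete V -> seq_complete W -> seq_complete (V * W : normedModType R)%type.
Proof.
move=> hV hW u Cu.
have [|l Hl] := hV (fst \o u).
  move=> e e0; have [N HN] := Cu e e0; exists N => m n mN nN.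
  by apply: le_lt_trans (HN m n mN nN); rewrite prod_normE le_max lexx.
have [|l' Hl'] := hW (snd \o u).
  move=> e e0; have [N HN] := Cu e e0; exists N => m n mN nN.
  by apply: le_lt_trans (HN m n mN nN); rewrite prod_normE le_max lexx orbT.
exists (l, l') => e e0; have [N HN] := Hl e e0; have [N' HN'] := Hl' e e0.
exists (maxn N N') => n; rewrite geq_max => /andP[nN nN'].
by rewrite prod_normE gt_max; apply/andP; split; [exact: HN | exact: HN'].
Qed.

Lemma seq_complete_row n : seq_complete ('rV[R]_n.+1 : normedModType R).
Proof.
move=> u Cu.
have ex i : exists l : R, forall e : R, 0 < e -> exists N, forall k, (N <= k)%N -> `|u k 0 i - l| < e.
  apply: (@seq_complete_real R (fun k => u k 0 i)) => e e0.
  have [N HN] := Cu e e0; exists N => m k mN kN; apply: le_lt_trans (HN m k mN kN).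
  rewrite [leRHS]mx_normrE (le_trans _ (le_bigmax _ _ (0, i))) //= !mxE //.
have [l Hl] := choice ex; exists (\row_i l i) => e e0.
have Hl' i : exists N, forall k, (N <= k)%N -> `|u k 0 i - l i| < e by exact: Hl.
have [N HN] := choice Hl'; exists (\max_i N i) => k kN.
rewrite [ltLHS]mx_normrE; apply: bigmax_lt => //= -[i j] _ /=.
rewrite !mxE ord1; apply: HN; apply: leq_trans kN; exact: leq_bigmax.
Qed.

#[export] Instance frechet_C2 o : is_frechet (curves o (C2 R)).
Proof. by apply: curves_frechet; apply: seq_complete_prod; exact: seq_complete_row. Qed.

#[export] Instance frechet_chart o : is_frechet (curves o ('rV[R]_3 * R^o)%type).
Proof.
by apply: curves_frechet; apply: seq_complete_prod; [exact: seq_complete_row | exact: seq_complete_real].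
Qed.

End LinearMaps.

(** * Primitives and integrals of continuous curves *)

Section Primitive.
Context {R : realType}.
Implicit Types f g : R -> R^o.

(** Clamping the argument extends [f] continuously to the line, and 0 and 2 become interior points
    of [-1,3], where the fundamental theorem of calculus provides two-sided derivatives. *)
Lemma primitive_continuous f : {within `[0, 2], continuous f} ->
  exists F : R -> R^o, [/\ isd F f, F 0 = 0 &
    F 2 = (\int[lebesgue_measure]_(t in `[0, 2]) (f t : R))].
Proof.
move=> cf; pose clamp t : R := Num.min 2 (Num.max 0 t).
have clamp02 t : 0 <= clamp t <= 2.
  by rewrite /clamp le_min ler0n le_max lexx ge_min lexx.
have clampE t : 0 <= t <= 2 -> clamp t = t.
  by move=> /andP[t0 t2]; rewrite /clamp max_r // min_r.
have clamp_lip s t : `|clamp s - clamp t| <= `|s - t|.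
  have clamp_le x y : x <= y -> clamp x <= clamp y /\ clamp y - clamp x <= y - x.
    rewrite /clamp !minEle !maxEle => xy.
    by case: (leP 0 x) => ?; case: (leP 0 y) => ?; do ?case: ifP => ?; split; lra.
  case: (leP s t) => [st|/ltW ts].
    have [h1 h2] := clamp_le _ _ st.
    by rewrite distrC [leRHS]distrC !ger0_norm ?subr_ge0.
  have [h1 h2] := clamp_le _ _ ts.
  by rewrite !ger0_norm ?subr_ge0.
pose f' := f \o clamp.
have cf' : continuous (f' : R -> R^o).
  move=> t; apply/cvgrPdist_lt => e e0.
  move/subspace_continuousP : cf => /(_ (clamp t)); rewrite /= in_itv /= => /(_ (clamp02 t)).
  move=> /cvgrPdist_lt /(_ e e0)[d d0 H].
  exists d => // s /= ts; apply: H; last by rewrite /= in_itv /=.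
  exact: le_lt_trans (clamp_lip _ _) ts.
have intf : lebesgue_measure.-integrable `[(-1 : R), 3] (EFin \o f').
  apply: continuous_compact_integrable; first exact: segment_compact.
  exact: continuous_subspaceT.
pose G (x : R) := (\int[lebesgue_measure]_(t in `[-1, x]) (f' t : R))%R.
have dG x : -1 < x < 3 -> derivable G x 1 /\ derive1 G x = f' x.
  move=> /andP[x1 x3]; apply: (@continuous_FTC1 R f' (BLeft (-1)) x 3) => //.
  exact: cf'.
pose F x := G x - G 0.
have dF x : -1 < x < 3 -> h^-1 *: (F (h + x) - F x) @[h --> (0 : R)^'] --> (f' x : R^o).
  move=> x13; have [dGx eG] := dG x x13.
  have : h^-1 *: (G (h + x) - G x) @[h --> (0 : R)^'] --> (f' x : R^o).
    rewrite -eG /derive1; move: dGx; rewrite /derivable.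
    set a := (fun h : R => _); set b := (fun h : R => _).
    by have -> : a = b by apply/funext => h; rewrite /a /b /= [h%:A]mulr1.
  apply: cvg_trans; apply: near_eq_cvg; apply: nearW => h.
  by rewrite /F opprB addrA subrK.
have isdF : isd (F : R -> R^o) f.
  move=> t t02; have t13 : -1 < t < 3 by move: t02; rewrite /in02 => /andP[? ?]; apply/andP; split; lra.
  apply/cvgrPdist_lt => e e0.
  have /cvgrPdist_lt /(_ e e0)[d d0 H] := dF t t13.
  apply/near02P; exists d => // s s02 st sd.
  have := H (s - t); rewrite /= sub0r normrN subrK /f' /= clampE //.
  by apply => //; rewrite subr_eq0.
exists F; split=> //; first by rewrite /F subrr.
rewrite /Rintegral.
have dFx x : -1 < x < 3 -> derivable (F : R -> R) x 1.
  move=> /dF Fx; rewrite /derivable; apply/cvg_ex; exists (f' x).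
  apply: cvg_trans Fx; apply: near_eq_cvg; apply: nearW => h /=.
  by rewrite [h%:A]mulr1.
have cF x : -1 < x < 3 -> {for x, continuous (F : R -> R)}.
  by move=> /dFx /derivable1_diffP; exact: differentiable_continuous.
have -> : (\int[lebesgue_measure]_(x in `[0%R : R, 2%R]) (f x : R)%:E = (F 2%R)%:E - (F 0%R)%:E)%E.
  apply: (continuous_FTC2 (F := F)) => //.
  - split.
    + move=> x; rewrite in_itv /= => /andP[x0 x2]; apply: dFx; apply/andP; split; lra.
    + apply: cvg_at_right_filter; apply: cF; apply/andP; split; lra.
    + apply: cvg_at_left_filter; apply: cF; apply/andP; split; lra.
  - move=> x; rewrite in_itv /= => /andP[x0 x2].
    have x13 : -1 < x < 3 by apply/andP; split; lra.
    have x02 : 0 <= x <= 2 by rewrite !ltW.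
    have -> : f x = f' x by rewrite /f' /= clampE.
    exact: (@cvg_lim _ (@norm_hausdorff _ _) _ _ _ _ _ (dF x x13)).
by rewrite /= /F subrr subr0.
Qed.

End Primitive.

(** * The L^2 structure *)

Section Integral.
Context {R : realType}.
Implicit Types (f g : R -> R^o) (o : option bool).
Notation SC := (curves None (R^o : normedModType R)).

Definition integral02 f : R := \int[lebesgue_measure]_(t in `[0, 2]) (f t : R).

Lemma in02_2 : @in02 R 2. Proof. by rewrite /in02 lexx ler0n. Qed.

Lemma isd_const (V : normedModType R) (F G g : R -> V) : isd F g -> isd G g ->
  forall t, in02 t -> F t - G t = F 0 - G 0.
Proof.
move=> Fg Gg t t02; have t0 : 0 <= t by case/andP: t02.
have d : isd (fun s => F s + (-1) *: G s) (fun s => g s + (-1) *: g s).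
  by apply: isdD => //; exact: (isd_blin (blin_scale V (-1))).
have := @isd_mean _ _ _ _ 0 t 0 d (@in02_0 R) t02 t0.
rewrite mul0r !scaleN1r => H; apply/eqP; rewrite -subr_eq0 -normr_le0; apply: H.
by move=> s _; rewrite scaleN1r subrr normr0.
Qed.

Lemma integral02P f F : cls None f -> isd F f -> integral02 f = (F 2 : R) - F 0.
Proof.
move=> cf Ff; have [G [Gf G0 G2]] := primitive_continuous (isd_continuous (cls_isd cf)).
have h := isd_const Ff Gf in02_2; rewrite G0 subr0 in h.
by rewrite /integral02 -G2 -h subKr.
Qed.

Lemma integral02_ex f : cls None f -> exists F, isd F f /\ integral02 f = (F 2 : R) - F 0.
Proof.
move=> cf; have [G [Gf _ _]] := primitive_continuous (isd_continuous (cls_isd cf)).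
by exists G; split=> //; exact: integral02P.
Qed.

Lemma integral02_lin a f g : cls None f -> cls None g ->
  integral02 (a *: f + g) = a * integral02 f + integral02 g.
Proof.
move=> cf cg; have [F [Ff ->]] := integral02_ex cf; have [G [Gg ->]] := integral02_ex cg.
have caf := clsZ a cf.
have d : isd (fun t => a *: F t + G t) (a *: f + g).
  by apply: isdD => //; exact: (isd_blin (blin_scale _ a)).
rewrite (integral02P (clsD caf cg) d) /GRing.scale /=; ring.
Qed.

Lemma integral02_bound f : cls None f -> `|integral02 f| <= 2 * supnorm f.
Proof.
move=> cf; have [F [Ff ->]] := integral02_ex cf.
have := @isd_mean _ _ _ _ 0 2 (supnorm f) Ff (@in02_0 R) in02_2 (ler0n _ _).
rewrite subr0 mulrC; apply => s s02; exact: cls_sup cf s02.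
Qed.

(** A primitive is nondecreasing. Were its end values equal it would be constant, and [f] would
    vanish. *)
Lemma integral02_gt0 f : cls None f -> (forall t, in02 t -> 0 <= (f t : R)) ->
  (exists2 t, in02 t & f t <> 0) -> 0 < integral02 f.
Proof.
move=> cf f0 [t t02 ft]; have [F [Ff ->]] := integral02_ex cf.
have mono a b : in02 a -> in02 b -> a <= b -> (F a : R) <= F b.
  move=> a02 b02 ab; pose M := supnorm f.
  (* Monotonicity out of the mean value inequality: as [|M - f| <= M], the function [M s - F s]
     grows by at most [M (b - a)]. *)
  have d : isd (fun s => (M * s : R^o) + (-1) *: F s) (fun s => (M : R^o) + (-1) *: f s).
    apply: isdD; last exact: (isd_blin (blin_scale _ _)).
    move=> s s02; apply: cvg_trans (@cvg_cst _ (M : R^o) _ (near02 s) _).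
    apply: near_eq_cvg; apply/near02P; exists 1 => // r r02 rs _.
    by rewrite /diff_quot -mulrBr /GRing.scale /= mulrC mulfK // subr_eq0.
  have := @isd_mean _ _ _ _ a b M d a02 b02 ab.
  have H s : a <= s <= b -> `|(M : R^o) + (-1) *: f s| <= M.
    move=> /andP[as_ sb].
    have s02 : in02 s by move: a02 b02; rewrite /in02 => /andP[? ?] /andP[? ?]; apply/andP; split; lra.
    have h1 := f0 s s02; have h2 : (f s : R) <= M.
      by apply: le_trans (ler_norm _) _; exact: cls_sup cf s02.
    by rewrite scaleN1r ger0_norm ?subr_ge0 // gerBl.
  move=> /(_ H); rewrite !scaleN1r.
  have -> : (M * b : R^o) - F b - ((M * a : R^o) - F a) = M * (b - a) - ((F b : R) - F a) by ring.
  rewrite ler_norml => /andP[_]; rewrite gerDl oppr_le0 subr_ge0; exact.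
rewrite subr_gt0 lt_neqAle mono ?ler0n ?in02_2 ?in02_0 // andbT.
apply/eqP => F02; apply: ft.
have F0 s : in02 s -> F s = F 0.
  move=> s02; have /andP[s0 s2] := s02; apply/eqP; rewrite eq_le [X in _ && X]mono ?in02_0 // andbT F02.
  by apply: mono => //; exact: in02_2.
have dc : isd F (fun=> 0) by apply: isd_eq (isd_cst (F 0)) => // s s02; rewrite F0.
by rewrite -(deriv02E Ff t02) (deriv02E dc t02).
Qed.

Lemma bilin_ip : @bilin R SC SC (fs_real R) (fun f g => integral02 (cmul f g)).
Proof.
split=> //.
- move=> a f f' g cf cf' cg.
  have -> : cmul (a *: f + f') g = a *: cmul f g + cmul f' g.
    exact: (bilin_l bilin_mul a cf cf' cg).
  exact: (integral02_lin a (smooth_mul cf cg) (smooth_mul cf' cg)).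
- move=> a f g g' cf cg cg'.
  have -> : cmul f (a *: g + g') = a *: cmul f g + cmul f g'.
    exact: (bilin_r bilin_mul a cf cg cg').
  exact: (integral02_lin a (smooth_mul cf cg) (smooth_mul cf cg')).
- move=> k; have [C C0 HC] := @csn_mul R k; exists k, (2 * C); first exact: mulr_gt0.
  move=> f g cf cg /=; have cfg := smooth_mul cf cg.
  apply: le_trans (integral02_bound cfg) _.
  rewrite -!mulrA ler_pM2l // !mulrA.
  exact: le_trans (supnorm_csn k cfg) (HC _ _ cf cg).
Qed.

End Integral.

Section BilinearOps.
Context {R : realType}.
Implicit Types E F G : fspace R.

Lemma bilin_comp E E' F F' G {hE : is_frechet E} {hE' : is_frechet E'} {hF : is_frechet F}
    {hF' : is_frechet F'} {hG : is_frechet G} (b : E' -> F' -> G) (S : E -> E') (T : F -> F') :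
  bilin b -> flin S -> flin T -> bilin (fun x y => b (S x) (T y)).
Proof.
move=> hb hS hT; split.
- by move=> x y hx hy; apply: (bilin_car hb); [exact: (flin_car hS) | exact: (flin_car hT)].
- move=> a x x' y hx hx' hy; rewrite (flin_lin hS) // (bilin_l hb) //;
    first [exact: (flin_car hS) | exact: (flin_car hT)].
- move=> a x y y' hx hy hy'; rewrite (flin_lin hT) // (bilin_r hb) //;
    first [exact: (flin_car hS) | exact: (flin_car hT)].
- move=> k; have [m [C C0 HC]] := bilin_bound hb k.
  have [m1 [C1 C10 H1]] := flin_bound hS m; have [m2 [C2 C20 H2]] := flin_bound hT m.
  exists (maxn m1 m2), (C * C1 * C2); first by rewrite !mulr_gt0.
  move=> x y hx hy; have cSx := flin_car hS hx; have cTy := flin_car hT hy.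
  apply: le_trans (HC _ _ cSx cTy) _.
  have h1 : fs_sn m (S x) <= C1 * fs_sn (maxn m1 m2) x.
    by apply: le_trans (H1 x hx) _; rewrite ler_pM2l // fs_sn_le // leq_maxl.
  have h2 : fs_sn m (T y) <= C2 * fs_sn (maxn m1 m2) y.
    by apply: le_trans (H2 y hy) _; rewrite ler_pM2l // fs_sn_le // leq_maxr.
  have -> : C * C1 * C2 * fs_sn (maxn m1 m2) x * fs_sn (maxn m1 m2) y =
      C * ((C1 * fs_sn (maxn m1 m2) x) * (C2 * fs_sn (maxn m1 m2) y)) by ring.
  rewrite -mulrA ler_pM2l //; apply: ler_pM => //; exact: fs_sn_ge0.
Qed.

Lemma bilinD E F G {hE : is_frechet E} {hF : is_frechet F} {hG : is_frechet G}
    (b b' : E -> F -> G) : bilin b -> bilin b' -> bilin (fun x y => b x y + b' x y).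
Proof.
move=> hb hb'; split.
- by move=> x y hx hy; apply: fs_carD; [exact: (bilin_car hb) | exact: (bilin_car hb')].
- by move=> a x x' y hx hx' hy; rewrite (bilin_l hb) // (bilin_l hb') // scalerDr addrACA.
- by move=> a x y y' hx hy hy'; rewrite (bilin_r hb) // (bilin_r hb') // scalerDr addrACA.
- move=> k; have [m [C C0 H]] := bilin_bound hb k; have [m' [C' C0' H']] := bilin_bound hb' k.
  exists (maxn m m'), (C + C'); first exact: addr_gt0.
  move=> x y hx hy; apply: le_trans (fr_snD _ (bilin_car hb hx hy) (bilin_car hb' hx hy)) _.
  rewrite !mulrDl; apply: lerD.
    apply: le_trans (H x y hx hy) _; rewrite -!mulrA ler_pM2l //.
    by apply: ler_pM; rewrite ?fs_sn_ge0 // fs_sn_le // leq_maxl.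
  apply: le_trans (H' x y hx hy) _; rewrite -!mulrA ler_pM2l //.
  by apply: ler_pM; rewrite ?fs_sn_ge0 // fs_sn_le // leq_maxr.
Qed.

Lemma flin_scale E {hE : is_frechet E} (a : R) : flin (fun x : E => a *: x).
Proof.
split=> [x|b x y _ _|k]; first exact: fs_carZ.
  by rewrite scalerDr !scalerA mulrC.
exists k, (`|a| + 1); first by rewrite ltr_wpDl.
by move=> x hx; rewrite fr_snZ // ler_wpM2r ?fs_sn_ge0 // lerDl.
Qed.

End BilinearOps.

Section L2Kahler.
Context {R : realType}.
Implicit Types (o : option bool) (u v : R -> C2 R) (z : C2 R).
Notation SC := (curves None (R^o : normedModType R)).

Definition ccoord (b : bool) (j : 'I_2) (z : C2 R) : R^o := (if b then z.2 else z.1) 0 j.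

Definition ccurve b j u : R -> R^o := fun t => ccoord b j (u t).

Lemma blin_ccoord b j : @blin R (C2 R) (R^o : normedModType R) (ccoord b j).
Proof.
case: b.
  exact: (blin_comp (blin_snd 'rV[R]_2 'rV[R]_2) (@blin_entry R 0 1 0 j)).
exact: (blin_comp (blin_fst 'rV[R]_2 'rV[R]_2) (@blin_entry R 0 1 0 j)).
Qed.

Lemma flin_ccurve o b j : @flin R (curves o (C2 R)) SC (ccurve b j).
Proof.
have hf := flin_blin o (blin_ccoord b j); split.
- by move=> u cu; exact: (cls_none (flin_car hf cu)).
- exact: (flin_lin hf).
- exact: (flin_bound hf).
Qed.

Definition ip (f g : R -> R^o) : R := integral02 (cmul f g).

Lemma integral02_sum (f0 f1 f2 f3 : R -> R^o) :
  cls None f0 -> cls None f1 -> cls None f2 -> cls None f3 ->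
  integral02 (f0 + (f1 + (f2 + f3))) =
  integral02 f0 + (integral02 f1 + (integral02 f2 + integral02 f3)).
Proof.
move=> c0 c1 c2 c3.
have add (f g : R -> R^o) : cls None f -> cls None g -> integral02 (f + g) = integral02 f + integral02 g.
  by move=> cf cg; have := integral02_lin 1 cf cg; rewrite scale1r mul1r.
have c23 := clsD c2 c3; have c123 := clsD c1 c23.
by rewrite (add _ _ c0 c123) (add _ _ c1 c23) (add _ _ c2 c3).
Qed.

Lemma ccurve_smooth o b j u : cls o u -> cls None (ccurve b j u).
Proof. exact: (flin_car (flin_ccurve o b j)). Qed.

Lemma herm_re o u v : cls o u -> cls o v -> complex.Re (herm_L2 u v) =
  ip (ccurve false 0 u) (ccurve false 0 v) + (ip (ccurve true 0 u) (ccurve true 0 v) +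
  (ip (ccurve false 1 u) (ccurve false 1 v) + ip (ccurve true 1 u) (ccurve true 1 v))).
Proof.
move=> cu cv; rewrite /ip -integral02_sum; try by apply: smooth_mul; [exact: ccurve_smooth cu | exact: ccurve_smooth cv].
rewrite /herm_L2 /integral02 /=; congr Rintegral; apply/funext => t.
rewrite /C2_herm !big_ord_recl big_ord0 /C2_coord /= /cmul /ccurve /ccoord /= !fctE.
have -> : lift ord0 ord0 = 1 :> 'I_2 by exact/val_inj.
ring.
Qed.

Lemma herm_im o u v : cls o u -> cls o v -> - complex.Im (herm_L2 u v) =
  ip (ccurve false 0 u) (ccurve true 0 v) + (ip (-1 *: ccurve true 0 u) (ccurve false 0 v) +
  (ip (ccurve false 1 u) (ccurve true 1 v) + ip (-1 *: ccurve true 1 u) (ccurve false 1 v))).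
Proof.
move=> cu cv; have cf b j := ccurve_smooth b j cu; have cg b j := ccurve_smooth b j cv.
rewrite /ip -integral02_sum; try by apply: smooth_mul; [first [exact: cf | exact: clsZ (cf _ _)] | exact: cg].
have N (f : R -> R^o) : cls None f -> - integral02 f = integral02 (-1 *: f).
  move=> ?; have := integral02_lin (-1) (_ : cls None f) (@cls0 R None _) => /(_ _).
  rewrite addr0 => ->//; rewrite mulN1r.
  have := integral02_lin 1 (@cls0 R None (R^o : normedModType R)) (@cls0 R None _).
  by rewrite scaler0 addr0 mul1r => /eqP; rewrite -subr_eq0 opprD addrA subrr add0r oppr_eq0 => /eqP ->; rewrite addr0.
pose k := cmul (ccurve true 0 u) (ccurve false 0 v) + (-1 *: cmul (ccurve false 0 u) (ccurve true 0 v) +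
   (cmul (ccurve true 1 u) (ccurve false 1 v) + -1 *: cmul (ccurve false 1 u) (ccurve true 1 v))).
have ck : cls None k.
  do ?apply: clsD; try apply: clsZ; by apply: smooth_mul; [exact: cf | exact: cg].
transitivity (- integral02 k).
  rewrite /herm_L2 /integral02 /=; congr (- _); congr Rintegral; apply/funext => t.
  rewrite /C2_herm !big_ord_recl big_ord0 /C2_coord /= /k /cmul /ccurve /ccoord /= !fctE /GRing.scale /=.
  have -> : lift ord0 ord0 = 1 :> 'I_2 by exact/val_inj.
  ring.
rewrite (N _ ck); congr integral02; apply/funext => t.
by rewrite /k /cmul !fctE /GRing.scale /=; ring.
Qed.

Lemma blin_C2i : @blin R (C2 R) (C2 R) (@C2_i R).
Proof.
split=> [a x y|].
  apply: injective_projections => //=; by rewrite opprD scalerN.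
exists 1 => // x; rewrite mul1r prod_normE [leRHS]prod_normE /= normrN ge_max !le_max !lexx orbT //.
Qed.

Lemma ccurve_C2i u j : ccurve false j (fun t => C2_i (u t)) = -1 *: ccurve true j u /\
  ccurve true j (fun t => C2_i (u t)) = ccurve false j u.
Proof. by split=> //; apply/funext => t; rewrite fctE scaleN1r /ccurve /ccoord /= mxE. Qed.

Lemma bilin_eq (E F G : fspace R) {hE : is_frechet E} {hF : is_frechet F} (b b' : E -> F -> G) :
  (forall x y, fs_car x -> fs_car y -> b' x y = b x y) -> bilin b -> bilin b'.
Proof.
move=> e hb; split.
- by move=> x y hx hy; rewrite e //; exact: (bilin_car hb).
- by move=> a x x' y hx hx' hy; rewrite !e ?(bilin_l hb) //; apply: fr_lin.
- by move=> a x y y' hx hy hy'; rewrite !e ?(bilin_r hb) //; apply: fr_lin.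
- move=> k; have [m [C C0 H]] := bilin_bound hb k; exists m, C => // x y hx hy.
  by rewrite e //; exact: H.
Qed.

Lemma ipC f g : ip f g = ip g f.
Proof. by rewrite /ip; congr integral02; apply/funext => t; rewrite /cmul mulrC. Qed.

Lemma ipZl a f g : cls None f -> cls None g -> ip (a *: f) g = a * ip f g.
Proof. exact: (bilinZl bilin_ip). Qed.

Lemma L2_flat o : @flat_kahler R (curves o (C2 R)) (fun u v => complex.Re (herm_L2 u v))
  (fun u v => - complex.Im (herm_L2 u v)) (fun u t => C2_i (u t)).
Proof.
have ccS b j : @flin R (curves o (C2 R)) SC (fun u => -1 *: ccurve b j u).
  exact: (flin_comp (flin_ccurve o b j) (@flin_scale R SC _ (-1))).
have ipS (S T : curves o (C2 R) -> SC) : flin S -> flin T ->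
    @bilin R (curves o (C2 R)) (curves o (C2 R)) (fs_real R) (fun u v => ip (S u) (T v)).
  exact: (bilin_comp bilin_ip).
have C2i_smooth u : cls o u -> cls o (fun t => C2_i (u t)) by exact: (cls_blin blin_C2i).
split.
- apply: (@bilin_eq (curves o (C2 R)) (curves o (C2 R)) (fs_real R) _ _ (fun u v => ip (ccurve false 0 u) (ccurve false 0 v) +
    (ip (ccurve true 0 u) (ccurve true 0 v) +
    (ip (ccurve false 1 u) (ccurve false 1 v) + ip (ccurve true 1 u) (ccurve true 1 v))) : fs_real R)).
    by move=> u v cu cv; exact: herm_re cu cv.
  by do !apply: bilinD; apply: ipS; exact: flin_ccurve.
- apply: (@bilin_eq (curves o (C2 R)) (curves o (C2 R)) (fs_real R) _ _ (fun u v => ip (ccurve false 0 u) (ccurve true 0 v) +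
    (ip (-1 *: ccurve true 0 u) (ccurve false 0 v) +
    (ip (ccurve false 1 u) (ccurve true 1 v) + ip (-1 *: ccurve true 1 u) (ccurve false 1 v))) : fs_real R)).
    by move=> u v cu cv; exact: herm_im cu cv.
  by do !apply: bilinD; apply: (ipS (fun u => _) (fun v => _)); first [exact: flin_ccurve | exact: ccS].
- exact: flin_blin blin_C2i.
- by move=> u cu; apply/funext => t; apply: injective_projections; rewrite /= ?fctE.
- by move=> u v cu cv; rewrite (herm_re cu cv) (herm_re cv cu) (ipC (ccurve false 0 u))
    (ipC (ccurve true 0 u)) (ipC (ccurve false 1 u)) (ipC (ccurve true 1 u)).
- move=> u cu u0; rewrite (herm_re cu cu).
  (* The metric is a sum of four squares, one for each real coordinate; a nonzero coordinate makes
     its own square positive. *)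
  have sq (f : R -> R^o) : cls None f -> 0 <= ip f f /\ (forall t, in02 t -> f t <> 0 -> 0 < ip f f).
    move=> cf; have cff := smooth_mul cf cf.
    have pos t : in02 t -> f t <> 0 -> 0 < ip f f.
      move=> t02 ft; apply: integral02_gt0 => //.
        by move=> s _; rewrite /cmul -expr2 sqr_ge0.
      by exists t => // /eqP; rewrite /cmul mulf_eq0 orbb => /eqP.
    split=> //; have [[t [t02 ft]]|] := pselect (exists t, in02 t /\ f t <> 0).
      by apply: ltW; exact: (pos t).
    move=> /forallNP H; have f0 : f = (fun=> 0).
      apply/funext => t; have [t02|t02] := boolP (in02 t); last exact: cls_out cf t02.
      by apply: contrapT => ft; apply: (H t).
    have c0 : cls None (0 : R -> R^o) by exact: cls0.
    have := ipZl 0 c0 c0; rewrite mul0r scale0r => e.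
    by rewrite f0 [ip _ _]e.
  have [t [t02 ut]] : exists t, in02 t /\ u t <> 0.
    apply: contrapT => /forallNP H; apply: u0; apply/funext => t.
    have [t02|t02] := boolP (in02 t); last exact: cls_out cu t02.
    by apply: contrapT => ut; apply: (H t).
  have [b [j bj]] : exists b j, ccurve b j u t <> 0.
    apply: contrapT => H; apply: ut; apply: injective_projections; apply/rowP => j; rewrite mxE;
      apply: contrapT => uj; apply: H; [by exists false, j | by exists true, j].
  have h1 := sq _ (ccurve_smooth false 0 cu); have h2 := sq _ (ccurve_smooth true 0 cu).
  have h3 := sq _ (ccurve_smooth false 1 cu); have h4 := sq _ (ccurve_smooth true 1 cu).
  case: h1 h2 h3 h4 => [p1 q1] [p2 q2] [p3 q3] [p4 q4].
  have j01 : j = 0 \/ j = 1.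
    by case: j {bj} => -[|[|//]] ?; [left|right]; exact/val_inj.
  by case: b j01 bj => -[]-> bj;
    [have := q2 t t02 bj | have := q4 t t02 bj | have := q1 t t02 bj | have := q3 t t02 bj] => ?; lra.
- move=> u v cu cv; rewrite (herm_im cu cv) (herm_im cv cu).
  have cf b j := ccurve_smooth b j cu; have cg b j := ccurve_smooth b j cv.
  rewrite !ipZl //; rewrite (ipC (ccurve false 0 v)) (ipC (ccurve true 0 v)) (ipC (ccurve false 1 v)) (ipC (ccurve true 1 v)).
  by ring.
- move=> u v cu cv; rewrite (herm_re cu cv) (herm_im cu (C2i_smooth _ cv)).
  have [-> ->] := ccurve_C2i v 0; have [-> ->] := ccurve_C2i v 1.
  have cf b j := ccurve_smooth b j cu; have cg b j := ccurve_smooth b j cv.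
  rewrite !ipZl //; try exact: clsZ (cg _ _).
  rewrite !(ipC _ (-1 *: _)) !ipZl //.
  by rewrite (ipC (ccurve true 0 v)) (ipC (ccurve true 1 v)); ring.
Qed.

End L2Kahler.

(** * Quaternions and rotations *)

Section Quaternions.
Context {R : realType}.
Implicit Types (p q z : C2 R) (A B : 'M[R]_3) (k : nat).

(* A point of C2 is read as the quaternion with real coordinates [qc 0 z], ...,
   [qc 3 z]. *)
Definition qc k z : R := (if odd k then z.2 else z.1) 0 (if (k < 2)%N then 0 else 1).

(** The quaternion [a + b i + c j + d k = (a + b i) + (c + d i) j], with complex coordinates
    [a + b i] and [c + d i]. Multiplication by [i] in C^2 is thus left multiplication by the
    quaternion [i]. *)
Definition qmk (a b c d : R) : C2 R :=
  (\row_(j < 2) (if j == 0 then a else c), \row_(j < 2) (if j == 0 then b else d)).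

Lemma qc_mk a b c d :
  [/\ qc 0 (qmk a b c d) = a, qc 1 (qmk a b c d) = b, qc 2 (qmk a b c d) = c
    & qc 3 (qmk a b c d) = d].
Proof. by split; rewrite /qc /= mxE. Qed.

Lemma qmkE z : qmk (qc 0 z) (qc 1 z) (qc 2 z) (qc 3 z) = z.
Proof.
case: z => x y; congr (_, _); apply/rowP => j; rewrite mxE /qc /=.
  by case: ifP => [/eqP ->//|]; case: j => -[|[|//]] i //= _; congr (x _ _); exact/val_inj.
by case: ifP => [/eqP ->//|]; case: j => -[|[|//]] i //= _; congr (y _ _); exact/val_inj.
Qed.

Lemma qcZ k a z : qc k (a *: z) = a * qc k z.
Proof. by rewrite /qc; case: ifP => _; rewrite mxE. Qed.

Definition qn z : R := qc 0 z ^+ 2 + qc 1 z ^+ 2 + qc 2 z ^+ 2 + qc 3 z ^+ 2.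

Definition qconj z := qmk (qc 0 z) (- qc 1 z) (- qc 2 z) (- qc 3 z).

Definition qmul p q := qmk
  (qc 0 p * qc 0 q - qc 1 p * qc 1 q - qc 2 p * qc 2 q - qc 3 p * qc 3 q)
  (qc 0 p * qc 1 q + qc 1 p * qc 0 q + qc 2 p * qc 3 q - qc 3 p * qc 2 q)
  (qc 0 p * qc 2 q - qc 1 p * qc 3 q + qc 2 p * qc 0 q + qc 3 p * qc 1 q)
  (qc 0 p * qc 3 q + qc 1 p * qc 2 q - qc 2 p * qc 1 q + qc 3 p * qc 0 q).

(** With nine named entries, matrix identities become polynomial identities. *)
Definition mk3 (a b c d e f g h i : R) : 'M[R]_3 :=
  \matrix_(k, l) nth 0 (nth [::] [:: [:: a; b; c]; [:: d; e; f]; [:: g; h; i]] k) l.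

Lemma mk3E A : exists a b c d e f g h i, A = mk3 a b c d e f g h i.
Proof.
pose n (k l : nat) : R := A (inord k) (inord l).
exists (n 0 0)%N, (n 0 1)%N, (n 0 2)%N, (n 1 0)%N, (n 1 1)%N, (n 1 2)%N, (n 2 0)%N, (n 2 1)%N, (n 2 2)%N.
by apply/matrixP => -[[|[|[|//]]] ?] [[|[|[|//]]] ?]; rewrite !mxE /= /n; congr (A _ _);
  apply/val_inj; rewrite /= inordK.
Qed.

Lemma mk3_eq a b c d e f g h i a' b' c' d' e' f' g' h' i' :
  [/\ a = a', b = b' & c = c'] -> [/\ d = d', e = e' & f = f'] -> [/\ g = g', h = h' & i = i'] ->
  mk3 a b c d e f g h i = mk3 a' b' c' d' e' f' g' h' i'.
Proof. by move=> [-> -> ->] [-> -> ->] [-> -> ->]. Qed.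

Lemma mk3_inj a b c d e f g h i a' b' c' d' e' f' g' h' i' :
  mk3 a b c d e f g h i = mk3 a' b' c' d' e' f' g' h' i' ->
  [/\ [/\ a = a', b = b' & c = c'], [/\ d = d', e = e' & f = f'] & [/\ g = g', h = h' & i = i']].
Proof.
move=> /matrixP E.
have E' k l (hk : (k < 3)%N) (hl : (l < 3)%N) := E (Ordinal hk) (Ordinal hl).
by split; split; [have := E' 0%N 0%N isT isT | have := E' 0%N 1%N isT isT | have := E' 0%N 2%N isT isT
  | have := E' 1%N 0%N isT isT | have := E' 1%N 1%N isT isT | have := E' 1%N 2%N isT isT
  | have := E' 2%N 0%N isT isT | have := E' 2%N 1%N isT isT | have := E' 2%N 2%N isT isT]; rewrite !mxE.
Qed.

Lemma mk3_mul a b c d e f g h i a' b' c' d' e' f' g' h' i' :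
  mk3 a b c d e f g h i *m mk3 a' b' c' d' e' f' g' h' i' =
  mk3 (a * a' + b * d' + c * g') (a * b' + b * e' + c * h') (a * c' + b * f' + c * i')
      (d * a' + e * d' + f * g') (d * b' + e * e' + f * h') (d * c' + e * f' + f * i')
      (g * a' + h * d' + i * g') (g * b' + h * e' + i * h') (g * c' + h * f' + i * i').
Proof.
apply/matrixP => -[[|[|[|//]]] ?] [[|[|[|//]]] ?];
  by rewrite !mxE !big_ord_recl big_ord0 !mxE /= addr0 addrA.
Qed.

Lemma mk3_tr a b c d e f g h i : (mk3 a b c d e f g h i)^T = mk3 a d g b e h c f i.
Proof. by apply/matrixP => -[[|[|[|//]]] ?] [[|[|[|//]]] ?]; rewrite !mxE. Qed.

Lemma mk3_scale x a b c d e f g h i : x *: mk3 a b c d e f g h i =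
  mk3 (x * a) (x * b) (x * c) (x * d) (x * e) (x * f) (x * g) (x * h) (x * i).
Proof. by apply/matrixP => -[[|[|[|//]]] ?] [[|[|[|//]]] ?]; rewrite !mxE. Qed.

Lemma mk3_scalar x : x%:M = mk3 x 0 0 0 x 0 0 0 x.
Proof. by apply/matrixP => -[[|[|[|//]]] ?] [[|[|[|//]]] ?]; rewrite !mxE. Qed.

Lemma mk3_trace a b c d e f g h i : \tr (mk3 a b c d e f g h i) = a + e + i.
Proof. by rewrite /mxtrace !big_ord_recl big_ord0 !mxE /= addr0 addrA. Qed.

Lemma mk3_det a b c d e f g h i : \det (mk3 a b c d e f g h i) =
  a * (e * i - f * h) - b * (d * i - f * g) + c * (d * h - e * g).
Proof.
rewrite (expand_det_row _ ord0) !big_ord_recl big_ord0 /cofactor.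
rewrite !(expand_det_row _ ord0) !big_ord_recl !big_ord0 /cofactor !det_mx11 !mxE /=.
rewrite !expr0 !exprD !expr1 ?expr0; ring.
Qed.

(** The matrix of [x |-> q x conj(q)] on imaginary quaternions, a rotation times the square norm of
    [q]. *)
Definition qrot4 (a b c d : R) : 'M[R]_3 := mk3
  (a ^+ 2 + b ^+ 2 - c ^+ 2 - d ^+ 2) (2 * (b * c - a * d)) (2 * (b * d + a * c))
  (2 * (b * c + a * d)) (a ^+ 2 - b ^+ 2 + c ^+ 2 - d ^+ 2) (2 * (c * d - a * b))
  (2 * (b * d - a * c)) (2 * (c * d + a * b)) (a ^+ 2 - b ^+ 2 - c ^+ 2 + d ^+ 2).

Definition qrot z := qrot4 (qc 0 z) (qc 1 z) (qc 2 z) (qc 3 z).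

Definition hop z : 'M[R]_3 * R^o := ((qn z)^-1 *: qrot z, qn z).

Lemma qrotM p q : qrot (qmul p q) = qrot p *m qrot q.
Proof.
rewrite /qrot; have [-> -> -> ->] := qc_mk
  (qc 0 p * qc 0 q - qc 1 p * qc 1 q - qc 2 p * qc 2 q - qc 3 p * qc 3 q)
  (qc 0 p * qc 1 q + qc 1 p * qc 0 q + qc 2 p * qc 3 q - qc 3 p * qc 2 q)
  (qc 0 p * qc 2 q - qc 1 p * qc 3 q + qc 2 p * qc 0 q + qc 3 p * qc 1 q)
  (qc 0 p * qc 3 q + qc 1 p * qc 2 q - qc 2 p * qc 1 q + qc 3 p * qc 0 q).
by rewrite mk3_mul; apply: mk3_eq; split; ring.
Qed.

Lemma qrot_conj p : qrot (qconj p) = (qrot p)^T.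
Proof.
rewrite /qrot; have [-> -> -> ->] := qc_mk (qc 0 p) (- qc 1 p) (- qc 2 p) (- qc 3 p).
by rewrite mk3_tr; apply: mk3_eq; split; ring.
Qed.

Lemma qnM p q : qn (qmul p q) = qn p * qn q.
Proof.
rewrite /qn; have [-> -> -> ->] := qc_mk
  (qc 0 p * qc 0 q - qc 1 p * qc 1 q - qc 2 p * qc 2 q - qc 3 p * qc 3 q)
  (qc 0 p * qc 1 q + qc 1 p * qc 0 q + qc 2 p * qc 3 q - qc 3 p * qc 2 q)
  (qc 0 p * qc 2 q - qc 1 p * qc 3 q + qc 2 p * qc 0 q + qc 3 p * qc 1 q)
  (qc 0 p * qc 3 q + qc 1 p * qc 2 q - qc 2 p * qc 1 q + qc 3 p * qc 0 q).
by ring.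
Qed.

Lemma qn_conj p : qn (qconj p) = qn p.
Proof.
rewrite /qn; have [-> -> -> ->] := qc_mk (qc 0 p) (- qc 1 p) (- qc 2 p) (- qc 3 p).
by rewrite !sqrrN.
Qed.

Lemma qmulA_conj p q : qmul p (qmul (qconj p) q) = qn p *: q.
Proof.
rewrite -[RHS]qmkE /qn {1}/qmul.
have [-> -> -> ->] := qc_mk
  (qc 0 (qconj p) * qc 0 q - qc 1 (qconj p) * qc 1 q - qc 2 (qconj p) * qc 2 q - qc 3 (qconj p) * qc 3 q)
  (qc 0 (qconj p) * qc 1 q + qc 1 (qconj p) * qc 0 q + qc 2 (qconj p) * qc 3 q - qc 3 (qconj p) * qc 2 q)
  (qc 0 (qconj p) * qc 2 q - qc 1 (qconj p) * qc 3 q + qc 2 (qconj p) * qc 0 q + qc 3 (qconj p) * qc 1 q)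
  (qc 0 (qconj p) * qc 3 q + qc 1 (qconj p) * qc 2 q - qc 2 (qconj p) * qc 1 q + qc 3 (qconj p) * qc 0 q).
have [-> -> -> ->] := qc_mk (qc 0 p) (- qc 1 p) (- qc 2 p) (- qc 3 p).
by congr qmk; rewrite qcZ; ring.
Qed.

Lemma qrotZ a z : qrot (a *: z) = a ^+ 2 *: qrot z.
Proof.
by rewrite /qrot !qcZ mk3_scale; apply: mk3_eq; split; ring.
Qed.

Lemma qnZ a z : qn (a *: z) = a ^+ 2 * qn z.
Proof. by rewrite /qn !qcZ; ring. Qed.

Lemma qn_ge0 z : 0 <= qn z.
Proof. by rewrite /qn !addr_ge0 // sqr_ge0. Qed.

Lemma qn_eq0 z : qn z = 0 -> z = 0.
Proof.
rewrite /qn => e.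
have [h0 h1 h2 h3] : [/\ qc 0 z = 0, qc 1 z = 0, qc 2 z = 0 & qc 3 z = 0].
  have := (sqr_ge0 (qc 0 z), sqr_ge0 (qc 1 z), sqr_ge0 (qc 2 z), sqr_ge0 (qc 3 z)).
  move=> [[[s0 s1] s2] s3].
  by split; apply/eqP; rewrite -(sqrf_eq0 (qc _ z)); apply/eqP; lra.
rewrite -(qmkE z) h0 h1 h2 h3.
by congr (_, _); apply/rowP => j; rewrite !mxE if_same.
Qed.

Lemma qn_gt0 z : z <> 0 -> 0 < qn z.
Proof.
by move=> z0; rewrite lt_neqAle qn_ge0 andbT eq_sym; apply/eqP => /qn_eq0.
Qed.

Lemma qrot_tr z : qrot z *m (qrot z)^T = (qn z ^+ 2)%:M.
Proof. by rewrite mk3_tr mk3_mul mk3_scalar /qn; apply: mk3_eq; split; ring. Qed.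

Lemma hop_SO3Rp z : z <> 0 -> @SO3Rp R (hop z).
Proof.
move=> /qn_gt0 z0; have z0' := lt0r_neq0 z0; split=> //=.
  rewrite linearZ /= -scalemxAl -scalemxAr qrot_tr !scale_scalar_mx.
  by congr (_%:M); field.
rewrite mk3_scale mk3_det.
rewrite /qn in z0' *; field; exact: z0'.
Qed.

Lemma hop_conj p q : p <> 0 -> (hop p).1^T *m (hop q).1 =
  (qn (qmul (qconj p) q))^-1 *: qrot (qmul (qconj p) q).
Proof.
move=> /qn_gt0/lt0r_neq0 p0.
rewrite /= [(_ *: _)^T]linearZ /= -scalemxAl -scalemxAr scalerA qrotM qrot_conj qnM qn_conj.
by rewrite invfM.
Qed.

(** Trace -1 therefore means vanishing real part: this is the domain of the Cayley coordinates seen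
    upstairs. *)
Lemma hop_trace q : q <> 0 -> 1 + \tr ((qn q)^-1 *: qrot q) = 4 * qc 0 q ^+ 2 / qn q.
Proof.
move=> /qn_gt0/lt0r_neq0 q0; rewrite mk3_scale mk3_trace.
by rewrite /qn in q0 *; field.
Qed.

Lemma hop_cayley q : q <> 0 -> qc 0 q != 0 -> cayley ((qn q)^-1 *: qrot q) =
  \row_(j < 3) (qc j.+1 q / qc 0 q).
Proof.
move=> q0 r0; rewrite /cayley hop_trace //; move/qn_gt0/lt0r_neq0: q0 => q0.
apply/rowP => -[[|[|[|//]]] ?]; rewrite !mxE /=; field; rewrite q0 r0 //.
Qed.

(** The quaternion [r = conj(p) q] has a scalar rotation matrix, so its imaginary part vanishes and
    it is plus or minus the square norm of [p]. *)
Lemma hop_inj p q : p <> 0 -> hop p = hop q -> q = p \/ q = - p.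
Proof.
move=> p0 e; have n0 := qn_gt0 p0; have n0' := lt0r_neq0 n0.
case: e => er en; set r := qmul (qconj p) q.
have hr : qrot r = (qn p ^+ 2)%:M.
  have : qn p *: ((qn p)^-1 *: qrot p) = qn q *: ((qn q)^-1 *: qrot q) by rewrite er en.
  rewrite !scalerA -en mulfV // !scale1r => erot.
  by rewrite /r qrotM qrot_conj -erot mk3_tr mk3_mul mk3_scalar /qn; apply: mk3_eq; split; ring.
have [r1 r2 r3 r0] : [/\ qc 1 r = 0, qc 2 r = 0, qc 3 r = 0 & qc 0 r ^+ 2 = qn p ^+ 2].
  move: hr; rewrite mk3_scalar => /mk3_inj [[h00 _ _] [_ h11 _] [_ _ h22]].
  have hn : qc 0 r ^+ 2 + qc 1 r ^+ 2 + qc 2 r ^+ 2 + qc 3 r ^+ 2 = qn p ^+ 2.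
    by rewrite -/(qn r) /r qnM qn_conj -en expr2.
  by split; [apply/eqP; rewrite -sqrf_eq0; apply/eqP; lra..|lra].
have hq : qn p *: q = qc 0 r *: p.
  rewrite -qmulA_conj -/r -[RHS]qmkE !qcZ /qmul r1 r2 r3; congr qmk; ring.
have hq' : q = (qn p)^-1 *: (qc 0 r *: p) by rewrite -hq scalerA mulVf // scale1r.
move/eqP: r0; rewrite eqf_sqr => /orP[]/eqP r0; [left|right].
  by rewrite hq' r0 scalerA mulVf // scale1r.
by rewrite hq' r0 scalerA mulrN mulVf // scaleN1r.
Qed.

(* [4 q_a q_b], as linear functions of the rotation matrix of the unit
   quaternion [q]. *)
Definition quat_row A (k : nat) : C2 R :=
  let a i j := A (inord i) (inord j) in
  let v0 := a 2%N 1%N - a 1%N 2%N in let v1 := a 0%N 2%N - a 2%N 0%N in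
  let v2 := a 1%N 0%N - a 0%N 1%N in
  let s01 := a 0%N 1%N + a 1%N 0%N in let s02 := a 0%N 2%N + a 2%N 0%N in
  let s12 := a 1%N 2%N + a 2%N 1%N in
  let d0 := a 0%N 0%N in let d1 := a 1%N 1%N in let d2 := a 2%N 2%N in
  match k with
  | 0 => qmk (1 + d0 + d1 + d2) v0 v1 v2
  | 1 => qmk v0 (1 + d0 - d1 - d2) s01 s02
  | 2 => qmk v1 s01 (1 - d0 + d1 - d2) s12
  | _ => qmk v2 s02 s12 (1 - d0 - d1 + d2)
  end.

Lemma quat_row_mk3 a b c d e f g h i k : quat_row (mk3 a b c d e f g h i) k =
  match k with
  | 0 => qmk (1 + a + e + i) (h - f) (c - g) (d - b)
  | 1 => qmk (h - f) (1 + a - e - i) (b + d) (c + g)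
  | 2 => qmk (c - g) (b + d) (1 - a + e - i) (f + h)
  | _ => qmk (d - b) (c + g) (f + h) (1 - a - e + i)
  end.
Proof. by rewrite /quat_row !mxE !inordK //; case: k => [|[|[|k]]] /=. Qed.

(** The cofactor matrix [B] satisfies [B^T A = det A = 1], hence [B = A]. *)
Lemma SO3_relations a b c d e f g h i : let A := mk3 a b c d e f g h i in
  A *m A^T = 1%:M -> \det A = 1 ->
  [/\ A^T *m A = 1%:M, [/\ a = e * i - f * h, b = f * g - d * i & c = d * h - e * g],
    [/\ d = c * h - b * i, e = a * i - c * g & f = b * g - a * h] &
    [/\ g = b * f - c * e, h = c * d - a * f & i = a * e - b * d]].
Proof.
move=> A AA dA; have AA' : A^T *m A = 1%:M by exact: mulmx1C.
pose B := mk3 (e * i - f * h) (f * g - d * i) (d * h - e * g) (c * h - b * i) (a * i - c * g)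
  (b * g - a * h) (b * f - c * e) (c * d - a * f) (a * e - b * d).
have BA : B^T *m A = 1%:M.
  rewrite /B /A mk3_tr mk3_mul mk3_scalar; move: dA; rewrite mk3_det => dA.
  by apply: mk3_eq; split; lra.
have BA' : B^T = A^T by rewrite -[B^T]mulmx1 -AA mulmxA BA mul1mx.
have : B = A by rewrite -[B]trmxK BA' trmxK.
by move=> /esym/mk3_inj [h1 h2 h3]; split.
Qed.

(** If [A] is the rotation of the unit quaternion [q], row [k] is [4 q_k q], of square norm 4 times
    its entry [4 q_k^2]. The proof uses only the orthogonality and cofactor relations, because this
    is how [q] is going to be obtained. *)
Lemma quat_rowP A k : A *m A^T = 1%:M -> \det A = 1 -> (k < 4)%N ->
  qrot (quat_row A k) = (4 * qc k (quat_row A k)) *: A /\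
  qn (quat_row A k) = 4 * qc k (quat_row A k).
Proof.
have [a [b [c [d [e [f [g [h [i ->]]]]]]]]] := mk3E A.
move=> AA dA; have [AA' [c1 c2 c3] [c4 c5 c6] [c7 c8 c9]] := SO3_relations AA dA.
move: AA AA'; rewrite !mk3_tr !mk3_mul !mk3_scalar.
move=> /mk3_inj [[r1 r2 r3] [_ r4 r5] [_ _ r6]] /mk3_inj [[l1 l2 l3] [_ l4 l5] [_ _ l6]].
rewrite quat_row_mk3.
case: k => [|[|[|[|//]]]] _; rewrite /qrot /qn.
- have [-> -> -> ->] := qc_mk (1 + a + e + i) (h - f) (c - g) (d - b).
  rewrite mk3_scale; split; last by lra.
  by apply: mk3_eq; split; lra.
- have [-> -> -> ->] := qc_mk (h - f) (1 + a - e - i) (b + d) (c + g).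
  rewrite mk3_scale; split; last by lra.
  by apply: mk3_eq; split; lra.
- have [-> -> -> ->] := qc_mk (c - g) (b + d) (1 - a + e - i) (f + h).
  rewrite mk3_scale; split; last by lra.
  by apply: mk3_eq; split; lra.
- have [-> -> -> ->] := qc_mk (d - b) (c + g) (f + h) (1 - a - e + i).
  rewrite mk3_scale; split; last by lra.
  by apply: mk3_eq; split; lra.
Qed.

End Quaternions.

(** * The covering in the charts *)

Section Tables.
Context {R : realType}.
Implicit Types (o : option bool) (f g : nat -> R -> R^o) (l : seq (R * (nat * nat))) (k : nat).
Notation SC := (curves None (R^o : normedModType R)).

(** Bilinear expressions in the components are given by tables of coefficients and index pairs, so
    that their class and their smoothness are settled once for all of them. *)
Definition qbil l f g : R -> R^o := \sum_(x <- l) x.1 *: cmul (f x.2.1) (g x.2.2).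

Lemma cls_qbil o o' l f g : (forall k, cls o (f k)) -> (forall k, cls o' (g k)) ->
  cls (omul o o') (qbil l f g).
Proof.
move=> cf cg; rewrite /qbil; elim: l => [|x l IH]; first by rewrite big_nil; exact: cls0.
by rewrite big_cons; apply: clsD => //; apply: clsZ; apply: cls_mul.
Qed.

Lemma Cn_qbil n (E : fspace R) {hE : is_frechet E} (U : set E) l (F G : nat -> E -> R -> R^o) :
  fopen U -> (forall k, Cn (F := SC) n U (F k)) -> (forall k, Cn (F := SC) n U (G k)) ->
  Cn (F := SC) n U (fun x => qbil l (fun k => F k x) (fun k => G k x)).
Proof.
move=> oU CF CG; elim: l => [|x l IH].
  apply: (Cn_eq (f := fun=> 0 : SC)) => //; first by move=> x _; rewrite /qbil big_nil.
  by apply: Cn_cst => //; exact: fs_car0.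
apply: (Cn_eq (f := fun y => x.1 *: cmul (F x.2.1 y) (G x.2.2 y) +
    qbil l (fun k => F k y) (fun k => G k y) : SC)) => //.
  by move=> y _; rewrite /qbil big_cons.
apply: CnD => //; apply: (Cn_comp (V := @fs_car R SC) (g := fun h : SC => x.1 *: h)) => //.
- exact: fopen_fs_car.
- by apply: Cn_car; apply: Cn_mul.
- exact: Cn_mul.
- by apply: Cn_flin; [exact: flin_scale | exact: fopen_fs_car].
Qed.

(* Components of [p q] and of [conj p q]. *)
Definition mulT k : seq (R * (nat * nat)) := match k with
  | 0%N => [:: (1, (0, 0)%N); (-1, (1, 1)%N); (-1, (2, 2)%N); (-1, (3, 3)%N)]
  | 1%N => [:: (1, (0, 1)%N); (1, (1, 0)%N); (1, (2, 3)%N); (-1, (3, 2)%N)]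
  | 2%N => [:: (1, (0, 2)%N); (-1, (1, 3)%N); (1, (2, 0)%N); (1, (3, 1)%N)]
  | _ => [:: (1, (0, 3)%N); (1, (1, 2)%N); (-1, (2, 1)%N); (1, (3, 0)%N)]
  end.

Definition cnjT k : seq (R * (nat * nat)) := match k with
  | 0%N => [:: (1, (0, 0)%N); (1, (1, 1)%N); (1, (2, 2)%N); (1, (3, 3)%N)]
  | 1%N => [:: (1, (0, 1)%N); (-1, (1, 0)%N); (-1, (2, 3)%N); (1, (3, 2)%N)]
  | 2%N => [:: (1, (0, 2)%N); (1, (1, 3)%N); (-1, (2, 0)%N); (-1, (3, 1)%N)]
  | _ => [:: (1, (0, 3)%N); (-1, (1, 2)%N); (1, (2, 1)%N); (-1, (3, 0)%N)]
  end.

Lemma qbilE l f g t : qbil l f g t = \sum_(x <- l) x.1 * ((f x.2.1 t : R) * (g x.2.2 t : R)).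
Proof. by rewrite /qbil fct_sumE; apply: eq_bigr => x _; rewrite fctE. Qed.

Lemma qbil_mul k f g t (p q : C2 R) : (k < 4)%N ->
  (forall j, (j < 4)%N -> f j t = qc j p) -> (forall j, (j < 4)%N -> g j t = qc j q) -> qbil (mulT k) f g t = qc k (qmul p q).
Proof.
move=> k4 fp gq; rewrite qbilE /qmul.
have [h0 h1 h2 h3] := qc_mk
  (qc 0 p * qc 0 q - qc 1 p * qc 1 q - qc 2 p * qc 2 q - qc 3 p * qc 3 q)
  (qc 0 p * qc 1 q + qc 1 p * qc 0 q + qc 2 p * qc 3 q - qc 3 p * qc 2 q)
  (qc 0 p * qc 2 q - qc 1 p * qc 3 q + qc 2 p * qc 0 q + qc 3 p * qc 1 q)
  (qc 0 p * qc 3 q + qc 1 p * qc 2 q - qc 2 p * qc 1 q + qc 3 p * qc 0 q).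
by case: k k4 => [|[|[|[|//]]]] _; rewrite ?(h0, h1, h2, h3) /mulT !big_cons big_nil /= !fp // !gq //; ring.
Qed.

Lemma qbil_cnj k f g t (p q : C2 R) : (k < 4)%N ->
  (forall j, (j < 4)%N -> f j t = qc j p) -> (forall j, (j < 4)%N -> g j t = qc j q) ->
  qbil (cnjT k) f g t = qc k (qmul (qconj p) q).
Proof.
move=> k4 fp gq; rewrite qbilE /qmul.
have [c0 c1 c2 c3] := qc_mk (qc 0 p) (- qc 1 p) (- qc 2 p) (- qc 3 p).
rewrite -/(qconj p) in c0 c1 c2 c3; rewrite c0 c1 c2 c3.
set x0 := (X in qmk X _ _ _); set x1 := (X in qmk _ X _ _).
set x2 := (X in qmk _ _ X _); set x3 := (X in qmk _ _ _ X).
have [h0 h1 h2 h3] := qc_mk x0 x1 x2 x3.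
by case: k k4 => [|[|[|[|//]]]] _; rewrite ?(h0, h1, h2, h3) /x0 /x1 /x2 /x3 /cnjT !big_cons big_nil /= !fp // !gq //; ring.
Qed.

Lemma qbil_nrm f t (p : C2 R) : (forall j, (j < 4)%N -> f j t = qc j p) -> qbil (cnjT 0) f f t = qn p.
Proof. by move=> fp; rewrite qbilE /= !big_cons big_nil /= !fp // /qn; ring. Qed.

Section Assemble.
Context {V : normedModType R} (e : nat -> V).

Definition lincurve f : R -> V := \sum_(k < 4) (fun t => f k t *: e k).

Lemma lincurveE f t : lincurve f t = \sum_(k < 4) f k t *: e k.
Proof. by rewrite /lincurve fct_sumE. Qed.

Lemma cls_lincurve o f : (forall k, (k < 4)%N -> cls o (f k)) -> cls o (lincurve f).
Proof.
move=> cf; rewrite /lincurve; elim/big_ind: _ => [|x y|k _]; [exact: cls0 | exact: clsD|].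
by apply: (cls_blin (blin_line (e k))); exact: cf.
Qed.

Lemma Cn_lincurve n (E : fspace R) {hE : is_frechet E} {hV : is_frechet (curves None V)}
    (U : set E) (F : nat -> E -> R -> R^o) :
  fopen U -> (forall k, (k < 4)%N -> Cn (F := SC) n U (F k)) ->
  Cn (F := curves None V) n U (fun x => lincurve (fun k => F k x)).
Proof.
move=> oU CF.
pose G k : E -> curves None V := fun x t => F k x t *: e k.
have CG k : (k < 4)%N -> Cn n U (G k).
  move=> k4; apply: (Cn_comp (V := @fs_car R SC) (F := SC) (f := F k)
      (g := (fun (h : R -> R^o) t => h t *: e k) : SC -> curves None V)) => //.
  - exact: fopen_fs_car.
  - by apply: Cn_car; exact: CF.
  - exact: CF.
  - by apply: Cn_flin; [exact: (flin_blin None (blin_line (e k))) | exact: fopen_fs_car].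
apply: (Cn_eq (f := fun x => G 0%N x + (G 1%N x + (G 2%N x + G 3%N x)))) => //.
  by move=> x _; rewrite /lincurve !big_ord_recl big_ord0 addr0.
by do !(apply: CnD => //); exact: CG.
Qed.

End Assemble.

Definition qe k : C2 R := qmk (k == 0)%:R (k == 1)%N%:R (k == 2)%N%:R (k == 3)%N%:R.

Definition ce k : ('rV[R]_3 * R^o)%type := (\row_(j < 3) (j == k :> nat)%:R, (k == 3)%N%:R).

Lemma lin_qe f t : lincurve qe f t = qmk (f 0%N t) (f 1%N t) (f 2%N t) (f 3%N t).
Proof.
rewrite lincurveE !big_ord_recl big_ord0 addr0.
by congr (_, _); apply/rowP => j; rewrite !mxE /=; case: ifP => _; rewrite /GRing.scale /=; ring.
Qed.

Lemma lin_ce f t : lincurve ce f t = (\row_(j < 3) (f j t : R), f 3%N t).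
Proof.
rewrite lincurveE !big_ord_recl big_ord0 addr0; apply: injective_projections => /=.
  apply/rowP => -[[|[|[|//]]] ?]; rewrite !mxE /=; ring.
by rewrite /GRing.scale /=; ring.
Qed.

End Tables.

Section Lifts.
Context {R : realType} (per : bool).
Implicit Types (b : bool) (y : R -> C2 R) (x : R -> ('rV[R]_3 * R^o)%type).
Notation SC := (curves None (R^o : normedModType R)).
Notation chart := ('rV[R]_3 * R^o : normedModType R)%type.

(* The class of the lifts with sign [b], that of the base being [lc false]. *)
Definition lc b : option bool := if per then Some b else None.

Lemma omul_lc b b' : omul (lc b) (lc b') = lc (b (+) b').
Proof. by rewrite /lc; case: per. Qed.

Lemma per_even_lc : per_even (lc false).
Proof. by rewrite /per_even omul_lc. Qed.

Definition qcc y k : R -> R^o := fun t => qc k (y t).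

Definition nowhere0 y : Prop := forall t, in02 t -> y t <> 0.

Lemma blin_qc k : @blin R (C2 R) (R^o : normedModType R) (qc k).
Proof. exact: blin_ccoord. Qed.

Lemma cls_qcc o y k : cls o y -> cls o (qcc y k).
Proof. exact: (cls_blin (blin_qc k)). Qed.

Lemma Cn_qcc n (U : set (R -> C2 R)) k : @fopen R (curves None (C2 R)) U ->
  @Cn R n (curves None (C2 R)) SC U (fun y => qcc y k).
Proof. by move=> oU; apply: Cn_flin => //; exact: (flin_blin None (blin_qc k)). Qed.

(** The reciprocal as [w / w^2], valid for either sign of [w]. *)
Definition cinv (w : R -> R^o) : R -> R^o :=
  let r := crsqrt (cmul w w) in cmul w (cmul r r).

Lemma cinvE w t : in02 t -> (w t : R) != 0 -> cinv w t = (w t : R)^-1.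
Proof.
move=> t02 w0; rewrite /cinv /cmul crsqrtE // -expr2 sqrtr_sqr.
have n0 : `|w t : R| != 0 by rewrite normr_eq0.
have e : `|w t : R| * `|w t : R| = (w t : R) * (w t : R) by rewrite -!expr2 real_normK ?num_real.
by rewrite exprVn expr2 e; field.
Qed.

Lemma positive_sqr (w : R -> R^o) : cls None w -> (forall t, in02 t -> (w t : R) != 0) ->
  positive_curves (cmul w w).
Proof.
move=> cw w0; split=> [|t t02]; first exact: (smooth_mul cw cw).
by rewrite /cmul -expr2 lt_neqAle sqr_ge0 andbT eq_sym sqrf_eq0 w0.
Qed.

Lemma cls_cinv b (w : R -> R^o) : cls (lc b) w -> (forall t, in02 t -> (w t : R) != 0) ->
  cls (lc b) (cinv w).
Proof.
move=> cw w0; have [_ p] := positive_sqr (cls_none cw) w0.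
have cww : cls (lc false) (cmul w w) by rewrite -(addbb b) -omul_lc; apply: cls_mul.
have cr := cls_rsqrt per_even_lc p cww.
have crr : cls (lc false) (cmul (crsqrt (cmul w w)) (crsqrt (cmul w w))).
  by rewrite per_even_lc; apply: cls_mul.
by rewrite /cinv -(addbF b) -omul_lc; apply: cls_mul.
Qed.

Lemma Cn_cinv n (E : fspace R) {hE : is_frechet E} (U : set E) (F : E -> R -> R^o) : fopen U ->
  (forall z, U z -> forall t, in02 t -> (F z t : R) != 0) ->
  Cn (F := SC) n U F -> Cn (F := SC) n U (fun z => cinv (F z)).
Proof.
move=> oU F0 CF.
have CFF : Cn (F := SC) n U (fun z => cmul (F z) (F z)) by exact: Cn_mul.
have Cr : Cn (F := SC) n U (fun z => crsqrt (cmul (F z) (F z))).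
  have p z : U z -> positive_curves (cmul (F z) (F z)).
    by move=> Uz; apply: positive_sqr (F0 z Uz); exact: (Cn_car CF Uz).
  exact: (@Cn_rsqrt R n E _ U (fun z => cmul (F z) (F z) : SC) oU p CFF).
by apply: (Cn_mul oU CF); apply: (Cn_mul oU).
Qed.

Section Chart.
Context (f : R -> C2 R).

Definition wcoord y k : R -> R^o := qbil (cnjT k) (qcc f) (qcc y).

Definition pcoord y k : R -> R^o :=
  if (k < 3)%N then cmul (wcoord y k.+1) (cinv (wcoord y 0)) else qbil (cnjT 0) (qcc y) (qcc y).

Definition lift_chart y : R -> chart := lincurve ce (pcoord y).

Definition xcoord x k : R -> R^o :=
  if k is k'.+1 then (fun t => (x t).1 0 (inord k')) else on02 (fun=> 1).

Definition xspeed x : R -> R^o := fun t => (x t).2.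

(** With [n] the product of the square norms of [f] and [1 + xi], this is
    [s / sqrt (s n) = sqrt (s / n)], the factor giving the product speed [s]. *)
Definition lscale x : R -> R^o :=
  cmul (xspeed x) (crsqrt (cmul (xspeed x) (cmul (qbil (cnjT 0) (qcc f) (qcc f))
    (qbil (cnjT 0) (xcoord x) (xcoord x))))).

Definition chart_lift x : R -> C2 R :=
  lincurve qe (fun k => cmul (lscale x) (qbil (mulT k) (qcc f) (xcoord x))).

Lemma wcoordE y k t : (k < 4)%N -> wcoord y k t = qc k (qmul (qconj (f t)) (y t)).
Proof. by move=> k4; apply: qbil_cnj. Qed.

Definition transverse y : Prop := forall t, in02 t -> wcoord y 0 t != 0 :> R.

Lemma wcoord0 y t : wcoord y 0 t != 0 :> R -> y t <> 0.
Proof.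
move=> /eqP w0 y0; apply: w0; rewrite wcoordE // y0 /qmul.
have z k : qc k (0 : C2 R) = 0 by rewrite /qc; case: ifP => _; rewrite mxE.
rewrite !z !mulr0.
have [-> _ _ _] := qc_mk (0 - 0 - 0 - 0 : R) (0 + 0 + 0 - 0) (0 - 0 + 0 + 0) (0 + 0 - 0 + 0).
by rewrite !subr0.
Qed.

Lemma transverse_nowhere0 y : transverse y -> nowhere0 y.
Proof. by move=> ty t t02; exact: (wcoord0 (ty t t02)). Qed.

Lemma wcoord_trace y t : f t <> 0 -> y t <> 0 ->
  \tr ((hop (f t)).1^T *m (hop (y t)).1) <> -1 <-> wcoord y 0 t != 0 :> R.
Proof.
move=> f0 y0; rewrite hop_conj // wcoordE //.
set q := qmul _ _; have q0 : q <> 0.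
  move=> e; have := qnM (qconj (f t)) (y t); rewrite -/q e qn_conj.
  have -> : qn (0 : C2 R) = 0.
    by rewrite -(scale0r (0 : C2 R)) qnZ expr2 mul0r mul0r.
  by move/esym/eqP; rewrite mulf_eq0 !gt_eqF // qn_gt0.
have n0 := qn_gt0 q0; have := hop_trace q0; set T := \tr _ => e.
split.
  move=> T1; apply/eqP => w0; apply: T1; move: e.
  by rewrite w0 expr2 mul0r mulr0 mul0r => e; lra.
move=> w0 T1; move: e; rewrite T1 subrr => /esym/eqP.
by rewrite !mulf_eq0 invr_eq0 (gt_eqF n0) orbF pnatr_eq0 /= ?sqrf_eq0 !(negPf w0).
Qed.

Lemma lift_chartE y t : in02 t -> f t <> 0 -> wcoord y 0 t != 0 :> R ->
  lift_chart y t = (cayley ((hop (f t)).1^T *m (hop (y t)).1), (hop (y t)).2).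
Proof.
move=> t02 f0 w0; have y0 := wcoord0 w0.
have w0' := w0; rewrite wcoordE // in w0'.
have q0 : qmul (qconj (f t)) (y t) <> 0.
  move=> e; move: w0'; rewrite e /qc /= mxE eqxx //.
rewrite hop_conj // hop_cayley // /lift_chart lin_ce /pcoord.
apply: injective_projections; last exact: qbil_nrm.
apply/rowP => k; rewrite /= !mxE ltn_ord /cmul cinvE //.
by rewrite (wcoordE _ _ (ltn_ord k : (k.+1 < 4)%N)) wcoordE.
Qed.

Lemma cls_lift_chart b y : cls (lc b) f -> cls (lc b) y -> transverse y ->
  cls (lc false) (lift_chart y).
Proof.
move=> cf cy ty; have cw k : cls (lc false) (wcoord y k).
  by rewrite -(addbb b) -omul_lc; apply: cls_qbil => j; exact: cls_qcc.
apply: cls_lincurve => k _; rewrite /pcoord; case: ifP => _.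
  by rewrite per_even_lc; apply: cls_mul => //; exact: (cls_cinv (cw 0%N) ty).
by rewrite -(addbb b) -omul_lc; apply: cls_qbil => j; exact: cls_qcc.
Qed.

Hypothesis cf : cls None f.

Definition transverse_set : set (R -> C2 R) := [set y | cls None y /\ transverse y].

Lemma Cn_wcoord n (U : set (R -> C2 R)) k : @fopen R (curves None (C2 R)) U ->
  @Cn R n (curves None (C2 R)) SC U (fun y => wcoord y k).
Proof.
move=> oU; apply: (@Cn_qbil R n (curves None (C2 R)) _ U _ (fun k _ => qcc f k) (fun k y => qcc y k)) => //.
  by move=> j; apply: Cn_cst => //; exact: (cls_qcc j cf).
by move=> j; exact: Cn_qcc.
Qed.

(** A curve is nowhere zero when its square is positive, which is an open condition. *)
Lemma fopen_transverse : @fopen R (curves None (C2 R)) transverse_set.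
Proof.
pose S : set (curves None (C2 R)) := @fs_car R (curves None (C2 R)).
have oS : fopen S by exact: fopen_fs_car.
have Cw : @Cn R 0 (curves None (C2 R)) SC S (fun y => cmul (wcoord y 0) (wcoord y 0)).
  by apply: (Cn_mul oS); exact: Cn_wcoord.
pose W : curves None (C2 R) -> SC := fun y => cmul (wcoord y 0) (wcoord y 0).
have -> : transverse_set = S `&` W @^-1` @positive_curves R.
  apply/seteqP; split=> y.
    move=> [cy ty]; split=> //; apply: positive_sqr => //.
    exact: (Cn_car (Cn_wcoord 0 0 oS) cy).
  move=> [cy [_ py]]; split=> // t t02; have := py t t02.
  by rewrite /W /cmul -expr2 lt_neqAle eq_sym sqrf_eq0 => /andP[].
exact: (fopen_preim oS (Cn_car Cw) (Cn_cont Cw) (@fopen_positive R)).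
Qed.

Lemma Cn_lift_chart n :
  @Cn R n (curves None (C2 R)) (curves None chart) transverse_set lift_chart.
Proof.
have oT := fopen_transverse.
apply: (@Cn_lincurve R chart ce n (curves None (C2 R)) (@frechet_C2 R None) (@frechet_chart R None)
  transverse_set (fun k y => pcoord y k) oT) => k k4.
rewrite /pcoord; case: (k < 3)%N.
  apply: (Cn_mul oT (Cn_wcoord n k.+1 oT)); apply: (Cn_cinv oT) => [y [_ ty]//|].
  exact: (Cn_wcoord n 0 oT).
by apply: (@Cn_qbil R n (curves None (C2 R)) _ transverse_set _ (fun k y => qcc y k) (fun k y => qcc y k)) => // j;
  exact: Cn_qcc.
Qed.

End Chart.
End Lifts.

(** * Sections over the Cayley charts *)

Section ChartLift.
Context {R : realType}.
Implicit Types (per b : bool) (x : R -> ('rV[R]_3 * R^o)%type) (f : R -> C2 R).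
Notation SC := (curves None (R^o : normedModType R)).
Notation chart := ('rV[R]_3 * R^o : normedModType R)%type.

Definition positive_charts o : set (R -> chart) :=
  [set x | cls o x /\ forall t, in02 t -> 0 < (x t).2 :> R].

Definition qcay (v : 'rV[R]_3) : C2 R := qmk 1 (v 0 (inord 0)) (v 0 (inord 1)) (v 0 (inord 2)).

Lemma qcay0 v : qc 0 (qcay v) = 1.
Proof. by have [] := qc_mk (1 : R) (v 0 (inord 0)) (v 0 (inord 1)) (v 0 (inord 2)). Qed.

Lemma qcay_neq0 v : qcay v <> 0.
Proof.
move=> e; have := qcay0 v; rewrite e /qc /= mxE => /esym/eqP; by rewrite oner_eq0.
Qed.

Lemma xcoordE x k t : in02 t -> (k < 4)%N -> xcoord x k t = qc k (qcay (x t).1).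
Proof.
move=> t02 k4; have [h0 h1 h2 h3] := qc_mk (1 : R) ((x t).1 0 (inord 0))
  ((x t).1 0 (inord 1)) ((x t).1 0 (inord 2)).
by case: k k4 => [|[|[|[|//]]]] _; rewrite /qcay ?(h0, h1, h2, h3) //= on02E.
Qed.

(** The quaternion [1 + xi] is row 0 of [quat_row] divided by [1 + tr B], hence a multiple of the
    unit quaternion of [B]. *)
Lemma qcay_cayley (B : 'M[R]_3) : B *m B^T = 1%:M -> \det B = 1 -> \tr B <> -1 ->
  (qn (qcay (cayley B)))^-1 *: qrot (qcay (cayley B)) = B.
Proof.
move=> BB dB; have [rB nB] := quat_rowP (k := 0) BB dB isT.
move: BB dB rB nB; have [a [b [c [d [e [g [h [i [j ->]]]]]]]]] := mk3E B.
move=> BB dB; rewrite quat_row_mk3 mk3_trace => rB nB tB.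
have t0 : 1 + a + e + j != 0 by apply/eqP => t0; apply: tB; lra.
have -> : qcay (cayley (mk3 a b c d e g h i j)) =
    (1 + a + e + j)^-1 *: qmk (1 + a + e + j) (i - g) (c - h) (d - b).
  have [h0 h1 h2 h3] := qc_mk (1 + a + e + j) (i - g) (c - h) (d - b).
  rewrite -[RHS]qmkE !qcZ h0 h1 h2 h3 mulVf // /qcay /cayley mk3_trace !addrA.
  have e3 k (k3 : (k < 3)%N) : inord k = Ordinal k3 by apply/val_inj; rewrite /= inordK.
  by rewrite (e3 0%N isT) (e3 1%N isT) (e3 2%N isT); congr qmk; rewrite !mxE.
rewrite qrotZ qnZ rB nB !scalerA.
have [-> _ _ _] := qc_mk (1 + a + e + j) (i - g) (c - h) (d - b).
by rewrite -[RHS]scale1r; congr (_ *: _); field.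
Qed.

Section Chart.
Context (f : R -> C2 R) (f0 : nowhere0 f).

Lemma chart_liftE x t : in02 t -> 0 < (x t).2 :> R ->
  hop (chart_lift f x t) = ((hop (f t)).1 *m ((qn (qcay (x t).1))^-1 *: qrot (qcay (x t).1)), (x t).2) /\
  chart_lift f x t <> 0.
Proof.
move=> t02 s0; pose l := lscale f x t : R.
have n1 := qn_gt0 (f0 t02); have n2 := qn_gt0 (@qcay_neq0 (x t).1).
have e : chart_lift f x t = l *: qmul (f t) (qcay (x t).1).
  rewrite /chart_lift lin_qe -[RHS]qmkE !qcZ /l /cmul.
  by congr qmk; congr (_ * _); apply: qbil_mul => // j j4; exact: xcoordE.
have el : l ^+ 2 * (qn (f t) * qn (qcay (x t).1)) = (x t).2.
  rewrite /l /lscale /cmul /xspeed crsqrtE // (qbil_nrm (p := f t)) // (qbil_nrm (p := qcay (x t).1)); last first.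
    by move=> j j4; exact: xcoordE.
  set s : R := (x t).2; set N := qn (qcay _).
  rewrite exprMn exprVn sqr_sqrtr; last by rewrite !mulr_ge0 // ltW.
  by field; rewrite !gt_eqF.
have l0 : l ^+ 2 != 0.
  by apply/eqP => l0; move: el; rewrite l0 mul0r => /esym/eqP; rewrite gt_eqF.
have en : qn (chart_lift f x t) = (x t).2 by rewrite e qnZ qnM.
split; last first.
  move=> h0; move: en; rewrite h0 -(scale0r (0 : C2 R)) qnZ expr2 mul0r mul0r => /esym/eqP.
  by rewrite gt_eqF.
rewrite /hop en; congr (_, _); rewrite e qrotZ qrotM -scalemxAl -scalemxAr !scalerA -el.
have ln0 : l != 0 by rewrite -sqrf_eq0.
by congr (_ *: _); field; rewrite ln0 !lt0r_neq0.
Qed.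

Lemma cls_xcoord per x k : cls (lc per false) x -> cls (lc per false) (xcoord x k).
Proof.
move=> cx; case: k => [|k]; first exact: (cls_cst _ (per_even_lc per)).
exact: (cls_blin (blin_comp (blin_fst 'rV[R]_3 R^o) (@blin_entry R 0 2 0 (inord k))) cx).
Qed.

Lemma cls_xspeed o x : cls o x -> cls o (xspeed x).
Proof. exact: (cls_blin (blin_snd 'rV[R]_3 R^o)). Qed.

Lemma lscale_positive x t : in02 t -> 0 < (x t).2 :> R ->
  0 < (cmul (xspeed x) (cmul (qbil (cnjT 0) (qcc f) (qcc f))
    (qbil (cnjT 0) (xcoord x) (xcoord x))) t : R).
Proof.
move=> t02 s0; rewrite /cmul (qbil_nrm (p := f t)) // (qbil_nrm (p := qcay (x t).1)); last first.
  by move=> j j4; exact: xcoordE.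
by rewrite !mulr_gt0 ?qn_gt0 //; [exact: f0 | exact: qcay_neq0].
Qed.

Lemma cls_chart_lift per b x : cls (lc per b) f -> positive_charts (lc per false) x ->
  cls (lc per b) (chart_lift f x).
Proof.
move=> cf [cx s0]; apply: cls_lincurve => k _.
have H := per_even_lc per.
have cS := cls_xspeed cx.
have cF : cls (lc per false) (qbil (cnjT 0) (qcc f) (qcc f)).
  by rewrite -(addbb b) -omul_lc; apply: cls_qbil => j; exact: cls_qcc.
have cX : cls (lc per false) (qbil (cnjT 0) (xcoord x) (xcoord x)).
  by rewrite H; apply: cls_qbil => j; exact: cls_xcoord.
have cFX : cls (lc per false) (cmul (qbil (cnjT 0) (qcc f) (qcc f)) (qbil (cnjT 0) (xcoord x) (xcoord x))).
  by rewrite H; apply: cls_mul.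
have cSFX : cls (lc per false) (cmul (xspeed x) (cmul (qbil (cnjT 0) (qcc f) (qcc f)) (qbil (cnjT 0) (xcoord x) (xcoord x)))).
  by rewrite H; apply: cls_mul.
have cR := cls_rsqrt H (fun t t02 => lscale_positive t02 (s0 t t02)) cSFX.
have cL : cls (lc per false) (lscale f x) by rewrite H; apply: cls_mul.
have cM : cls (lc per b) (qbil (mulT k) (qcc f) (xcoord x)).
  by rewrite -(addbF b) -omul_lc; apply: cls_qbil => j; [exact: cls_qcc | exact: cls_xcoord].
by rewrite -(addFb b) -omul_lc; apply: cls_mul.
Qed.

Lemma fopen_positive_charts o : @fopen R (curves o chart) (positive_charts o).
Proof.
pose S : set (curves o chart) := @fs_car R (curves o chart).
have oS : fopen S by exact: fopen_fs_car.
have hl : @flin R (curves o chart) SC (@xspeed R).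
  have hs := flin_blin o (blin_snd 'rV[R]_3 R^o); split.
  - by move=> x cx; exact: (cls_none (cls_xspeed cx)).
  - exact: (flin_lin hs).
  - exact: (flin_bound hs).
have C0 : @Cn R 0 (curves o chart) SC S (@xspeed R) by exact: Cn_flin.
have -> : positive_charts o = S `&` @xspeed R @^-1` @positive_curves R.
  apply/seteqP; split=> x; last by move=> [cx [_ s0]].
  by move=> [cx s0]; split=> //; split=> //; exact: (cls_none (cls_xspeed cx)).
exact: (fopen_preim oS (Cn_car C0) (Cn_cont C0) (@fopen_positive R)).
Qed.

Hypothesis cf : cls None f.

Lemma Cn_chart_lift n :
  @Cn R n (curves None chart) (curves None (C2 R)) (positive_charts None) (chart_lift f).
Proof.
have oP := fopen_positive_charts None.
have CS : @Cn R n (curves None chart) SC (positive_charts None) (@xspeed R).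
  by apply: Cn_flin => //; exact: (flin_blin None (blin_snd 'rV[R]_3 R^o)).
have CX k : @Cn R n (curves None chart) SC (positive_charts None) (fun x => xcoord x k).
  case: k => [|k]; first by apply: Cn_cst => //; exact: (@cls_cst R None _ erefl).
  apply: Cn_flin => //.
  exact: (flin_blin None (blin_comp (blin_fst 'rV[R]_3 R^o) (@blin_entry R 0 2 0 (inord k)))).
have CF k : @Cn R n (curves None chart) SC (positive_charts None) (fun _ => qcc f k).
  by apply: Cn_cst => //; exact: (cls_qcc k cf).
have CXX : @Cn R n (curves None chart) SC (positive_charts None)
    (fun x => qbil (cnjT 0) (xcoord x) (xcoord x)).
  by apply: (@Cn_qbil R n (curves None chart) (@frechet_chart R None) _ _ (fun k x => xcoord x k) (fun k x => xcoord x k)).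
have CFF : @Cn R n (curves None chart) SC (positive_charts None)
    (fun x => qbil (cnjT 0) (qcc f) (qcc f)).
  by apply: (@Cn_qbil R n (curves None chart) (@frechet_chart R None) _ _ (fun k x => qcc f k) (fun k x => qcc f k)).
have CM k : @Cn R n (curves None chart) SC (positive_charts None)
    (fun x => qbil (mulT k) (qcc f) (xcoord x)).
  by apply: (@Cn_qbil R n (curves None chart) (@frechet_chart R None) _ _ (fun k x => qcc f k) (fun k x => xcoord x k)).
have CD : @Cn R n (curves None chart) SC (positive_charts None)
    (fun x => cmul (xspeed x) (cmul (qbil (cnjT 0) (qcc f) (qcc f)) (qbil (cnjT 0) (xcoord x) (xcoord x)))).
  by apply: (Cn_mul oP CS); apply: (Cn_mul oP CFF CXX).
have CL : @Cn R n (curves None chart) SC (positive_charts None) (lscale f).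
  apply: (Cn_mul oP CS); apply: (Cn_rsqrt oP _ CD) => x Px; split; first exact: (Cn_car CD Px).
  by move=> t t02; apply: lscale_positive => //; exact: Px.2.
apply: (@Cn_lincurve R (C2 R) qe n (curves None chart) (@frechet_chart R None) (@frechet_C2 R None)
  (positive_charts None) (fun k x => cmul (lscale f x) (qbil (mulT k) (qcc f) (xcoord x))) oP) => k _.
exact: (Cn_mul oP CL (CM k)).
Qed.

End Chart.
End ChartLift.

(** * Lifting of curves *)

Section Hopf.
Context {R : realType}.
Implicit Types (o : option bool) (per b : bool) (f : R -> C2 R) (V W : normedModType R).
Notation SC := (curves None (R^o : normedModType R)).
Notation MR := ('M[R]_3 * R^o : normedModType R)%type.
Implicit Types (g h : R -> MR).

Definition hopc f : R -> MR := on02 (fun t => hop (f t)).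

Lemma blin_pair1 V W : @blin R V (V * W : normedModType R)%type (fun x => (x, 0)).
Proof.
split=> [a x y|]; first by congr (_, _); rewrite /= scaler0 addr0.
by exists 1 => // x; rewrite mul1r prod_normE /= normr0 ge_max lexx /=.
Qed.

Lemma blin_pair2 V W : @blin R W (V * W : normedModType R)%type (fun x => (0, x)).
Proof.
split=> [a x y|]; first by congr (_, _); rewrite /= scaler0 addr0.
by exists 1 => // x; rewrite mul1r prod_normE /= normr0 ge_max lexx andbT.
Qed.

Lemma cls_pair o V W (u : R -> V) (v : R -> W) : cls o u -> cls o v ->
  @cls R o (V * W : normedModType R)%type (fun t => (u t, v t)).
Proof.
move=> cu cv.
have -> : (fun t => (u t, v t)) = ((fun t => (u t, 0)) + (fun t => (0, v t)) : R -> (V * W)%type).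
  by apply/funext => t; apply: injective_projections; rewrite fctE /= ?addr0 ?add0r.
by apply: clsD; [exact: (cls_blin (blin_pair1 V W) cu) | exact: (cls_blin (blin_pair2 V W) cv)].
Qed.

Lemma blin_matrix V (l : 'M[R]_3 -> V) : (forall a x y, l (a *: x + y) = a *: l x + l y) ->
  @blin R ('M[R]_3 : normedModType R) V l.
Proof.
move=> ll; split=> //; pose C := \sum_(i < 3) \sum_(j < 3) `|l (delta_mx i j)|.
have lD x y : l (x + y) = l x + l y by have := ll 1 x y; rewrite !scale1r.
have l0 : l 0 = 0 by apply/(@addrI _ (l 0)); rewrite -lD !addr0.
have lZ a x : l (a *: x) = a *: l x by have := ll a x 0; rewrite l0 !addr0.
have lS (I : finType) (F : I -> 'M[R]_3) : l (\sum_i F i) = \sum_i l (F i).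
  by apply: (big_morph l lD l0).
have C0 : 0 <= C by apply: sumr_ge0 => i _; apply: sumr_ge0.
exists (C + 1) => [|x]; first exact: ltr_wpDl.
apply: le_trans (_ : C * `|x| <= _); last by rewrite ler_wpM2r // lerDl.
rewrite {1}(matrix_sum_delta x) lS /C mulr_suml; apply: le_trans (ler_norm_sum _ _ _) _.
apply: ler_sum => i _; rewrite lS mulr_suml; apply: le_trans (ler_norm_sum _ _ _) _.
apply: ler_sum => j _; rewrite lZ normrZ mulrC ler_wpM2l //.
rewrite [leRHS]mx_normrE; exact: (le_trans _ (le_bigmax _ _ (i, j))).
Qed.

Lemma cls_sum o V (I : finType) (u : I -> R -> V) :
  (forall i, cls o (u i)) -> cls o (\sum_i u i).
Proof. by move=> cu; elim/big_ind: _ => [|x y|i _]; [exact: cls0 | exact: clsD | exact: cu]. Qed.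

Lemma cls_matrix o (m : 'I_3 -> 'I_3 -> R -> R^o) : (forall i j, cls o (m i j)) ->
  @cls R o ('M[R]_3 : normedModType R) (fun t => \matrix_(i, j) (m i j t : R)).
Proof.
move=> cm; pose D i j : R -> ('M[R]_3 : normedModType R) := fun t => m i j t *: delta_mx i j.
have -> : (fun t => \matrix_(i, j) (m i j t : R)) = \sum_i \sum_j D i j.
  apply/funext => t; rewrite fct_sumE [LHS]matrix_sum_delta; apply: eq_bigr => i _.
  by rewrite fct_sumE; apply: eq_bigr => j _; rewrite mxE.
apply: cls_sum => i; apply: cls_sum => j; exact: (cls_blin (blin_line _) (cm i j)).
Qed.

Lemma cls_const o V (v : V) : per_even o -> cls o (on02 (fun=> v)).
Proof.
move=> ho; have c := cls_blin (blin_line v) (cls_cst 1 ho).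
have -> : on02 (fun=> v) = (fun t : R => on02 (fun=> 1 : R^o) t *: v); last exact: c.
by apply/funext => t; rewrite /on02; case: ifP => _; rewrite ?scale1r ?scale0r.
Qed.

Definition rotT (i j : nat) : seq (R * (nat * nat)) :=
  nth [::] (nth [::] [::
   [:: [:: (1, (0, 0)%N); (1, (1, 1)%N); (-1, (2, 2)%N); (-1, (3, 3)%N)];
       [:: (2, (1, 2)%N); (-2, (0, 3)%N)]; [:: (2, (1, 3)%N); (2, (0, 2)%N)]];
   [:: [:: (2, (1, 2)%N); (2, (0, 3)%N)];
       [:: (1, (0, 0)%N); (-1, (1, 1)%N); (1, (2, 2)%N); (-1, (3, 3)%N)];
       [:: (2, (2, 3)%N); (-2, (0, 1)%N)]];
   [:: [:: (2, (1, 3)%N); (-2, (0, 2)%N)]; [:: (2, (2, 3)%N); (2, (0, 1)%N)];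
       [:: (1, (0, 0)%N); (-1, (1, 1)%N); (-1, (2, 2)%N); (1, (3, 3)%N)]]] i) j.

Lemma rotTE f t (i j : 'I_3) : qbil (rotT i j) (qcc f) (qcc f) t = qrot (f t) i j.
Proof.
rewrite qbilE; case: i => [[|[|[|//]]] ?]; case: j => [[|[|[|//]]] ?];
  rewrite !mxE /= !big_cons big_nil /qcc /=; ring.
Qed.

Lemma cls_hopc per b f : cls (lc per b) f -> nowhere0 f -> cls (lc per false) (hopc f).
Proof.
move=> cf f0; have H := per_even_lc per.
have cq l : cls (lc per false) (qbil l (qcc f) (qcc f)).
  by rewrite -(addbb b) -omul_lc; apply: cls_qbil => j; exact: cls_qcc.
have pN t : in02 t -> (qbil (cnjT 0) (qcc f) (qcc f) t : R) != 0.
  by move=> t02; rewrite (qbil_nrm (p := f t)) // gt_eqF // qn_gt0 //; exact: f0.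
have ci := cls_cinv (cq (cnjT 0)) pN.
have cm i j : cls (lc per false) (cmul (cinv (qbil (cnjT 0) (qcc f) (qcc f))) (qbil (rotT i j) (qcc f) (qcc f))).
  by rewrite H; apply: cls_mul.
have cp := cls_pair (cls_matrix (fun i j => cm i j)) (cq (cnjT 0)).
have con := cls_on cp; rewrite -con in cp; rewrite /hopc.
have -> : on02 (fun t => hop (f t) : MR) = on02 (fun t => (\matrix_(i, j)
   (cmul (cinv (qbil (cnjT 0) (qcc f) (qcc f))) (qbil (rotT i j) (qcc f) (qcc f)) t : R),
   qbil (cnjT 0) (qcc f) (qcc f) t)); last exact: cp.
apply: on02_eq => t t02; apply: injective_projections; last by rewrite (qbil_nrm (p := f t)).
apply/matrixP => i j; rewrite mxE [RHS]mxE /cmul rotTE cinvE ?pN //.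
by rewrite (qbil_nrm (p := f t)).
Qed.

(** The four diagonal entries [4 q_k^2] add up to 4, so one of the rows of [quat_row] is nonzero;
    rescaled to square norm [s], it is a preimage. *)
Lemma SO3Rp_hop (x : 'M[R]_3 * R^o) : SO3Rp x -> exists2 z, z <> 0 & hop z = x.
Proof.
case: x => A s [/= AA dA s0].
have [k k4 kn] : exists2 k, (k < 4)%N & qc k (quat_row A k) != 0.
  apply: contrapT => H.
  have Z k : (k < 4)%N -> qc k (quat_row A k) = 0.
    by move=> k4; apply/eqP; apply: contrapT => /negP ?; apply: H; exists k.
  move: (Z 0%N isT) (Z 1%N isT) (Z 2%N isT) (Z 3%N isT).
  have [a [b [c [d [e [g [h [i [j ->]]]]]]]]] := mk3E A; rewrite !quat_row_mk3.
  have [-> _ _ _] := qc_mk (1 + a + e + j) (i - g) (c - h) (d - b).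
  have [_ -> _ _] := qc_mk (i - g) (1 + a - e - j) (b + d) (c + h).
  have [_ _ -> _] := qc_mk (c - h) (b + d) (1 - a + e - j) (g + i).
  have [_ _ _ ->] := qc_mk (d - b) (c + h) (g + i) (1 - a - e + j).
  by move=> {AA dA H Z} ? ? ? ?; lra.
have [rA nA] := quat_rowP AA dA k4.
set q := quat_row A k in kn rA nA; set c := qc k q in kn rA nA.
have c0 : 0 < c.
  by have := qn_ge0 q; rewrite nA pmulr_rge0 // le_eqVlt eq_sym (negPf kn).
pose l := Num.sqrt (s / (4 * c)).
have l2 : l ^+ 2 = s / (4 * c) by rewrite sqr_sqrtr // divr_ge0 ?ltW // mulr_gt0.
have nl : qn (l *: q) = s by rewrite qnZ l2 nA; field; rewrite gt_eqF.
exists (l *: q).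
  move=> e; move: nl; rewrite e -(scale0r (0 : C2 R)) qnZ expr2 mul0r mul0r => /eqP.
  by rewrite lt_eqF.
rewrite /hop nl; congr (_, _); rewrite qrotZ rA !scalerA l2 -[RHS]scale1r; congr (_ *: _).
by field; rewrite !gt_eqF.
Qed.

Definition SO3Rp_curve o g : Prop := cls o g /\ forall t, in02 t -> @SO3Rp R (g t).

Lemma isd_scale V (f f' : R -> V) (l : R) : 0 <= l <= 1 -> isd f f' ->
  isd (on02 (fun t => f (l * t))) (on02 (fun t => l *: f' (l * t))).
Proof.
move=> /andP[l0 l1] ff' t t02.
have lt02 : in02 (l * t).
  move: t02; rewrite /in02 => /andP[? ?]; apply/andP; split; first exact: mulr_ge0.
  by apply: le_trans (_ : 1 * t <= _); [rewrite ler_wpM2r | rewrite mul1r].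
(* For [l = 0] the points [l s] and [l t] coincide and the derivative of [f] cannot be invoked, but
   the curve is constant. *)
rewrite on02E //; have [->|ln0] := eqVneq l 0.
  rewrite scale0r; apply: cvg_trans (@cvg_cst _ (0 : V) _ (near02 t) _).
  apply: near_eq_cvg; apply/near02P; exists 1 => // s s02 st _.
  by rewrite /diff_quot !on02E // !mul0r subrr scaler0.
have lp : 0 < l by rewrite lt_neqAle eq_sym ln0.
apply/cvgrPdist_lt => e e0.
have /cvgrPdist_lt /(_ (e / l) (divr_gt0 e0 lp)) /near02P[d d0 H] := ff' _ lt02.
apply/near02P; exists (d / l); first exact: divr_gt0.
move=> s s02 st sd; have ls02 : in02 (l * s).
  move: s02; rewrite /in02 => /andP[? ?]; apply/andP; split; first exact: mulr_ge0.
  by apply: le_trans (_ : 1 * s <= _); [rewrite ler_wpM2r | rewrite mul1r].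
have lst : l * s != l * t by rewrite (inj_eq (mulfI ln0)).
have lsd : `|l * s - l * t| < d.
  by rewrite -mulrBr normrM gtr0_norm // mulrC -ltr_pdivlMr.
have := H _ ls02 lst lsd; rewrite ltr_pdivlMr // mulrC => {}H.
rewrite -{1}(gtr0_norm lp) -normrZ in H.
have e1 : l * (l * s - l * t)^-1 = (s - t)^-1 by rewrite -mulrBr invfM mulrA mulfV // mul1r.
by move: H; rewrite /diff_quot !on02E // scalerBr scalerA e1.
Qed.

Lemma cls_scale V (f : R -> V) (l : R) : 0 <= l <= 1 -> cls None f ->
  cls None (on02 (fun t => f (l * t))).
Proof.
move=> l01 cf; apply/clsP => n; elim: n f cf => [|n IH] f cf; have d := isd_scale l01 (cls_isd cf).
  by split=> //; [exact: on02_on02 | exact: isd_diff02 d].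
apply: DnS d _ => //; first exact: on02_on02.
have -> : on02 (fun t => l *: deriv02 f (l * t)) = (fun t => l *: on02 (fun t => deriv02 f (l * t)) t).
  by apply/funext => t; rewrite /on02; case: ifP => _ //; rewrite scaler0.
by apply: (Dn_blin (blin_scale V l)); apply: IH; exact: cls_deriv.
Qed.

End Hopf.

Section PathLifting.
Context {R : realType}.
Notation SC := (curves None (R^o : normedModType R)).
Notation MR := ('M[R]_3 * R^o : normedModType R)%type.
Notation chart := ('rV[R]_3 * R^o : normedModType R)%type.
Implicit Types (o : option bool) (f : R -> C2 R) (g h : R -> MR).

Definition chart_curve g h : R -> chart :=
  on02 (fun t => (cayley ((g t).1^T *m (h t).1), (h t).2)).

Definition lift_of g f : Prop :=
  [/\ cls None f, nowhere0 f & forall t, in02 t -> hop (f t) = g t].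

Definition entry (i j : 'I_3) g : R -> R^o := fun t => (g t).1 i j.

Lemma cls_entry o i j g : cls o g -> cls o (entry i j g).
Proof. exact: (cls_blin (blin_comp (blin_fst 'M[R]_3 R^o) (@blin_entry R 2 2 i j))). Qed.

Lemma cls_speed o g : cls o g -> cls o (fun t => (g t).2).
Proof. exact: (cls_blin (blin_snd 'M[R]_3 R^o)). Qed.

Lemma cls_row o (m : 'I_3 -> R -> R^o) : (forall j, cls o (m j)) ->
  @cls R o ('rV[R]_3 : normedModType R) (fun t => \row_j (m j t : R)).
Proof.
move=> cm; pose D j : R -> ('rV[R]_3 : normedModType R) := fun t => m j t *: delta_mx 0 j.
have -> : (fun t => \row_j (m j t : R)) = \sum_j D j.
  apply/funext => t; rewrite fct_sumE [LHS]row_sum_delta.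
  by apply: eq_bigr => j _; rewrite mxE.
by apply: cls_sum => j; exact: (cls_blin (blin_line _) (cm j)).
Qed.

Lemma chart_curve_smooth g h : cls None g -> cls None h ->
  (forall t, in02 t -> \tr ((g t).1^T *m (h t).1) <> -1) -> cls None (chart_curve g h).
Proof.
move=> cg ch tr1.
pose B i j : R -> R^o := \sum_k cmul (entry k i g) (entry k j h).
have BE i j t : B i j t = ((g t).1^T *m (h t).1) i j.
  by rewrite /B fct_sumE mxE; apply: eq_bigr => k _; rewrite mxE.
have cB i j : cls None (B i j).
  by apply: cls_sum => k; exact: (smooth_mul (cls_entry k i cg) (cls_entry k j ch)).
pose T : R -> R^o := on02 (fun=> 1 : R^o) + \sum_i B i i.
have cT : cls None T.
  by apply: clsD; [exact: (@cls_cst R None 1 erefl) | apply: cls_sum => i; exact: cB].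
have TE t : in02 t -> T t = 1 + \tr ((g t).1^T *m (h t).1).
  move=> t02; rewrite /T fctE on02E // fct_sumE /mxtrace.
  by congr (_ + _); apply: eq_bigr => i _; rewrite BE.
have T0 t : in02 t -> (T t : R) != 0.
  by move=> t02; rewrite TE //; apply/eqP => e; apply: (tr1 t t02); lra.
have ci : cls None (cinv T) := @cls_cinv R false false T cT T0.
have cm (i : 'I_3) : cls None (cmul (cinv T) (B (i + 2%:R) (i + 1) - B (i + 1) (i + 2%:R))).
  by apply: (smooth_mul ci); apply: clsB; exact: cB.
have cp := cls_pair (cls_row cm) (cls_speed ch).
have con := cls_on cp; rewrite -con in cp; rewrite /chart_curve.
have -> : on02 (fun t => (cayley ((g t).1^T *m (h t).1), (h t).2) : chart) = on02 (fun t =>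
  (\row_i (cmul (cinv T) (B (i + 2%:R) (i + 1) - B (i + 1) (i + 2%:R)) t : R), (h t).2)); last exact: cp.
apply: on02_eq => t t02; apply: injective_projections => //.
apply/rowP => i; rewrite /cayley mxE [in RHS]mxE [in RHS]/cmul cinvE ?T0 // TE //.
by rewrite [in LHS]mxE -!BE.
Qed.

Lemma SO3_quotient (A B : 'M[R]_3) : A *m A^T = 1%:M -> \det A = 1 -> B *m B^T = 1%:M ->
  \det B = 1 -> (A^T *m B) *m (A^T *m B)^T = 1%:M /\ \det (A^T *m B) = 1.
Proof.
move=> AA dA BB dB; split; last by rewrite det_mulmx det_tr dA dB mulr1.
by rewrite trmx_mul trmxK mulmxA -(mulmxA A^T) BB mulmx1; exact: mulmx1C.
Qed.

Lemma hop_chart_lift g h f t : hop (f t) = g t -> nowhere0 f -> in02 t -> SO3Rp (g t) -> SO3Rp (h t) ->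
  \tr ((g t).1^T *m (h t).1) <> -1 -> hop (chart_lift f (chart_curve g h) t) = h t /\
  chart_lift f (chart_curve g h) t <> 0.
Proof.
move=> fg f0 t02 [gg dg _] [hh dh s0] tr1.
have s0' : 0 < (chart_curve g h t).2 :> R by rewrite /chart_curve on02E.
have [e n0] := chart_liftE f0 t02 s0'; split=> //; rewrite {}e.
rewrite fg /chart_curve on02E //=; have [BB dB] := SO3_quotient gg dg hh dh.
rewrite (qcay_cayley BB dB tr1) mulmxA gg mul1mx.
by case: (h t).
Qed.

(** The section over the chart centred at [g], taken at the coordinates of [h], is a lift of [h],
    with its smoothness included. *)
Lemma lift_step g h f : SO3Rp_curve None g -> SO3Rp_curve None h -> lift_of g f ->
  (forall t, in02 t -> \tr ((g t).1^T *m (h t).1) <> -1) ->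
  lift_of h (chart_lift f (chart_curve g h)).
Proof.
move=> [cg pg] [ch ph] [cf f0 fg] tr1.
have pc : positive_charts None (chart_curve g h).
  split=> [|t t02]; first exact: (chart_curve_smooth cg ch tr1).
  by rewrite /chart_curve on02E //; have [] := ph t t02.
split.
- exact: (@cls_chart_lift R f f0 false false (chart_curve g h) cf pc).
- by move=> t t02; have [] := hop_chart_lift (fg t t02) f0 t02 (pg t t02) (ph t t02) (tr1 t t02).
- by move=> t t02; have [] := hop_chart_lift (fg t t02) f0 t02 (pg t t02) (ph t t02) (tr1 t t02).
Qed.

Lemma trace_close g : SO3Rp_curve None g -> exists2 d : R, 0 < d &
  forall s t, in02 s -> in02 t -> s <= t -> t - s < d -> \tr ((g s).1^T *m (g t).1) <> -1.
Proof.
move=> [cg pg]; have [M M0 HM] := isd_bounded (cls_isd cg).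
have [K K0 HK] := isd_bounded (cls_isd (cls_deriv cg)).
have ent (x : MR) i j : `|x.1 i j| <= `|x|.
  apply: le_trans (_ : `|x.1| <= _); last by rewrite prod_normE le_max lexx.
  by rewrite [leRHS]mx_normrE; exact: (le_trans _ (le_bigmax _ _ (i, j))).
(* Going from the trace 3 of the identity to -1 takes a change of -4, whereas nine products of
   entries account for at most [9 M K (t - s)]. *)
exists (4 / (9 * (M * K) + 1)); first by rewrite divr_gt0 // ltr_wpDl // !mulr_ge0 // ltW.
move=> s t s02 t02 st; rewrite ltr_pdivlMr; last by rewrite ltr_wpDl // !mulr_ge0 // ltW.
move=> d tr1; have [gg _ _] := pg s s02; have gg' := mulmx1C gg.
have e : \tr ((g s).1^T *m ((g t).1 - (g s).1)) = -4.
  by rewrite mulmxBr linearB /= tr1 gg' mxtrace1; ring.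
have b : `|\tr ((g s).1^T *m ((g t).1 - (g s).1))| <= \sum_(i < 3) \sum_(j < 3) M * (K * (t - s)).
  apply: le_trans (ler_norm_sum _ _ _) _; apply: ler_sum => i _.
  rewrite mxE; apply: le_trans (ler_norm_sum _ _ _) _; apply: ler_sum => j _.
  rewrite normrM mxE; apply: ler_pM => //; first exact: le_trans (ent _ _ _) (HM s s02).
  apply: le_trans (ent (g t - g s) j i) _; apply: (isd_mean (cls_isd cg) s02 t02 st) => r /andP[sr rt].
  apply: HK; move: s02 t02; rewrite /in02 => /andP[? ?] /andP[? ?].
  by apply/andP; split; [exact: le_trans sr | exact: le_trans rt _].
move: b; rewrite e !sumr_const !card_ord normrN ger0_norm // => b.
have ts : 0 <= t - s by rewrite subr_ge0.
have := mulr_ge0 (mulr_ge0 (ltW M0) (ltW K0)) ts => mk.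
have : (4 : R) <= 9 * (M * K * (t - s)) by apply: le_trans b _; rewrite -mulrA !mulr_natl -mulrnA mulrA.
move: d; rewrite mulrDr mulr1; lra.
Qed.

Lemma path_lift g : SO3Rp_curve None g -> exists f, lift_of g f.
Proof.
move=> Pg; have [d d0 Hd] := trace_close Pg; have [cg pg] := Pg.
(* Successive curves compare [g] at times that differ by [t / N <= 2 / N < d]. *)
pose N := (Num.truncn (2 / d)).+1.
have N0 : 0 < N%:R :> R by rewrite ltr0n.
have Nd : 2 / N%:R < d.
  by rewrite ltr_pdivrMr // mulrC -ltr_pdivrMr // /N truncnS_gt // divr_ge0 // ltW.
pose l (k : nat) : R := k%:R / N%:R.
have l01 k : (k <= N)%N -> 0 <= l k <= 1.
  by move=> kN; rewrite divr_ge0 //= ?ler0n // ler_pdivrMr // mul1r ler_nat.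
pose G k : R -> MR := on02 (fun t => g (l k * t)).
have sc k t : (k <= N)%N -> in02 t -> in02 (l k * t).
  move=> kN; have /andP[l0 l1] := l01 k kN; rewrite /in02 => /andP[t0 t2]; apply/andP; split.
    exact: mulr_ge0.
  by apply: le_trans t2; rewrite ler_piMl.
have PG k : (k <= N)%N -> SO3Rp_curve None (G k).
  move=> kN; split; first exact: (cls_scale (l01 k kN) cg).
  by move=> t t02; rewrite /G on02E //; apply: pg; exact: sc.
have L k : (k <= N)%N -> exists f, lift_of (G k) f.
  elim: k => [|k IH] kN.
    (* For [k = 0] the curve is constant, with a constant lift. *)
    have [z z0 zg] := SO3Rp_hop (pg 0 (@in02_0 R)).
    exists (on02 (fun=> z)); split; first exact: (@cls_const R None).
      by move=> t t02; rewrite on02E.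
    by move=> t t02; rewrite /G !on02E // /l !mul0r.
  have kN' := ltnW kN; have [f fk] := IH kN'.
  exists (chart_lift f (chart_curve (G k) (G k.+1))).
  apply: lift_step (PG k kN') (PG _ kN) fk _ => t t02; rewrite /G !on02E //.
  have /andP[t0 t2] := t02.
  have e : l k.+1 * t - l k * t = t / N%:R by rewrite /l -natr1; field; rewrite gt_eqF.
  apply: Hd; [exact: sc | exact: sc | |].
    by rewrite -subr_ge0 e divr_ge0 // ltW.
  by rewrite e; apply: le_lt_trans Nd; rewrite ler_pM2r // invr_gt0.
have [f [cf f0 fg]] := L N (leqnn _); exists f; split=> // t t02.
by rewrite fg // /G on02E // /l mulfV ?gt_eqF // mul1r.
Qed.

End PathLifting.

(** * Lifts of loops are loops or antiloops *)

Section LoopLifts.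
Context {R : realType}.
Notation MR := ('M[R]_3 * R^o : normedModType R)%type.
Implicit Types (o : option bool) (f y : R -> C2 R) (g h : R -> MR).

Lemma quat_row_hop (z : C2 R) a : z <> 0 -> (a < 4)%N ->
  quat_row (hop z).1 a = (4 * qc a z / qn z) *: z.
Proof.
move=> /qn_gt0/lt0r_neq0 z0 a4; rewrite -[RHS]qmkE !qcZ /hop /= mk3_scale quat_row_mk3.
by case: a a4 => [|[|[|[|//]]]] _; rewrite /qn in z0 *; congr qmk; field.
Qed.

(** [quat_row] is affine in the matrix; its value at 0 is removed to have a linear map. *)
Lemma blin_quat_row a : @blin R ('M[R]_3 : normedModType R) (C2 R)
  (fun A => quat_row A a - quat_row 0 a).
Proof.
apply: blin_matrix => c A B; apply: injective_projections; apply/rowP => j;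
  by case: a => [|[|[|a]]]; rewrite !mxE /=; case: (j == 0); ring.
Qed.

Lemma lift_products g f a b : SO3Rp_curve (Some false) g -> lift_of g f -> (a < 4)%N ->
  cls (Some false) (cmul (qcc f a) (qcc f b)).
Proof.
move=> [cg pg] [cf f0 fg] a4.
pose W : R -> C2 R := (fun t => quat_row (g t).1 a - quat_row 0 a) + on02 (fun=> quat_row 0 a).
have cW : cls (Some false) W.
  apply: clsD; last exact: (@cls_const R (Some false)).
  exact: (cls_blin (blin_comp (blin_fst 'M[R]_3 R^o) (blin_quat_row a)) cg).
have cS := clsZ 4^-1 (cls_speed cg).
have cP := cls_mul cS (cls_qcc b cW).
have -> : cmul (qcc f a) (qcc f b) = cmul (4^-1 *: (fun t => (g t).2)) (qcc W b); last exact: cP.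
apply: eq_on02 => [||t t02].
- exact: cls_on (smooth_mul (cls_qcc a cf) (cls_qcc b cf)).
- exact: cls_on cP.
have n0 := lt0r_neq0 (qn_gt0 (f0 t t02)).
rewrite /cmul /qcc /W !fctE on02E // addrNK -fg // quat_row_hop //; last exact: f0.
by rewrite qcZ /GRing.scale /=; field.
Qed.

Lemma cls_upgrade (F : nat -> R -> R^o) (s : R -> R^o) c :
  (forall a, (a < 4)%N -> cls None (F a)) -> cls (Some false) s ->
  (forall t, in02 t -> s t = \sum_(a < 4) F a t ^+ 2) ->
  (forall t, in02 t -> (s t : R) != 0) ->
  (forall a b, (a < 4)%N -> (b < 4)%N -> cls (Some false) (cmul (F a) (F b))) ->
  (forall a, (a < 4)%N -> endc (Some c) (F a)) ->
  forall a, (a < 4)%N -> cls (Some c) (F a).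
Proof.
move=> cF cs sE s0 cP eF.
(* Since [sum_b F_b^2 = s], one has [sum_b F_b' F_b = s' / 2]; expanding [sum_b (F_a F_b)' F_b] then
   isolates [s F_a']. All coefficients on the right are loops, so order [n] for the [F_b] yields
   order [n + 1]. *)
pose rhs a : R -> R^o := cmul (cinv s)
  (\sum_(b < 4) cmul (deriv02 (cmul (F a) (F b))) (F b) - 2^-1 *: cmul (deriv02 s) (F a)).
have ci : cls (Some false) (cinv s) := @cls_cinv R true false s cs s0.
have dF a : (a < 4)%N -> isd (F a) (rhs a).
  move=> a4; apply: isd_eq (cls_isd (cF a a4)) => // t t02.
  have ds : deriv02 s t = 2 * \sum_(b < 4) (deriv02 (F b) t : R) * F b t.
    have := deriv02E (f := s) (g := (2 : R) *: \sum_(b < 4) cmul (deriv02 (F b)) (F b)).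
    rewrite fctE fct_sumE; apply=> //.
    have d (b : 'I_4) : isd (cmul (F b) (F b)) (2 *: cmul (deriv02 (F b)) (F b)).
      apply: isd_eq (isd_mul (cls_isd (cF b _)) (cls_isd (cF b _))) => // r _.
      by rewrite !fctE /cmul /GRing.scale /=; ring.
    have dd := isdD (d ord0) (isdD (d 1) (isdD (d 2%:R) (d 3%:R))).
    apply: isd_eq dd => r r02.
      by rewrite sE // !big_ord_recl big_ord0 /cmul /= addr0 -!expr2.
    by rewrite !fctE !big_ord_recl big_ord0 addr0 /cmul /GRing.scale /=; ring.
  rewrite /rhs /cmul cinvE ?s0 // !fctE fct_sumE.
  have -> : \sum_(b < 4) (deriv02 (fun r => F a r * F b r) t : R) * F b t =
      deriv02 (F a) t * s t + F a t * \sum_(b < 4) (deriv02 (F b) t : R) * F b t.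
    rewrite sE // !mulr_sumr -big_split; apply: eq_bigr => b _ /=.
    rewrite (deriv02E (isd_mul (cls_isd (cF a a4)) (cls_isd (cF b (ltn_ord b)))) t02).
    by rewrite fctE /cmul /=; ring.
  rewrite ds; have := s0 t t02; rewrite /GRing.scale /= => st0.
  by field.
have D n : forall a, (a < 4)%N -> Dn (Some c) n (F a).
  elim: n => [|n IH] a a4.
    by split=> //; [exact: cls_on (cF a a4) | exact: eF | exact: isd_diff02 (dF a a4)].
  apply: DnS (dF a a4) _; [exact: cls_on (cF a a4) | exact: eF|].
  have key (u : R -> R^o) b : cls (Some false) u -> (b < 4)%N -> Dn (Some c) n (cmul u (F b)).
    move=> cu b4; have Du := iffLR (@clsP R (Some false) _ u) cu n.
    exact: (@DnM R (Some false) (Some c) n u (F b) Du (IH b b4)).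
  have Di := iffLR (@clsP R (Some false) _ (cinv s)) ci n.
  apply: (@DnM R (Some false) (Some c) n (cinv s) _ Di).
  apply: DnD; last first.
    rewrite -scaleNr; apply: (Dn_blin (blin_scale _ (- 2^-1))); apply: key => //.
    exact: cls_deriv.
  elim/big_ind: _ => [|u v|b _]; [exact: Dn0 | exact: DnD |].
  by apply: key => //; apply: cls_deriv; exact: cP.
by move=> a a4; apply: (iffRL (@clsP R (Some c) _ (F a))) => n; exact: D.
Qed.

Lemma lin_qcc o f : cls o f -> lincurve qe (qcc f) = f.
Proof.
by move=> cf; apply/funext => t; rewrite lin_qe qmkE.
Qed.

Lemma loop_lift per g f : SO3Rp_curve (lc per false) g -> lift_of g f ->
  exists b, cls (lc per b) f.
Proof.
case: per => [|] Pg Lf; last by exists false; have [] := Lf.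
have [cf f0 fg] := Lf; have [cg pg] := Pg.
have g20 : g 2 = g 0 by have [_ /(_ 0%N)] := cg.
have [c ec] : exists c, f 2 = sg c (f 0).
  have e : hop (f 0) = hop (f 2) by rewrite !fg ?in02_0 ?in02_2.
  by have [->|->] := hop_inj (f0 0 (@in02_0 R)) e; [exists false | exists true].
exists c; rewrite -(lin_qcc cf); apply: cls_lincurve => a a4.
apply: (cls_upgrade (F := qcc f) (s := fun t => (g t).2)) => //.
- by move=> b _; exact: (cls_qcc b cf).
- exact: (cls_speed cg).
- by move=> t t02; rewrite -fg // !big_ord_recl big_ord0 addr0 /= /qn !addrA.
- by move=> t t02; have [_ _ s0] := pg t t02; exact: lt0r_neq0.
- by move=> a' b a4' b4; exact: (lift_products b Pg Lf).
- by move=> b _; rewrite /endc /qcc ec; case: (c) => //=; rewrite -scaleN1r qcZ mulN1r.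
Qed.

Lemma constant_sign (w : R -> R^o) : cls None w -> (forall t, in02 t -> (w t : R) != 0) ->
  (forall t, in02 t -> 0 < (w t : R)) \/ (forall t, in02 t -> (w t : R) < 0).
Proof.
move=> cw w0; have cont := isd_continuous (cls_isd cw).
suff S t : in02 t -> 0 < (w t : R) * w 0.
  have := w0 0 (@in02_0 R); rewrite neq_lt => /orP[w00|w00]; [right|left] => t t02; move: (S t t02).
    by rewrite nmulr_lgt0.
  by rewrite pmulr_lgt0.
move=> t02; have /andP[t0 t2] := t02; rewrite lt_neqAle eq_sym mulf_neq0 ?w0 ?in02_0 //=.
rewrite leNgt; apply/negP => neg.
have cont' : {within `[0, t], continuous w}.
  apply: continuous_subspaceW cont => s; rewrite /= !in_itv /= => /andP[-> st]; exact: le_trans t2.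
have [|s] := @IVT R w 0 t 0 t0 cont'.
  have := w0 0 (@in02_0 R); rewrite neq_lt => /orP[w00|w00].
    have wt : 0 < (w t : R) by move: neg; rewrite nmulr_llt0.
    by rewrite minElt maxElt (lt_trans w00 wt) !ltW.
  have wt : (w t : R) < 0 by move: neg; rewrite pmulr_llt0.
  by rewrite minElt maxElt ltNge (ltW (lt_trans wt w00)) /= !ltW.
rewrite in_itv /= => /andP[s0 st] ws.
have s02 : in02 s by rewrite /in02 s0 (le_trans st t2).
by have := w0 s s02; rewrite ws eqxx.
Qed.

End LoopLifts.

(** * Curves in SO(3) x R+ *)

Section HopfCover.
Context {R : realType} (per : bool).
Notation MR := ('M[R]_3 * R^o : normedModType R)%type.
Notation SC := (curves None (R^o : normedModType R)).
Notation chart := ('rV[R]_3 * R^o : normedModType R)%type.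
Notation N := (@SO3Rp_mfd R (@cls R (lc per false))).
Implicit Types (o : option bool) (y : R -> C2 R) (g p : R -> MR) (b : bool).

Definition base_curve g : Prop := SO3Rp_curve (lc per false) g.

Definition is_lift g (l : bool * (R -> C2 R)) : Prop :=
  [/\ cls (lc per l.1) l.2, nowhere0 l.2 & forall t, in02 t -> hop (l.2 t) = g t].

(** The lift about which the chart [g] is described upstairs. The default concerns only indices [g]
    whose chart is empty. *)
Definition the_lift g : bool * (R -> C2 R) := xget (false, 0) [set l | is_lift g l].

Lemma exists_lift g : base_curve g -> exists l, is_lift g l.
Proof.
move=> [cg pg]; have Pg : SO3Rp_curve None g by split=> //; exact: (cls_none cg).
have [f Lf] := path_lift Pg.
have [b cf] := @loop_lift R per g f (conj cg pg) Lf.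
by exists (b, f); have [_ f0 fg] := Lf; split.
Qed.

Lemma the_liftP g : base_curve g -> is_lift g (the_lift g).
Proof. by move=> /exists_lift[l Ll]; apply: (@xgetPex _ (false, 0) [set l | is_lift g l]); exists l. Qed.

Definition nonvanishing : set (R -> C2 R) := [set y | (exists b, cls (lc per b) y) /\ nowhere0 y].

Definition classes b : set (R -> C2 R) := @cls R (lc per b) (C2 R).

Lemma hopcE y t : in02 t -> hopc y t = hop (y t).
Proof. exact: on02E. Qed.

Lemma total_base y : nonvanishing y -> base_curve (hopc y).
Proof.
move=> [[b cy] y0]; split; first exact: (cls_hopc cy y0).
by move=> t t02; rewrite hopcE //; apply: hop_SO3Rp; exact: y0.
Qed.

Lemma total_class y b b' : per -> nonvanishing y -> classes b y -> classes b' y -> b = b'.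
Proof.
rewrite /classes /lc; case: per => // _ [_ y0] c c'.
have e : y 2 = sg b (y 0) by case: b c => -[_ /(_ 0%N)].
have e' : y 2 = sg b' (y 0) by case: b' c' => -[_ /(_ 0%N)].
have n0 := y0 0 (@in02_0 R).
have H : y 0 <> - y 0.
  move=> h; apply: n0; have : 2 *: y 0 = 0 by rewrite scaler_nat mulr2n {1}h addNr.
  by move/eqP; rewrite scaler_eq0 pnatr_eq0 => /eqP.
by case: b b' e e' {c c'} => -[] -> //= /esym // h; case: H; rewrite // -h.
Qed.

Lemma total_class_eq y b b' : nonvanishing y -> classes b y -> classes b' y -> classes b = classes b'.
Proof.
move=> Ty cb cb'; have [p|] := boolP per; first by rewrite (total_class p Ty cb cb').
by rewrite /classes /lc; case: per.
Qed.

Lemma dom_base g p : mf_dom (p := N) g p -> [/\ base_curve g, base_curve p &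
  forall t, in02 t -> \tr ((g t).1^T *m (p t).1) <> -1].
Proof. by []. Qed.

(** For loops, a lift over the chart has the class of the base lift [f]: otherwise the real part of
    [conj(f) y] would be antiperiodic, hence change sign, whereas it vanishes nowhere. *)
Lemma dom_lift g : base_curve g -> [set y | nonvanishing y /\ mf_dom (p := N) g (hopc y)] =
  classes (the_lift g).1 `&` transverse (the_lift g).2.
Proof.
move=> Bg; have [cf f0 fg] := the_liftP Bg; move: (the_lift g) cf f0 fg => [c f] /= cf f0 fg.
apply/seteqP; split=> {}y.
  move=> [[[b cy] y0] /dom_base[_ _ tr1]].
  have ty : transverse f y.
    move=> t t02; have [H _] := wcoord_trace (f0 t t02) (y0 t t02); apply: H.
    by rewrite fg // -hopcE //; exact: tr1.
  split=> //; rewrite /classes; suff <- : lc per b = lc per c by [].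
  have cw : cls (lc per (c (+) b)) (wcoord f y 0).
    by rewrite -omul_lc; apply: cls_qbil => j; exact: cls_qcc.
  rewrite /lc; move: cw; rewrite /lc; case: (per) => // cw; congr Some; apply: contrapT => bc.
  have e : wcoord f y 0 2 = - wcoord f y 0 0.
    by have [_ /(_ 0%N)] : cls (Some true) (wcoord f y 0) by move: cw bc; case: (b) (c) => -[].
  have [s|s] := constant_sign (cls_none cw) ty.
    by have := s 2 (@in02_2 R); rewrite e oppr_gt0 => h; have := lt_trans h (s 0 (@in02_0 R)); rewrite ltxx.
  by have := s 2 (@in02_2 R); rewrite e oppr_lt0 => h; have := lt_trans h (s 0 (@in02_0 R)); rewrite ltxx.
move=> [cy ty]; have y0 := transverse_nowhere0 ty.
have Ty : nonvanishing y by split=> //; exists c.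
split=> //; split=> //; first exact: total_base.
move=> t t02; rewrite hopcE // -fg //; apply/(wcoord_trace (f0 t t02) (y0 t t02)); exact: ty.
Qed.

Lemma base_total p : base_curve p -> exists2 y, nonvanishing y & hopc y = p.
Proof.
move=> Bp; have [[c y] [cy y0 yp]] := exists_lift Bp; exists y; first by split=> //; exists c.
apply: eq_on02; [exact: on02_on02 | exact: cls_on Bp.1|].
by move=> t t02; rewrite hopcE // yp.
Qed.

Lemma total_P g y : nonvanishing y -> mf_dom (p := N) g (hopc y) ->
  classes (the_lift g).1 y /\ mf_map (p := N) g (hopc y) = lift_chart (the_lift g).2 y.
Proof.
move=> Ty dy; have [Bg _ _] := dom_base dy.
have : [set y | nonvanishing y /\ mf_dom (p := N) g (hopc y)] y by [].
rewrite (dom_lift Bg) => -[cy ty]; split=> //.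
have [cf f0 fg] := the_liftP Bg; have cP := cls_lift_chart cf cy ty.
apply: eq_on02; [exact: on02_on02 | exact: (cls_on cP)|] => t t02.
rewrite -[LHS]/(chart_curve g (hopc y) t) /chart_curve on02E //.
by rewrite (lift_chartE t02 (f0 t t02) (ty t t02)) -fg // hopcE.
Qed.

Lemma chart_section g p : mf_dom (p := N) g p ->
  let y := chart_lift (the_lift g).2 (mf_map (p := N) g p) in
  [/\ positive_charts (lc per false) (mf_map (p := N) g p), nonvanishing y & hopc y = p].
Proof.
move=> dp; have [Bg Bp tr1] := dom_base dp; have [cf f0 fg] := the_liftP Bg.
have pos : positive_charts (lc per false) (mf_map (p := N) g p).
  have [y Ty yp] := base_total Bp; rewrite -yp in dp *; have [cy ->] := total_P Ty dp.
  have : [set y | nonvanishing y /\ mf_dom (p := N) g (hopc y)] y by [].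
  rewrite (dom_lift Bg) => -[_ ty]; split; first exact: (cls_lift_chart cf cy ty).
  move=> t t02; rewrite (lift_chartE t02 (f0 t t02) (ty t t02)) /=.
  by apply: qn_gt0; have [_] := Ty; exact.
split=> //; last first.
  apply: eq_on02; [exact: on02_on02 | exact: cls_on Bp.1|] => t t02; rewrite hopcE //.
  by have [] := hop_chart_lift (fg t t02) f0 t02 (Bg.2 t t02) (Bp.2 t t02) (tr1 t t02).
split; first by exists (the_lift g).1; apply: cls_chart_lift.
move=> t t02.
by have [] := hop_chart_lift (fg t t02) f0 t02 (Bg.2 t t02) (Bp.2 t t02) (tr1 t t02).
Qed.

Lemma image_base g : base_curve g ->
  mf_map (p := N) g @` mf_dom (p := N) g = positive_charts (lc per false).
Proof.
move=> Bg; have [cf f0 fg] := the_liftP Bg; apply/seteqP; split=> [_ [p dp <-]|x Px].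
  by have [] := chart_section dp.
have [cx x0] := Px; pose y := chart_lift (the_lift g).2 x.
have cy : cls (lc per (the_lift g).1) y by exact: cls_chart_lift.
have yE t : in02 t -> hop (y t) =
    ((g t).1 *m ((qn (qcay (x t).1))^-1 *: qrot (qcay (x t).1)), (x t).2) /\ y t <> 0.
  by move=> t02; rewrite -fg //; exact: (chart_liftE f0 t02 (x0 t t02)).
have Ty : nonvanishing y by split; [exists (the_lift g).1 | move=> t /yE[]].
have gy t : in02 t -> (g t).1^T *m (hopc y t).1 = (qn (qcay (x t).1))^-1 *: qrot (qcay (x t).1).
  move=> t02; rewrite hopcE // (yE t t02).1 mulmxA.
  by have [gg _ _] := Bg.2 t t02; rewrite (mulmx1C gg) mul1mx.
exists (hopc y).
  split=> //; first exact: total_base.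
  (* The real part of [1 + xi] is 1, so 1 plus the trace is 4 divided by a square norm and cannot
     vanish. *)
  move=> t t02; rewrite gy // => tr1; have := hop_trace (@qcay_neq0 R (x t).1).
  rewrite tr1 subrr qcay0 expr1n => /esym/eqP.
  by rewrite mulr1 mulf_eq0 invr_eq0 pnatr_eq0 /= gt_eqF // qn_gt0 //; exact: qcay_neq0.
apply: eq_on02; [exact: on02_on02 | exact: cls_on cx|] => t t02.
rewrite -[LHS]/(chart_curve g (hopc y) t) /chart_curve on02E // gy // hopcE // (yE t t02).1 /=; apply: injective_projections => //=.
have e3 k (k3 : (k < 3)%N) : inord k = Ordinal k3 by apply/val_inj; rewrite /= inordK.
rewrite hop_cayley ?qcay0 ?oner_eq0 //; last exact: qcay_neq0.
have [_ h1 h2 h3] := qc_mk (1 : R) ((x t).1 0 (inord 0)) ((x t).1 0 (inord 1)) ((x t).1 0 (inord 2)).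
apply/rowP => -[[|[|[|//]]] k3]; rewrite mxE divr1 /= /qcay ?(h1, h2, h3);
  by congr ((x t).1 _ _); rewrite e3; exact/val_inj.
Qed.

(** The lifts agree up to a sign at each time. The real part of [conj(y) y'] is then plus or minus
    the square norm of [y], never zero, so the sign is constant. *)
Lemma hopc_pm y y' : nonvanishing y -> nonvanishing y' -> hopc y = hopc y' -> y' = y \/ y' = - y.
Proof.
move=> [[b cy] y0] [[b' cy'] y0'] e.
have pm t : in02 t -> y' t = y t \/ y' t = - y t.
  by move=> t02; apply: hop_inj (y0 t t02) _; rewrite -!hopcE // e.
pose w : R -> R^o := qbil (cnjT 0) (qcc y) (qcc y').
have cw : cls None w.
  by apply: (@cls_qbil R None None) => k; [exact: (cls_none (cls_qcc k cy)) | exact: (cls_none (cls_qcc k cy'))].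
have wp t : y' t = y t -> w t = qn (y t).
  by move=> h; rewrite /w qbilE /= !big_cons big_nil /qcc h /qn /=; ring.
have wm t : y' t = - y t -> w t = - qn (y t).
  by move=> h; rewrite /w qbilE /= !big_cons big_nil /qcc h -scaleN1r !qcZ /qn /=; ring.
have n0 t : in02 t -> 0 < qn (y t) by move=> t02; apply: qn_gt0; exact: y0.
have w0 t : in02 t -> (w t : R) != 0.
  by move=> t02; case: (pm t t02) => [/wp|/wm] ->; rewrite ?oppr_eq0 gt_eqF // n0.
have [s|s] := constant_sign cw w0; [left|right].
  apply: eq_on02; [exact: (cls_on cy') | exact: (cls_on cy)|] => t t02.
  have [//|/wm h] := pm t t02; have := s t t02; rewrite h oppr_gt0 => h'.
  by have := lt_trans h' (n0 t t02); rewrite ltxx.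
apply: eq_on02; [exact: (cls_on cy') | exact: (cls_on (clsN cy))|] => t t02.
have [/wp h|//] := pm t t02; have := s t t02; rewrite h => h'.
by have := lt_trans h' (n0 t t02); rewrite ltxx.
Qed.

Lemma hopN (z : C2 R) : hop (- z) = hop z.
Proof. by rewrite /hop -scaleN1r qrotZ qnZ sqrrN expr1n mul1r scale1r. Qed.

Lemma totalN y : nonvanishing y -> nonvanishing (- y) /\ hopc (- y) = hopc y.
Proof.
move=> [[b cy] y0]; split.
  split; first by exists b; exact: clsN.
  by move=> t t02 /eqP; rewrite oppr_eq0 => /eqP; exact: y0.
by apply/funext => t; rewrite /hopc /on02 fctE hopN.
Qed.

Lemma classes_none b : classes b `<=` @cls R None (C2 R).
Proof. by move=> y; exact: cls_none. Qed.

Lemma fopen_closed (A : lmodType R) (c c' U : set A) (s : nat -> A -> R) : c' `<=` c ->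
  fopen (E := Fspace c s) U -> fopen (E := Fspace c' s) (c' `&` U).
Proof.
move=> cc' [_ oU]; split=> [x []//|x [cx Ux]].
have [k [e e0 H]] := oU x Ux; exists k, e => // y cy yx; split=> //.
by apply: H => //; exact: cc'.
Qed.

Lemma fopen_total b : @fopen R (curves (lc per b) (C2 R)) (nonvanishing `&` classes b).
Proof.
pose E := curves None (C2 R); pose S : set E := @fs_car R E.
have oS : fopen S by exact: fopen_fs_car.
pose W : E -> SC := fun y => qbil (cnjT 0) (qcc y) (qcc y).
have CW : @Cn R 0 E SC S W.
  by apply: (@Cn_qbil R 0 E _ S (cnjT 0) (fun k y => qcc y k) (fun k y => qcc y k)) => // k; exact: Cn_qcc.
have oP : fopen (S `&` W @^-1` @positive_curves R).
  exact: (fopen_preim oS (Cn_car CW) (Cn_cont CW) (@fopen_positive R)).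
have := fopen_closed (@classes_none b) oP.
suff -> : nonvanishing `&` classes b = classes b `&` (S `&` W @^-1` @positive_curves R) by [].
have WE y t : W y t = qn (y t) by exact: qbil_nrm.
apply/seteqP; split=> y.
  move=> [[_ y0] cy]; split=> //; split; first exact: (cls_none cy).
  split; first exact: (Cn_car CW (cls_none cy)).
  by move=> t t02; rewrite WE; apply: qn_gt0; exact: y0.
move=> [cy [_ [_ p]]]; split=> //; split; first by exists b.
move=> t t02 e; have := p t t02; rewrite WE e -(scale0r (0 : C2 R)) qnZ expr2 !mul0r.
by rewrite ltxx.
Qed.

Lemma hopf_flat_cover : @flat_cover R (R -> C2 R) (@fs_sn R (curves None (C2 R))) bool classes N
  (fun g => (the_lift g).1) nonvanishing hopc (fun g => chart_lift (the_lift g).2)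
  (fun g => lift_chart (the_lift g).2).
Proof.
have dom0 g : ~ base_curve g -> mf_dom (p := N) g = set0.
  by move=> Bg; apply/seteqP; split=> // p /dom_base[].
have V0 g : ~ base_curve g -> [set y | nonvanishing y /\ mf_dom (p := N) g (hopc y)] = set0.
  by move=> Bg; apply/seteqP; split=> // y [_ /dom_base[]].
have oV g : fopen (E := curves (lc per (the_lift g).1) (C2 R))
    [set y | nonvanishing y /\ mf_dom (p := N) g (hopc y)].
  have [Bg|/V0 ->] := pselect (base_curve g); last exact: fopen0.
  have [cf _ _] := the_liftP Bg; rewrite (dom_lift Bg).
  have := fopen_closed (@classes_none (the_lift g).1) (fopen_transverse (cls_none cf)).
  suff <- : classes (the_lift g).1 `&` transverse_set (the_lift g).2 =
    classes (the_lift g).1 `&` transverse (the_lift g).2 by [].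
  by apply/seteqP; split=> y [cy ty]; split=> //; [exact: ty.2 | split=> //; exact: (cls_none cy)].
have oD (g : R -> MR) : @fopen R (curves (lc per false) chart) (mf_map (p := N) g @` mf_dom (p := N) g).
  have [Bg|/dom0 ->] := pselect (base_curve g); last by rewrite image_set0; exact: fopen0.
  by rewrite (image_base Bg); exact: fopen_positive_charts.
split.
- by move=> b; exact: frechet_C2.
- by move=> g; exact: frechet_chart.
- by move=> g p /dom_base[].
(* Each curve lies in the chart centred at itself, the identity having trace 3. *)
- move=> p Bp; exists p; split=> // t t02; have [pp _ _] := Bp.2 t t02.
  by rewrite (mulmx1C pp) mxtrace1 => /eqP; rewrite -subr_eq0 opprK natr1 pnatr_eq0.
- exact: fopen_total.
- by move=> y [[b cy] _]; exists b.
- exact: total_class_eq.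
- exact: total_base.
- exact: total_P.
- exact: oV.
(* An index off the manifold has an empty chart; otherwise smoothness is restricted from the spaces
   of paths. *)
- move=> g n; have [Bg|/V0 V00] := pselect (base_curve g); last first.
    by apply: (@Csmooth0 R (curves (lc per (the_lift g).1) (C2 R))); rewrite ?V00.
  have [cf _ _] := the_liftP Bg.
  apply: Cn_restrict (Cn_lift_chart (cls_none cf) n); try exact: frechet_C2; try exact: frechet_chart.
  + exact: classes_none.
  + by move=> x; exact: cls_none.
  + by rewrite (dom_lift Bg) => y [cy ty]; split=> //; exact: (cls_none cy).
  + exact: oV.
  + by rewrite (dom_lift Bg) => y [cy ty]; exact: (cls_lift_chart cf cy ty).
- exact: oD.
- by move=> g p dp; have [] := chart_section dp.
- move=> g n; have [Bg|/dom0 d0] := pselect (base_curve g); last first.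
    by apply: (@Csmooth0 R (curves (lc per false) chart)); rewrite d0 image_set0.
  have [cf f0 _] := the_liftP Bg.
  apply: Cn_restrict (Cn_chart_lift f0 (cls_none cf) n); try exact: frechet_C2; try exact: frechet_chart.
  + by move=> x; exact: cls_none.
  + exact: classes_none.
  + by rewrite (image_base Bg) => x [cx x0]; split=> //; exact: (cls_none cx).
  + exact: oD.
  + by rewrite (image_base Bg) => x Px; exact: (cls_chart_lift f0 cf Px).
- exact: hopc_pm.
- exact: totalN.
- move=> y [_ y0] e; apply: (y0 0 (@in02_0 R)); by rewrite e.
Qed.

End HopfCover.

(** * Framed paths *)

Section FramedPaths.
Context {R : realType}.
Notation MR := ('M[R]_3 * R^o : normedModType R)%type.
Notation V3 := ('rV[R]_3 : normedModType R).
Implicit Types (o : option bool) (u v : 'rV[R]_3) (q : R -> MR) (x y : (R -> 'rV[R]_3) * (R -> 'rV[R]_3)).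

Definition crd u (k : nat) : R := u 0 (inord k).

Lemma inord3 k (k3 : (k < 3)%N) : inord k = Ordinal k3.
Proof. by apply/val_inj; rewrite /= inordK. Qed.

Lemma crd_eq u v : (forall k, (k < 3)%N -> crd u k = crd v k) -> u = v.
Proof.
move=> H; apply/rowP => i; have := H i (ltn_ord i); rewrite /crd.
by have -> : inord i = i by apply/val_inj; rewrite /= inordK.
Qed.

Lemma dot3E u v : dot3 u v = crd u 0 * crd v 0 + crd u 1 * crd v 1 + crd u 2 * crd v 2.
Proof.
rewrite /dot3 !big_ord_recl big_ord0 /crd addr0 addrA (inord3 (k := 0)) (inord3 (k := 1)) (inord3 (k := 2)).
by congr (u _ _ * v _ _ + u _ _ * v _ _ + u _ _ * v _ _); exact/val_inj.
Qed.

Lemma cross3E u v : [/\ crd (cross3 u v) 0 = crd u 1 * crd v 2 - crd u 2 * crd v 1,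
  crd (cross3 u v) 1 = crd u 2 * crd v 0 - crd u 0 * crd v 2 &
  crd (cross3 u v) 2 = crd u 0 * crd v 1 - crd u 1 * crd v 0].
Proof.
by rewrite /crd (inord3 (k := 0)) (inord3 (k := 1)) (inord3 (k := 2)); split; rewrite mxE;
  congr (u _ _ * v _ _ - u _ _ * v _ _); exact/val_inj.
Qed.

Lemma dot3_ge0 u : 0 <= dot3 u u.
Proof. by rewrite dot3E -!expr2 !addr_ge0 // sqr_ge0. Qed.

Lemma dot3_gt0 u : u <> 0 -> 0 < dot3 u u.
Proof.
move=> u0; rewrite lt_neqAle dot3_ge0 andbT eq_sym; apply/eqP; rewrite dot3E => e; apply: u0.
have := (sqr_ge0 (crd u 0), sqr_ge0 (crd u 1), sqr_ge0 (crd u 2)); move=> [[s0 s1] s2].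
rewrite -!expr2 in e; apply: crd_eq => k k3; rewrite [RHS]mxE.
by case: k k3 => [|[|[|//]]] _; apply/eqP; rewrite -sqrf_eq0; apply/eqP; lra.
Qed.

Lemma norm3_sqr u : norm3 u ^+ 2 = dot3 u u.
Proof. by rewrite sqr_sqrtr // dot3_ge0. Qed.

Lemma norm3_gt0 u : u <> 0 -> 0 < norm3 u.
Proof. by move=> u0; rewrite sqrtr_gt0 dot3_gt0. Qed.

Definition frame u v : 'M[R]_3 * R^o :=
  let s := norm3 u in let T := s^-1 *: u in
  (\matrix_(i, j) (nth 0 [:: T; v; cross3 T v] j) 0 i, s).

Lemma frame_mk3 (T v w : 'rV[R]_3) : \matrix_(i < 3, j < 3) (nth 0 [:: T; v; w] j) 0 i =
  mk3 (crd T 0) (crd v 0) (crd w 0) (crd T 1) (crd v 1) (crd w 1) (crd T 2) (crd v 2) (crd w 2).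
Proof.
rewrite /crd (inord3 (k := 0)) (inord3 (k := 1)) (inord3 (k := 2)).
by apply/matrixP => -[[|[|[|//]]] ?] [[|[|[|//]]] ?]; rewrite !mxE /=; congr (_ _ _); exact/val_inj.
Qed.

Lemma frame_SO3Rp u v : u <> 0 -> norm3 v = 1 -> dot3 v u = 0 -> SO3Rp (frame u v).
Proof.
move=> u0 nv vu; have s0 := norm3_gt0 u0; rewrite /frame; set s := norm3 u in s0 *.
have sn := lt0r_neq0 s0.
set T := s^-1 *: u; have [c0 c1 c2] := cross3E T v.
have cT k : crd T k = s^-1 * crd u k by rewrite /crd mxE.
have dv : dot3 v v = 1 by rewrite -norm3_sqr nv expr1n.
have dT : dot3 T T = 1.
  have := norm3_sqr u; rewrite -/s !dot3E !cT => e.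
  have -> : s^-1 * crd u 0 * (s^-1 * crd u 0) + s^-1 * crd u 1 * (s^-1 * crd u 1) +
     s^-1 * crd u 2 * (s^-1 * crd u 2) = s^-1 ^+ 2 * (crd u 0 * crd u 0 + crd u 1 * crd u 1 + crd u 2 * crd u 2) by ring.
  by rewrite -e exprVn mulVf // sqrf_eq0.
have dTv : dot3 T v = 0.
  by move: vu; rewrite !dot3E !cT => e; have := congr1 ( *%R s^-1) e; rewrite mulr0 => <-; ring.
rewrite !dot3E in dv dT dTv.
(* Lagrange's identity for the norm of a cross product. *)
have key (a b c d e f : R) : (b * f - c * e) ^+ 2 + (c * d - a * f) ^+ 2 + (a * e - b * d) ^+ 2 =
    (a * a + b * b + c * c) * (d * d + e * e + f * f) - (a * d + b * e + c * f) ^+ 2 by ring.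
have := key (crd T 0) (crd T 1) (crd T 2) (crd v 0) (crd v 1) (crd v 2); rewrite dT dv dTv => K.
split=> //=; rewrite frame_mk3 ?mk3_det.
  apply: mulmx1C; rewrite mk3_tr mk3_mul mk3_scalar c0 c1 c2.
  by apply: mk3_eq; split; first [ring | lra].
by rewrite c0 c1 c2; lra.
Qed.

Definition colc (j : 'I_3) q : R -> 'rV[R]_3 := fun t => \row_i (q t).1 i j.

Lemma cls_colc o j q : cls o q -> @cls R o V3 (colc j q).
Proof. by move=> cq; apply: cls_row => i; exact: cls_entry. Qed.

(** The velocity is the speed times the first column; the third column is the cross product of the
    other two by the cofactor relations. *)
Lemma frame_colc (a : 'M[R]_3 * R^o) : SO3Rp a ->
  let c j := \row_i a.1 i j in
  [/\ a.2 *: c 0 <> 0, norm3 (c 1) = 1, dot3 (c 1) (a.2 *: c 0) = 0 & frame (a.2 *: c 0) (c 1) = a].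
Proof.
case: a => A s [/= AA dA s0].
have [a [b [c [d [e [g [h [i [j EA]]]]]]]]] := mk3E A.
have [AA'] := SO3_relations (etrans (congr1 (fun M => M *m M^T) (esym EA)) AA) (etrans (congr1 _ (esym EA)) dA).
rewrite mk3_tr mk3_mul mk3_scalar in AA'.
have [[a00 a01 _] [_ a11 _] _] := mk3_inj AA'.
move=> [r1 r2 r3] [r4 r5 r6] [r7 r8 r9].
pose x0 : 'rV[R]_3 := \row_i A i 0; pose x1 : 'rV[R]_3 := \row_i A i 1.
have C0 : [/\ crd x0 0 = a, crd x0 1 = d & crd x0 2 = h].
  by rewrite /crd (inord3 (k := 0)) (inord3 (k := 1)) (inord3 (k := 2)) /x0 EA; split; rewrite !mxE.
have C1 : [/\ crd x1 0 = b, crd x1 1 = e & crd x1 2 = i].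
  by rewrite /crd (inord3 (k := 0)) (inord3 (k := 1)) (inord3 (k := 2)) /x1 EA; split; rewrite !mxE.
case: C0 C1 => [p0 p1 p2] [l0 l1 l2].
have sZ k : crd (s *: x0) k = s * crd x0 k by rewrite /crd mxE.
have n0 : norm3 (s *: x0) = s.
  rewrite /norm3 dot3E !sZ p0 p1 p2 -[RHS](ger0_norm (ltW s0)) -sqrtr_sqr; congr Num.sqrt.
  have -> : s * a * (s * a) + s * d * (s * d) + s * h * (s * h) = s ^+ 2 * (a * a + d * d + h * h) by ring.
  by rewrite a00 mulr1.
have sn := lt0r_neq0 s0.
split.
- move=> e0; have : norm3 (s *: x0) = 0.
    by rewrite e0 /norm3 dot3E /crd !mxE mulr0 !addr0 sqrtr0.
  by rewrite n0 => /eqP; rewrite (negPf sn).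
- by rewrite /norm3 dot3E l0 l1 l2 a11 sqrtr1.
- rewrite dot3E !sZ l0 l1 l2 p0 p1 p2.
  have -> : b * (s * a) + e * (s * d) + i * (s * h) = s * (a * b + d * e + h * i) by ring.
  by rewrite a01 mulr0.
- rewrite /frame n0 scalerA mulVf // scale1r frame_mk3.
  have [-> -> ->] := cross3E x0 x1; rewrite p0 p1 p2 l0 l1 l2; congr (_, _).
  by rewrite EA; apply: mk3_eq; split=> //; lra.
Qed.

Lemma cls_frame o x : per_even o -> cls o (deriv02 x.1) -> cls o x.2 ->
  (forall t, in02 t -> deriv02 x.1 t <> 0) -> cls o (frame_curve x).
Proof.
move=> ho cd cv d0; pose D (i : 'I_3) : R -> R^o := fun t => deriv02 x.1 t 0 i.
have cD i : cls o (D i) by exact: (cls_blin (@blin_entry R 0 2 0 i) cd).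
pose V (i : 'I_3) : R -> R^o := fun t => x.2 t 0 i.
have cV i : cls o (V i) by exact: (cls_blin (@blin_entry R 0 2 0 i) cv).
have cM (f g : R -> R^o) : cls o f -> cls o g -> cls o (cmul f g) by rewrite {3}ho; exact: cls_mul.
pose uu : R -> R^o := \sum_i cmul (D i) (D i).
have cuu : cls o uu by apply: cls_sum => i; exact: cM.
have uuE t : uu t = dot3 (deriv02 x.1 t) (deriv02 x.1 t) by rewrite /uu fct_sumE.
have uu0 t : in02 t -> 0 < (uu t : R) by move=> t02; rewrite uuE dot3_gt0 //; exact: d0.
have cr := cls_rsqrt ho uu0 cuu.
pose T i := cmul (crsqrt uu) (D i); have cT i : cls o (T i) by exact: cM.
pose X (i : 'I_3) : R -> R^o := cmul (T (i + 1)) (V (i + 2%:R)) - cmul (T (i + 2%:R)) (V (i + 1)).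
have cX i : cls o (X i) by apply: clsB; exact: cM.
pose m (i j : 'I_3) : R -> R^o := nth 0 [:: T i; V i; X i] j.
have cm i j : cls o (m i j) by case: j => -[|[|[|//]]] ?; rewrite /m /=.
have cp := cls_pair (cls_matrix cm) (cM _ (crsqrt uu) cuu cr).
have con := cls_on cp; rewrite -con in cp.
have -> : frame_curve x = on02 (fun t => (\matrix_(i, j) (m i j t : R), cmul uu (crsqrt uu) t)); last exact: cp.
apply: on02_eq => t t02.
have e : norm3 (deriv02 x.1 t) = Num.sqrt (uu t : R) by rewrite uuE.
have s0 : Num.sqrt (uu t : R) != 0 by rewrite gt_eqF // sqrtr_gt0 uu0.
have TE i : T i t = ((norm3 (deriv02 x.1 t))^-1 *: deriv02 x.1 t) 0 i by rewrite mxE e /T /cmul crsqrtE.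
apply: injective_projections => /=; last first.
  rewrite e /cmul crsqrtE // -{2}(sqr_sqrtr (ltW (uu0 t t02))) expr2 mulfK //.
apply/matrixP => i j; rewrite mxE [RHS]mxE; case: j => -[|[|[|//]]] ?; rewrite /m /= ?TE //.
by rewrite [LHS]mxE -!TE.
Qed.

End FramedPaths.

(** * Framed paths modulo translation *)

Section FramedClasses.
Context {R : realType}.
Notation MR := ('M[R]_3 * R^o : normedModType R)%type.
Notation V3 := ('rV[R]_3 : normedModType R).
Implicit Types (per : bool) (q : R -> MR) (x y : (R -> 'rV[R]_3) * (R -> 'rV[R]_3)).

(** Both manifolds of framed paths at once: for [per = false] the last two conditions follow from
    the first. *)
Definition framed_in per x : Prop :=
  [/\ is_framed x, @cls R (lc per false) V3 (deriv02 x.1) & @cls R (lc per false) V3 x.2].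

Lemma framed_in_false : @framed_in false = @is_framed R.
Proof.
apply/funext => x; apply/propext; split=> [[fx _ _]|fx]; first exact: fx.
have [c1 c2 _] := fx.
by split; [exact: fx | exact: (@cls_deriv R None V3 _ c1) | exact: c2].
Qed.

Lemma framed_in_true : @framed_in true = @is_frame_periodic R.
Proof. by apply/funext => x; apply/propext; split=> -[a b c]; exact: (And3 a b c). Qed.

Lemma frame_fst (u v : 'rV[R]_3) : u <> 0 -> (frame u v).2 *: (\row_i (frame u v).1 i 0) = u.
Proof.
move=> /norm3_gt0/lt0r_neq0 n0; apply/rowP => i.
by rewrite !mxE /= mulrA mulfV // mul1r.
Qed.

Lemma frame_snd (u v : 'rV[R]_3) : \row_i (frame u v).1 i 1 = v.
Proof. by apply/rowP => i; rewrite !mxE. Qed.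

Lemma frame_curveE x t : in02 t -> frame_curve x t = frame (deriv02 x.1 t) (x.2 t).
Proof. exact: on02E. Qed.

Lemma isd_shift (V : normedModType R) (f f' : R -> V) (a : V) : isd f f' -> isd (on02 (fun t => f t + a)) f'.
Proof.
move=> ff'; apply: isd_eq (isdD ff' (isd_cst a)) => t t02; first by rewrite on02E.
by rewrite addr0.
Qed.

Lemma framed_isd x : is_framed x -> isd x.1 (deriv02 x.1).
Proof. by move=> [c1 _ _]; exact: (@cls_isd R None V3). Qed.

Lemma frame_curve_shift x a : is_framed x ->
  frame_curve (on02 (fun t => x.1 t + a), x.2) = frame_curve x.
Proof.
move=> fx; apply: on02_eq => t t02 /=.
by rewrite (deriv02_isd (isd_shift a (framed_isd fx)) (on02_deriv _)).
Qed.

Lemma mem_framed_class x : is_framed x -> framed_class x x.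
Proof.
move=> fx; split=> //; exists 0; rewrite [LHS]surjective_pairing; congr (_, _).
have [c1 _ _] := fx; rewrite -[LHS](@cls_on R None V3 _ c1).
by apply: on02_eq => t _; rewrite addr0.
Qed.

Lemma class_curveE x : is_framed x -> class_curve (framed_class x) = frame_curve x.
Proof.
move=> fx; have := @xgetPex _ (0, 0) _ (ex_intro _ x (mem_framed_class fx)).
rewrite /class_curve; case=> _ [a ->]; exact: frame_curve_shift.
Qed.

(** The frame curve determines [V] and the velocity, and two primitives of the velocity differ by a
    translation. *)
Lemma frame_curve_inj x y : is_framed x -> is_framed y -> frame_curve x = frame_curve y ->
  framed_class y x.
Proof.
move=> fx fy e; have [cx vx px] := fx; have [cy vy py] := fy; split=> //.
have e2 : x.2 = y.2.
  apply: eq_on02; [exact: (@cls_on R None V3 _ vx) | exact: (@cls_on R None V3 _ vy)|] => t t02.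
  by rewrite -(frame_snd (deriv02 x.1 t) (x.2 t)) -frame_curveE // e frame_curveE // frame_snd.
have ed t : in02 t -> deriv02 x.1 t = deriv02 y.1 t.
  move=> t02; have [dx _ _] := px t t02; have [dy _ _] := py t t02.
  by rewrite -(frame_fst (x.2 t) dx) -frame_curveE // e frame_curveE // frame_fst.
exists (x.1 0 - y.1 0); rewrite [LHS]surjective_pairing e2; congr (_, _).
rewrite -[LHS](@cls_on R None V3 _ cx); apply: on02_eq => t t02.
have yd : isd y.1 (deriv02 x.1).
  by apply: isd_eq (framed_isd fy) => // s s02; rewrite ed.
by rewrite -(isd_const (framed_isd fx) yd t02) addrC subrK.
Qed.

Lemma framed_class_eq x y : is_framed x -> is_framed y -> frame_curve x = frame_curve y ->
  framed_class x = framed_class y.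
Proof.
move=> + + e; have half x' y' : is_framed x' -> is_framed y' -> frame_curve x' = frame_curve y' ->
    framed_class x' `<=` framed_class y'.
  move=> fx fy e' z [fz [a za]]; apply: frame_curve_inj => //.
  by rewrite za frame_curve_shift.
by move=> fx fy; apply/seteqP; split; apply: half.
Qed.

Lemma framed_curve per x : framed_in per x -> SO3Rp_curve (lc per false) (frame_curve x).
Proof.
move=> [[_ _ px] cd cv]; split.
  by apply: cls_frame (per_even_lc per) cd cv _ => t /px[].
by move=> t t02; rewrite frame_curveE //; have [? ? ?] := px t t02; exact: frame_SO3Rp.
Qed.

(** The velocity is integrated coordinate by coordinate. The resulting curve need not close up,
    since frame periodicity constrains only its derivative. *)
Lemma framed_surj per q : SO3Rp_curve (lc per false) q -> exists2 x, framed_in per x & frame_curve x = q.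
Proof.
move=> [cq pq]; pose d : R -> V3 := fun t => (q t).2 *: colc 0 q t.
have cd : cls (lc per false) d.
  have cm (i : 'I_3) : cls (lc per false) (cmul (fun t => (q t).2) (entry i 0 q)).
    rewrite per_even_lc; exact: (cls_mul (cls_speed cq) (cls_entry i 0 cq)).
  have -> : d = (fun t => \row_i (cmul (fun t => (q t).2) (entry i 0 q) t : R)); last exact: cls_row.
  by apply/funext => t; apply/rowP => i; rewrite !mxE.
have cd0 := cls_none cd.
have ex (i : 'I_3) : exists F : R -> R^o, isd F (fun t => d t 0 i).
  have cdi := cls_blin (@blin_entry R 0 2 0 i) cd0.
  by have [F [Fd _ _]] := primitive_continuous (isd_continuous (cls_isd cdi)); exists F.
have [F Fd] := choice ex.
pose c : R -> V3 := on02 (fun t => \row_i (F i t : R)).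
have dc : isd c d.
  have di i := isd_blin (blin_line (delta_mx 0 i : V3)) (Fd i).
  apply: isd_eq (isdD (di ord0) (isdD (di 1) (di 2%:R))) => t t02.
    rewrite /c on02E // [RHS]row_sum_delta !big_ord_recl big_ord0 addr0 !mxE.
    by congr (_ *: delta_mx _ _ + (_ *: delta_mx _ _ + _ *: delta_mx _ _));
      try congr (F _ _); exact/val_inj.
  rewrite [RHS]row_sum_delta !big_ord_recl big_ord0 addr0.
  by congr (d t _ _ *: delta_mx _ _ + (d t _ _ *: delta_mx _ _ + d t _ _ *: delta_mx _ _)); exact/val_inj.
have ec : deriv02 c = d by apply: deriv02_isd dc _; exact: (cls_on cd).
have cc : cls None c by apply: (cls_isdP (g := d)) => //; exact: on02_on02.
have cv := cls_colc 1 cq.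
have H t : in02 t -> [/\ d t <> 0, norm3 (colc 1 q t) = 1, dot3 (colc 1 q t) (d t) = 0 &
    frame (d t) (colc 1 q t) = q t].
  by move=> t02; exact: (frame_colc (pq t t02)).
have fx : is_framed (c, colc 1 q).
  split; [exact: cc | exact: (cls_none cv) | move=> t t02; rewrite /= ec].
  by have [h1 h2 h3 _] := H t t02; exact: And3 h1 h2 h3.
exists (c, colc 1 q).
  split; [exact: fx | rewrite /= ec; exact: cd | exact: cv].
apply: eq_on02; [exact: on02_on02 | exact: (cls_on cq)|] => t t02.
by rewrite frame_curveE //= ec; have [] := H t t02.
Qed.

End FramedClasses.

Lemma flat_cover_transport (R : realType) (A : lmodType R) (sn : nat -> A -> R) (K : Type)
    (car : K -> set A) (N : premfd R) (cl : mf_idx N -> K) (T : set A) (pr : A -> mf_pt N)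
    (L : forall i : mf_idx N, mf_mod i -> A) (P : forall i : mf_idx N, A -> mf_mod i)
    (Y : Type) (pts : set Y) (b : Y -> mf_pt N) (c : mf_pt N -> Y) :
  flat_cover sn car cl T pr L P ->
  (forall y, pts y -> mf_pts N (b y)) ->
  (forall q, mf_pts N q -> pts (c q) /\ b (c q) = q) ->
  (forall y, pts y -> c (b y) = y) ->
  @flat_cover R A sn K car (transport_mfd pts b) cl T (c \o pr) L P.
Proof.
move=> H bpts cpts cb.
have domE i y : T y -> mf_dom (p := transport_mfd pts b) i (c (pr y)) <-> mf_dom (p := N) i (pr y).
  move=> Ty; have [p1 p2] := cpts _ (fc_pr H Ty); rewrite /= p2.
  by split=> [[]|].
have VE i : [set y | T y /\ mf_dom (p := transport_mfd pts b) i ((c \o pr) y)] =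
    [set y | T y /\ mf_dom (p := N) i (pr y)].
  by apply/seteqP; split=> y [Ty dy]; split=> //; apply/(domE i y Ty).
have IE i : mf_map (p := transport_mfd pts b) i @` mf_dom (p := transport_mfd pts b) i =
    mf_map (p := N) i @` mf_dom (p := N) i.
  apply/seteqP; split=> _ [p dp <-]; first by exists (b p) => //; have [] := dp.
  have [p1 p2] := cpts _ (fc_sub H dp); exists (c p); last by rewrite /= p2.
  by split=> //; rewrite /= p2.
split.
- exact: fc_frechet H.
- exact: fc_mod H.
- by move=> i p [].
- by move=> p pp; have [i di] := fc_cover H (bpts p pp); exists i.
- exact: fc_total H.
- exact: fc_class H.
- exact: fc_class_eq H.
- by move=> y Ty; have [] := cpts _ (fc_pr H Ty).
- move=> i y Ty /(domE i y Ty) dy; have [h1 h2] := fc_P H Ty dy; split=> //.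
  by rewrite /= (cpts _ (fc_pr H Ty)).2.
- by move=> i; rewrite VE; exact: fc_open H i.
- by move=> i; rewrite VE; exact: fc_P_smooth H i.
- by move=> i; rewrite IE; exact: fc_image H i.
- move=> i p [pp di]; have [h1 h2] := fc_L H di; split=> //.
  by rewrite /= h2 cb.
- by move=> i; rewrite IE; exact: fc_L_smooth H i.
- move=> y y' Ty Ty' e; apply: (fc_pm H Ty Ty').
  by rewrite -(cpts _ (fc_pr H Ty)).2 -(cpts _ (fc_pr H Ty')).2; congr b.
- by move=> y Ty; have [h1 h2] := fc_neg H Ty; split=> //=; rewrite h2.
- exact: fc_neq0 H.
Qed.

Section FramedCover.
Context {R : realType}.
Implicit Types (per : bool) (x : (R -> 'rV[R]_3) * (R -> 'rV[R]_3)) (q : R -> 'M[R]_3 * R^o).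
Notation MR := ('M[R]_3 * R^o : normedModType R)%type.

(** The inverse of [class_curve], chosen among all framed classes: the same map then serves for
    paths and for frame-periodic paths, as the second covering has to be a restriction of the
    first. *)
Definition framing (q : R -> 'M[R]_3 * R^o) : set ((R -> 'rV[R]_3) * (R -> 'rV[R]_3)) :=
  xget set0 [set o | (@framed_class R @` @is_framed R) o /\ class_curve o = q].

Definition framed_mfd per : premfd R :=
  transport_mfd (M := SO3Rp_mfd (@cls R (lc per false)))
    (@framed_class R @` framed_in per) (@class_curve R).

Lemma framingE x q : is_framed x -> frame_curve x = q -> framing q = framed_class x.
Proof.
move=> fx xq; have [] : [set o | (@framed_class R @` @is_framed R) o /\ class_curve o = q] (framing q).
  by apply: xgetPex; exists (framed_class x); split; [exists x | rewrite class_curveE].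
move=> [y fy <-]; rewrite class_curveE // => yq.
by apply: framed_class_eq => //; rewrite yq.
Qed.

Lemma framed_flat_cover per : @flat_cover R (R -> C2 R) (@fs_sn R (curves None (C2 R))) bool
  (@classes R per) (framed_mfd per) (fun g => (the_lift per g).1) (nonvanishing per)
  (framing \o @hopc R) (fun g => chart_lift (the_lift per g).2)
  (fun g => lift_chart (the_lift per g).2).
Proof.
apply: (flat_cover_transport (hopf_flat_cover per)).
- by move=> _ [x [fx cd cv] <-]; rewrite class_curveE //; exact: framed_curve.
- move=> q Bq; have [x [fx cd cv] xq] := framed_surj Bq.
  by rewrite (framingE fx xq); split; [exists x | rewrite class_curveE].
- move=> _ [x [fx cd cv] <-]; rewrite class_curveE //; exact: framingE.
Qed.

Lemma total_classes per b : nonvanishing per `&` classes per b =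
  [set f | @cls R (lc per b) (C2 R) f /\ forall t, in02 t -> f t <> 0].
Proof.
apply/seteqP; split=> y; first by move=> [[_ y0] cy].
by move=> [cy y0]; split=> //; split=> //; exists b.
Qed.

End FramedCover.

Section Final.
Context {R : realType}.
Implicit Types (per b : bool).

Definition L2_metric (u v : R -> C2 R) : R := complex.Re (herm_L2 u v).
Definition L2_symplectic (u v : R -> C2 R) : R := - complex.Im (herm_L2 u v).
Definition curve_i (u : R -> C2 R) : R -> C2 R := fun t => C2_i (u t).

Lemma flat_classes per b : @flat_kahler R (Fspace (@classes R per b) (@fs_sn R (curves None (C2 R))))
  L2_metric L2_symplectic curve_i.
Proof. exact: (L2_flat (lc per b)). Qed.

Definition framed_kahler per : kahler_data (@framed_mfd R per) :=
  fc_kahler (framed_flat_cover per) (g0 := L2_metric) (w0 := L2_symplectic) (J0 := curve_i).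

Lemma framed_is_kahler per : is_kahler (@framed_kahler per).
Proof. exact: (fc_is_kahler (framed_flat_cover per) (flat_classes per)). Qed.

Definition spinor_path : (R -> C2 R) -> set ((R -> 'rV[R]_3) * (R -> 'rV[R]_3)) :=
  framing \o @hopc R.

Lemma framed_kahler_map per b : kahler_map (N := framed_mfd per)
  (L2_kahler (@cls R (lc per b))) (framed_kahler per) spinor_path.
Proof.
have := fc_kahler_map (framed_flat_cover per) (flat_classes per) (k := b).
by rewrite /fc_total_mfd total_classes.
Qed.

Lemma framed_covering : smooth_double_covering (M := C2o_mfd (@cls R None)) (N := framed_mfd false) spinor_path.
Proof.
have := fc_covering (@framed_flat_cover R false) (k := false) (fun=> erefl).
by rewrite /fc_total_mfd total_classes.
Qed.

Lemma framed_covering_sum : smooth_double_covering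
  (M := sum_mfd (C2o_mfd (@cls R (Some false))) (C2o_mfd (@cls R (Some true)))) (N := framed_mfd true)
  (@sum_fun R (C2o_mfd (@cls R (Some false))) (C2o_mfd (@cls R (Some true))) (framed_mfd true) spinor_path spinor_path).
Proof.
have := fc_covering_sum (@framed_flat_cover R true) (fun y b b' => @total_class R true y b b' isT).
by rewrite /fc_total_mfd !total_classes.
Qed.

End Final.

Theorem proposition3p1 (R : realType) :
  exists p : mf_pt (PoC2 R) -> mf_pt (O_mfd R),
    let p' : mf_pt (sum_mfd (LoC2 R) (AoC2 R)) -> mf_pt (Ofp_mfd R) :=
      fun s => match s with inl x => p x | inr x => p x end in
    [/\ @smooth_double_covering R (PoC2 R) (O_mfd R) p,
        @smooth_double_covering R (sum_mfd (LoC2 R) (AoC2 R)) (Ofp_mfd R) p',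
        (exists2 K : kahler_data (O_mfd R),
           is_kahler K & kahler_map (L2_kahler (@smooth_curve R)) K p) &
        (exists2 K : kahler_data (Ofp_mfd R),
           is_kahler K &
           kahler_map (sum_kahler (L2_kahler (@smooth_loop R))
                                  (L2_kahler (@smooth_antiloop R))) K p')].
Proof.
exists (@spinor_path R); split.
- by have := @framed_covering R; rewrite /framed_mfd framed_in_false.
- by have := @framed_covering_sum R; rewrite /framed_mfd framed_in_true.
- have H1 := @framed_is_kahler R false; have H2 := @framed_kahler_map R false false.
  (* The structure is generalised first, since its type depends on the set of classes being
     rewritten. *)
  move: (framed_kahler false) H1 H2; rewrite /framed_mfd framed_in_false => K H1 H2.
  by exists K.
- have H1 := @framed_is_kahler R true.
  have H2 := kahler_map_sum (@framed_kahler_map R true false) (@framed_kahler_map R true true).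
  move: (framed_kahler true) H1 H2; rewrite /framed_mfd framed_in_true => K H1 H2.
  by exists K.
Qed.
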